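(* Let $\Omega\subset\mathbb{R}^N$ be a bounded domain, $1<p<\infty$, $h\in W^{-1,p'}(\Omega)$, and let $f:\Omega\times\mathbb{R}\to\mathbb{R}$ be a Carathéodory function such that $\sup_{|s|\le R}|f(\cdot,s)|\in L^1(\Omega)$ for all $R>0$. Let $1\le\alpha\le p$ and let $\varphi$ be a comparison function of order $\alpha$. Put $F(x,s)=\int_0^s f(x,t)\,dt$, $G(x,s)=F(x,s)-\frac{\lambda_1}{p}|s|^p$ and $G_\varphi^{\pm}(x)=\limsup_{s\to\pm\infty}\frac{G(x,s)}{\varphi(s)}$. Suppose that (1) $G_\varphi^{\pm}\le\eta$ a.e. uniformly in $\Omega$ for some $\eta\in X_\alpha$; (2) $\int_\Omega G_\varphi^+(x)(\varphi_1(x))^\alpha\,dx<0$ and $\int_\Omega G_\varphi^-(x)(\varphi_1(x))^\alpha\,dx<0$. Then the functional $\Phi(u)=\frac1p\int_\Omega|\nabla u|^p\,dx-\int_\Omega F(x,u)\,dx-\langle h,u\rangle$ achieves its minimum over $W^{1,p}_0(\Omega)$ at a point $u\in W_0^{1,p}(\Omega)$ with $\int_\Omega F(x,u)\,dx\in\mathbb{R}$, and hence $u$ is a weak solution of the problem $-\Delta_p u=f(x,u)+h$ in $\Omega$, $u=0$ on $\partial\Omega$.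
   Context: Notation: $m'$ is the conjugate exponent of $m$; $p^*=Np/(N-p)$ if $p<N$; $\langle\cdot,\cdot\rangle$ is the duality pairing between $W^{-1,p'}(\Omega)$ and $W^{1,p}_0(\Omega)$; $\|\cdot\|_{1,p}$ is the usual norm of $W^{1,p}_0(\Omega)$; $\Delta_p u=\operatorname{div}(|\nabla u|^{p-2}\nabla u)$, viewed as a map $W^{1,p}_0(\Omega)\to W^{-1,p'}(\Omega)$. The first eigenvalue of $-\Delta_p$ is $\lambda_1=\min\{\int_\Omega|\nabla u|^p\,dx/\int_\Omega|u|^p\,dx:\ u\in W_0^{1,p}(\Omega)\setminus\{0\}\}$; it is simple, and $\varphi_1$ denotes the associated normalized eigenfunction with $\varphi_1>0$ a.e. A continuous even function $\varphi:\mathbb{R}\to\mathbb{R}^+$ is a comparison function of order $\alpha$ ($1\le\alpha\le p$) if: (i) $\varphi(s)/|s|^p\to0$ as $s\to+\infty$; (ii) $\varphi(s)/|s|\to+\infty$ as $s\to+\infty$; (iii) $\varphi(s_n)/\varphi(t_n)\to r^\alpha$ whenever $s_n\to\infty$, $t_n\to\infty$ and $s_n/t_n\to r>0$; (iv) for all $\beta>\alpha$ there exist $t_0,a,b$ such that $\varphi(ts)/\varphi(t)\le a|s|^\beta+b$ for all $t\ge t_0$ and all $s\ge0$. $X_\alpha$ is the set of measurable functions $\eta$ on $\Omega$ such that $\eta\in L^1(\Omega)$ if $p>N$; $\eta\in L^q(\Omega)$ for some $q>1$ if $p=N$; $\eta\in L^q(\Omega)$ for some $q>(p^*/\alpha)'$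 if $p<N$. ''$G_\varphi^\pm\le\eta$ a.e. uniformly in $\Omega$'' means: for every $\varepsilon>0$ there is $R>0$ such that $G(x,s)\le(\eta(x)+\varepsilon)\varphi(s)$ for a.e. $x\in\Omega$ and all $|s|\ge R$. Convention: if $\int_\Omega F(x,u)^+\,dx=\int_\Omega F(x,u)^-\,dx=+\infty$, then $\int_\Omega(-F(x,u))\,dx$ is taken to be $+\infty$, so $\Phi(u)=+\infty$; $\Phi$ takes values in $\overline{\mathbb{R}}$. Weak solutions: let $L^\infty_0(\Omega)$ be the set of $v\in L^\infty(\Omega)$ vanishing a.e. outside a compact subset of $\Omega$. For $u\in W^{1,p}_0(\Omega)$ let $V_u=\{v\in W^{1,p}_0(\Omega)\cap L^\infty_0(\Omega):\ u\in L^\infty(\{x\in\Omega: v(x)\ne0\})\}$ and $A_u=\{v\in W_0^{1,p}(\Omega):\ f(x,u)v\in L^1(\Omega)\}$. Both are dense linear subspaces of $W^{1,p}_0(\Omega)$ and $V_u\subset A_u$. One says $f(x,u)\in W^{-1,p'}(\Omega)$ if $\sup\{\int_\Omega f(x,u)v\,dx:\ v\in A_u,\ \|v\|_{1,p}\le1\}<+\infty$ (the supremum over $V_u$ has the same value); then $f(x,u)$ is identified with the unique continuous linear extension to $W_0^{1,p}(\Omega)$ of $v\mapsto\int_\Omega f(x,u)v\,dx$, $v\in V_u$. A function $u\in W_0^{1,p}(\Omega)$ is a weak solution of the problem if $f(x,u)\in W^{-1,p'}(\Omega)$ in this sense and $-\Delta_pu=f(x,u)+h$ holds in $W^{-1,p'}(\Omega)$;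 in particular $\int_\Omega|\nabla u|^{p-2}\nabla u\cdot\nabla v\,dx=\int_\Omega f(x,u)v\,dx+\langle h,v\rangle$ for all $v\in A_u$. *)

(* Defs.v *)
From HB Require Import structures.
From mathcomp Require Import all_boot all_order all_algebra.
From mathcomp Require Import all_classical all_reals all_analysis.

Set Implicit Arguments.
Unset Strict Implicit.
Unset Printing Implicit Defensive.

Import Order.TTheory GRing.Theory Num.Theory.
Import numFieldNormedType.Exports.

Local Open Scope classical_set_scope.
Local Open Scope ring_scope.

(** The space R^N, N >= 1, is ['rV[R]_n.+1] with [N = n.+1].  Its norm
    [`|x|] in the library is the sup norm (which gives the usual topology and
    bounded sets); Euclidean lengths are written out explicitly below.
    The library has no Lebesgue measure on R^N, so it is obtained here in the
    textbook way: the outer measure defined by countable covers by open boxes,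
    restricted to the Caratheodory-measurable sets.  In particular the measure
    is complete and "measurable" means Lebesgue measurable. *)

Definition obox (R : realType) (n : nat) (B : 'rV[R]_n.+1 * 'rV[R]_n.+1) :
    set 'rV[R]_n.+1 :=
  [set x | forall i, B.1 ord0 i < x ord0 i < B.2 ord0 i].

Definition obox_vol (R : realType) (n : nat) (B : 'rV[R]_n.+1 * 'rV[R]_n.+1) :
    R :=
  \prod_(i < n.+1) Num.max 0 (B.2 ord0 i - B.1 ord0 i).

Definition leb_outer (R : realType) (n : nat) (A : set 'rV[R]_n.+1) : \bar R :=
  ereal_inf [set (\sum_(k <oo) (obox_vol (B k))%:E)%E |
             B in [set B : nat -> 'rV[R]_n.+1 * 'rV[R]_n.+1 |
                   A `<=` \bigcup_k obox (B k)]].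

Section leb_outer_is_outer_measure.
Local Open Scope ereal_scope.
Context (R : realType) (n : nat).
Local Notation mu := (@leb_outer R n).

Lemma obox_vol_ge0 (B : 'rV[R]_n.+1 * 'rV[R]_n.+1) : (0 <= obox_vol B)%R.
Proof. by apply: prodr_ge0 => i _; rewrite le_max lexx. Qed.

Lemma leb_outer_ge0 (A : set 'rV[R]_n.+1) : 0 <= mu A.
Proof.
apply: le_ereal_inf_tmp => _ [B _ <-].
by apply: nneseries_ge0 => k _ _; rewrite lee_fin obox_vol_ge0.
Qed.

Lemma leb_outer0 : mu set0 = 0.
Proof.
apply/eqP; rewrite eq_le leb_outer_ge0 andbT.
apply: ereal_inf_lbound; exists (fun=> (0%R, 0%R)); first by move=> x [].
apply: eseries0 => k _ _; rewrite /obox_vol big_ord_recl /= subrr.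
by rewrite maxxx mul0r.
Qed.

Lemma le_leb_outer : {homo mu : A B / A `<=` B >-> A <= B}.
Proof.
move=> A B AB; apply/ereal_inf_le_tmp => x [C BC <-].
by exists C => //; exact: subset_trans AB BC.
Qed.

Lemma leb_outer_sigma_subadditive : sigma_subadditive mu.
Proof.
move=> A; have [[i ioo]|] := pselect (exists i, mu (A i) = +oo).
  rewrite (eseries_pinfty _ _ ioo) ?leey// => k _.
  by rewrite -ltNye (lt_le_trans _ (leb_outer_ge0 _)).
rewrite -forallNE => Aoo.
suff add2e (e : {posnum R}) :
    mu (\bigcup_n A n) <= \sum_(i <oo) mu (A i) + e%:num%:E.
  by apply/lee_addgt0Pr => _/posnumP[].
rewrite (le_trans _ (epsilon_trick _ _ _))//; last first.
  by move=> k; exact: leb_outer_ge0.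
pose vol (B : 'rV[R]_n.+1 * 'rV[R]_n.+1) := (obox_vol B)%:E.
have vol0 B : 0 <= vol B by rewrite lee_fin obox_vol_ge0.
pose P k (B : nat -> 'rV[R]_n.+1 * 'rV[R]_n.+1) :=
  A k `<=` \bigcup_j obox (B j) /\
  \sum_(j <oo) vol (B j) <= mu (A k) + (e%:num / (2 ^ k.+1)%:R)%:E.
have [G PG] : {G : nat -> nat -> 'rV[R]_n.+1 * 'rV[R]_n.+1 &
    forall k, P k (G k)}.
  apply: (@choice _ _ P) => k; rewrite /P /leb_outer.
  set S := (X in ereal_inf X); move infS : (ereal_inf S) => iS.
  case: iS infS => [r Sr|Soo|Soo].
  - have en1 : (0 < e%:num / (2 ^ k.+1)%:R)%R by [].
    have /(lb_ereal_inf_adherent en1) : ereal_inf S \is a fin_num by rewrite Sr.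
    move=> [x [B AB muBx] xS].
    by exists B; split => //; rewrite muBx -Sr; exact/ltW.
  - by have := Aoo k; rewrite /leb_outer Soo.
  - suff : lbound S 0 by move/le_ereal_inf_tmp; rewrite Soo.
    by move=> /= _ [B AB <-]; apply: nneseries_ge0 => ? _ _; exact: vol0.
have muG_ge0 x : 0 <= (vol \o uncurry G) x by exact: vol0.
apply: (@le_trans _ _ (\esum_(i in setT) (vol \o uncurry G) i)).
  rewrite /leb_outer; apply: ereal_inf_lbound => /=.
  have /card_esym/ppcard_eqP[f] := card_nat2.
  exists (uncurry G \o f).
    apply: (@subset_trans _ (\bigcup_k \bigcup_j obox (G k j))) => [t [i _]|].
      by have [AG _] := PG i; move=> /AG[j _ ?]; exists i => //; exists j.
    move=> t [i _ [j _ Bijt]]; exists (f^-1%FUN (i, j)) => //=.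
    by rewrite invK ?inE.
  rewrite -(esum_pred_image (vol \o uncurry G) _ xpredT) ?[fun=> _]set_true//.
  by rewrite image_eq.
rewrite (_ : esum _ _ = \sum_(i <oo) \sum_(j <oo ) vol (G i j)); last first.
  pose J : nat -> set (nat * nat) := fun i => [set (i, j) | j in setT].
  rewrite (_ : setT = \bigcup_k J k); last first.
    by rewrite predeqE => -[a b]; split => // _; exists a => //; exists b.
  rewrite esum_bigcupT /=; last 2 first.
    - apply/trivIsetP => i j _ _ ij.
      rewrite predeqE => -[k m] /=; split => //= -[] [_] _ [<-{k} _].
      by move=> [m' _] [] /esym/eqP; rewrite (negbTE ij).
    - by move=> /= [k m]; exact: vol0.
  rewrite -(image_id [set: nat]) -fun_true esum_pred_image//; last first.
    by move=> k _; exact: esum_ge0.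
  apply: eq_eseriesr => /= j _.
  rewrite -(esum_pred_image (vol \o uncurry G) (pair j) predT)//=; last first.
    by move=> ? ? _ _; exact: (@can_inj _ _ _ snd).
  by congr esum; rewrite predeqE => -[a b]; split; move=> [i _ <-]; exists i.
apply: lee_lim.
- apply: is_cvg_nneseries => k *.
  by apply: nneseries_ge0 => m *; exact: (muG_ge0 (k, m)).
- by apply: is_cvg_nneseries => k *; apply: adde_ge0 => //; exact: leb_outer_ge0.
- by near=> k; apply: lee_sum => i _; by have [] := PG i.
Unshelve. all: by end_near. Qed.

HB.instance Definition _ := isOuterMeasure.Build R _ mu
  leb_outer0 leb_outer_ge0 le_leb_outer leb_outer_sigma_subadditive.

End leb_outer_is_outer_measure.

Notation lebT R n := (caratheodory_type (@leb_outer R n)).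

Definition leb (R : realType) (n : nat) : set (lebT R n) -> \bar R :=
  @leb_outer R n.
HB.instance Definition _ (R : realType) (n : nat) :=
  isMeasure.Build _ _ _ (@leb R n)
    (caratheodory_measure0 (@leb_outer R n))
    (@caratheodory_measure_ge0 _ _ (@leb_outer R n))
    (@caratheodory_measure_sigma_additive _ _ (@leb_outer R n)).
Arguments leb {R n}.

(** Functions on [Om] are represented by functions on the whole of R^N whose
    values outside [Om] are never used; they are not quotiented by equality
    almost everywhere. *)

Definition bounded_domain (R : realType) (n : nat) (Om : set 'rV[R]_n.+1) :=
  [/\ open Om, connected Om, Om !=set0 & bounded_set Om].

Definition aeOn (R : realType) (n : nat) (Om : set 'rV[R]_n.+1)
    (P : 'rV[R]_n.+1 -> Prop) : Prop :=
  {ae (@leb R n), forall x, Om x -> P x}.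

Definition Lebesgue (R : realType) (n : nat) (q : R) (Om : set 'rV[R]_n.+1)
    (u : 'rV[R]_n.+1 -> R) : Prop :=
  measurable_fun (Om : set (lebT R n)) (u : lebT R n -> R) /\
  (\int[leb]_(x in Om) (`|u x| `^ q)%:E < +oo)%E.

Definition dotv (R : realType) (n : nat) (v w : 'rV[R]_n.+1) : R :=
  \sum_(i < n.+1) v ord0 i * w ord0 i.

Definition euclid (R : realType) (n : nat) (v : 'rV[R]_n.+1) : R :=
  Num.sqrt (dotv v v).

Definition partial (R : realType) (n : nat) (i : 'I_n.+1)
    (f : 'rV[R]_n.+1 -> R) : 'rV[R]_n.+1 -> R :=
  fun x => 'D_(delta_mx ord0 i) f x.

Fixpoint class_C (R : realType) (n : nat) (k : nat) (f : 'rV[R]_n.+1 -> R) :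
    Prop :=
  continuous f /\
  match k with
  | 0%N => True
  | k'.+1 => forall i : 'I_n.+1,
      (forall x, derivable f x (delta_mx ord0 i)) /\ class_C k' (partial i f)
  end.

Definition test_function (R : realType) (n : nat) (Om : set 'rV[R]_n.+1)
    (f : 'rV[R]_n.+1 -> R) : Prop :=
  (forall k, class_C k f) /\
  exists K : set 'rV[R]_n.+1,
    [/\ compact K, K `<=` Om & forall x, ~ K x -> f x = 0].

Definition weak_gradient (R : realType) (n : nat) (p : R)
    (Om : set 'rV[R]_n.+1) (u : 'rV[R]_n.+1 -> R)
    (g : 'rV[R]_n.+1 -> 'rV[R]_n.+1) : Prop :=
  (forall i, Lebesgue p Om (fun x => g x ord0 i)) /\
  (forall f, test_function Om f -> forall i,
     \int[leb]_(x in Om) (u x * partial i f x) =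
     - \int[leb]_(x in Om) (g x ord0 i * f x)).

Definition W1p (R : realType) (n : nat) (p : R) (Om : set 'rV[R]_n.+1)
    (u : 'rV[R]_n.+1 -> R) : Prop :=
  Lebesgue p Om u /\ exists g, weak_gradient p Om u g.

(* [grad p Om u] is a representative of the weak gradient of u, which is unique
   up to equality a.e.; it is meaningful only when [W1p p Om u]. *)
Definition grad (R : realType) (n : nat) (p : R) (Om : set 'rV[R]_n.+1)
    (u : 'rV[R]_n.+1 -> R) : 'rV[R]_n.+1 -> 'rV[R]_n.+1 :=
  get [set g | weak_gradient p Om u g].

Definition dirichlet (R : realType) (n : nat) (p : R) (Om : set 'rV[R]_n.+1)
    (u : 'rV[R]_n.+1 -> R) : R :=
  \int[leb]_(x in Om) (euclid (grad p Om u x) `^ p).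

Definition norm1p (R : realType) (n : nat) (p : R) (Om : set 'rV[R]_n.+1)
    (u : 'rV[R]_n.+1 -> R) : R :=
  ((\int[leb]_(x in Om) (`|u x| `^ p)) + dirichlet p Om u) `^ p^-1.

Definition W1p0 (R : realType) (n : nat) (p : R) (Om : set 'rV[R]_n.+1)
    (u : 'rV[R]_n.+1 -> R) : Prop :=
  W1p p Om u /\
  forall e : R, 0 < e ->
    exists2 f, test_function Om f & norm1p p Om (fun x => u x - f x) < e.

(* W^{-1,p'}: continuous linear forms on W^{1,p}_0.  The bound by the norm makes
   such a form invariant under a.e. equality; the pairing <h, u> is [h u]. *)
Definition dualW (R : realType) (n : nat) (p : R) (Om : set 'rV[R]_n.+1)
    (h : ('rV[R]_n.+1 -> R) -> R) : Prop :=
  (forall (a : R) u v, W1p0 p Om u -> W1p0 p Om v ->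
     h (fun x => a * u x + v x) = a * h u + h v) /\
  (exists C : R, forall u, W1p0 p Om u -> `|h u| <= C * norm1p p Om u).

(* The duality product <-Delta_p u, v>.  Where grad u = 0 the integrand is 0,
   also for p < 2, since the library's power gives 0 `^ r = 0 for r != 0. *)
Definition neg_plaplacian (R : realType) (n : nat) (p : R)
    (Om : set 'rV[R]_n.+1) (u v : 'rV[R]_n.+1 -> R) : R :=
  \int[leb]_(x in Om)
     (euclid (grad p Om u x) `^ (p - 2) *
      dotv (grad p Om u x) (grad p Om v x)).

(* On a bounded domain the infimum is attained, i.e. it is the minimum of the
   Rayleigh quotient. *)
Definition lambda1 (R : realType) (n : nat) (p : R) (Om : set 'rV[R]_n.+1) :
    R :=
  inf [set dirichlet p Om u / \int[leb]_(x in Om) (`|u x| `^ p) |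
       u in [set u | W1p0 p Om u /\ ~ aeOn Om (fun x => u x = 0)]].

Definition first_eigenfunction (R : realType) (n : nat) (p : R)
    (Om : set 'rV[R]_n.+1) (phi1 : 'rV[R]_n.+1 -> R) : Prop :=
  [/\ W1p0 p Om phi1,
      forall v, W1p0 p Om v ->
        neg_plaplacian p Om phi1 v =
        lambda1 p Om *
          \int[leb]_(x in Om) (`|phi1 x| `^ (p - 2) * phi1 x * v x),
      aeOn Om (fun x => 0 < phi1 x)
    & norm1p p Om phi1 = 1].

Definition comparison_function (R : realType) (p alpha : R) (phi : R -> R) :
    Prop :=
  [/\ continuous phi, (forall s, phi (- s) = phi s) & (forall s, 0 <= phi s)] /\
  [/\ phi s / `|s| `^ p @[s --> +oo_R] --> (0 : R),
      phi s / `|s| @[s --> +oo_R] --> +oo_R,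
      (forall (s t : nat -> R) (r : R), 0 < r ->
         s k @[k --> \oo] --> +oo_R -> t k @[k --> \oo] --> +oo_R ->
         s k / t k @[k --> \oo] --> r ->
         phi (s k) / phi (t k) @[k --> \oo] --> r `^ alpha)
    & (forall beta : R, alpha < beta ->
         exists t0 a b : R, forall t s : R, t0 <= t -> 0 <= s ->
           phi (t * s) / phi t <= a * `|s| `^ beta + b)].

Definition conj_exponent (R : realType) (m : R) : R := m / (m - 1).

Definition sobolev_exponent (R : realType) (N : nat) (p : R) : R :=
  N%:R * p / (N%:R - p).

Definition X_alpha (R : realType) (n : nat) (p alpha : R)
    (Om : set 'rV[R]_n.+1) (eta : 'rV[R]_n.+1 -> R) : Prop :=
  [/\ n.+1%:R < p -> Lebesgue 1 Om eta,
      p = n.+1%:R -> exists2 q : R, 1 < q & Lebesgue q Om eta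
    & p < n.+1%:R -> exists2 q : R,
        conj_exponent (sobolev_exponent n.+1 p / alpha) < q &
        Lebesgue q Om eta].

Definition caratheodory_function (R : realType) (n : nat)
    (Om : set 'rV[R]_n.+1) (f : 'rV[R]_n.+1 -> R -> R) : Prop :=
  (forall s : R, measurable_fun (Om : set (lebT R n))
                   ((fun x => f x s) : lebT R n -> R)) /\
  aeOn Om (fun x => continuous (f x)).

Definition locally_sup_integrable (R : realType) (n : nat)
    (Om : set 'rV[R]_n.+1) (f : 'rV[R]_n.+1 -> R -> R) : Prop :=
  forall r : R, 0 < r ->
    (@leb R n).-integrable Om
      (fun x => ereal_sup [set (`|f x s|)%:E | s in [set s : R | `|s| <= r]]).

Definition primitive (R : realType) (n : nat) (f : 'rV[R]_n.+1 -> R -> R)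
    (x : 'rV[R]_n.+1) (s : R) : R :=
  if 0 <= s then \int[lebesgue_measure]_(t in `[0, s]) f x t
  else - \int[lebesgue_measure]_(t in `[s, 0]) f x t.

Definition Gfun (R : realType) (n : nat) (p : R) (Om : set 'rV[R]_n.+1)
    (f : 'rV[R]_n.+1 -> R -> R) (x : 'rV[R]_n.+1) (s : R) : R :=
  primitive f x s - lambda1 p Om / p * `|s| `^ p.

Definition Gplus (R : realType) (n : nat) (p : R) (Om : set 'rV[R]_n.+1)
    (f : 'rV[R]_n.+1 -> R -> R) (phi : R -> R) (x : 'rV[R]_n.+1) : \bar R :=
  limf_esup (fun s : R => (Gfun p Om f x s / phi s)%:E) +oo_R.

Definition Gminus (R : realType) (n : nat) (p : R) (Om : set 'rV[R]_n.+1)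
    (f : 'rV[R]_n.+1 -> R -> R) (phi : R -> R) (x : 'rV[R]_n.+1) : \bar R :=
  limf_esup (fun s : R => (Gfun p Om f x s / phi s)%:E) -oo_R.

Definition G_le_uniformly (R : realType) (n : nat) (p : R)
    (Om : set 'rV[R]_n.+1) (f : 'rV[R]_n.+1 -> R -> R) (phi : R -> R)
    (eta : 'rV[R]_n.+1 -> R) : Prop :=
  forall e : R, 0 < e -> exists2 r : R, 0 < r &
    aeOn Om (fun x => forall s : R, r <= `|s| ->
      Gfun p Om f x s <= (eta x + e) * phi s).

(* The integral of -F(x,u), set to +oo when the positive and negative parts
   both have infinite integral (the convention of the library would be -oo). *)
Definition int_negF (R : realType) (n : nat) (Om : set 'rV[R]_n.+1)
    (f : 'rV[R]_n.+1 -> R -> R) (u : 'rV[R]_n.+1 -> R) : \bar R :=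
  let Ipos := (\int[leb]_(x in Om) (Num.max (primitive f x (u x)) 0)%:E)%E in
  let Ineg := (\int[leb]_(x in Om) (Num.max (- primitive f x (u x)) 0)%:E)%E in
  if (Ipos == +oo%E) && (Ineg == +oo%E) then +oo%E
  else (\int[leb]_(x in Om) (- primitive f x (u x))%:E)%E.

Definition Phi (R : realType) (n : nat) (p : R) (Om : set 'rV[R]_n.+1)
    (f : 'rV[R]_n.+1 -> R -> R) (h : ('rV[R]_n.+1 -> R) -> R)
    (u : 'rV[R]_n.+1 -> R) : \bar R :=
  ((p^-1 * dirichlet p Om u)%:E + int_negF Om f u - (h u)%:E)%E.

Definition Linf0 (R : realType) (n : nat) (Om : set 'rV[R]_n.+1)
    (v : 'rV[R]_n.+1 -> R) : Prop :=
  [/\ measurable_fun (Om : set (lebT R n)) (v : lebT R n -> R),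
      (exists M : R, aeOn Om (fun x => `|v x| <= M))
    & exists K : set 'rV[R]_n.+1,
        [/\ compact K, K `<=` Om & aeOn Om (fun x => ~ K x -> v x = 0)]].

Definition Vspace (R : realType) (n : nat) (p : R) (Om : set 'rV[R]_n.+1)
    (u v : 'rV[R]_n.+1 -> R) : Prop :=
  [/\ W1p0 p Om v, Linf0 Om v
    & exists M : R, aeOn Om (fun x => v x != 0 -> `|u x| <= M)].

Definition Aspace (R : realType) (n : nat) (p : R) (Om : set 'rV[R]_n.+1)
    (f : 'rV[R]_n.+1 -> R -> R) (u v : 'rV[R]_n.+1 -> R) : Prop :=
  W1p0 p Om v /\
  (@leb R n).-integrable Om (fun x => (f x (u x) * v x)%:E).

(* "f(x,u) belongs to W^{-1,p'}" *)
Definition in_dualW (R : realType) (n : nat) (p : R) (Om : set 'rV[R]_n.+1)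
    (f : 'rV[R]_n.+1 -> R -> R) (u : 'rV[R]_n.+1 -> R) : Prop :=
  (ereal_sup [set (\int[leb]_(x in Om) (f x (u x) * v x))%:E |
              v in [set v | Aspace p Om f u v /\ (norm1p p Om v <= 1)%R]]
   < +oo)%E.

(* T is the continuous linear form on W^{1,p}_0 identified with f(x,u) *)
Definition represents (R : realType) (n : nat) (p : R) (Om : set 'rV[R]_n.+1)
    (f : 'rV[R]_n.+1 -> R -> R) (u : 'rV[R]_n.+1 -> R)
    (T : ('rV[R]_n.+1 -> R) -> R) : Prop :=
  dualW p Om T /\
  forall v, Vspace p Om u v ->
    T v = \int[leb]_(x in Om) (f x (u x) * v x).

Definition weak_solution (R : realType) (n : nat) (p : R)
    (Om : set 'rV[R]_n.+1) (f : 'rV[R]_n.+1 -> R -> R)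
    (h : ('rV[R]_n.+1 -> R) -> R) (u : 'rV[R]_n.+1 -> R) : Prop :=
  [/\ W1p0 p Om u, in_dualW p Om f u
    & exists2 T, represents p Om f u T &
        forall v, W1p0 p Om v -> neg_plaplacian p Om u v = T v + h v].

(* Main.v *)
(** The energy of u splits as (1/p)(int |grad u|^p - lambda_1 int |u|^p) - int G(x,u) - <h,u>.
    The first part is non-negative by the definition of lambda_1.  If the energy stayed bounded
    along functions u_k of norm t_k -> oo, then phi(t) = o(t^p) would force u_k / t_k to converge to
    a minimizer of the Rayleigh quotient, hence to c phi_1 with c <> 0 (simplicity of lambda_1, by
    Picone's identity and the connectedness of the domain), while t = o(phi(t)) and a reverse Fatou
    lemma, whose uniform integrability comes from the Sobolev and Morrey inequalities, would give
    int G_phi^{+-} phi_1^alpha >= 0.  So the energy is coercive; by Rellich's theorem and the same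
    Fatou argument it is lower semicontinuous, and a minimizer u exists.  Its first variation along
    bounded test functions supported where u is bounded gives the Euler-Lagrange equation, and
    truncation extends it to every v with f(x,u) v integrable. *)

Require Import Defs.
From HB Require Import structures.
From mathcomp Require Import all_boot all_order all_algebra.
From mathcomp Require Import all_classical all_reals all_analysis measurable_realfun.
From mathcomp Require Import ring lra zify.

Set Implicit Arguments.
Unset Strict Implicit.
Unset Printing Implicit Defensive.

Import Order.TTheory GRing.Theory Num.Theory.
Import numFieldNormedType.Exports.

Local Open Scope classical_set_scope.
Local Open Scope ring_scope.

(** * Lebesgue measure on R^N: boxes, open sets, translations *)

Section leb_basics.
Context (R : realType) (n : nat).
Local Notation V := 'rV[R]_n.+1.
Local Notation mu := (@leb_outer R n).

(** Gradients are carried along in pairs [Dpair u g], limits of (f, grad f) for test functions f, so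
    that those of truncations, products and limits are computed rather than chosen. Averages over
    boxes halved one coordinate at a time give a telescoping expansion whose level k gains a factor
    2^(-ks), with s > 0 exactly in the subcritical range; the embedding and compactness theorems all
    come from it. Weak limits are replaced by iterated midpoints, which converge strongly by uniform
    convexity. Positive measure of boxes is inherited from the normalized eigenfunction. The
    obstacle in the simplicity of lambda_1 is that phi_1 is only positive a.e., with no lower bound
    on compact sets, so w / phi_1 need not be a Sobolev function. Picone's identity therefore only
    serves to get grad w = (w / phi_1) grad phi_1. Then c phi_1 lies in W^{1,p}_0 for the indicator
    c of {w > t phi_1}, and an energy estimate on {phi_1 <= d} as d -> 0 shows that c has zero weak
    gradient. *)

Definition setc (x : V) (i : 'I_n.+1) (a : R) : V :=
  \row_j (if j == i then a else x ord0 j).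

Lemma setcE x i a j : setc x i a ord0 j = if j == i then a else x ord0 j.
Proof. by rewrite mxE. Qed.

Lemma obox_volD1 (B : V * V) i : obox_vol B =
  Num.max 0 (B.2 ord0 i - B.1 ord0 i) *
  \prod_(j < n.+1 | j != i) Num.max 0 (B.2 ord0 j - B.1 ord0 j).
Proof. by rewrite /obox_vol (bigD1 i). Qed.

Lemma leb_outer_le_cover (A : set V) (B : nat -> V * V) :
  A `<=` \bigcup_k obox (B k) ->
  (mu A <= \sum_(k <oo) (obox_vol (B k))%:E)%E.
Proof. by move=> AB; apply: ereal_inf_lbound; exists B. Qed.

(** Caratheodory's criterion on a cover of X: each box is cut at level [a], and the volumes of the
    two pieces exceed that of the box by an arbitrarily small amount in total. The upper piece must
    be enlarged because an open box cut at [a] misses the hyperplane x_i = a. *)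
Lemma measurable_halfspace (i : 'I_n.+1) (a : R) :
  measurable ([set x : V | x ord0 i < a] : set (lebT R n)).
Proof.
set A := [set x : V | _].
apply: le_caratheodory_measurable => X.
apply: (@le_ereal_inf_tmp _ _ (_ + _)%E) => _ [B XB <-].
apply/lee_addgt0Pr => e e0.
pose P (k : nat) :=
  \prod_(j < n.+1 | j != i) Num.max 0 ((B k).2 ord0 j - (B k).1 ord0 j).
have P0 k : 0 <= P k by apply: prodr_ge0 => j _; rewrite le_max lexx.
(* The enlargement costs [tau k] times the cross section [P k], hence at most e / 2^(k+1); the added
   1 keeps the quotient meaningful when [P k] = 0. *)
pose tau k := e / (2 ^ k.+1)%:R / (P k + 1).
have P1 k : 0 < P k + 1 by apply: ltr_wpDl.
have tau0 k : 0 < tau k by rewrite !divr_gt0// ltr0n expn_gt0.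
pose B1 k := ((B k).1, setc (B k).2 i (Num.min ((B k).2 ord0 i) a)).
pose B2 k := (setc (B k).1 i (Num.max ((B k).1 ord0 i) a - tau k), (B k).2).
have XA1 : X `&` A `<=` \bigcup_k obox (B1 k).
  move=> x [Xx Ax]; have [k _ Bx] := XB x Xx; exists k => // j.
  rewrite /B1 /= setcE; have := Bx j => /andP[-> h].
  by case: eqP => [ji|_]//=; rewrite lt_min -?ji h /=; rewrite ji.
have XA2 : X `&` ~` A `<=` \bigcup_k obox (B2 k).
  move=> x [Xx Ax]; have [k _ Bx] := XB x Xx; exists k => // j.
  rewrite /B2 /= setcE; have := Bx j => /andP[h ->]; rewrite andbT.
  case: eqP => [ji|_]//=.
  have {}Ax : a <= x ord0 i by rewrite leNgt; apply/negP.
  rewrite ltrBlDr (le_lt_trans (y := x ord0 i)) ?ji ?ltrDl//.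
  by rewrite ge_max Ax andbT -ji ltW.
apply: le_trans (leeD (leb_outer_le_cover XA1) (leb_outer_le_cover XA2)) _.
rewrite -nneseriesD; last 2 first.
  by move=> k _ _; rewrite lee_fin obox_vol_ge0.
  by move=> k _ _; rewrite lee_fin obox_vol_ge0.
apply: le_trans (epsilon_trick _ _ (ltW e0)); last first.
  by move=> k; rewrite lee_fin obox_vol_ge0.
apply: lee_nneseries => k _.
  by rewrite -EFinD lee_fin addr_ge0// obox_vol_ge0.
rewrite -!EFinD lee_fin !(@obox_volD1 _ i).
have -> : \prod_(j < n.+1 | j != i)
   Num.max 0 ((B1 k).2 ord0 j - (B1 k).1 ord0 j) = P k.
  by apply: eq_bigr => j /negbTE ji; rewrite setcE ji.
have -> : \prod_(j < n.+1 | j != i)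
   Num.max 0 ((B2 k).2 ord0 j - (B2 k).1 ord0 j) = P k.
  by apply: eq_bigr => j /negbTE ji; rewrite setcE ji.
rewrite -/(P k) /= !setcE eqxx -mulrDl.
set c := (B k).1 _ _; set d := (B k).2 _ _.
have H : Num.max 0 (Num.min d a - c) + Num.max 0 (d - (Num.max c a - tau k))
         <= Num.max 0 (d - c) + tau k.
  have := tau0 k; move: (tau k) => t t0.
  rewrite /Num.max /Num.min; repeat case: ifPn; rewrite -?leNgt => *; lra.
apply: le_trans (ler_wpM2r (P0 k) H) _; rewrite mulrDl lerD2l.
rewrite /tau mulrAC ler_pdivrMr// ler_wpM2l// ?lerDl//.
by rewrite divr_ge0// ltW.
Qed.

Definition cbox (B : V * V) : set V :=
  [set x | forall i, B.1 ord0 i <= x ord0 i <= B.2 ord0 i].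

Lemma measurable_coord_ge i a :
  measurable ([set x : V | a <= x ord0 i] : set (lebT R n)).
Proof.
rewrite (_ : [set x : V | _] = ~` [set x : V | x ord0 i < a]); last first.
  by apply/seteqP; split => x /=; rewrite leNgt => /negP.
by apply: measurableC; exact: measurable_halfspace.
Qed.

Lemma measurable_coord_gt i a :
  measurable ([set x : V | a < x ord0 i] : set (lebT R n)).
Proof.
rewrite (_ : [set x : V | _] =
    \bigcup_k [set x : V | a + k.+1%:R^-1 <= x ord0 i]).
  by apply: bigcup_measurable => k _; exact: measurable_coord_ge.
apply/seteqP; split => x /=.
  move=> /ltr_add_invr[k kx].
  by exists k => //=; exact: ltW.
by move=> [k _ /=]; apply: lt_le_trans; rewrite ltrDl invr_gt0 ltr0n.
Qed.

Lemma measurable_obox B : measurable (obox B : set (lebT R n)).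
Proof.
rewrite (_ : obox B = \bigcap_(i in [set: 'I_n.+1])
  ([set x : V | B.1 ord0 i < x ord0 i] `&` [set x : V | x ord0 i < B.2 ord0 i])).
  apply: fin_bigcap_measurable => // i _.
  apply: measurableI; [exact: measurable_coord_gt|exact: measurable_halfspace].
apply/seteqP; split => x /= h i; first by move=> _; apply/andP.
by have [//|? ?] := h i; apply/andP.
Qed.

Definition hbox (B : V * V) : set V :=
  [set x | forall i, B.1 ord0 i <= x ord0 i < B.2 ord0 i].

Lemma measurable_hbox B : measurable (hbox B : set (lebT R n)).
Proof.
rewrite (_ : hbox B = \bigcap_(i in [set: 'I_n.+1])
  ([set x : V | B.1 ord0 i <= x ord0 i] `&` [set x : V | x ord0 i < B.2 ord0 i])).
  apply: fin_bigcap_measurable => // i _.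
  apply: measurableI; [exact: measurable_coord_ge|exact: measurable_halfspace].
apply/seteqP; split => x /= h i; first by move=> _; apply/andP.
by have [//|? ?] := h i; apply/andP.
Qed.

(** Enumerates the boxes with rational corners; a code that decodes to nothing yields the corner
    pair (0, 0), whose open box is empty. *)
Definition rbox (k : nat) : V * V :=
  if @unpickle ('rV[rat]_n.+1 * 'rV[rat]_n.+1)%type k is Some q
  then (map_mx ratr q.1, map_mx ratr q.2) else (0, 0).

Lemma open_rbox (U : set V) x : open U -> U x ->
  exists k, obox (rbox k) x /\ cbox (rbox k) `<=` U.
Proof.
move=> oU Ux; have /nbhs_ballP[e /= e0 xU] := open_nbhs_nbhs (conj oU Ux).
have H (i : 'I_n.+1) : exists q : rat * rat,
    [/\ x ord0 i - e < ratr q.1, ratr q.1 < x ord0 i,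
        x ord0 i < ratr q.2 & ratr q.2 < x ord0 i + e].
  have [q1] := @rat_in_itvoo R (x ord0 i - e) (x ord0 i) ltac:(lra).
  have [q2] := @rat_in_itvoo R (x ord0 i) (x ord0 i + e) ltac:(lra).
  by rewrite !in_itv /= => /andP[? ?] /andP[? ?]; exists (q1, q2).
have /choice[q qP] := H.
pose Q := (\row_i (q i).1, \row_i (q i).2) : 'rV[rat]_n.+1 * 'rV[rat]_n.+1.
exists (pickle Q); rewrite /rbox pickleK; split.
  by move=> i; have [? ? ? ?] := qP i; rewrite /= !mxE; apply/andP.
move=> y yQ; apply: xU; split => // i j; rewrite (ord1 i).
have := yQ j; rewrite /= !mxE /ball /= => /andP[? ?].
have [? ? ? ?] := qP j.
by rewrite ltr_norml; apply/andP; split; lra.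
Qed.

Lemma obox_cbox B : obox B `<=` cbox B.
Proof. by move=> x xB i; have /andP[/ltW -> /ltW ->] := xB i. Qed.

Lemma open_bigcup_rbox (U : set V) : open U ->
  U = \bigcup_(k in [set k | cbox (rbox k) `<=` U]) obox (rbox k).
Proof.
move=> oU; apply/seteqP; split => x.
  by move=> Ux; have [k [? ?]] := open_rbox oU Ux; exists k.
by move=> [k /= kU /obox_cbox/kU].
Qed.

Lemma leb_open_measurable (U : set V) : open U -> measurable (U : set (lebT R n)).
Proof.
move=> oU; rewrite (open_bigcup_rbox oU).
by apply: bigcup_measurable => k _; exact: measurable_obox.
Qed.

Lemma continuous_leb_measurable (f : V -> R) : continuous f ->
  measurable_fun (setT : set (lebT R n)) (f : lebT R n -> R).
Proof.
move=> cf; apply: (@measurability _ _ (lebT R n) _ setT f _ (@RGenOInfty.measurableE R)).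
move=> _ [_ [a ->] <-]; rewrite setTI.
apply: leb_open_measurable; apply: open_comp; last exact: interval_open.
by move=> x _; exact: cf.
Qed.

(** Covers by boxes translate with unchanged volumes. *)
Lemma leb_outer_shift_le (A : set V) y :
  (mu ((fun x => x + y)%R @^-1` A) <= mu A)%E.
Proof.
rewrite [leRHS]/leb_outer; apply: le_ereal_inf_tmp => _ [B XB <-].
apply: (@le_trans _ _ (\sum_(k <oo) (obox_vol ((B k).1 - y, (B k).2 - y)%R)%:E)%E).
  apply: leb_outer_le_cover => x /= /XB [k _ Bx]; exists k => // i.
  by have := Bx i; rewrite /= !mxE ltrBlDr ltrBrDr.
apply: lee_nneseries => k _; first by rewrite lee_fin obox_vol_ge0.
rewrite lee_fin /obox_vol le_eqVlt; apply/orP; left; apply/eqP.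
by apply: eq_bigr => i _ /=; rewrite !mxE; congr Num.max; ring.
Qed.

Lemma leb_outer_shift (A : set V) y :
  mu ((fun x => x + y)%R @^-1` A) = mu A.
Proof.
apply/eqP; rewrite eq_le leb_outer_shift_le /=.
have {1}-> : A = (fun x => x - y)%R @^-1` ((fun x => x + y)%R @^-1` A).
  by apply/seteqP; split => x /=; rewrite subrK.
exact: leb_outer_shift_le.
Qed.

(** The Caratheodory condition for the shifted set, tested on X, is the condition for A tested on a
    translate of X. *)
Lemma measurable_shift (A : set V) y : measurable (A : set (lebT R n)) ->
  measurable ((fun x => x + y)%R @^-1` A : set (lebT R n)).
Proof.
rewrite /measurable /= => mA X; have := mA ((fun x => x - y)%R @^-1` X).
have E (Z : set V) : (fun x => x + y)%R @^-1` ((fun x => x - y)%R @^-1` Z) = Z.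
  by apply/seteqP; split => x /=; rewrite addrK.
by rewrite -(leb_outer_shift _ y) -(leb_outer_shift (_ `&` _) y)
  -(leb_outer_shift (_ `&` ~` A) y) !preimage_setI E preimage_setC.
Qed.

(** The box is covered by itself, followed by boxes (0, 0) of volume zero. *)
Lemma leb_obox_le (B : V * V) : (leb (obox B) <= (obox_vol B)%:E)%E.
Proof.
pose C k := if k == 0%N then B else (0, 0).
apply: le_trans (@leb_outer_le_cover _ C _) _.
  by move=> x Bx; exists 0%N.
rewrite (nneseries_split 0 1)//; last first.
  by move=> k _; rewrite lee_fin obox_vol_ge0.
rewrite big_nat1 /= eseries0 ?adde0// => k k1 _.
rewrite /C ifF ?(gtn_eqF k1)// /obox_vol big_ord_recl /= subrr.
by rewrite maxxx mul0r.
Qed.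

Lemma bounded_sub_obox (A : set V) : bounded_set A ->
  exists2 M : R, 0 < M & A `<=` obox (const_mx (- M), const_mx M).
Proof.
move=> [M [_ MA]]; pose M' := `|M| + 1.
have M'M : M < M' by rewrite /M' (le_lt_trans (ler_norm M))// ltrDl.
exists (M' + 1) => [|x Ax i]; first by rewrite ltr_wpDl// addr_ge0.
have := MA M' M'M x Ax => xM.
have : `|x ord0 i| <= M'.
  apply: le_trans xM; rewrite {2}/Num.norm /= mx_normrE.
  exact: (le_bigmax _ (fun ij : 'I_1 * 'I_n.+1 => `|x ij.1 ij.2|) (ord0, i)).
rewrite /= !mxE ler_norml => /andP[? ?]; apply/andP; split; lra.
Qed.

Lemma leb_bounded_fin (A : set V) : bounded_set A -> (leb A < +oo)%E.
Proof.
move=> /bounded_sub_obox[M M0 AM].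
apply: le_lt_trans (le_leb_outer AM) _.
exact: le_lt_trans (leb_obox_le _) (ltry _).
Qed.

End leb_basics.

(** * Subsequences and elementary inequalities for real powers *)

Section sequences_aux.
Context (R : realType).

Lemma extract_subseq (P : nat -> nat -> Prop) :
  (forall k, exists N, forall m, (N <= m)%N -> P k m) ->
  exists s : nat -> nat, {homo s : i j / (i < j)%N} /\ forall k, P k (s k).
Proof.
move=> /choice[N NP].
pose s := fix s k := if k is k'.+1 then maxn (s k').+1 (N k) else N 0%N.
have sN k : (N k <= s k)%N by case: k => [|k] //=; rewrite leq_maxr.
exists s; split; last by move=> k; exact: NP.
by apply: homo_ltn => [i j k|i] /=; [exact: ltn_trans|rewrite leq_maxl].
Qed.

Lemma homo_ltn_ge (s : nat -> nat) :
  {homo s : i j / (i < j)%N} -> forall k, (k <= s k)%N.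
Proof.
move=> h; elim=> // k; move=> /leq_ltn_trans; apply.
by apply: h.
Qed.

Lemma cvg_subseq (T : topologicalType) (u : nat -> T) (l : T) (s : nat -> nat) :
  {homo s : i j / (i < j)%N} -> u k @[k --> \oo] --> l ->
  u (s k) @[k --> \oo] --> l.
Proof.
move=> hs ul; apply: cvg_comp ul.
by move=> A [N _ NA]; exists N => // k /= Nk; apply: NA => /=;
  exact: leq_trans Nk (homo_ltn_ge hs k).
Qed.

(** The telescoping series of [a] is absolutely dominated by a geometric one. *)
Lemma cvg_geometric_steps (a : nat -> R) (C r : R) : 0 <= r < 1 ->
  (forall k, `|a k.+1 - a k| <= C * r ^+ k) -> cvgn a.
Proof.
move=> /andP[r0 r1] H.
have E : a = (fun k => a 0%N + series (telescope a) k).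
  apply/funext => k; rewrite seriesEnat /= telescope_sumr//.
  by rewrite addrC subrK.
have C0 : 0 <= C by have := H 0%N; rewrite expr0 mulr1; exact: le_trans.
have : cvgn [normed series (telescope a)].
  apply: (@series_le_cvg _ _ (geometric C r)).
  - by move=> k /=.
  - by move=> k; rewrite /= mulr_ge0// exprn_ge0.
  - by move=> k; exact: H.
  - by apply: is_cvg_geometric_series; rewrite ger0_norm.
move=> /normed_cvg cs; rewrite E; apply: is_cvgD => //; exact: is_cvg_cst.
Qed.

(** Both terms are at most the larger one, so the sum is at most twice it. The constant 2^p is crude
    for p >= 1 but holds for every p >= 0. *)
Lemma powRD_le (p a b : R) : 0 <= p -> 0 <= a -> 0 <= b ->
  (a + b) `^ p <= 2 `^ p * (a `^ p + b `^ p).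
Proof.
move=> p0 a0 b0.
have [ab|ba] := leP a b.
  apply: (@le_trans _ _ ((2 * b) `^ p)).
    by apply: ge0_ler_powR => //; rewrite ?nnegrE ?addr_ge0 ?mulr_ge0//; lra.
  by rewrite powRM// ler_wpM2l ?powR_ge0// lerDr powR_ge0.
apply: (@le_trans _ _ ((2 * a) `^ p)).
  by apply: ge0_ler_powR => //; rewrite ?nnegrE ?addr_ge0 ?mulr_ge0//; lra.
by rewrite powRM// ler_wpM2l ?powR_ge0// lerDl powR_ge0.
Qed.

Lemma powR_normD_le (p a b : R) : 0 <= p ->
  `|a + b| `^ p <= 2 `^ p * (`|a| `^ p + `|b| `^ p).
Proof.
move=> p0; apply: le_trans (powRD_le p0 (normr_ge0 a) (normr_ge0 b)).
by apply: ge0_ler_powR => //; rewrite ?nnegrE ?addr_ge0// ler_normD.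
Qed.

Lemma powRK (p x : R) : 0 < p -> 0 <= x -> (x `^ p) `^ p^-1 = x.
Proof. by move=> p0 x0; rewrite -powRrM mulfV ?gt_eqF// powRr1. Qed.

Lemma powRVK (p x : R) : 0 < p -> 0 <= x -> (x `^ p^-1) `^ p = x.
Proof. by move=> p0 x0; rewrite -powRrM mulVf ?gt_eqF// powRr1. Qed.

Lemma continuous_powR_gt0 (p x : R) : 0 < x -> {for x, continuous (@powR R ^~ p)}.
Proof.
move=> x0; apply: differentiable_continuous; apply/derivable1_diffP.
by have [] := is_derive1_powR p x0.
Qed.

(** Away from 0 this is differentiability of the power; at 0, |t|^p < e as soon as |t| < e^(1/p). *)
Lemma continuous_normpow (p : R) : 0 < p -> continuous (fun z : R => `|z| `^ p).
Proof.
move=> p0 z; have [->|z0] := eqVneq z 0; last first.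
  apply: (@continuous_comp _ _ _ (@Num.norm R R) (@powR R ^~ p)).
    exact: norm_continuous.
  by apply: continuous_powR_gt0; rewrite normr_gt0.
apply/cvgrPdist_lt => e e0; rewrite normr0 powR0 ?gt_eqF//.
near=> t; rewrite sub0r normrN ger0_norm ?powR_ge0//.
rewrite -(@powRVK p e)// ?ltW//; apply: gt0_ltr_powR; rewrite ?nnegrE ?powR_ge0//.
near: t; have := @cvgr0_norm_lt _ _ _ (nbhs (0 : R)) _ id cvg_id.
by apply; rewrite powR_gt0.
Unshelve. all: by end_near. Qed.

Lemma cvg_normpow (I : Type) (F : set_system I) {FF : Filter F} (f : I -> R)
    (p l : R) : 0 < p ->
  f x @[x --> F] --> l -> `|f x| `^ p @[x --> F] --> `|l| `^ p.
Proof. by move=> p0 fl; exact: continuous_cvg (@continuous_normpow p p0 l) fl. Qed.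

End sequences_aux.

(** * Integration: almost everywhere arguments, dominated convergence, completeness of L^p *)

Section integral_toolkit.
Context d (T : measurableType d) (R : realType) (mu : {measure set T -> \bar R}).
Context (D : set T) (mD : measurable D).
Implicit Types f g : T -> R.
Local Notation mf f := (measurable_fun D (f : T -> R)).
Local Notation ig f := (mu.-integrable D (EFin \o (f : T -> R))).
Local Notation I f := (Rintegral mu D (f : T -> R)).

(** Completeness of the measure makes the part of the preimage inside the exceptional null set
    measurable. *)
Lemma measurable_fun_ae f g : measure_is_complete mu -> mf f ->
  (\forall x \ae mu, D x -> f x = g x) -> mf g.
Proof.
move=> cmu fm fg mD' Y mY.
set N := ~` [set x | D x -> f x = g x].
have mN : measurable N by apply: cmu.
rewrite (_ : D `&` g @^-1` Y = ((D `&` f @^-1` Y) `\` N) `|` (D `&` g @^-1` Y `&` N)).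
  apply: measurableU; first by apply: measurableD => //; exact: fm.
  apply: cmu; apply: negligibleS fg => x []; exact.
apply/seteqP; split => x /=.
  move=> [Dx Yx]; have [Nx|Nx] := pselect (N x); first by right.
  by left; split => //; split => //; move/contrapT : Nx => ->.
move=> [[[Dx Yx] Nx]|[]//]; split => //.
by move/contrapT : Nx => <-.
Qed.

Lemma ig_mf f : ig f -> mf f.
Proof. by move=> /integrableP[/measurable_EFinP]. Qed.

Lemma mf_norm f : mf f -> mf (fun x => `|f x|).
Proof. by move=> fm; exact: (measurableT_comp (@normr_measurable R setT)). Qed.

Lemma mf_powR f p : mf f -> mf (fun x => f x `^ p).
Proof. by move=> fm; exact: (measurableT_comp (@measurable_powR R p)). Qed.

Lemma mf_normpow f p : mf f -> mf (fun x => `|f x| `^ p).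
Proof. by move=> fm; apply: mf_powR; exact: mf_norm. Qed.

Lemma ig_le f g : mf g -> ig f -> (\forall x \ae mu, D x -> `|g x| <= f x) -> ig g.
Proof.
move=> gm fi fg; apply/integrableP; split; first exact/measurable_EFinP.
have /integrableP[fm' fi'] := fi.
apply: le_lt_trans fi'; apply: ae_ge0_le_integral => //.
- by apply/measurable_EFinP; exact: mf_norm.
- by apply/measurable_EFinP; apply: mf_norm; exact: ig_mf.
- by apply: filterS fg => x /= fgx Dx; rewrite lee_fin (le_trans (fgx Dx))// ler_norm.
Qed.

Lemma ig_ae f g : mf g -> ig f -> (\forall x \ae mu, D x -> f x = g x) -> ig g.
Proof.
move=> gm fi fg; apply: (@ig_le (fun x => `|f x|)) => //.
  exact: integrable_norm.
by apply: filterS fg => x /= /[apply] ->.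
Qed.

Lemma igD f g : ig f -> ig g -> ig (fun x => f x + g x).
Proof. by move=> fi gi; have := integrableD mD fi gi; apply: eq_integrable. Qed.

Lemma igZ (k : R) f : ig f -> ig (fun x => k * f x).
Proof. by move=> fi; have := integrableZl mD k fi; apply: eq_integrable. Qed.

Lemma igN f : ig f -> ig (fun x => - f x).
Proof.
by move=> /(igZ (-1)); apply: eq_integrable => // x _; rewrite /= mulN1r.
Qed.

Lemma igB f g : ig f -> ig g -> ig (fun x => f x - g x).
Proof. by move=> fi gi; exact: igD fi (igN gi). Qed.

Lemma ig0 : ig (fun=> 0).
Proof. by have := integrable0 mu D; apply: eq_integrable. Qed.

Lemma ig_norm f : ig f -> ig (fun x => `|f x|).
Proof. exact: integrable_norm. Qed.

Lemma ig_cst (k : R) : (mu D < +oo)%E -> ig (fun=> k).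
Proof. move=> fD; apply: measurable_bounded_integrable => //.
exists `|k|; split; first exact: num_real.
by move=> M kM x _ /=; exact: ltW. Qed.

Lemma ig_sum (I' : Type) (r : seq I') (P : pred I') (F : I' -> T -> R) :
  (forall i, P i -> ig (F i)) -> ig (fun x => \sum_(i <- r | P i) F i x).
Proof.
move=> h; elim: r => [|i r ih].
  by apply: eq_integrable ig0 => // x _ /=; rewrite big_nil.
have [Pi|nPi] := boolP (P i).
  apply: eq_integrable (igD (h i Pi) ih) => // x _ /=.
  by rewrite big_cons Pi.
by apply: eq_integrable ih => // x _ /=; rewrite big_cons (negbTE nPi).
Qed.

Lemma I_eq_ae f g : mf f -> mf g -> (\forall x \ae mu, D x -> f x = g x) -> I f = I g.
Proof.
move=> fm gm fg; congr fine; apply: ae_eq_integral => //.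
- exact/measurable_EFinP.
- exact/measurable_EFinP.
- by apply: filterS fg => x /= /[apply] ->.
Qed.

Lemma I_eq f g : (forall x, D x -> f x = g x) -> I f = I g.
Proof. by move=> h; apply: eq_Rintegral => x; rewrite inE => /h. Qed.

Lemma I_ge0 f : (forall x, D x -> 0 <= f x) -> 0 <= I f.
Proof. exact: Rintegral_ge0. Qed.

Lemma I_le_ae f g : ig f -> ig g -> (\forall x \ae mu, D x -> f x <= g x) -> I f <= I g.
Proof.
move=> fi gi fg; rewrite -subr_ge0 -RintegralB//.
rewrite (_ : I _ = I (fun x => `|g x - f x|)); first by apply: I_ge0.
have bi := igB gi fi.
apply: I_eq_ae; [exact: ig_mf|exact/mf_norm/ig_mf|].
by apply: filterS fg => x /= /[apply] h; rewrite ger0_norm// subr_ge0.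
Qed.

Lemma I_le f g : ig f -> ig g -> (forall x, D x -> f x <= g x) -> I f <= I g.
Proof. exact: le_Rintegral. Qed.

Lemma I_sum (I' : Type) (r : seq I') (P : pred I') (F : I' -> T -> R) :
  (forall i, P i -> ig (F i)) ->
  I (fun x => \sum_(i <- r | P i) F i x) = \sum_(i <- r | P i) I (F i).
Proof.
move=> h; elim: r => [|i r ih].
  rewrite big_nil -[RHS](mul0r (fine (mu D))) -(Rintegral_cst mu mD).
  by apply: I_eq => x _; rewrite big_nil.
rewrite big_cons; case: ifPn => [Pi|nPi].
  rewrite -ih -RintegralD//; [|exact: h|exact: ig_sum].
  by apply: I_eq => x _; rewrite big_cons Pi.
by rewrite -ih; apply: I_eq => x _; rewrite big_cons (negbTE nPi).
Qed.

Lemma EFin_I f : ig f -> (I f)%:E = (\int[mu]_(x in D) (f x)%:E)%E.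
Proof. by move=> fi; rewrite fineK//; exact: integrable_fin_num. Qed.

Lemma ig_ge0P f : mf f -> (forall x, D x -> 0 <= f x) ->
  ig f <-> (\int[mu]_(x in D) (f x)%:E < +oo)%E.
Proof.
move=> fm f0; have E : (\int[mu]_(x in D) (f x)%:E = \int[mu]_(x in D) `|(f x)%:E|)%E.
  by apply: eq_integral => x; rewrite inE => Dx; rewrite gee0_abs// lee_fin f0.
split; first by move=> /integrableP[_]; rewrite -E.
by move=> h; apply/integrableP; split; [exact/measurable_EFinP|rewrite -E].
Qed.

Lemma dominated_cvgR (F : nat -> T -> R) f g : (forall k, mf (F k)) -> mf f ->
  ig g -> (\forall x \ae mu, D x -> F k x @[k --> \oo] --> f x) ->
  (forall k, \forall x \ae mu, D x -> `|F k x| <= g x) ->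
  [/\ ig f, I (F k) @[k --> \oo] --> I f & forall k, ig (F k)].
Proof.
move=> Fm fm gi Ff Fg.
have Fi k : ig (F k) by apply: (ig_le (Fm k) gi (Fg k)).
have Fg' := ae_foralln Fg.
have [] := @dominated_convergence _ _ _ mu D mD (fun k => EFin \o F k) (EFin \o f) (EFin \o g).
- by move=> k; exact/measurable_EFinP.
- exact/measurable_EFinP.
- by apply: filterS Ff => x /= /[apply]; apply: cvg_EFin; exact: nearW.
- by [].
- by apply: filterS Fg' => x h k Dx /=; rewrite lee_fin h.
move=> fi _ cv; split => //.
by apply: fine_cvg; rewrite EFin_I.
Qed.

(** Integrability of the limit comes together with the bound, which is how membership in L^p passes
    to limits below. *)
Lemma fatouR (F : nat -> T -> R) f (C : R) : (forall k, ig (F k)) -> mf f ->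
  (forall k x, D x -> 0 <= F k x) ->
  (\forall x \ae mu, D x -> F k x @[k --> \oo] --> f x) ->
  (forall k, I (F k) <= C) ->
  (forall x, D x -> 0 <= f x) -> ig f /\ I f <= C.
Proof.
move=> Fi fm F0 Ff FC f0.
have Fm k : measurable_fun D (EFin \o F k).
  by apply/measurable_EFinP; exact: ig_mf.
have fm' : measurable_fun D (EFin \o f) by exact/measurable_EFinP.
have H : (\int[mu]_(x in D) (f x)%:E <= C%:E)%E.
  have := @fatou _ _ _ mu D mD (fun k => EFin \o F k) Fm (fun k x Dx => F0 k x Dx).
  have -> : (\int[mu]_(x in D) limn_einf (fun k => (EFin \o F k) x) =
     \int[mu]_(x in D) (f x)%:E)%E.
    apply: ge0_ae_eq_integral => //.
    - rewrite /limn_einf; apply: measurableT_comp => //.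
      by apply: measurable_fun_limn_esup => k; exact: measurableT_comp.
    - move=> x Dx; rewrite limn_einf_lim; apply: lime_ge.
        exact: is_cvg_einfs.
      by apply: nearW => k; apply: le_ereal_inf_tmp => _ /= [m _ <-]; rewrite lee_fin F0.
    - apply: filterS Ff => x /= /[apply] h.
      have : (EFin \o (fun k => F k x)) k @[k --> \oo] --> (f x)%:E.
        by apply: cvg_EFin => //; exact: nearW.
      by move=> /cvg_limn_einf_sup[].
  move=> /le_trans; apply.
  rewrite limn_einf_lim; apply: lime_le; first exact: is_cvg_einfs.
  apply: nearW => k; apply: (@le_trans _ _ (I (F k))%:E); last by rewrite lee_fin.
  by rewrite EFin_I//; apply: ereal_inf_lbound => /=; exists k => /=.
have fi : ig f by apply/ig_ge0P => //; exact: le_lt_trans H (ltry _).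
by split => //; rewrite -lee_fin EFin_I.
Qed.

(** The sum of 2^k h_k has integral at most the sum of 2^(-k), so it is finite almost everywhere,
    and its value at x serves as the constant C. *)
Lemma ae_fast_decay (h : nat -> T -> R) : (forall k, ig (h k)) ->
  (forall k x, D x -> 0 <= h k x) -> (forall k, I (h k) <= 4^-1 ^+ k) ->
  \forall x \ae mu, D x -> exists C : R, forall k, h k x <= C * 2^-1 ^+ k.
Proof.
move=> hi h0 hI.
pose S x := (\sum_(0 <= k <oo) (2 ^+ k * h k x)%:E)%E.
have m2 k : measurable_fun D (fun x => (2 ^+ k * h k x)%:E).
  by apply/measurable_EFinP; apply: ig_mf; exact: igZ.
have p2 k x : D x -> (0 <= (2 ^+ k * h k x)%:E)%E.
  by move=> Dx; rewrite lee_fin mulr_ge0 ?exprn_ge0// h0.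
have mS : measurable_fun D S by apply: ge0_emeasurable_sum => // k x Dx _; exact: p2.
have S0 x : D x -> (0 <= S x)%E by move=> Dx; apply: nneseries_ge0 => k _ _; exact: p2.
have Si : mu.-integrable D S.
  apply/integrableP; split => //.
  rewrite (_ : (\int[mu]_(x in D) `|S x| = \int[mu]_(x in D) S x)%E); last first.
    by apply: eq_integral => x; rewrite inE => Dx; rewrite gee0_abs// S0.
  rewrite integral_nneseries//.
  apply: (@le_lt_trans _ _ (\sum_(0 <= k <oo) (2^-1 ^+ k)%:E)%E).
    apply: lee_nneseries => [k _ _|k _].
      by apply: integral_ge0 => x; exact: p2.
    rewrite -(EFin_I (igZ (2 ^+ k) (hi k))) lee_fin RintegralZl//.
    rewrite (_ : 2^-1 ^+ k = 2 ^+ k * 4^-1 ^+ k); last first.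
      by rewrite -exprMn; congr (_ ^+ _); lra.
    by rewrite ler_wpM2l ?exprn_ge0.
  apply: (@le_lt_trans _ _ 2%:E); last exact: ltry.
  apply: lime_le; first by apply: is_cvg_nneseries => k _ _; rewrite lee_fin exprn_ge0.
  apply: nearW => k; rewrite sumEFin lee_fin.
  have := @geometric_le_lim R k 1 2^-1 ler01.
  rewrite seriesEnat /= => h2; apply: le_trans (le_trans (h2 _ _) _) => //.
  - by apply: ler_sum => i _; rewrite mul1r.
  - by rewrite ger0_norm; lra.
  - by rewrite (_ : 1 - 2^-1 = 2^-1 :> R) ?invrK ?mul1r//; lra.
have := integrable_ae mD Si; apply: filterS => x /= /[swap] Dx /(_ Dx) fS.
exists (fine (S x)) => k.
rewrite exprVn ler_pdivlMr ?exprn_gt0// mulrC.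
rewrite -lee_fin fineK//.
rewrite /S (nneseriesD1 (n := k)) //; last by move=> *; exact: p2.
rewrite mulrC leeDl//; apply: nneseries_ge0 => m _ _; exact: p2.
Qed.

(** Along indices where the integrals are at most 4^(-k), fast decay applies. *)
Lemma L1_cvg_subseq (h : nat -> T -> R) : (forall k, ig (h k)) ->
  (forall k x, D x -> 0 <= h k x) -> I (h k) @[k --> \oo] --> 0 ->
  exists2 s : nat -> nat, {homo s : i j / (i < j)%N} &
    \forall x \ae mu, D x -> h (s k) x @[k --> \oo] --> 0.
Proof.
move=> hi h0 hI.
have [|s [hs sI]] := @extract_subseq (fun k m => I (h m) <= 4^-1 ^+ k).
  move=> k; have /cvgrPdist_le/(_ (4^-1 ^+ k) _)[|N _ NP] := hI.
    by rewrite exprn_gt0.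
  exists N => m /NP /=; rewrite sub0r normrN; apply: le_trans; exact: ler_norm.
exists s => //; have := @ae_fast_decay (fun k => h (s k)) _ _ sI.
move=> /(_ (fun=> hi _) (fun=> h0 _)); apply: filterS => x /= /[swap] Dx /(_ Dx)[C HC].
apply: (@squeeze_cvgr _ _ _ _ (fun=> 0) (fun k => C * 2^-1 ^+ k)).
- by apply: nearW => k; rewrite h0//= HC.
- exact: cvg_cst.
- rewrite -[X in _ --> X](mulr0 C); apply: cvgMl_tmp.
  by apply: cvg_expr; rewrite ger0_norm; lra.
Qed.

(** Riesz and Fischer: along indices where the p-th powers of the steps integrate to at most 4^(-k),
    the steps at almost every x are bounded by a geometric sequence of ratio 2^(-1/p). Fatou's lemma
    with the second index going to infinity then gives convergence of the whole sequence in L^p. *)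
Lemma Lp_complete (p : R) (f : nat -> T -> R) : 0 < p ->
  (forall k, mf (f k)) -> (forall k, ig (fun x => `|f k x| `^ p)) ->
  (forall e : R, 0 < e -> exists N, forall k l, (N <= k)%N -> (N <= l)%N ->
     I (fun x => `|f k x - f l x| `^ p) <= e) ->
  exists (g : T -> R) (s : nat -> nat),
   [/\ {homo s : i j / (i < j)%N}, mf g, ig (fun x => `|g x| `^ p),
       I (fun x => `|f k x - g x| `^ p) @[k --> \oo] --> 0 &
       \forall x \ae mu, D x -> f (s k) x @[k --> \oo] --> g x].
Proof.
move=> p0 fm fi fC.
have dm k l : mf (fun x => f k x - f l x) by apply: measurable_funB.
have di k l : ig (fun x => `|f k x - f l x| `^ p).
  apply: (@ig_le (fun x => 2 `^ p * (`|f k x| `^ p + `|f l x| `^ p))).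
  - exact: mf_normpow.
  - by apply: igZ; exact: igD.
  - apply: aeW => x _; rewrite ger0_norm ?powR_ge0//.
    by rewrite -(normrN (f l x)); apply: powR_normD_le; exact: ltW.
have [|s [hs sI]] := @extract_subseq (fun k m => forall l, (m <= l)%N ->
    I (fun x => `|f l x - f m x| `^ p) <= 4^-1 ^+ k).
  move=> k; have [|N NP] := fC (4^-1 ^+ k); first by rewrite exprn_gt0.
  by exists N => m Nm l ml; apply: NP => //; exact: leq_trans ml.
have ae1 := @ae_fast_decay (fun k x => `|f (s k.+1) x - f (s k) x| `^ p)
  (fun k => di _ _) (fun k x _ => powR_ge0 _ _)
  (fun k => sI k _ (ltnW (hs _ _ (ltnSn k)))).
have ae2 : \forall x \ae mu, D x -> cvgn (fun k => f (s k) x).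
  apply: filterS ae1 => x /= /[apply] -[C HC].
  have C0 : 0 <= C by have := HC 0%N; rewrite expr0 mulr1; apply: le_trans; exact: powR_ge0.
  apply: (@cvg_geometric_steps _ _ (C `^ p^-1) (2^-1 `^ p^-1)).
    have E1 : (1 : R) `^ p^-1 = 1 by rewrite powR1.
  rewrite powR_ge0 /= -[X in _ < X]E1.
  by apply: gt0_ltr_powR; rewrite ?invr_gt0// ?nnegrE; lra.
  move=> k; have -> : (2^-1 `^ p^-1) ^+ k = (2^-1 ^+ k) `^ p^-1 :> R.
    by elim: k => [|k ih]; rewrite ?expr0 ?powR1// !exprS powRM ?exprn_ge0// ih.
  rewrite -powRM ?exprn_ge0//.
  have E2 (z : R) : 0 <= z -> z = (z `^ p) `^ p^-1.
    by move=> z0; rewrite -powRrM mulfV ?gt_eqF// powRr1.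
  rewrite [leLHS]E2//.
  apply: ge0_ler_powR; rewrite ?nnegrE ?invr_ge0 ?powR_ge0 ?mulr_ge0 ?exprn_ge0//.
  exact: ltW.
pose N := [set x | ~ (D x -> cvgn (fun k => f (s k) x))].
have [M [mM M0 NM]] : mu.-negligible N by exact: ae2.
(* The limit is set to 0 on a measurable null set [M] containing the points of divergence, which
   makes it an everywhere limit of measurable functions. *)
pose g x := \1_(~` M) x * limn (fun k => f (s k) x).
have gE x : ~ M x -> g x = limn (fun k => f (s k) x).
  by move=> Mx; rewrite /g indicE mem_set// mul1r.
have gM x : M x -> \1_(~` M) x = 0 :> R.
  by move=> Mx; rewrite indicE memNset// => /(_ Mx).
have gc x : D x -> ~ M x -> f (s k) x @[k --> \oo] --> g x.
  move=> Dx Mx; rewrite gE//.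
  have [h|h] := pselect (D x -> cvgn (fun k => f (s k) x)); first exact: h Dx.
  by exfalso; apply: Mx; apply: NM.
have aeg : \forall x \ae mu, D x -> f (s k) x @[k --> \oo] --> g x.
  exists M; split => // x /=; apply: contra_notP => Mx Dx; exact: gc.
have gm : mf g.
  apply: (@measurable_fun_cvg _ _ _ _ (fun k x => \1_(~` M) x * f (s k) x)).
    move=> k; apply: measurable_funM => //; apply: measurable_indic.
    exact: measurableC.
  move=> x Dx; have [Mx|Mx] := pselect (M x).
    by rewrite /g (gM _ Mx) mul0r; under eq_fun do rewrite mul0r; exact: cvg_cst.
  apply: cvg_trans (gc x Dx Mx); apply: near_eq_cvg; apply: nearW => k.
  by rewrite indicE mem_set// mul1r.
have FC e : 0 < e -> exists N, forall k, (N <= k)%N ->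
    ig (fun x => `|f k x - g x| `^ p) /\ I (fun x => `|f k x - g x| `^ p) <= e.
  move=> e0; have [N1 NP] := fC e e0; exists N1 => k Nk.
  apply: (@fatouR (fun l x => `|f k x - f (s (N1 + l)%N) x| `^ p)) => //.
  - by apply: mf_normpow; exact: measurable_funB.
  - apply: filterS aeg => x /= /[apply] h.
    have c1 : f (s (N1 + l)%N) x @[l --> \oo] --> g x.
      by have := h; rewrite -(cvg_shiftn N1); under eq_fun do rewrite addnC.
    by apply: cvg_normpow => //; apply: cvgB => //; exact: cvg_cst.
  - move=> l; apply: NP => //; apply: leq_trans (homo_ltn_ge hs _).
    exact: leq_addr.
exists g, s; split => //.
- have [N1 /(_ N1 (leqnn _))[ii _]] := FC 1 ltr01.
  apply: (@ig_le (fun x => 2 `^ p * (`|f N1 x| `^ p + `|f N1 x - g x| `^ p))).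
  - exact: mf_normpow.
  - by apply: igZ; exact: igD.
  - apply: aeW => x _; rewrite ger0_norm ?powR_ge0//.
    have := powR_normD_le (f N1 x) (- (f N1 x - g x)) (ltW p0).
    by rewrite normrN opprB addrC subrK.
- apply/cvgrPdist_le => e e0; have [N1 NP] := FC e e0.
  exists N1 => // k /= /NP[_ h]; rewrite sub0r normrN ger0_norm//.
  by apply: I_ge0 => x _; exact: powR_ge0.
Qed.

End integral_toolkit.

Lemma cvg_sumR (R : realType) (I T : Type) (F : set_system T) {FF : Filter F}
    (r : seq I) (P : pred I) (f : I -> T -> R) (l : I -> R) :
  (forall i, P i -> f i x @[x --> F] --> l i) ->
  \sum_(i <- r | P i) f i x @[x --> F] --> \sum_(i <- r | P i) l i.
Proof.
move=> h; elim: r => [|i r ih].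
  by rewrite big_nil; under eq_fun do rewrite big_nil; exact: cvg_cst.
rewrite big_cons; under eq_fun do rewrite big_cons.
by case: ifPn => // Pi; apply: cvgD => //; exact: h.
Qed.

(** * The Euclidean inner product and the convex function |Z|^p *)

Section euclidean.
Context (R : realType) (n : nat).
Local Notation V := 'rV[R]_n.+1.
Implicit Types u v w X Y Z W : V.

Lemma dotvC v w : dotv v w = dotv w v.
Proof. by apply: eq_bigr => i _; rewrite mulrC. Qed.

Lemma dotvDl u v w : dotv (u + v) w = dotv u w + dotv v w.
Proof. by rewrite -big_split; apply: eq_bigr => i _ /=; rewrite mxE mulrDl. Qed.

Lemma dotvDr u v w : dotv w (u + v) = dotv w u + dotv w v.
Proof. by rewrite dotvC dotvDl !(dotvC w). Qed.

Lemma dotvZl (a : R) v w : dotv (a *: v) w = a * dotv v w.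
Proof. by rewrite mulr_sumr; apply: eq_bigr => i _; rewrite mxE mulrA. Qed.

Lemma dotvZr (a : R) v w : dotv w (a *: v) = a * dotv w v.
Proof. by rewrite dotvC dotvZl dotvC. Qed.

Lemma dotvNl v w : dotv (- v) w = - dotv v w.
Proof. by rewrite -scaleN1r dotvZl mulN1r. Qed.

Lemma dotvNr v w : dotv w (- v) = - dotv w v.
Proof. by rewrite dotvC dotvNl dotvC. Qed.

Lemma dotvv_ge0 v : 0 <= dotv v v.
Proof. by apply: sumr_ge0 => i _; rewrite -expr2 sqr_ge0. Qed.

Lemma euclid_ge0 v : 0 <= euclid v.
Proof. exact: sqrtr_ge0. Qed.

Lemma euclid2 v : euclid v ^+ 2 = dotv v v.
Proof. by rewrite sqr_sqrtr// dotvv_ge0. Qed.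

Lemma coord_le_euclid v i : `|v ord0 i| <= euclid v.
Proof.
rewrite -sqrtr_sqr; apply: ler_wsqrtr.
by rewrite /dotv (bigD1 i)//= expr2 lerDl sumr_ge0// => j _; rewrite -expr2 sqr_ge0.
Qed.

Lemma euclid0 : euclid (0 : V) = 0.
Proof.
by rewrite /euclid /dotv big1 ?sqrtr0// => i _; rewrite mxE mul0r.
Qed.

Lemma euclid_eq0 v : (euclid v == 0) = (v == 0).
Proof.
apply/eqP/eqP => [v0|->]; last exact: euclid0.
apply/rowP => i; rewrite !mxE; apply/eqP; rewrite -normr_le0 -v0.
exact: coord_le_euclid.
Qed.

Lemma euclidZ a v : euclid (a *: v) = `|a| * euclid v.
Proof.
by rewrite /euclid dotvZl dotvZr mulrA -expr2 sqrtrM ?sqr_ge0// sqrtr_sqr.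
Qed.

Lemma euclidN v : euclid (- v) = euclid v.
Proof. by rewrite -scaleN1r euclidZ normrN1 mul1r. Qed.

(** Cauchy and Schwarz, from | |v|^2 w - (v . w) v |^2 >= 0 divided by |v|^2. *)
Lemma dotv_le v w : dotv v w <= euclid v * euclid w.
Proof.
have [->|v0] := eqVneq v 0.
  by rewrite euclid0 mul0r -(scale0r (0 : V)) dotvZl mul0r.
have e0 : 0 < euclid v by rewrite lt_def euclid_eq0 v0 euclid_ge0.
have := dotvv_ge0 (euclid v ^+ 2 *: w - dotv v w *: v).
rewrite !(dotvDl, dotvDr, dotvNl, dotvNr, dotvZl, dotvZr) (dotvC w v) -!euclid2.
set a := euclid v; set b := euclid w; set c := dotv v w => H.
have {}H : c ^+ 2 <= (a * b) ^+ 2.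
  have : 0 <= a ^+ 2 * ((a * b) ^+ 2 - c ^+ 2) by lra.
  by rewrite pmulr_rge0 ?exprn_gt0// subr_ge0.
rewrite (le_trans (ler_norm c))// -sqrtr_sqr -[leRHS]ger0_norm.
  by rewrite -sqrtr_sqr ler_wsqrtr.
by rewrite mulr_ge0 ?euclid_ge0.
Qed.

Lemma normr_dotv_le v w : `|dotv v w| <= euclid v * euclid w.
Proof.
rewrite ler_norml dotv_le andbT lerNl -dotvNl.
by rewrite (le_trans (dotv_le _ _))// euclidN.
Qed.

Lemma euclidD v w : euclid (v + w) <= euclid v + euclid w.
Proof.
rewrite -(@ler_pXn2r _ 2) ?nnegrE ?addr_ge0 ?euclid_ge0//.
rewrite euclid2 !(dotvDl, dotvDr) (dotvC w v) sqrrD -!euclid2.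
have := dotv_le v w; lra.
Qed.

Lemma euclidB v w : euclid (v - w) <= euclid v + euclid w.
Proof. by rewrite -(euclidN w) euclidD. Qed.

Lemma euclid_sum_le v : euclid v <= \sum_(i < n.+1) `|v ord0 i|.
Proof.
rewrite -[leRHS]ger0_norm ?sumr_ge0// -sqrtr_sqr; apply: ler_wsqrtr.
rewrite expr2 mulr_suml /dotv; apply: ler_sum => i _.
apply: (@le_trans _ _ (`|v ord0 i| * `|v ord0 i|)).
  by rewrite -normrM ler_norm.
by rewrite ler_wpM2l// (bigD1 i)//= lerDl sumr_ge0.
Qed.

Lemma continuous_dotv : continuous (fun v : V => dotv v v).
Proof.
move=> v; rewrite /dotv.
apply: (@cvg_sumR R _ _ (nbhs v) _) => i _; apply: cvgM; exact: coord_continuous.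
Qed.

Lemma continuous_euclid : continuous (@euclid R n).
Proof.
move=> v; apply: (@continuous_comp _ _ _ (fun v => dotv v v) (@Num.sqrt R)).
  exact: continuous_dotv.
exact: sqrt_continuous.
Qed.

Lemma cvg_dotv (v w : nat -> V) (a b : V) :
  (forall i, v k ord0 i @[k --> \oo] --> a ord0 i) ->
  (forall i, w k ord0 i @[k --> \oo] --> b ord0 i) ->
  dotv (v k) (w k) @[k --> \oo] --> dotv a b.
Proof.
by move=> va wb; rewrite /dotv; apply: cvg_sumR => i _; apply: cvgM.
Qed.

Lemma cvg_euclid (v : nat -> V) (a : V) :
  (forall i, v k ord0 i @[k --> \oo] --> a ord0 i) ->
  euclid (v k) @[k --> \oo] --> euclid a.
Proof.
move=> va; apply: (continuous_cvg _ (@sqrt_continuous R (dotv a a))).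
exact: cvg_dotv.
Qed.

Section power.
Context (p : R) (p1 : 1 < p).

Let p0 : 0 < p. Proof. by apply: lt_trans p1. Qed.

(** With t = s e^y the claim divided by s^p reads p e^y < e^(p y) + p - 1. It is the sum of e^y
    times 1 + (p - 1) y < e^((p-1) y) and of p - 1 times e^y (1 - y) < 1, both tangent-line
    inequalities for exp, strict because y is not 0. *)
Lemma young_lt (s t : R) : 0 <= s -> 0 <= t -> s != t ->
  p * s `^ (p - 1) * t < t `^ p + (p - 1) * s `^ p.
Proof.
move=> s0 t0 st; have p10 : p - 1 != 0 by rewrite subr_eq0 gt_eqF.
have [t00|tN0] := eqVneq t 0.
  rewrite t00 mulr0 powR0 ?gt_eqF// add0r mulr_gt0 ?subr_gt0// powR_gt0//.
  by rewrite lt_def s0 andbT -t00.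
have [s00|sN0] := eqVneq s 0.
  rewrite s00 !powR0 ?(gt_eqF p0)// !mulr0 mul0r addr0 powR_gt0//.
  by rewrite lt_def tN0.
have {s0}s0 : 0 < s by rewrite lt_def sN0.
have {t0}t0 : 0 < t by rewrite lt_def tN0.
pose y := ln t - ln s.
have y0 : y != 0.
  rewrite subr_eq0; apply: contra st => /eqP h.
  by apply/eqP; rewrite -(lnK s0) -(lnK t0) h.
have ty : t = s * expR y by rewrite expRD expRN !lnK// mulrCA mulfV ?mulr1.
have e1 : 1 + (p - 1) * y < expR ((p - 1) * y).
  by apply: expR_gt1Dx; rewrite mulf_neq0.
have e2 : 1 + (- y) < expR (- y) by apply: expR_gt1Dx; rewrite oppr_eq0.
rewrite ty powRM ?expR_ge0 ?(ltW s0)//.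
have -> : p * s `^ (p - 1) * (s * expR y) = s `^ p * (p * expR y).
  by rewrite -(mulr_powRB1 (ltW s0) p0); ring.
rewrite [(p - 1) * _]mulrC -mulrDr ltr_pM2l ?powR_gt0//.
have -> : expR y `^ p = expR y * expR ((p - 1) * y).
  by rewrite /powR gt_eqF ?expR_gt0// expRK -expRD; congr expR; ring.
have e3 : expR y * (1 + (p - 1) * y) < expR y * expR ((p - 1) * y).
  by rewrite ltr_pM2l ?expR_gt0.
have e4 : (p - 1) * (expR y * (1 - y)) < p - 1.
  have e5 : expR y * (1 - y) < 1.
    by rewrite -[ltRHS](mulfV (lt0r_neq0 (expR_gt0 y))) -expRN ltr_pM2l ?expR_gt0.
  by rewrite -[ltRHS]mulr1 ltr_pM2l// subr_gt0.
lra.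
Qed.

Lemma young_le (s t : R) : 0 <= s -> 0 <= t ->
  p * s `^ (p - 1) * t <= t `^ p + (p - 1) * s `^ p.
Proof.
move=> s0 t0; have [->|st] := eqVneq s t; last exact/ltW/young_lt.
by rewrite -(mulr_powRB1 t0 p0); lra.
Qed.

(** The gradient of |Z|^p / p. At Z = 0 it is 0 through the vector factor, whatever value the power
    takes. *)
Definition pgrad Z : V := euclid Z `^ (p - 2) *: Z.

Lemma dotv_pgrad Z W : dotv (pgrad Z) W = euclid Z `^ (p - 2) * dotv Z W.
Proof. by rewrite dotvZl. Qed.

Lemma euclid_pow_split Z : euclid Z `^ (p - 2) * euclid Z = euclid Z `^ (p - 1).
Proof.
have [->|z0] := eqVneq (euclid Z) 0.
  by rewrite mulr0 powR0// subr_eq0 gt_eqF.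
have zp : 0 < euclid Z by rewrite lt_def z0 euclid_ge0.
rewrite -{2}(powRr1 (ltW zp)) -powRD; first by congr powR; ring.
by rewrite z0 implybT.
Qed.

Lemma euclid_pgrad Z : euclid (pgrad Z) = euclid Z `^ (p - 1).
Proof. by rewrite euclidZ ger0_norm ?powR_ge0// euclid_pow_split. Qed.

Lemma dotv_pgradv Z : dotv (pgrad Z) Z = euclid Z `^ p.
Proof.
rewrite dotv_pgrad -euclid2 expr2 mulrA euclid_pow_split mulrC.
by rewrite mulr_powRB1// euclid_ge0.
Qed.

Lemma dotv_pgrad_le Z W : dotv (pgrad Z) W <= euclid Z `^ (p - 1) * euclid W.
Proof. by rewrite -euclid_pgrad dotv_le. Qed.

Lemma normr_dotv_pgrad_le Z W :
  `|dotv (pgrad Z) W| <= euclid Z `^ (p - 1) * euclid W.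
Proof. by rewrite -euclid_pgrad normr_dotv_le. Qed.

(** Cauchy-Schwarz and Young together; strictness comes from Young when |Z| and |W| differ, and from
    |W - Z|^2 > 0 when they agree. *)
Lemma subgrad_lt Z W : W != Z ->
  euclid Z `^ p + p * dotv (pgrad Z) (W - Z) < euclid W `^ p.
Proof.
move=> WZ; rewrite dotvDr dotvNr dotv_pgradv.
have [e|ne] := eqVneq (euclid Z) (euclid W); last first.
  have := young_lt (euclid_ge0 Z) (euclid_ge0 W) ne.
  have := dotv_pgrad_le Z W; set a := dotv _ _; set b := _ * euclid W => ab.
  rewrite -mulrA -/b => h; have : p * a <= p * b by rewrite ler_pM2l.
  lra.
rewrite -e; have z0 : 0 < euclid Z.
  rewrite lt_def euclid_ge0 andbT; apply: contra WZ => z0.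
  by have := z0; rewrite e euclid_eq0 => /eqP ->; move: z0; rewrite euclid_eq0 => /eqP ->.
have h : dotv Z W < euclid Z ^+ 2.
  have : 0 < dotv (W - Z) (W - Z).
    rewrite -euclid2 exprn_gt0// lt_def euclid_ge0 andbT euclid_eq0.
    by rewrite subr_eq0.
  rewrite !(dotvDl, dotvDr, dotvNl, dotvNr) -!euclid2 -e (dotvC W Z); lra.
have : dotv (pgrad Z) W < euclid Z `^ p.
  rewrite dotv_pgrad -dotv_pgradv dotv_pgrad -euclid2 ltr_pM2l ?powR_gt0//.
rewrite -(ltr_pM2l p0); lra.
Qed.

Lemma subgrad_le Z W :
  euclid Z `^ p + p * dotv (pgrad Z) (W - Z) <= euclid W `^ p.
Proof.
have [->|WZ] := eqVneq W Z; last exact/ltW/subgrad_lt.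
by rewrite subrr -(scale0r (0 : V)) dotvZr mul0r mulr0 addr0.
Qed.

(** The subgradient inequalities at the combination Z towards X and towards Y, weighted so that the
    linear terms cancel. *)
Lemma euclid_pow_convex_le (s : R) X Y : 0 <= s <= 1 ->
  euclid (s *: X + (1 - s) *: Y) `^ p <=
  s * euclid X `^ p + (1 - s) * euclid Y `^ p.
Proof.
move=> /andP[s0 s1]; set Z := s *: X + _.
have h1 := subgrad_le Z X; have h2 := subgrad_le Z Y.
have e : s * dotv (pgrad Z) (X - Z) + (1 - s) * dotv (pgrad Z) (Y - Z) = 0.
  rewrite -!dotvZr -dotvDr.
  rewrite (_ : _ + _ = 0); first by rewrite -(scale0r (0 : V)) dotvZr mul0r.
  by apply/rowP => i; rewrite /Z !mxE; ring.
have k1 := ler_wpM2l s0 h1; have k2 := ler_wpM2l (_ : 0 <= 1 - s) h2.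
have s1' : 0 <= 1 - s by rewrite subr_ge0.
move: k1 e (k2 s1').
move: (dotv _ (X - Z)) (dotv _ (Y - Z)) => a b k1 e {}k2.
apply: le_trans (lerD k1 k2).
have -> : s * (euclid Z `^ p + p * a) + (1 - s) * (euclid Z `^ p + p * b) =
  euclid Z `^ p by move: (euclid Z `^ p) => z; rewrite -[RHS]addr0 -(mulr0 p) -e; ring.
by [].
Qed.

Lemma euclid_pow_convex_eq (s : R) X Y : 0 < s < 1 ->
  euclid (s *: X + (1 - s) *: Y) `^ p =
  s * euclid X `^ p + (1 - s) * euclid Y `^ p -> X = Y.
Proof.
move=> /andP[s0 s1]; set Z := s *: X + _ => E; apply/eqP/negPn/negP => XY.
have XZ : X != Z.
  apply: contra XY => /eqP XZ; rewrite -subr_eq0.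
  have : (1 - s) *: (X - Y) = 0.
    by move: XZ => /eqP; rewrite -subr_eq0 => /eqP <-; apply/rowP => i; rewrite /Z !mxE; ring.
  by move=> /eqP; rewrite scaler_eq0 [_ - s == 0]subr_eq0 (gt_eqF s1) /=.
have h1 := subgrad_lt XZ; have h2 := subgrad_le Z Y.
have e : s * dotv (pgrad Z) (X - Z) + (1 - s) * dotv (pgrad Z) (Y - Z) = 0.
  rewrite -!dotvZr -dotvDr.
  rewrite (_ : _ + _ = 0); first by rewrite -(scale0r (0 : V)) dotvZr mul0r.
  by apply/rowP => i; rewrite /Z !mxE; ring.
have k1 : s * (euclid Z `^ p + p * dotv (pgrad Z) (X - Z)) < s * euclid X `^ p.
  by rewrite ltr_pM2l.
have k2 := ler_wpM2l (_ : 0 <= 1 - s) h2.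
have s1' : 0 <= 1 - s by rewrite subr_ge0 ltW.
move: k1 e (k2 s1') E.
move: (dotv _ (X - Z)) (dotv _ (Y - Z)) => a b k1 e {}k2 E.
have := ltr_leD k1 k2.
have -> : s * (euclid Z `^ p + p * a) + (1 - s) * (euclid Z `^ p + p * b) =
  euclid Z `^ p by move: (euclid Z `^ p) => z; rewrite -[RHS]addr0 -(mulr0 p) -e; ring.
by rewrite E ltxx.
Qed.

Lemma euclid_powD_le X Y :
  euclid (X + Y) `^ p <= 2 `^ p * (euclid X `^ p + euclid Y `^ p).
Proof.
apply: le_trans (powRD_le (ltW p0) (euclid_ge0 X) (euclid_ge0 Y)).
by apply: ge0_ler_powR; rewrite ?nnegrE ?addr_ge0 ?euclid_ge0 ?euclidD// ltW.
Qed.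

Lemma euclid_powB_le X Y :
  euclid (X - Y) `^ p <= 2 `^ p * (euclid X `^ p + euclid Y `^ p).
Proof. by rewrite -(euclidN Y) euclid_powD_le. Qed.

Lemma euclid_powZ a X : euclid (a *: X) `^ p = `|a| `^ p * euclid X `^ p.
Proof. by rewrite euclidZ powRM ?euclid_ge0. Qed.

Lemma continuous_euclid_pow : continuous (fun v : V => euclid v `^ p).
Proof.
move=> v; rewrite (_ : (fun v => _) = (fun v : V => `|euclid v| `^ p)).
  exact: (@cvg_normpow R _ (nbhs v) _ (@euclid R n) p _ p0 (@continuous_euclid v)).
by apply/funext => w; rewrite ger0_norm ?euclid_ge0.
Qed.

(** Compactness takes the place of Clarkson's inequalities and treats all p > 1 at once. By
    homogeneity it suffices to take |X|^p + |Y|^p = 1. There the midpoint defect [M] has a positive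
    minimum on the compact set where |X - Y|^p >= e, by strict convexity, and |X - Y|^p is at most
    2^p everywhere. *)
Lemma uniform_convexity (e : R) : 0 < e -> exists2 C : R, 0 <= C &
  forall X Y : V, euclid (X - Y) `^ p <= e * (euclid X `^ p + euclid Y `^ p) +
    C * ((euclid X `^ p + euclid Y `^ p) / 2 - euclid (2^-1 *: (X + Y)) `^ p).
Proof.
move=> e0.
pose N (XY : V * V) := euclid XY.1 `^ p + euclid XY.2 `^ p.
pose Q (XY : V * V) := euclid (XY.1 - XY.2) `^ p.
pose M (XY : V * V) := N XY / 2 - euclid (2^-1 *: (XY.1 + XY.2)) `^ p.
have half X Y : 2^-1 *: (X + Y) = 2^-1 *: X + (1 - 2^-1) *: Y.
  by apply/rowP => i; rewrite !mxE; lra.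
have M0 XY : 0 <= M XY.
  rewrite /M subr_ge0 half; have := @euclid_pow_convex_le 2^-1 XY.1 XY.2.
  rewrite invr_ge0 ler0n /= invf_le1 ?ltr0n// ler1n => /(_ isT).
  rewrite /N; move: (euclid _ `^ p) (euclid _ `^ p) (euclid _ `^ p) => a b c; lra.
suff [C C0 HC] : exists2 C : R, 0 <= C & forall XY, N XY = 1 -> Q XY <= e + C * M XY.
  exists C => // X Y; have [N0|N0] := eqVneq (N (X, Y)) 0.
    have ex : euclid X = 0.
      apply: (@powR_eq0_eq0 _ _ p); apply/eqP; rewrite eq_le powR_ge0 andbT -N0.
      by rewrite /N lerDl powR_ge0.
    have ey : euclid Y = 0.
      apply: (@powR_eq0_eq0 _ _ p); apply/eqP; rewrite eq_le powR_ge0 andbT -N0.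
      by rewrite /N lerDr powR_ge0.
    move: (ex) (ey) => /eqP; rewrite euclid_eq0 => /eqP ->.
    move=> /eqP; rewrite euclid_eq0 => /eqP ->.
    by rewrite subrr addr0 scaler0 euclid0 powR0 ?gt_eqF//; lra.
  have N1 : 0 < N (X, Y) by rewrite lt_def N0 addr_ge0 ?powR_ge0.
  (* Dividing both vectors by s divides every term of the inequality by [N (X, Y)]. *)
  pose s := (N (X, Y)) `^ p^-1; have s0 : 0 < s by rewrite powR_gt0.
  have sp : s `^ p = N (X, Y) by rewrite powRVK// ltW.
  have E Z : euclid (s^-1 *: Z) `^ p = (N (X, Y))^-1 * euclid Z `^ p.
    rewrite euclid_powZ ger0_norm ?invr_ge0 ?(ltW s0)// -sp.
    have sp0 : s `^ p != 0 by rewrite gt_eqF// powR_gt0.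
    congr (_ * _); apply: (mulIf sp0); rewrite mulVf// -powRM ?invr_ge0 ?(ltW s0)//.
    by rewrite mulVf ?gt_eqF// powR1.
  have := HC (s^-1 *: X, s^-1 *: Y).
  rewrite /N /Q /M /N /= -scalerBr -scalerDr scalerA (mulrC 2^-1) -scalerA !E.
  rewrite -mulrDr -/(N (X, Y)) mulVf// => /(_ erefl).
  rewrite -(ler_pM2l N1) mulrA mulfV// mul1r => /le_trans; apply.
  rewrite -/(N (X, Y)); move: (N (X, Y)) N0 N1 => m m0 m1.
  set t := euclid _ `^ p.
  by rewrite le_eqVlt; apply/orP; left; apply/eqP; field.
pose K := [set XY : V * V | [/\ N XY = 1 & e <= Q XY]].
have cN : continuous N.
  move=> XY; apply: cvgD.
    apply: (@continuous_comp _ _ _ fst (fun v : V => euclid v `^ p)).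
      exact: cvg_fst.
    exact: continuous_euclid_pow.
  apply: (@continuous_comp _ _ _ snd (fun v : V => euclid v `^ p)).
    exact: cvg_snd.
  exact: continuous_euclid_pow.
have cQ : continuous Q.
  move=> XY; apply: (@continuous_comp _ _ _ (fun XY : V * V => XY.1 - XY.2) (fun v : V => euclid v `^ p)).
    by apply: cvgB; [exact: cvg_fst|exact: cvg_snd].
  exact: continuous_euclid_pow.
have cM : continuous M.
  move=> XY; apply: cvgB; first by apply: cvgM; [exact: cN|exact: cvg_cst].
  apply: (@continuous_comp _ _ _ (fun XY : V * V => 2^-1 *: (XY.1 + XY.2)) (fun v : V => euclid v `^ p)).
    by apply: cvgZr; apply: cvgD; [exact: cvg_fst|exact: cvg_snd].
  exact: continuous_euclid_pow.
have cK : compact K.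
  pose B := [set v : V | forall i, `[(-1 : R), 1]%classic (v ord0 i)].
  have cB : compact B by apply: (@rV_compact R n.+1 (fun=> `[(-1 : R), 1]%classic)) => i; exact: segment_compact.
  apply: (@subclosed_compact _ _ (B `*` B)).
  - rewrite (_ : K = N @^-1` [set 1] `&` Q @^-1` [set x | e <= x]); last first.
      by apply/seteqP; split => XY /= [].
    apply: closedI; apply: preimage_closed => //.
  - exact: compact_setX.
  - move=> [X Y] [/= N1 _].
    have aux Z : euclid Z `^ p <= 1 -> B Z.
      move=> Z1 i; rewrite /= in_itv /= -ler_norml.
      apply: le_trans (coord_le_euclid _ _) _.
      rewrite leNgt; apply/negP => h; move: Z1; rewrite leNgt => /negP; apply.
      have E1 : (1 : R) `^ p = 1 by rewrite powR1.
      by rewrite -[X in X < _]E1; apply: gt0_ltr_powR; rewrite ?nnegrE ?euclid_ge0.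
    split; apply: aux; rewrite -N1 /N /=; by rewrite ?lerDl ?lerDr powR_ge0.
have MQ XY : M XY = 0 -> e <= Q XY -> False.
  move=> MM; have -> : XY = (XY.2, XY.2).
    rewrite [LHS]surjective_pairing; congr pair.
    apply: (@euclid_pow_convex_eq 2^-1).
      by rewrite invr_gt0 ltr0n /= invf_lt1 ?ltr0n// ltr1n.
    rewrite -half; move: MM; rewrite /M /N.
    by move: (euclid _ `^ p) (euclid _ `^ p) (euclid _ `^ p) => a b c; lra.
  by rewrite /Q /= subrr euclid0 powR0 ?gt_eqF// leNgt e0.
have Q2 XY : N XY = 1 -> Q XY <= 2 `^ p.
  by move=> N1; have := euclid_powB_le XY.1 XY.2; rewrite -/(N XY) N1 mulr1.
have t0 : 0 <= 2 `^ p :> R by exact: powR_ge0.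
clearbody N Q M; move: (2 `^ p) t0 Q2 => t t0 Q2.
have [K0|/set0P K0] := eqVneq K set0.
  exists 0 => // XY N1; rewrite mul0r addr0 leNgt; apply/negP => h.
  suff : K XY by rewrite K0.
  by split => //; exact: ltW.
have [XY0 /set_mem KXY0 HM] := compact_EVT_min K0 cK (continuous_subspaceT cM).
have Mpos : 0 < M XY0.
  rewrite lt_def M0 andbT; apply/eqP => MM; have [N1 Q1] := KXY0.
  exact: MQ MM Q1.
(* Here [t] is 2^p: on the compact set the second term alone is at least 2^p, and off it the first
   term suffices. *)
exists (t / M XY0) => [|XY N1]; first by apply: divr_ge0.
have [Qe|eQ] := leP (Q XY) e.
  by rewrite (le_trans Qe)// lerDl mulr_ge0// divr_ge0.
have h := HM XY (mem_set (conj N1 (ltW eQ))).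
apply: (le_trans (Q2 _ N1)); apply: (@le_trans _ _ (t / M XY0 * M XY)).
  by rewrite -mulrA ler_peMr// ler_pdivlMl// mulr1.
by rewrite lerDr ltW.
Qed.

End power.
End euclidean.

(** * Smooth functions flat at zero and a smooth positive part *)

Section flat_functions.
Context (R : realType).

(* smooth on R, with all derivatives vanishing at 0 *)
Definition flat (c : R) (m : nat) (s : R) : R :=
  if 0 < s then s^-1 ^+ m * expR (- (c / s)) else 0.

Lemma flat_ge0 c m s : 0 <= flat c m s.
Proof.
by rewrite /flat; case: ifPn => // s0; rewrite mulr_ge0 ?expR_ge0// exprn_ge0// invr_ge0 ltW.
Qed.

Lemma flat_le0 c m s : s <= 0 -> flat c m s = 0.
Proof. by rewrite /flat leNgt => /negbTE ->. Qed.

Lemma flatS c m s : s * flat c m.+1 s = flat c m s.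
Proof.
rewrite /flat; case: ifPn => s0; last by rewrite mulr0.
by rewrite exprS mulrA mulrA mulfV ?gt_eqF// mul1r.
Qed.

Lemma flat0_le1 c s : 0 <= c -> flat c 0 s <= 1.
Proof.
move=> c0; rewrite /flat; case: ifPn => // s0.
by rewrite mul1r -expR0 ler_expR oppr_le0 divr_ge0// ltW.
Qed.

(** From e^y >= (y / N)^N with y = c / s and N = m + 2; the two extra powers leave the factor s^2,
    which forces derivative 0 at the origin. *)
Lemma flat_bound c m : 0 < c -> exists2 K : R, 0 <= K & forall s, flat c m s <= K * s ^+ 2.
Proof.
move=> c0; pose N := m.+2; exists ((N%:R / c) ^+ N) => [|s].
  by rewrite exprn_ge0// divr_ge0// ltW.
rewrite /flat; case: ifPn => s0; last first.
  by rewrite mulr_ge0 ?sqr_ge0// exprn_ge0// divr_ge0// ltW.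
have y0 : 0 < s^-1 by rewrite invr_gt0.
have h1 : (c / s / N%:R) ^+ N <= expR (c / s).
  have e1 : c / s = N%:R * (c / s / N%:R) by rewrite [RHS]mulrC divfK// pnatr_eq0.
  rewrite [X in expR X]e1 expRM_natl.
  have z0 : 0 <= c / s / N%:R by rewrite !divr_ge0// ltW.
  by apply: lerXn2r; rewrite ?nnegrE ?expR_ge0//; apply: le_trans (expR_ge1Dx _); rewrite lerDr.
rewrite expRN ler_pdivrMr ?expR_gt0//.
apply: (@le_trans _ _ ((N%:R / c) ^+ N * s ^+ 2 * (c / s / N%:R) ^+ N)); last first.
  by rewrite ler_wpM2l// mulr_ge0 ?sqr_ge0// exprn_ge0// divr_ge0// ltW.
rewrite mulrAC -exprMn.
have -> : N%:R / c * (c / s / N%:R) = s^-1 by field; rewrite ?gt_eqF//= ?pnatr_eq0// ltr0n.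
by rewrite /N -addn2 exprD -mulrA -exprMn mulVf ?gt_eqF// expr1n mulr1.
Qed.

Lemma is_derive0_bound (f : R -> R) (K : R) : f 0 = 0 ->
  (forall h, `|f h| <= K * h ^+ 2) -> is_derive (0 : R) 1 f 0.
Proof.
move=> f0 fK.
have H : h^-1 *: ((f \o shift 0) (h *: 1) - f 0) @[h --> 0^'] --> (0 : R).
  apply/cvgr0Pnorm_le => e e0.
  near=> h; rewrite /= f0 subr0 addr0 [h *: 1]mulr1.
  have h0 : h != 0 by near: h; exact: nbhs_dnbhs_neq.
  rewrite normrZ normfV ler_pdivrMl ?normr_gt0//.
  apply: le_trans (fK h) _; rewrite -(real_normK (num_real h)) expr2 mulrA mulrC ler_wpM2l//.
  have : `|h| <= e / (`|K| + 1).
    near: h; apply: dnbhs0_le; rewrite divr_gt0// ltr_wpDl//.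
  rewrite ler_pdivlMr ?ltr_wpDl// => h1; apply: le_trans h1.
  by rewrite mulrC ler_wpM2l// (le_trans (ler_norm K))// lerDl.
split; last exact/cvg_lim.
by apply/cvg_ex; exists 0.
Unshelve. all: by end_near. Qed.

Lemma is_derive_exprn (x : R) m :
  is_derive x 1 (fun y : R => y ^+ m) (m%:R * x ^+ m.-1).
Proof.
elim: m => [|m ih].
  rewrite mul0r; exact: (is_derive_cst (1 : R) x 1).
have := is_deriveM (is_derive_id x 1) ih => h.
rewrite (_ : (fun y : R => y ^+ m.+1) = id * (fun y : R => y ^+ m)); last first.
  by apply/funext => y; rewrite exprS.
apply: is_derive_eq h _; rewrite /GRing.scale /= mulr1.
case: m {ih} => [|m]; first by rewrite !mul0r mulr0 add0r expr0 mul1r.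
by rewrite mulrCA -exprS -[X in _ + X]mul1r -mulrDl natr1.
Qed.

(** The derivative is again a combination of flat functions with larger m, so smoothness follows by
    induction. *)
Lemma is_derive_flat c m (s : R) : 0 < c -> is_derive s 1 (flat c m)
  (c * flat c m.+2 s - m%:R * flat c m.+1 s).
Proof.
move=> c0; have [s0|s0|<-] := ltgtP 0 s.
- apply: (@near_eq_is_derive R R R (fun s : R => s^-1 ^+ m * expR (- (c * s^-1))) _ s 1).
    near=> t; rewrite /flat; suff -> : 0 < t by [].
    by near: t; exact: lt_nbhsr.
  have dV : is_derive s 1 (fun s : R => s^-1) (- s ^- 2 *: 1).
    by apply: (@is_deriveV _ id); rewrite ?gt_eqF//; exact: is_derive_id.
  have d1 := is_derive1_comp (is_derive_exprn s^-1 m) dV.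
  have d2 : is_derive s 1 (fun s : R => - (c * s^-1)) (- (c *: (- s ^- 2 *: 1))).
    by apply: is_deriveN; apply: is_deriveZ.
  have d3 := @is_derive1_comp R expR (fun s : R => - (c * s^-1)) s _ _ (is_derive_expR (- (c * s^-1))) d2.
  have := is_deriveM d1 d3; rewrite /flat s0.
  move=> h; apply: is_derive_eq h _.
  rewrite !scalerAl /= /GRing.scale /=.
  case: m {d1} => [|m]; first by rewrite !expr0 /=; field; rewrite gt_eqF.
  rewrite /= !exprS /=; move: (s^-1 ^+ m) (expR _) => t e; field; by rewrite gt_eqF.
- rewrite !flat_le0 ?ltW// !mulr0 subr0.
  apply: (@near_eq_is_derive R R R (cst 0) _ s 1).
  near=> t; rewrite flat_le0// ltW//; near: t; exact: lt_nbhsl.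
- rewrite !flat_le0// !mulr0 subr0.
  have [K K0 HK] := flat_bound m c0.
  apply: (@is_derive0_bound _ K); first by rewrite flat_le0.
  by move=> h; rewrite ger0_norm ?flat_ge0.
Unshelve. all: by end_near. Qed.

Lemma is_derive_continuous (f : R -> R) (x df : R) : is_derive x 1 f df ->
  {for x, continuous f}.
Proof.
by move=> [h _]; apply: differentiable_continuous; apply/derivable1_diffP.
Qed.

Lemma continuous_flat c m : 0 < c -> continuous (flat c m).
Proof. by move=> c0 s; exact: is_derive_continuous (is_derive_flat m s c0). Qed.

(** A smooth stand-in for the positive part, s e^(-c/s) for s > 0: for c > 0 it vanishes on s <= 0,
    is nondecreasing and 1-Lipschitz, and stays within c of max (s, 0). *)
Definition softpos (c s : R) : R := s * flat c 0 s.
Definition dsoftpos (c s : R) : R := flat c 0 s + c * flat c 1 s.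

Lemma is_derive_softpos c (s : R) : 0 < c -> is_derive s 1 (softpos c) (dsoftpos c s).
Proof.
move=> c0; have := is_deriveM (is_derive_id s 1) (is_derive_flat 0 s c0).
move=> h; apply: is_derive_eq h _.
rewrite /dsoftpos mul0r subr0 /GRing.scale /= mulr1 addrC; congr (_ + _).
by rewrite mulrCA flatS.
Qed.

Lemma softpos_le0 c s : s <= 0 -> softpos c s = 0.
Proof. by move=> s0; rewrite /softpos flat_le0// mulr0. Qed.

Lemma softpos_ge0 c s : 0 <= softpos c s.
Proof.
have [s0|s0] := leP s 0; first by rewrite softpos_le0.
by rewrite mulr_ge0 ?flat_ge0// ltW.
Qed.

Lemma dsoftpos_le0 c s : s <= 0 -> dsoftpos c s = 0.
Proof. by move=> s0; rewrite /dsoftpos !flat_le0// mulr0 addr0. Qed.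

Lemma dsoftpos_ge0 c s : 0 <= c -> 0 <= dsoftpos c s.
Proof. by move=> c0; rewrite addr_ge0 ?mulr_ge0 ?flat_ge0. Qed.

(** With y = c / s the derivative is (1 + y) e^(-y), and 1 + y <= e^y. *)
Lemma dsoftpos_le1 c s : 0 <= c -> dsoftpos c s <= 1.
Proof.
move=> c0; have [s0|s0] := leP s 0; first by rewrite dsoftpos_le0.
rewrite /dsoftpos /flat s0 expr0 expr1 mul1r mulrA -[X in X + _]mul1r -mulrDl.
by rewrite expRN ler_pdivrMr ?expR_gt0// mul1r expR_ge1Dx.
Qed.

(** For s > 0 the gap is s (1 - e^(-c/s)), at most s (c / s) = c. *)
Lemma softpos_dist c s : 0 <= c -> `|softpos c s - Num.max s 0| <= c.
Proof.
move=> c0; have [s0|s0] := leP s 0; first by rewrite softpos_le0// subrr normr0.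
have -> : softpos c s - s = s * (expR (- (c / s)) - 1).
  by rewrite /softpos /flat s0 mul1r mulrBr mulr1.
rewrite normrM gtr0_norm//.
rewrite distrC ger0_norm; last by rewrite subr_ge0 -expR0 ler_expR oppr_le0 divr_ge0// ltW.
have := @expR_ge1Dx R (- (c / s)); rewrite lerBlDl -lerBlDr => h.
apply: (@le_trans _ _ (s * (c / s))); last by rewrite mulrCA mulfV ?gt_eqF// mulr1.
by rewrite ler_wpM2l ?(ltW s0)//; lra.
Qed.

End flat_functions.

(** * Smooth functions of several variables *)

Section smooth_functions.
Context (R : realType) (n : nat).
Local Notation V := 'rV[R]_n.+1.
Implicit Types f g : V -> R.
Local Notation "''e_' i" := (delta_mx ord0 i : V) (at level 8, i at level 2).

Definition smooth f := forall k, class_C k f.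

(** Turns directional derivatives into derivatives in one real variable, where the chain rule and
    the mean value theorem are available. *)
Lemma is_derive_dir f (x v : V) (df : R) :
  is_derive x v f df <-> is_derive (0 : R) 1 (fun t => f (x + t *: v)) df.
Proof.
have E : (fun h : R => h^-1 *: ((f \o shift x) (h *: v) - f x)) =
  (fun h : R => h^-1 *: (((fun t => f (x + t *: v)) \o shift 0) (h *: (1 : R)) -
     (fun t => f (x + t *: v)) 0)).
  apply/funext => h /=; congr (_ *: (f _ - f _)).
    by rewrite addr0 [h *: 1]mulr1 addrC.
  by rewrite scale0r addr0.
by split=> -[h1 h2]; split; [move: h1|move: h2|move: h1|move: h2];
  rewrite /derivable /derive E.
Qed.

Lemma is_derive_line f (x v : V) (t df : R) :
  is_derive (x + t *: v) v f df <-> is_derive t 1 (fun t => f (x + t *: v)) df.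
Proof.
rewrite is_derive_dir.
have E : (fun h : R => h^-1 *: (((fun t0 => f (x + t *: v + t0 *: v)) \o shift 0) (h *: (1 : R)) -
     (fun t0 => f (x + t *: v + t0 *: v)) 0)) =
  (fun h : R => h^-1 *: (((fun t => f (x + t *: v)) \o shift t) (h *: (1 : R)) -
     (fun t => f (x + t *: v)) t)).
  apply/funext => h /=; congr (_ *: (f _ - f _)).
    by rewrite addr0 -addrA -scalerDl [t + _]addrC.
  by rewrite scale0r addr0.
by split=> -[h1 h2]; split; [move: h1|move: h2|move: h1|move: h2];
  rewrite /derivable /derive E.
Qed.

Lemma is_derive_comp (H : R -> R) f (x v : V) (df dH : R) :
  is_derive x v f df -> is_derive (f x) 1 H dH ->
  is_derive x v (H \o f) (dH * df).
Proof.
move=> /is_derive_dir hf hH; apply/is_derive_dir.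
have E : f x = f (x + (0 : R) *: v) by rewrite scale0r addr0.
by rewrite E in hH; exact: is_derive1_comp hH hf.
Qed.

(** The induction step of the smoothness proofs below: it is enough to exhibit partial derivatives
    [F] of class C^k. *)
Lemma class_CS k f (F : 'I_n.+1 -> V -> R) : continuous f ->
  (forall i x, is_derive x 'e_i f (F i x)) -> (forall i, class_C k (F i)) ->
  class_C k.+1 f.
Proof.
move=> cf fF FC; split => // i; split => [x|]; first by have [] := fF i x.
rewrite (_ : partial i f = F i)//; apply/funext => x.
by rewrite /partial; have [_ ->] := fF i x.
Qed.

Lemma class_C_continuous k f : class_C k f -> continuous f.
Proof. by case: k => [[]|k []]. Qed.

Lemma class_C_partial k f : class_C k.+1 f -> forall i x,
  is_derive x 'e_i f (partial i f x).
Proof. by move=> [_ h] i x; have [hd _] := h i; split; [exact: hd|]. Qed.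

Lemma class_C_le k f : class_C k.+1 f -> class_C k f.
Proof.
elim: k f => [|k ih] f; first by move=> [].
move=> [cf h]; split => // i; have [hd hp] := h i; split => //; exact: ih.
Qed.

Lemma class_C_cst k (a : R) : class_C k ((fun=> a) : V -> R).
Proof.
elim: k a => [|k ih] a; first by split=> //; exact: cst_continuous.
apply: (@class_CS _ _ (fun _ _ => 0)); first exact: cst_continuous.
by move=> i; exact: ih.
Qed.

Lemma class_CD k f g : class_C k f -> class_C k g -> class_C k (fun x => f x + g x).
Proof.
elim: k f g => [|k ih] f g hf hg; have cf := class_C_continuous hf; have cg := class_C_continuous hg.
  split=> // x; apply: (@continuousD _ _ _ f g); [exact: cf|exact: cg].
apply: (@class_CS _ _ (fun i x => partial i f x + partial i g x)) => [x|i x|i].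
- by apply: (@continuousD _ _ _ f g); [exact: cf|exact: cg].
- exact: is_deriveD (class_C_partial hf i x) (class_C_partial hg i x).
- by apply: ih; [have [_ /(_ i)[]] := hf|have [_ /(_ i)[]] := hg].
Qed.

Lemma class_CM k f g : class_C k f -> class_C k g -> class_C k (fun x => f x * g x).
Proof.
elim: k f g => [|k ih] f g hf hg; have cf := class_C_continuous hf; have cg := class_C_continuous hg.
  split=> // x; apply: (@continuousM _ _ f g); [exact: cf|exact: cg].
apply: (@class_CS _ _ (fun i x => f x * partial i g x + g x * partial i f x)) => [x|i x|i].
- by apply: (@continuousM _ _ f g); [exact: cf|exact: cg].
- exact: is_deriveM (class_C_partial hf i x) (class_C_partial hg i x).
- have [_ /(_ i)[_ pf]] := hf; have [_ /(_ i)[_ pg]] := hg.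
  by apply: class_CD; apply: ih => //; exact: class_C_le.
Qed.

Lemma smooth_cst (a : R) : smooth ((fun=> a) : V -> R). Proof. by move=> k; exact: class_C_cst. Qed.

Lemma smoothD f g : smooth f -> smooth g -> smooth (fun x => f x + g x).
Proof. by move=> hf hg k; exact: class_CD. Qed.

Lemma smoothM f g : smooth f -> smooth g -> smooth (fun x => f x * g x).
Proof. by move=> hf hg k; exact: class_CM. Qed.

Lemma smoothZ (a : R) f : smooth f -> smooth (fun x => a * f x).
Proof. by move=> hf; apply: smoothM => //; exact: smooth_cst. Qed.

Lemma smoothN f : smooth f -> smooth (fun x => - f x).
Proof.
move=> /(smoothZ (-1)); rewrite (_ : (fun x => -1 * f x) = (fun x => - f x))//.
by apply/funext => x; rewrite mulN1r.
Qed.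

Lemma smoothB f g : smooth f -> smooth g -> smooth (fun x => f x - g x).
Proof. by move=> hf hg; apply: smoothD => //; exact: smoothN. Qed.

Lemma smooth_continuous f : smooth f -> continuous f.
Proof. by move=> /(_ 0%N) []. Qed.

Lemma smooth_is_derive f : smooth f -> forall i x, is_derive x 'e_i f (partial i f x).
Proof. by move=> /(_ 1%N)/class_C_partial. Qed.

Lemma smooth_partial f i : smooth f -> smooth (partial i f).
Proof. by move=> hf k; have [_ /(_ i)[]] := hf k.+1. Qed.

Lemma is_derive_partial f i x df : is_derive x 'e_i f df -> partial i f x = df.
Proof. by move=> [_ <-]. Qed.

Lemma smooth_coord j : smooth (fun x : V => x ord0 j).
Proof.
case=> [|k]; first by split=> // x; exact: coord_continuous.
apply: (@class_CS _ _ (fun i _ => (i == j)%:R)) => [x|i x|i].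
- exact: coord_continuous.
- apply/is_derive_dir.
  rewrite (_ : (fun t : R => _) = cst (x ord0 j) + (fun t : R => (i == j)%:R * t)).
    have d1 := is_derive_cst (x ord0 j) (0 : R) 1.
    have d2 := is_deriveZ (i == j)%:R (is_derive_id (0 : R) 1).
    by apply: is_derive_eq (is_deriveD d1 d2) _; rewrite add0r /GRing.scale /= mulr1.
  by apply/funext => t /=; rewrite !mxE eqxx /= mulrC eq_sym; congr (_ + _ * _).
- exact: class_C_cst.
Qed.

Lemma smooth_prod (I : Type) (r : seq I) (P : pred I) (F : I -> V -> R) :
  (forall i, P i -> smooth (F i)) -> smooth (fun x => \prod_(i <- r | P i) F i x).
Proof.
move=> h; elim: r => [|i r ih].
  rewrite (_ : (fun=> _) = fun=> 1); first exact: smooth_cst.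
  by apply/funext => x; rewrite big_nil.
rewrite (_ : (fun=> _) = fun x => if P i then F i x * \prod_(j <- r | P j) F j x
  else \prod_(j <- r | P j) F j x); last by apply/funext => x; rewrite big_cons.
by move: (h i); case: (P i) => [/(_ isT) hi|_] //; exact: smoothM.
Qed.

Lemma smooth_flat c m f : 0 < c -> smooth f -> smooth (fun x => flat c m (f x)).
Proof.
(* The order m stays general in the induction, since partial derivatives raise it by one and by
   two. *)
move=> c0 hf k; elim: k m => [|k ih] m.
  split=> // x; apply: continuous_comp; first exact: smooth_continuous.
  exact: continuous_flat.
apply: (@class_CS _ _ (fun i x => (c * flat c m.+2 (f x) - m%:R * flat c m.+1 (f x)) * partial i f x)).
- move=> x; apply: continuous_comp; first exact: smooth_continuous.
  exact: continuous_flat.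
- by move=> i x; apply: is_derive_comp; [exact: smooth_is_derive|exact: is_derive_flat].
- move=> i; apply: class_CM; last exact: smooth_partial.
  rewrite (_ : (fun=> _) = fun x => c * flat c m.+2 (f x) + (- m%:R) * flat c m.+1 (f x)).
    by apply: class_CD; apply: class_CM; rewrite //; exact: class_C_cst.
  by apply/funext => x; rewrite mulNr.
Qed.

Lemma smooth_softpos c f : 0 < c -> smooth f -> smooth (fun x => softpos c (f x)).
Proof. by move=> c0 hf; apply: smoothM => //; exact: smooth_flat. Qed.

Lemma smooth_powR (r : R) f : smooth f -> (forall x, 0 < f x) ->
  smooth (fun x => f x `^ r).
Proof.
move=> hf f0 k; elim: k r => [|k ih] r.
  split=> // x; apply: (@continuous_comp _ _ _ f (fun y => y `^ r)).
    exact: smooth_continuous.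
  exact: continuous_powR_gt0.
apply: (@class_CS _ _ (fun i x => (r * f x `^ (r - 1)) * partial i f x)).
- move=> x; apply: (@continuous_comp _ _ _ f (fun y => y `^ r)).
    exact: smooth_continuous.
  exact: continuous_powR_gt0.
- move=> i x; apply: (@is_derive_comp (fun y => y `^ r)).
    exact: smooth_is_derive.
  exact: is_derive1_powR.
- move=> i; apply: class_CM; last exact: smooth_partial.
  by apply: class_CM => //; exact: class_C_cst.
Qed.

Lemma continuous_shift_pt (y : V) : continuous (fun x : V => x + y).
Proof. by move=> x; apply: continuousD; [move=> A; exact|exact: cst_continuous]. Qed.

Lemma is_derive_shift f (x y v : V) df : is_derive (x + y) v f df ->
  is_derive x v (fun x => f (x + y)) df.
Proof.
move=> /is_derive_dir h; apply/is_derive_dir.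
by under eq_fun do rewrite addrAC.
Qed.

Lemma smooth_shift f (y : V) : smooth f -> smooth (fun x => f (x + y)).
Proof.
move=> hf k; elim: k f hf => [|k ih] f hf.
  split=> // x; apply: (@continuous_comp _ _ _ (fun x : V => x + y) f).
    exact: continuous_shift_pt.
  exact: smooth_continuous.
apply: (@class_CS _ _ (fun i x => partial i f (x + y))).
- move=> x; apply: (@continuous_comp _ _ _ (fun x : V => x + y) f).
    exact: continuous_shift_pt.
  exact: smooth_continuous.
- by move=> i x; apply: is_derive_shift; exact: smooth_is_derive.
- by move=> i; apply: ih; exact: smooth_partial.
Qed.

Lemma partial_shift f i x y : smooth f ->
  partial i (fun x => f (x + y)) x = partial i f (x + y).
Proof.
by move=> hf; apply: is_derive_partial; apply: is_derive_shift; exact: smooth_is_derive.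
Qed.

Lemma partialD f g i x : smooth f -> smooth g ->
  partial i (fun x => f x + g x) x = partial i f x + partial i g x.
Proof.
by move=> hf hg; apply: is_derive_partial; apply: is_deriveD; exact: smooth_is_derive.
Qed.

Lemma partialZ (a : R) f i x : smooth f ->
  partial i (fun x => a * f x) x = a * partial i f x.
Proof.
by move=> hf; apply: is_derive_partial; apply: is_deriveZ; exact: smooth_is_derive.
Qed.

Lemma partialM f g i x : smooth f -> smooth g ->
  partial i (fun x => f x * g x) x = f x * partial i g x + g x * partial i f x.
Proof.
by move=> hf hg; apply: is_derive_partial; apply: is_deriveM; exact: smooth_is_derive.
Qed.

Lemma partialX f i m x : smooth f ->
  partial i (fun x => f x ^+ m) x = m%:R * f x ^+ m.-1 * partial i f x.
Proof.
move=> hf; apply: is_derive_partial.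
by apply: (@is_derive_comp (fun y => y ^+ m)); [exact: smooth_is_derive|exact: is_derive_exprn].
Qed.

Lemma partial_comp (H : R -> R) f i x dH : smooth f -> is_derive (f x) 1 H dH ->
  partial i (fun x => H (f x)) x = dH * partial i f x.
Proof.
move=> hf hH; apply: is_derive_partial; apply: is_derive_comp => //.
exact: smooth_is_derive.
Qed.

End smooth_functions.

(** * Test functions, translations and integration by parts *)

Section test_functions.
Context (R : realType) (n : nat).
Local Notation V := 'rV[R]_n.+1.
Implicit Types f g : V -> R.
Implicit Types Om A : set V.
Local Notation "''e_' i" := (delta_mx ord0 i : V) (at level 8, i at level 2).
Local Notation mu := (@leb R n).

Lemma test_smooth Om f : test_function Om f -> smooth f.
Proof. by case. Qed.

Lemma testD Om f g : test_function Om f -> test_function Om g ->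
  test_function Om (fun x => f x + g x).
Proof.
move=> [sf [K [cK KO Kf]]] [sg [L [cL LO Lg]]]; split; first exact: smoothD.
exists (K `|` L); split; [exact: compactU|by move=> x [/KO|/LO]|].
by move=> x KLx; rewrite Kf ?Lg ?addr0// => h; apply: KLx; [right|left].
Qed.

Lemma testMl Om f g : smooth g -> test_function Om f ->
  test_function Om (fun x => g x * f x).
Proof.
move=> sg [sf [K [cK KO Kf]]]; split; first exact: smoothM.
by exists K; split => // x /Kf ->; rewrite mulr0.
Qed.

Lemma testZ Om f a : test_function Om f -> test_function Om (fun x => a * f x).
Proof. by apply: testMl; exact: smooth_cst. Qed.

Lemma testN Om f : test_function Om f -> test_function Om (fun x => - f x).
Proof.
move=> /(testZ (-1)); rewrite (_ : (fun x => -1 * f x) = (fun x => - f x))//.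
by apply/funext => x; rewrite mulN1r.
Qed.

Lemma testB Om f g : test_function Om f -> test_function Om g ->
  test_function Om (fun x => f x - g x).
Proof. by move=> hf hg; apply: testD => //; exact: testN. Qed.

Lemma test0 Om : test_function Om (fun=> 0).
Proof.
split; first exact: smooth_cst.
by exists set0; split => //; exact: compact0.
Qed.

Lemma testS Om Om' f : Om `<=` Om' -> test_function Om f -> test_function Om' f.
Proof.
move=> OO [sf [K [cK KO Kf]]]; split => //; exists K; split => //.
exact: subset_trans OO.
Qed.

Lemma test_comp Om (H : R -> R) f : smooth (fun x => H (f x)) -> H 0 = 0 ->
  test_function Om f -> test_function Om (fun x => H (f x)).
Proof.
move=> sH H0 [sf [K [cK KO Kf]]]; split => //.
by exists K; split => // x /Kf ->.
Qed.

Lemma test_softpos Om f (c : R) : 0 < c -> test_function Om f ->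
  test_function Om (fun x => softpos c (f x)).
Proof.
move=> c0 hf; apply: test_comp => //; last by rewrite softpos_le0.
by apply: smooth_softpos => //; exact: test_smooth hf.
Qed.

Lemma compact_closed_rV (K : set V) : compact K -> closed K.
Proof. by apply: compact_closed; exact: norm_hausdorff. Qed.

Lemma test_partial Om f i : test_function Om f -> test_function Om (partial i f).
Proof.
move=> [sf [K [cK KO Kf]]]; split; first exact: smooth_partial.
exists K; split => // x Kx; apply: is_derive_partial.
apply: (@near_eq_is_derive _ _ _ (cst 0)).
have oK : open (~` K) by apply: closed_openC; exact: compact_closed_rV.
have := open_nbhs_nbhs (conj oK Kx); apply: filterS => y /= /Kf ->.
by [].
Qed.

Lemma test_shift f (y : V) : test_function setT f ->
  test_function setT (fun x => f (x + y)).
Proof.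
move=> [sf [K [cK _ Kf]]]; split; first exact: smooth_shift.
exists ((fun x => x - y) @` K); split => //.
  apply: continuous_compact => //; apply: continuous_subspaceT.
  exact: continuous_shift_pt.
by move=> x h; apply: Kf => Kx; apply: h; exists (x + y) => //; rewrite addrK.
Qed.

Lemma test_bounded Om f : test_function Om f ->
  exists2 M : R, 0 <= M & forall x, `|f x| <= M.
Proof.
move=> [sf [K [cK KO Kf]]].
have : compact (f @` K).
  apply: continuous_compact => //; apply: continuous_subspaceT.
  exact: smooth_continuous.
move=> /compact_bounded[M [_ MK]]; exists (`|M| + 1) => [|x]; first by rewrite addr_ge0.
have [Kx|Kx] := pselect (K x); last by rewrite Kf// normr0 addr_ge0.
by apply: MK; [rewrite (le_lt_trans (ler_norm M))// ltrDl|exists x].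
Qed.

Lemma smooth_measurable f (A : set V) : smooth f ->
  measurable_fun (A : set (lebT R n)) (f : lebT R n -> R).
Proof.
move=> sf; apply: (@measurable_funS _ _ (lebT R n) _ setT) => //.
by apply: continuous_leb_measurable; exact: smooth_continuous.
Qed.

Lemma closed_leb_measurable (K : set V) : closed K -> measurable (K : set (lebT R n)).
Proof.
move=> cK; rewrite -[K]setCK; apply: measurableC.
by apply: leb_open_measurable; exact: closed_openC.
Qed.

Lemma bounded_supp_ig (g : V -> R) (K : set V) (M : R) (A : set V) :
  measurable (A : set (lebT R n)) -> measurable (K : set (lebT R n)) ->
  (mu K < +oo)%E ->
  measurable_fun (A : set (lebT R n)) (g : lebT R n -> R) ->
  (forall x, `|g x| <= M) -> (forall x, ~ K x -> g x = 0) ->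
  mu.-integrable A (EFin \o g).
Proof.
move=> mA mK fK mg gM Kg.
have M0 : 0 <= M by exact: le_trans (gM 0).
apply: (@ig_le _ (lebT R n) _ mu A mA (fun x => M * \1_K x)) => //.
  apply: igZ => //; apply: (integrableS measurableT) => //.
  apply/integrableP; split.
    by apply/measurable_EFinP; exact: measurable_indic.
  rewrite (_ : (fun x => _) = (fun x => (\1_K x)%:E)); last first.
    by apply/funext => x /=; rewrite ger0_norm.
  by rewrite integral_indic// setIT.
apply: aeW => x _; have [Kx|Kx] := pselect (K x).
  by rewrite indicE mem_set// mulr1.
by rewrite Kg// normr0 mulr_ge0.
Qed.

Lemma compact_leb_fin (K : set V) : compact K -> (mu K < +oo)%E.
Proof. by move=> /compact_bounded; exact: leb_bounded_fin. Qed.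

Lemma test_dom_ig Om f (g : V -> R) (M : R) A : test_function Om f ->
  measurable (A : set (lebT R n)) ->
  measurable_fun (A : set (lebT R n)) (g : lebT R n -> R) ->
  (forall x, `|g x| <= M) -> (forall x, f x = 0 -> g x = 0) ->
  mu.-integrable A (EFin \o g).
Proof.
move=> [sf [K [cK KO Kf]]] mA mg gM gf.
apply: (@bounded_supp_ig g K M) => //.
- by apply: closed_leb_measurable; exact: compact_closed_rV.
- exact: compact_leb_fin.
- by move=> x /Kf/gf.
Qed.

Lemma test_ig Om f A : test_function Om f -> measurable (A : set (lebT R n)) ->
  mu.-integrable A (EFin \o f).
Proof.
move=> hf mA; have [M M0 fM] := test_bounded hf.
apply: (@test_dom_ig Om f f M) => //.
by apply: smooth_measurable; exact: test_smooth hf.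
Qed.

Lemma measurable_shift_fun (y : V) :
  measurable_fun (setT : set (lebT R n)) ((fun x : V => x + y) : lebT R n -> lebT R n).
Proof. by move=> _ A mA; rewrite setTI; exact: measurable_shift. Qed.

(** Change of variables through the push-forward measure, which equals [leb] by translation
    invariance of the outer measure. *)
Lemma int_shift f (y : V) A : measurable (A : set (lebT R n)) ->
  measurable_fun (setT : set (lebT R n)) (f : lebT R n -> R) ->
  mu.-integrable ((fun x => x + y) @^-1` A) (EFin \o (fun x => f (x + y))) ->
  \int[mu]_(x in (fun x => x + y) @^-1` A) f (x + y) = \int[mu]_(x in A) f x.
Proof.
move=> mA mf fi; rewrite /Rintegral; congr fine.
have := @integral_pushforward _ _ (lebT R n) (lebT R n) R _ (measurable_shift_fun y)
   mu A (EFin \o f) _ fi mA.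
move=> <-; last exact/measurable_EFinP.
have E := @eq_measure_integral _ (lebT R n) R A mu
  (measure_function_pushforward__canonical__measure_function_Measure mu
     (measurable_shift_fun y)) (EFin \o f).
apply: E => B mB BA; exact: (@leb_outer_shift R n B y).
Qed.

(** Differentiation under the integral sign, dominated by a bound of the partial derivative times
    |u|. Sliding a test function along an axis plays the role of Fubini's theorem below. *)
Lemma is_derive_slide (A : set V) (u f : V -> R) i (t : R) :
  measurable (A : set (lebT R n)) -> mu.-integrable A (EFin \o u) ->
  test_function setT f ->
  is_derive t 1 (fun t => \int[mu]_(x in A) (u x * f (x + t *: 'e_i)))
    (\int[mu]_(x in A) (u x * partial i f (x + t *: 'e_i))).
Proof.
move=> mA ui hf.
have [M M0 fM] := test_bounded hf.
have [M' M'0 pM] := test_bounded (test_partial i hf).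
pose F := fun (t : R) (x : V) => u x * f (x + t *: 'e_i).
have dF (s : R) (x : V) : is_derive s 1 (fun s => F s x) (u x * partial i f (x + s *: 'e_i)).
  apply: is_deriveZ; apply/is_derive_line; apply: smooth_is_derive.
  exact: test_smooth hf.
have It : `]t - 1, t + 1[%classic t by rewrite /= in_itv /=; apply/andP; split; lra.
have dF1 (s : R) x : derivable (F ^~ x) s 1 by have [] := dF s x.
have FI s : mu.-integrable A (EFin \o F s).
  apply: (@ig_le _ (lebT R n) _ mu A mA (fun x => M * `|u x|)) => //.
  - apply: measurable_funM; first exact: ig_mf ui.
    by apply: smooth_measurable; apply: smooth_shift; exact: test_smooth hf.
  - by apply: igZ => //; exact: integrable_norm.
  - by apply: aeW => x _; rewrite /F normrM mulrC ler_wpM2r.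
have GI : mu.-integrable A (EFin \o (fun x => M' * `|u x|)).
  by apply: igZ => //; exact: integrable_norm.
have pF s x : partial1of2 F s x = u x * partial i f (x + s *: 'e_i).
  by rewrite partial1of2E; have [_ ->] := dF s x.
have H1 := @derivable_under_integral R _ (lebT R n) mu F A mA t (t - 1) (t + 1) It
  (fun s _ => FI s) (fun s x _ _ => dF1 s x) (fun x => M' * `|u x|)
  (fun x => mulr_ge0 M'0 (normr_ge0 _)) GI.
have H2 := @differentiation_under_integral R _ (lebT R n) mu F A mA t (t - 1) (t + 1) It
  (fun s _ => FI s) (fun s x _ _ => dF1 s x) (fun x => M' * `|u x|)
  (fun x => mulr_ge0 M'0 (normr_ge0 _)) GI.
have bd s x : `]t - 1, t + 1[%classic s -> A x -> `|partial1of2 F s x| <= M' * `|u x|.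
  by move=> _ _; rewrite pF normrM mulrC ler_wpM2r.
split; first exact: H1.
have := H2 bd; rewrite derive1E => ->.
by apply: eq_Rintegral => x _; rewrite pF.
Qed.

Lemma int_supp (A : set V) (g : V -> R) : (forall x, ~ A x -> g x = 0) ->
  \int[mu]_x g x = \int[mu]_(x in A) g x.
Proof.
move=> gA; rewrite [RHS]Rintegral_mkcond; congr (Rintegral _ _ _).
apply/funext => x; rewrite /patch; case: ifPn => //.
by rewrite notin_setE => /gA.
Qed.

(** The integral of a translate of f does not depend on the translation, so its derivative, which is
    the integral of the partial derivative, vanishes. *)
Lemma int_partial f i : test_function setT f -> \int[mu]_x partial i f x = 0.
Proof.
move=> hf.
have FE t : \int[mu]_x f (x + t *: 'e_i) = \int[mu]_x f x.
  rewrite -(@int_shift f (t *: 'e_i) setT) //.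
  - by apply: smooth_measurable; exact: test_smooth hf.
  - by have := @test_ig setT _ setT (test_shift (t *: 'e_i) hf) measurableT.
have [K [cK _ Kf]] := hf.2.
have [M M0 KM] := bounded_sub_obox (compact_bounded cK).
(* A box of finite measure with margin 1, so that all translates by |t| < 1 keep their support
   inside it. *)
pose A := obox (const_mx (- (M + 1)), const_mx (M + 1)) : set V.
have mA : measurable (A : set (lebT R n)) by exact: measurable_obox.
have fA : (mu A < +oo)%E by apply: le_lt_trans (leb_obox_le _) (ltry _).
have KA x t : `|t| < 1 -> ~ A x -> ~ K (x + t *: 'e_i).
  move=> t1 Ax /KM KMx; apply: Ax => j; have := KMx j; rewrite /= !mxE eqxx /=.
  have : `|t * (j == i)%:R| < 1.
    by case: (j == i); rewrite ?mulr1 ?mulr0 ?normr0 ?ltr01.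
  by rewrite ltr_norml => /andP[? ?] /andP[? ?]; apply/andP; split; lra.
have c1 := @ig_cst _ (lebT R n) R mu A mA 1 fA.
have := @is_derive_slide A (fun=> 1) f i 0 mA c1 hf.
rewrite (_ : \int[mu]_(x in A) _ = \int[mu]_x partial i f x); last first.
  rewrite (@int_supp A); first by apply: eq_Rintegral => x _; rewrite mul1r scale0r addr0.
  move=> x Ax; have [M' _ _] := test_bounded hf.
  have [_ [K' [cK' _ K'f]]] := test_partial i hf.
  apply: is_derive_partial.
  apply: (@near_eq_is_derive _ _ _ (cst 0)).
  have oK : open (~` K) by apply: closed_openC; exact: compact_closed_rV.
  have Kx : ~ K x by have := @KA x 0; rewrite normr0 scale0r addr0; apply.
  by have := open_nbhs_nbhs (conj oK Kx); apply: filterS => y /= /Kf ->.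
move=> d1; have d2 : is_derive (0 : R) 1
    (fun t => \int[mu]_(x in A) (1 * f (x + t *: 'e_i))) 0.
  apply: (@near_eq_is_derive R R R (cst (\int[mu]_x f x))).
  have : \forall t \near (0 : R), `|t| < 1 by exact: nbhs0_lt.
  apply: filterS => t t1; rewrite -(FE t) (@int_supp A).
    by apply: eq_Rintegral => x _; rewrite mul1r.
  by move=> x Ax; apply: Kf; exact: KA.
by have [_ <-] := d1; have [_ ->] := d2.
Qed.

Lemma is_derive_slide_mono (a b : R) (g dg : R -> R) (C : R) : a <= b ->
  (forall t : R, is_derive t 1 g (dg t)) -> (forall t, a <= t <= b -> `|dg t| <= C) ->
  `|g b - g a| <= C * (b - a).
Proof.
move=> ab dd dC; have [->|nab] := eqVneq a b; first by rewrite !subrr normr0 mulr0.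
have {}ab : a < b by rewrite lt_neqAle nab.
have [|c] := MVT ab (fun x _ => dd x).
  apply: continuous_subspaceT => x; exact: is_derive_continuous (dd x).
rewrite in_itv /= => /andP[ac cb] ->.
rewrite normrM (ger0_norm (_ : 0 <= b - a)) ?subr_ge0 ?(ltW ab)//.
by rewrite ler_wpM2r ?subr_ge0 ?(ltW ab)// dC// !ltW.
Qed.

End test_functions.

(** * Bump functions and the fundamental lemma of the calculus of variations *)

Section bumps.
Context (R : realType) (n : nat).
Local Notation V := 'rV[R]_n.+1.
Local Notation mu := (@leb R n).
Implicit Types (B : V * V) (Om U : set V).

(** A product of factors exp (-c / s) with s the signed distance to a face, so that it tends to the
    indicator of the open box as c -> 0. *)
Definition bump (c : R) (B : V * V) (x : V) : R :=
  \prod_(i < n.+1) (flat c 0 (x ord0 i - B.1 ord0 i) * flat c 0 (B.2 ord0 i - x ord0 i)).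

Lemma compact_cbox B : compact (cbox B).
Proof.
have := @rV_compact R n.+1 (fun i => `[B.1 ord0 i, B.2 ord0 i]%classic)
  (fun i => @segment_compact R _ _).
by congr compact; apply/seteqP; split => x /= h i; have := h i; rewrite in_itv.
Qed.

Lemma smooth_bump c B : 0 < c -> smooth (bump c B).
Proof.
move=> c0; apply: smooth_prod => i _; apply: smoothM; apply: smooth_flat => //.
  by apply: smoothB; [exact: smooth_coord|exact: smooth_cst].
by apply: smoothB; [exact: smooth_cst|exact: smooth_coord].
Qed.

Lemma bump_out c B x : ~ obox B x -> bump c B x = 0.
Proof.
move=> /existsNP[i Bi]; rewrite /bump (bigD1 i)//=.
have [h|h] := leP (x ord0 i) (B.1 ord0 i); first by rewrite flat_le0 ?mul0r// subr_le0.
have [h'|h'] := leP (B.2 ord0 i) (x ord0 i).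
  by rewrite [flat _ _ (B.2 _ _ - _)]flat_le0 ?mulr0 ?mul0r// subr_le0.
by exfalso; apply: Bi; rewrite h h'.
Qed.

Lemma bump_ge0 c B x : 0 <= bump c B x.
Proof. by apply: prodr_ge0 => i _; rewrite mulr_ge0 ?flat_ge0. Qed.

Lemma prodr_itv01 (I : Type) (r : seq I) (P : pred I) (F : I -> R) :
  (forall i, P i -> 0 <= F i <= 1) -> 0 <= \prod_(i <- r | P i) F i <= 1.
Proof.
move=> h; elim/big_rec : _ => [|i y Pi /andP[y0 y1]]; first by rewrite ler01 lexx.
by have /andP[F0 F1] := h i Pi; rewrite mulr_ge0//= mulr_ile1.
Qed.

Lemma flat0X (c s : R) m : (0 < m)%N -> flat c 0 s ^+ m = flat (m%:R * c) 0 s.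
Proof.
move=> m0; rewrite /flat; case: ifPn => _; last by rewrite expr0n gtn_eqF.
by rewrite !mul1r -expRM_natl mulrN -mulrA.
Qed.

(** Each factor is exp (-c / s), so powers only rescale c; this makes every bump an m-th power of
    another bump, as [bump_gradient_bound] requires. *)
Lemma bumpX c B m x : (0 < m)%N -> bump c B x ^+ m = bump (m%:R * c) B x.
Proof.
by move=> m0; rewrite /bump -prodrXl; apply: eq_bigr => i _; rewrite exprMn !flat0X.
Qed.

Lemma bump_le1 c B x : 0 <= c -> bump c B x <= 1.
Proof.
move=> c0; suff /andP[] : 0 <= bump c B x <= 1 by [].
apply: prodr_itv01 => i _; rewrite mulr_ge0 ?flat_ge0//=.
by rewrite mulr_ile1 ?flat_ge0// flat0_le1.
Qed.

Lemma test_bump c B Om : 0 < c -> cbox B `<=` Om -> test_function Om (bump c B).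
Proof.
move=> c0 BO; split; first exact: smooth_bump.
exists (cbox B); split => //; first exact: compact_cbox.
by move=> x Bx; apply: bump_out => /obox_cbox.
Qed.

Lemma cvg_flat0 s : 0 < s -> flat k.+1%:R^-1 0 s @[k --> \oo] --> (1 : R).
Proof.
move=> s0; rewrite /flat s0; under eq_fun do rewrite mul1r.
suff : expR (- (k.+1%:R^-1 / s)) @[k --> \oo] --> expR (- (0 / s) : R).
  by rewrite mul0r oppr0 expR0.
apply: continuous_cvg; first exact: continuous_expR.
apply: cvgN; apply: cvgM; last exact: cvg_cst.
exact: cvg_harmonic.
Qed.

Lemma cvg_prodR (I T : Type) (F : set_system T) {FF : Filter F}
    (r : seq I) (P : pred I) (f : I -> T -> R) (l : I -> R) :
  (forall i, P i -> f i x @[x --> F] --> l i) ->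
  \prod_(i <- r | P i) f i x @[x --> F] --> \prod_(i <- r | P i) l i.
Proof.
move=> h; elim: r => [|i r ih].
  by rewrite big_nil; under eq_fun do rewrite big_nil; exact: cvg_cst.
rewrite big_cons; under eq_fun do rewrite big_cons.
by move: (h i); case: (P i) => [/(_ isT) hi|_] //; exact: cvgM.
Qed.

Lemma cvg_bump B x : bump k.+1%:R^-1 B x @[k --> \oo] --> (\1_(obox B) x : R).
Proof.
have [Bx|Bx] := pselect (obox B x); last first.
  under eq_fun do rewrite bump_out//.
  by rewrite indicE memNset//; exact: cvg_cst.
rewrite indicE mem_set//.
have -> : (true%:R = \prod_(i < n.+1) (1 * 1) :> R) by rewrite big1// => i _; rewrite mul1r.
apply: cvg_prodR => i _; have /andP[? ?] := Bx i.
by apply: cvgM; apply: cvg_flat0; rewrite subr_gt0.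
Qed.

Section union_of_boxes.
Context (U : set V) (oU : open U).

(** A smooth union of the first m rational boxes, restricted to those whose closures lie in U: one
    minus the product of the complements, hence for c > 0 with values in [0, 1] and compact support
    in U. *)
Definition open_approx_aux (c : R) (m : nat) (x : V) : R :=
  1 - \prod_(j < m | `[< cbox (rbox R n j) `<=` U >]) (1 - bump c (rbox R n j) x).

Definition open_approx (k : nat) : V -> R := open_approx_aux k.+1%:R^-1 k.

Let inv0 k : 0 < k.+1%:R^-1 :> R. Proof. by rewrite invr_gt0. Qed.

Lemma test_open_approx_aux c m : 0 < c -> test_function U (open_approx_aux c m).
Proof.
move=> c0; elim: m => [|m ih].
  rewrite (_ : open_approx_aux c 0 = fun=> 0); first exact: test0.
  by apply/funext => x; rewrite /open_approx_aux big_ord0 subrr.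
pose g := open_approx_aux c m.
have E x : open_approx_aux c m.+1 x = if `[< cbox (rbox R n m) `<=` U >]
    then g x + (1 - g x) * bump c (rbox R n m) x else g x.
  rewrite /open_approx_aux big_mkcond big_ord_recr /= -big_mkcond /=.
  case: ifPn => _; rewrite ?mulr1// /g /open_approx_aux.
  by move: (\prod_(_ < _ | _) _) => P; ring.
rewrite (_ : open_approx_aux c m.+1 = fun x => if `[< cbox (rbox R n m) `<=` U >]
    then g x + (1 - g x) * bump c (rbox R n m) x else g x); last exact/funext.
case: asboolP => // Um.
apply: testD => //; apply: testMl; last exact: test_bump.
by apply: smoothB; [exact: smooth_cst|exact: test_smooth ih].
Qed.

Lemma test_open_approx k : test_function U (open_approx k).
Proof. exact: test_open_approx_aux. Qed.

Lemma open_approx_itv k x : 0 <= open_approx k x <= 1.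
Proof.
have h : 0 <= \prod_(j < k | `[< cbox (rbox R n j) `<=` U >])
   (1 - bump k.+1%:R^-1 (rbox R n j) x) <= 1.
  apply: prodr_itv01 => j _; rewrite subr_ge0 bump_le1 ?(ltW (inv0 _))//= lerBlDr lerDl.
  exact: bump_ge0.
rewrite /open_approx /open_approx_aux; move: h; move: (\prod_(_ < _ | _) _) => P; lra.
Qed.

(** Once a box containing x is listed, its bump alone bounds the approximation from below and tends
    to 1 at x. *)
Lemma cvg_open_approx x : open_approx k x @[k --> \oo] --> (\1_U x : R).
Proof.
have [Ux|Ux] := pselect (U x); last first.
  rewrite indicE memNset// (_ : (fun k => _) = fun=> 0); first exact: cvg_cst.
  apply/funext => k; rewrite /open_approx /open_approx_aux big1 ?subrr// => j /asboolP jU.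
  by rewrite bump_out ?subr0// => /obox_cbox/jU.
rewrite indicE mem_set//.
have [j [jx jU]] := open_rbox oU Ux.
apply: (@squeeze_cvgr _ _ _ _ (fun k => bump k.+1%:R^-1 (rbox R n j) x) (fun=> 1)).
- near=> k; have /andP[_ ->] := open_approx_itv k x; rewrite andbT.
  have jk : (j < k)%N by near: k; exact: nbhs_infty_gt.
  rewrite /open_approx /open_approx_aux lerBrDl -lerBrDr.
  rewrite (bigD1 (Ordinal jk))/=; last exact/asboolP.
  rewrite ler_piMr ?subr_ge0 ?bump_le1 ?(ltW (inv0 _))//.
  set P := \prod_(_ < _ | _) _; suff /andP[] : 0 <= P <= 1 by [].
  apply: prodr_itv01 => i _; rewrite subr_ge0 bump_le1 ?(ltW (inv0 _))//= lerBlDr lerDl.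
  exact: bump_ge0.
- by have := @cvg_bump (rbox R n j) x; rewrite indicE mem_set.
- exact: cvg_cst.
Unshelve. all: by end_near. Qed.

End union_of_boxes.

Lemma leb_complete : measure_is_complete mu.
Proof. exact: measure_is_complete_caratheodory. Qed.

Lemma open_obox B : open (obox B).
Proof.
rewrite openE => x Bx.
change (nbhs x (obox B)).
apply: (@filter_forall V _ (fun (i : 'I_n.+1) (y : V) => B.1 ord0 i < y ord0 i < B.2 ord0 i) (nbhs x)) => i.
have /andP[h1 h2] := Bx i.
have ci := @coord_continuous R 1 n.+1 ord0 i x.
have : \forall y \near nbhs (x ord0 i), B.1 ord0 i < y < B.2 ord0 i.
  near=> y; apply/andP; split; near: y; [exact: lt_nbhsr|exact: lt_nbhsl].
exact: ci.
Unshelve. all: by end_near. Qed.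

(** By definition of the outer measure, the union of an almost optimal cover by open boxes is the
    required open set. *)
Lemma leb_outer_regular (E : set V) (e : R) : (mu E < +oo)%E -> 0 < e ->
  exists U : set V, [/\ open U, E `<=` U & (mu U <= mu E + e%:E)%E].
Proof.
move=> fE e0.
have E0 : (0 <= mu E)%E by exact: leb_outer_ge0.
have fin : leb_outer E \is a fin_num by rewrite ge0_fin_numE.
have [_ [B EB <-] Blt] := lb_ereal_inf_adherent e0 fin.
exists (\bigcup_k obox (B k)); split => //.
  apply: bigcup_open => k _.
  exact: open_obox.
apply: le_trans (ltW Blt); exact: leb_outer_le_cover.
Qed.

(** Dominated convergence along the smooth approximations of the indicator of U. *)
Lemma int_open0 Om U (g : V -> R) : open Om -> open U -> U `<=` Om ->
  mu.-integrable Om (EFin \o g) ->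
  (forall f, test_function Om f -> \int[mu]_(x in Om) (g x * f x) = 0) ->
  \int[mu]_(x in Om) (g x * \1_U x) = 0.
Proof.
move=> oO oU UO gi g0.
have mO := leb_open_measurable oO.
have [] := @dominated_cvgR _ (lebT R n) R mu Om mO
  (fun k x => g x * open_approx U k x) (fun x => g x * \1_U x) (fun x => `|g x|).
- move=> k; apply: measurable_funM; first exact: ig_mf gi.
  exact: smooth_measurable (test_smooth (test_open_approx U k)).
- apply: measurable_funM; first exact: ig_mf gi.
  by apply: measurable_indic; exact: leb_open_measurable.
- exact: integrable_norm.
- by apply: aeW => x _; apply: cvgM; [exact: cvg_cst|exact: cvg_open_approx].
- move=> k; apply: aeW => x _; rewrite normrM ler_piMr//.
  by have /andP[h1 h2] := open_approx_itv U k x; rewrite ger0_norm.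
move=> _ cv _; apply/esym/(cvg_unique _ _ cv) => //.
rewrite (_ : (fun k => _) = fun=> 0); first exact: cvg_cst.
apply/funext => k; apply: g0; apply: testS UO _; exact: test_open_approx.
Qed.

(** The vanishing is carried from test functions to indicators of open sets, and from these to a
    measurable F through a decreasing sequence of open sets whose intersection exceeds F by a null
    set. A function whose integral over every measurable subset is zero vanishes almost
    everywhere. *)
Lemma test_int0_ae Om (g : V -> R) : open Om -> (mu Om < +oo)%E ->
  mu.-integrable Om (EFin \o g) ->
  (forall f, test_function Om f -> \int[mu]_(x in Om) (g x * f x) = 0) ->
  \forall x \ae mu, Om x -> g x = 0.
Proof.
move=> oO fO gi g0.
have mO := leb_open_measurable oO.
have main (F : set V) : F `<=` Om -> measurable (F : set (lebT R n)) ->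
    \int[mu]_(x in Om) (g x * \1_F x) = 0.
  move=> FO mF.
  have fF : (mu F < +oo)%E by apply: le_lt_trans fO; exact: le_leb_outer.
  have /choice[U UP] : forall j : nat, exists U : set V,
      [/\ open U, F `<=` U & (mu U <= mu F + (j.+1%:R^-1)%:E)%E].
    by move=> j; apply: leb_outer_regular => //; rewrite invr_gt0.
  (* Finite intersections make the open envelopes decreasing, so that their indicators converge
     pointwise to that of [Z]. *)
  pose W := fix W m := if m is m'.+1 then W m' `&` U m else Om `&` U 0%N.
  have oW m : open (W m).
    by elim: m => [|m ih] /=; apply: openI => //; [have [] := UP 0%N|have [] := UP m.+1].
  have WO m : W m `<=` Om.
    by elim: m => [|m ih] /= x []// /ih.
  have FW m : F `<=` W m.
    elim: m => [|m ih] /= x Fx; split; [exact: FO|by have [_ + _] := UP 0%N; exact|exact: ih|].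
    by have [_ + _] := UP m.+1; exact.
  have WU m : W m `<=` U m by case: m => [|m] x [].
  have Wd m k : (m <= k)%N -> W k `<=` W m.
    by move=> /subnK <-; elim: (k - m)%N => // j ih x [/ih].
  pose Z := \bigcap_m W m.
  have mW m : measurable (W m : set (lebT R n)) by exact: leb_open_measurable.
  have mZ : measurable (Z : set (lebT R n)) by exact: bigcap_measurable.
  have Z0 : mu (Z `\` F) = 0%E.
    apply/eqP; rewrite eq_le measure_ge0 andbT.
    apply/lee_addgt0Pr => e e0; rewrite add0e.
    have [j je] : exists j : nat, j.+1%:R^-1 < e.
      have [j] := ltr_add_invr (e0 : 0 < e); rewrite add0r; by exists j.
    have [_ FU Ue] := UP j.
    apply: (@le_trans _ _ (mu (W j `\` F))).
      by apply: le_leb_outer => x [Zx Fx]; split => //; exact: Zx.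
    have E1 := @measureD _ (lebT R n) R mu (W j) F (mW j) mF.
    rewrite E1; last first.
      by apply: le_lt_trans fO; apply: le_leb_outer; exact: WO.
    have -> : W j `&` F = F.
      by apply/seteqP; split => x; [case|move=> Fx; split => //; exact: FW].
    rewrite leeBlDr ?ge0_fin_numE ?measure_ge0//.
    apply: le_trans (le_leb_outer (@WU j)) _; apply: le_trans Ue _.
    by rewrite addeC; apply: leeD => //; rewrite lee_fin ltW.
  have aeZ : \forall x \ae mu, Om x -> g x * \1_F x = g x * \1_Z x.
    exists (Z `\` F); split => //; first exact: measurableD.
    move=> x /= h; apply: contra_notP h => nZ _; congr (_ * _).
    rewrite !indicE; congr (_%:R); congr nat_of_bool; apply/idP/idP; rewrite !inE.
      by move=> Fx m _; exact: FW.
    by move=> Zx; apply: contrapT => nF; exact: nZ.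
  have mgF : measurable_fun (Om : set (lebT R n)) ((fun x => g x * \1_F x) : lebT R n -> R).
    by apply: measurable_funM; [exact: ig_mf gi|exact: measurable_indic].
  have mgZ : measurable_fun (Om : set (lebT R n)) ((fun x => g x * \1_Z x) : lebT R n -> R).
    by apply: measurable_funM; [exact: ig_mf gi|exact: measurable_indic].
  rewrite (I_eq_ae mO mgF mgZ aeZ).
  have [] := @dominated_cvgR _ (lebT R n) R mu Om mO
    (fun k x => g x * \1_(W k) x) (fun x => g x * \1_Z x) (fun x => `|g x|).
  - by move=> k; apply: measurable_funM; [exact: ig_mf gi|exact: measurable_indic].
  - by apply: measurable_funM; [exact: ig_mf gi|exact: measurable_indic].
  - exact: integrable_norm.
  - apply: aeW => x _; apply: cvgM; first exact: cvg_cst.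
    have [Zx|Zx] := pselect (Z x).
      rewrite indicE mem_set// (_ : (fun k => _) = fun=> 1); first exact: cvg_cst.
      by apply/funext => k; rewrite indicE mem_set//; exact: Zx.
    have [m mx] : exists m, ~ W m x.
      by apply: contrapT => /forallNP h; apply: Zx => m _; exact: contrapT (h m).
    apply: (@cvg_near_cst _ R); near=> k.
    have mk : (m <= k)%N by near: k; exact: nbhs_infty_ge.
    by rewrite !indicE !memNset// => /(Wd _ _ mk).
  - move=> k; apply: aeW => x _; rewrite normrM ler_piMr//.
    by rewrite indicE; case: (_ \in _); rewrite ?normr1 ?normr0.
  move=> _ cv _; apply/esym/(cvg_unique _ _ cv) => //.
  rewrite (_ : (fun k => _) = fun=> 0); first exact: cvg_cst.
  by apply/funext => k; apply: int_open0.
have := @integral_ae_eq _ (lebT R n) R mu Om mO (cst 0%E) (EFin \o g) gi.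
move=> h; have {h} := h ltac:(exact: measurable_cst); move=> h.
have : ae_eq mu Om (EFin \o g) (cst 0%E).
  apply: h => F FO mF; rewrite integral_cst//= mul0e.
  have giF : mu.-integrable F (EFin \o g) by apply: integrableS gi.
  rewrite -(EFin_I mF giF); congr EFin.
  rewrite -[RHS](main F FO mF) Rintegral_mkcond.
  rewrite [RHS]Rintegral_mkcond; congr (Rintegral _ _ _); apply/funext => x.
  rewrite /patch indicE; case: ifPn => xF; first by rewrite mem_set ?mulr1//; apply: FO; exact/set_mem.
  by rewrite mulr0; case: ifPn.
by apply: filterS => x /= /[apply] -[].
Unshelve. all: by end_near. Qed.

End bumps.

Lemma I_subset d (T : measurableType d) (R : realType) (mu : {measure set T -> \bar R})
    (A B : set T) (f : T -> R) : measurable A -> measurable B -> (forall x, 0 <= f x) ->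
  mu.-integrable B (EFin \o f) -> A `<=` B ->
  \int[mu]_(x in A) f x <= \int[mu]_(x in B) f x.
Proof.
move=> mA mB f0 fi AB; have fiA := integrableS mB mA AB fi.
rewrite -lee_fin (EFin_I mB fi) (EFin_I mA fiA); apply: ge0_subset_integral => //.
- by apply/measurable_EFinP; exact: ig_mf fi.
- by move=> x _; rewrite lee_fin.
Qed.

Lemma powR_mono (R : realType) (s a b : R) : 0 <= s -> 0 <= a -> a <= b -> a `^ s <= b `^ s.
Proof.
by move=> s0 a0 ab; apply: ge0_ler_powR; rewrite ?nnegrE// (le_trans a0).
Qed.

Lemma pow2_lt1 (R : realType) (c : R) : c < 0 -> (2 : R) `^ c < 1.
Proof.
move=> c0; rewrite /powR gt_eqF// -[X in _ < X]expR0 ltr_expR pmulr_llt0//.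
by rewrite ln_gt0//; lra.
Qed.

(** * Averages over binary boxes: Poincare, Sobolev and Morrey estimates *)

Section binary_boxes.
Context (R : realType) (n : nat) (L : R) (L0 : 0 < L).
Local Notation V := 'rV[R]_n.+1.
Local Notation mu := (@leb R n).
Local Notation "''e_' i" := (delta_mx ord0 i : V) (at level 8, i at level 2).
Implicit Types (f : V -> R) (lo x : V).

Definition gradc f : V -> V := fun x => \row_i partial i f x.

(* the coordinate halved at step k, and the side lengths after k steps *)
Definition cdir k : 'I_n.+1 := inord (k %% n.+1).
Definition side k (i : 'I_n.+1) : R := L * 2^-1 ^+ ((k + (n - i)) %/ n.+1).
(** Half-open, so that the two halves of a box partition it. *)
Definition qbox k lo : set V :=
  [set x | forall i, lo ord0 i <= x ord0 i < lo ord0 i + side k i].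
Definition up k lo : V := lo + side k.+1 (cdir k) *: 'e_(cdir k).

Lemma cdirE k : cdir k = (k %% n.+1)%N :> nat.
Proof. by rewrite /cdir inordK// ltn_mod. Qed.

Lemma side_gt0 k i : 0 < side k i.
Proof. by rewrite mulr_gt0// exprn_gt0// invr_gt0. Qed.

(** The exponent (k + (n - i)) / (n + 1) in [side] counts the steps j < k with j congruent to i
    modulo n + 1; it increases at step k exactly when i = [cdir k]. *)
Lemma sideS k i : side k i = (if i == cdir k then 2 else 1) * side k.+1 i.
Proof.
rewrite /side addSn divnS//.
have -> : (n.+1 %| (k + (n - i)).+1)%N = (i == cdir k).
  rewrite -val_eqE /= cdirE -addnS -subSn ?leq_ord//.
  have hi := ltn_ord i; rewrite {1}(divn_eq k n.+1) -addnA dvdn_addr ?dvdn_mull//.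
  move: (k %% n.+1)%N (ltn_pmod k (ltn0Sn n)) => r hr.
  case: ltngtP => ir.
  - by rewrite -(subnK (ltnW ir)) -addnA subnKC ?(ltnW hi)// dvdn_addl// gtnNdvd//; lia.
  - by rewrite gtnNdvd//; lia.
  - by rewrite ir subnKC ?dvdnn// ltnW.
by case: eqP => _; rewrite ?add1n ?add0n ?mul1r// exprS; field.
Qed.

Lemma side_cdir k : side k (cdir k) = 2 * side k.+1 (cdir k).
Proof. by rewrite sideS eqxx. Qed.

Lemma side_cdirE k : side k.+1 (cdir k) = L / 2 * 2^-1 ^+ (k %/ n.+1).
Proof.
have h := side_cdir k; have -> : side k.+1 (cdir k) = side k (cdir k) / 2 by rewrite h; field.
have E : (k %% n.+1 + (n - k %% n.+1) = n)%N by rewrite subnKC// -ltnS ltn_mod.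
rewrite /side cdirE {1}(divn_eq k n.+1) -addnA E divnMDl// (divn_small (ltnSn n)) addn0.
by field.
Qed.

Lemma side_le k i : side k i <= L * 2^-1 ^+ (k %/ n.+1).
Proof.
rewrite /side; apply: ler_wpM2l; first exact: ltW.
by apply: ler_wiXn2l; [lra|lra|apply: leq_div2r; exact: leq_addr].
Qed.

Lemma upE k lo i : up k lo ord0 i = lo ord0 i + (i == cdir k)%:R * side k.+1 (cdir k).
Proof. by rewrite !mxE eqxx /= mulrC. Qed.

Lemma qbox_lo k lo x : (qbox k.+1 lo x) <->
  (qbox k lo x /\ x ord0 (cdir k) < lo ord0 (cdir k) + side k.+1 (cdir k)).
Proof.
split=> [h|[h1 h2] i].
  split; last by have /andP[] := h (cdir k).
  move=> i; have /andP[-> h2] := h i; rewrite (lt_le_trans h2)// lerD2l [leRHS]sideS.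
  by case: ifP => _; have := side_gt0 k.+1 i; lra.
have /andP[-> h3] := h1 i; rewrite /=.
have [->|ne] := eqVneq i (cdir k); first exact: h2.
by move: h3; rewrite sideS (negbTE ne) mul1r.
Qed.

Lemma qbox_up k lo x : (qbox k.+1 (up k lo) x) <->
  (qbox k lo x /\ lo ord0 (cdir k) + side k.+1 (cdir k) <= x ord0 (cdir k)).
Proof.
split=> [h|[h1 h2] i].
  split.
    move=> i; have := h i; rewrite !upE [side k i]sideS.
    have [->|ne] := eqVneq i (cdir k); rewrite ?mul0r ?addr0 ?mul1r//.
    by have := side_gt0 k.+1 (cdir k) => s0 /andP[a b]; apply/andP; split; lra.
  by have := h (cdir k); rewrite upE eqxx mul1r => /andP[].
have := h1 i; rewrite !upE [side k i]sideS.
have [->|ne] := eqVneq i (cdir k); rewrite ?mul0r ?addr0 ?mul1r//.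
by move=> /andP[a b]; apply/andP; split; lra.
Qed.

Lemma qbox_split k lo : qbox k lo = qbox k.+1 lo `|` qbox k.+1 (up k lo).
Proof.
apply/seteqP; split=> x /=.
  move=> Qx; have [lt|ge] := ltP (x ord0 (cdir k)) (lo ord0 (cdir k) + side k.+1 (cdir k)).
    by left; apply/qbox_lo.
  by right; apply/qbox_up.
by move=> [/qbox_lo[]|/qbox_up[]].
Qed.

Lemma qbox_disj k lo : [disjoint qbox k.+1 lo & qbox k.+1 (up k lo)].
Proof.
apply/disj_setPS => x [/qbox_lo[_ a] /qbox_up[_ b]].
by move: (le_lt_trans b a); rewrite ltxx.
Qed.

Lemma qboxE k lo : qbox k lo = hbox (lo, lo + \row_i side k i).
Proof. by apply/seteqP; split => x h i; have := h i; rewrite /= !mxE. Qed.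

Lemma measurable_qbox k lo : measurable (qbox k lo : set (lebT R n)).
Proof. by rewrite qboxE; exact: measurable_hbox. Qed.

Lemma qbox_shift k lo y : (fun x => x + y) @^-1` qbox k (lo + y) = qbox k lo.
Proof.
by apply/seteqP; split => x h i; have := h i; rewrite /= !mxE => /andP[a b]; apply/andP; split; lra.
Qed.

Lemma leb_qbox_shift k lo : (mu (qbox k lo) = mu (qbox k 0))%E.
Proof. by rewrite -(qbox_shift k 0 lo) add0r; apply/esym; exact: leb_outer_shift. Qed.

Lemma leb_qbox_fin k lo : (mu (qbox k lo) < +oo)%E.
Proof.
pose B : V * V := (lo - const_mx 1, lo + \row_i side k i).
apply: (@le_lt_trans _ _ (mu (obox B))); last exact: le_lt_trans (leb_obox_le _) (ltry _).
apply: le_leb_outer => x h i; have := h i; rewrite !mxE => /andP[a b].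
by apply/andP; split; lra.
Qed.

(** The measure itself, not the product of the sides: halving and translation invariance give vol k
    = 2^(-k) vol 0, so positivity has to be assumed of vol 0 alone. *)
Definition vol k : R := fine (mu (qbox k 0)).

Lemma leb_qbox k lo : mu (qbox k lo) = (vol k)%:E.
Proof.
rewrite leb_qbox_shift /vol fineK// ge0_fin_numE; first exact: leb_qbox_fin.
exact: measure_ge0.
Qed.

Lemma fine_leb_qbox k lo : fine (@leb R n (qbox k lo)) = vol k.
Proof. by rewrite leb_qbox. Qed.

Lemma volS k : vol k = 2 * vol k.+1.
Proof.
apply: EFin_inj; rewrite -(leb_qbox k 0) qbox_split measureU.
- rewrite [LHS](_ : _ = (vol k.+1)%:E + (vol k.+1)%:E)%E; last by congr (_ + _)%E; exact: leb_qbox.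
  by rewrite -EFinD; congr EFin; ring.
- exact: measurable_qbox.
- exact: measurable_qbox.
- by apply/seteqP; split => // x [/qbox_lo[_ a] /qbox_up[_ b]]; move: (le_lt_trans b a); rewrite ltxx.
Qed.

Lemma volE k : vol k = vol 0 * 2^-1 ^+ k.
Proof.
elim: k => [|k ih]; first by rewrite expr0 mulr1.
have := volS k; rewrite ih exprS => h; have -> : vol k.+1 = (vol 0 * 2^-1 ^+ k) / 2 by rewrite h; field.
by ring.
Qed.

Context (vol0 : 0 < vol 0).

Lemma vol_gt0 k : 0 < vol k.
Proof. by rewrite volE mulr_gt0// exprn_gt0// invr_gt0. Qed.

Definition avg k lo f : R := (vol k)^-1 * \int[mu]_(x in qbox k lo) f x.

Local Notation test f := (test_function setT f).
Local Notation ig A f := (mu.-integrable (A : set (lebT R n)) (EFin \o (f : lebT R n -> R))).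

Lemma qtest_ig k lo f : test f -> ig (qbox k lo) f.
Proof. by move=> tf; apply: test_ig tf _; exact: measurable_qbox. Qed.

Lemma int_qbox_split k lo f : ig (qbox k lo) f ->
  \int[mu]_(x in qbox k lo) f x =
  \int[mu]_(x in qbox k.+1 lo) f x + \int[mu]_(x in qbox k.+1 (up k lo)) f x.
Proof.
rewrite qbox_split => fi; rewrite Rintegral_setU//.
- exact: measurable_qbox.
- exact: measurable_qbox.
- exact: qbox_disj.
Qed.

Lemma avg_split k lo f : test f ->
  avg k lo f = 2^-1 * (avg k.+1 lo f + avg k.+1 (up k lo) f).
Proof.
move=> tf; rewrite /avg (int_qbox_split (qtest_ig k lo tf)) volS invfM.
by rewrite -mulrDr mulrA.
Qed.

Lemma qbox_slide k lo t : 0 <= t <= side k.+1 (cdir k) ->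
  (fun x => x - t *: 'e_(cdir k)) @^-1` qbox k.+1 lo `<=` qbox k lo.
Proof.
move=> /andP[t0 ts] x h i; have := h i; rewrite !mxE eqxx /= [side k i]sideS.
have [->|ne] := eqVneq i (cdir k); rewrite ?mulr0 ?mulr1 ?subr0 ?mul1r// => /andP[a b].
by apply/andP; split; lra.
Qed.

(** The upper half is the lower half slid along one axis, so the difference of the integrals is
    controlled by the derivative along the slide; every intermediate translate stays in the parent
    box. *)
Lemma avg_diff k lo f : test f ->
  `|avg k.+1 (up k lo) f - avg k.+1 lo f| <=
  (vol k.+1)^-1 * (side k.+1 (cdir k) * \int[mu]_(x in qbox k lo) `|partial (cdir k) f x|).
Proof.
move=> tf; set i := cdir k; set s := side k.+1 i.
have mQ := measurable_qbox k.+1 lo.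
pose phi t := \int[mu]_(x in qbox k.+1 lo) f (x + t *: 'e_i).
have E : \int[mu]_(x in qbox k.+1 (up k lo)) f x = phi s.
  rewrite /phi -(@int_shift _ _ f (s *: 'e_i) (qbox k.+1 (up k lo))).
  - by rewrite /up qbox_shift.
  - exact: measurable_qbox.
  - by apply: smooth_measurable; exact: test_smooth tf.
  - rewrite /up qbox_shift; apply: qtest_ig; exact: test_shift.
rewrite /avg E -mulrBr normrM ger0_norm ?invr_ge0 ?(ltW (vol_gt0 _))//.
apply: ler_wpM2l; first by rewrite invr_ge0 ltW// vol_gt0.
have -> : \int[mu]_(x in qbox k.+1 lo) f x = phi 0.
  by apply: I_eq => x _; rewrite scale0r addr0.
pose dphi t := \int[mu]_(x in qbox k.+1 lo) partial i f (x + t *: 'e_i).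
have c1 : ig (qbox k.+1 lo) (fun=> 1).
  by apply: (ig_cst mQ); exact: leb_qbox_fin.
have dphiP t : is_derive t (1 : R) phi (dphi t).
  have := is_derive_slide i t mQ c1 tf; congr is_derive.
    by apply/funext => u; apply: I_eq => x _; rewrite mul1r.
  by apply: I_eq => x _; rewrite mul1r.
have tp := test_partial i tf.
have tpn (A : set V) : measurable (A : set (lebT R n)) -> ig A (fun x => `|partial i f x|).
  by move=> mA; apply: ig_norm; apply: test_ig tp mA.
have bd t : 0 <= t <= s -> `|dphi t| <= \int[mu]_(x in qbox k lo) `|partial i f x|.
  move=> ts; have tps : test (fun x => partial i f (x + t *: 'e_i)) by exact: test_shift.
  apply: le_trans (le_normr_Rintegral mQ (qtest_ig _ _ tps)) _.
  have mQ' : measurable ((fun x => x - t *: 'e_i) @^-1` qbox k.+1 lo : set (lebT R n)).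
    exact: measurable_shift.
  have E2 : (fun x => x + t *: 'e_i) @^-1` ((fun x => x - t *: 'e_i) @^-1` qbox k.+1 lo) = qbox k.+1 lo.
    by apply/seteqP; split => x /=; rewrite addrK.
  have := @int_shift _ _ (fun x => `|partial i f x|) (t *: 'e_i) _ mQ'; rewrite E2 => ->.
  - apply: I_subset => //; [exact: measurable_qbox|exact: tpn (measurable_qbox _ _)|exact: qbox_slide].
  - by apply: mf_norm; apply: smooth_measurable; exact: test_smooth tp.
  - exact: ig_norm (qtest_ig _ _ tps).
have := is_derive_slide_mono (ltW (side_gt0 k.+1 i)) dphiP bd.
by rewrite subr0 mulrC.
Qed.

Context (p : R) (p1 : 1 < p).
Let p0 : 0 < p. Proof. exact: lt_trans p1. Qed.

(** Young's inequality with s the average of w is the tangent-line inequality of t^p at s;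
    integrating it gives Jensen's inequality. *)
Lemma jensen_qbox k lo (w : V -> R) : (forall x, 0 <= w x) -> ig (qbox k lo) w ->
  ig (qbox k lo) (fun x => w x `^ p) ->
  ((vol k)^-1 * \int[mu]_(x in qbox k lo) w x) `^ p <=
  (vol k)^-1 * \int[mu]_(x in qbox k lo) (w x `^ p).
Proof.
move=> w0 wi wpi; have mQ := measurable_qbox k lo; have v0 := vol_gt0 k.
set s := (vol k)^-1 * _.
have s0 : 0 <= s by rewrite mulr_ge0 ?invr_ge0 ?(ltW v0)// I_ge0.
have ci := ig_cst mQ ((p - 1) * s `^ p) (leb_qbox_fin k lo).
have H : \int[mu]_(x in qbox k lo) (p * s `^ (p - 1) * w x) <=
    \int[mu]_(x in qbox k lo) (w x `^ p + (p - 1) * s `^ p).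
  apply: (I_le mQ); [exact: (igZ mQ _ wi)|exact: (igD mQ wpi ci)|].
  by move=> x _; exact: young_le.
rewrite (RintegralZl _ mQ wi) (RintegralD mQ wpi ci) (Rintegral_cst mu mQ) fine_leb_qbox in H.
have E : \int[mu]_(x in qbox k lo) w x = vol k * s by rewrite /s mulrA mulfV ?mul1r// gt_eqF.
rewrite -(ler_pM2l v0) mulrA mulfV ?gt_eqF// mul1r.
have sp : s * s `^ (p - 1) = s `^ p by rewrite mulr_powRB1.
rewrite E in H; have E2 : p * s `^ (p - 1) * (vol k * s) = vol k * (p * s `^ p) by rewrite -sp; ring.
rewrite E2 in H; move: H; move: (\int[mu]_(x in _) _) (s `^ p) (vol k) => I a v.
lra.
Qed.

Definition egrad f x : R := euclid (gradc f x) `^ p.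

Lemma egrad_ge0 f x : 0 <= egrad f x. Proof. exact: powR_ge0. Qed.

Lemma partial_le_egrad f i x : `|partial i f x| `^ p <= egrad f x.
Proof.
apply: ge0_ler_powR; rewrite ?nnegrE ?euclid_ge0//; first exact: ltW.
by have := coord_le_euclid (gradc f x) i; rewrite mxE.
Qed.

Lemma test_gradc_bounded f : test f -> exists M, forall x, euclid (gradc f x) <= M.
Proof.
move=> tf; have /choice[M HM] : forall i, exists M, forall x, `|partial i f x| <= M.
  by move=> i; have [M _ h] := test_bounded (test_partial i tf); exists M.
exists (\sum_i M i) => x; apply: le_trans (euclid_sum_le _) _.
by apply: ler_sum => i _; rewrite mxE.
Qed.

Lemma mf_euclid_gradc f (A : set V) : test f ->
  measurable_fun (A : set (lebT R n)) ((fun x => euclid (gradc f x)) : lebT R n -> R).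
Proof.
move=> tf; apply: (@measurableT_comp _ _ _ _ _ _ (@Num.sqrt R)).
  exact: continuous_measurable_fun (@sqrt_continuous R).
rewrite /dotv; apply: measurable_sum => i.
rewrite (_ : (fun x => _) = (fun x => partial i f x * partial i f x)).
  by apply: measurable_funM; apply: smooth_measurable; exact: test_smooth (test_partial i tf).
by apply/funext => x; rewrite !mxE.
Qed.

Lemma egrad_ig k lo f : test f -> ig (qbox k lo) (egrad f).
Proof.
move=> tf; have [M fM] := test_gradc_bounded tf; have mQ := measurable_qbox k lo.
apply: (ig_le mQ _ (ig_cst mQ (M `^ p) (leb_qbox_fin k lo))).
  by apply: mf_powR; exact: mf_euclid_gradc.
apply: aeW => x _; rewrite ger0_norm ?egrad_ge0//.
apply: ge0_ler_powR; rewrite ?nnegrE ?euclid_ge0//; first exact: ltW.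
exact: le_trans (euclid_ge0 _) (fM x).
Qed.

Definition Eq k lo f : R := \int[mu]_(x in qbox k lo) egrad f x.

Lemma Eq_ge0 k lo f : 0 <= Eq k lo f.
Proof. by apply: I_ge0 => x _; exact: egrad_ge0. Qed.

Lemma Eq_split k lo f : test f -> Eq k lo f = Eq k.+1 lo f + Eq k.+1 (up k lo) f.
Proof. by move=> tf; apply: int_qbox_split; exact: egrad_ig. Qed.

(* Poincare inequality between a box and its halves *)
Lemma avg_child k lo c f : test f -> c = lo \/ c = up k lo ->
  `|avg k.+1 c f - avg k lo f| `^ p <= side k.+1 (cdir k) `^ p * ((vol k)^-1 * Eq k lo f).
Proof.
move=> tf cP; set i := cdir k; set s := side k.+1 i.
have mQ := measurable_qbox k lo; have tp := test_partial i tf.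
have E : `|avg k.+1 c f - avg k lo f| = 2^-1 * `|avg k.+1 (up k lo) f - avg k.+1 lo f|.
  rewrite (avg_split k lo tf) -[X in X * `|_|]ger0_norm ?invr_ge0// -normrM.
  by case: cP => ->; [rewrite -normrN|]; congr `|_|; field.
have pi : ig (qbox k lo) (fun x => `|partial i f x|) by apply: ig_norm; exact: qtest_ig.
have ppi : ig (qbox k lo) (fun x => `|partial i f x| `^ p).
  apply: (ig_le mQ _ (egrad_ig k lo tf)).
    by apply: mf_normpow; apply: smooth_measurable; exact: test_smooth tp.
  by apply: aeW => x _; rewrite ger0_norm ?powR_ge0// partial_le_egrad.
have H := jensen_qbox (fun x => normr_ge0 _) pi ppi.
have H2 : \int[mu]_(x in qbox k lo) (`|partial i f x| `^ p) <= Eq k lo f.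
  by apply: (I_le mQ ppi (egrad_ig k lo tf)) => x _; exact: partial_le_egrad.
have le1 : `|avg k.+1 c f - avg k lo f| <= s * ((vol k)^-1 * \int[mu]_(x in qbox k lo) `|partial i f x|).
  rewrite E; apply: (@le_trans _ _ (2^-1 * ((vol k.+1)^-1 *
     (s * \int[mu]_(x in qbox k lo) `|partial i f x|)))).
    by apply: ler_wpM2l => //; exact: avg_diff.
  by rewrite [vol k]volS invfM le_eqVlt; apply/orP; left; apply/eqP; ring.
have I0 : 0 <= \int[mu]_(x in qbox k lo) `|partial i f x| by exact: I_ge0.
have vi : 0 <= (vol k)^-1 by rewrite invr_ge0 ltW// vol_gt0.
have s0 := ltW (side_gt0 k.+1 i).
apply: (@le_trans _ _ ((s * ((vol k)^-1 * \int[mu]_(x in qbox k lo) `|partial i f x|)) `^ p)).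
  by apply: ge0_ler_powR; rewrite ?nnegrE ?mulr_ge0// ltW.
rewrite (powRM p s0 (mulr_ge0 vi I0)); apply: ler_wpM2l; first exact: powR_ge0.
by apply: le_trans H _; apply: ler_wpM2l.
Qed.

(* [bavg m k lo f x]: average of f over the box of level k + m containing x,
   for x in the box of level k at lo *)
Fixpoint bavg m k lo f x : R :=
  if m is m'.+1 then
    if x ord0 (cdir k) < lo ord0 (cdir k) + side k.+1 (cdir k)
    then bavg m' k.+1 lo f x else bavg m' k.+1 (up k lo) f x
  else avg k lo f.

Lemma bavg_lo m k lo f x : qbox k.+1 lo x -> bavg m.+1 k lo f x = bavg m k.+1 lo f x.
Proof. by move=> /qbox_lo[_ h] /=; rewrite h. Qed.

Lemma bavg_up m k lo f x : qbox k.+1 (up k lo) x ->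
  bavg m.+1 k lo f x = bavg m k.+1 (up k lo) f x.
Proof. by move=> /qbox_up[_ h] /=; rewrite ltNge h. Qed.

(** The box [lo'] is found from x alone, hence serves every function at once. *)
Lemma bavg_avg m k lo f x : qbox k lo x -> exists lo', qbox (k + m) lo' x /\
  forall g, bavg m k lo g x = avg (k + m) lo' g.
Proof.
elim: m k lo => [|m ih] k lo Qx; first by exists lo; rewrite addn0.
rewrite -addSnnS; have := Qx; rewrite qbox_split => -[Q'x|Q'x].
  have [lo' [h1 h2]] := ih _ _ Q'x; exists lo'; split => // g.
  by rewrite (bavg_lo _ _ Q'x) h2.
have [lo' [h1 h2]] := ih _ _ Q'x; exists lo'; split => // g.
by rewrite (bavg_up _ _ Q'x) h2.
Qed.

(** The Poincare constant between levels k and k + 1; by [cgap_le] it is at most a multiple of 2^(k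
    (1 - p/N)). *)
Definition cgap k : R := side k.+1 (cdir k) `^ p * (vol k)^-1.

Lemma cgap_ge0 k : 0 <= cgap k.
Proof. by rewrite mulr_ge0 ?powR_ge0// invr_ge0 ltW// vol_gt0. Qed.

(** The Poincare inequality on the box of level k + m containing x, whose energy is at most that of
    the large box. *)
Lemma bavg_gap m k lo f x : test f -> qbox k lo x ->
  `|bavg m.+1 k lo f x - bavg m k lo f x| `^ p <= cgap (k + m) * Eq k lo f.
Proof.
move=> tf; elim: m k lo => [|m ih] k lo Qx.
  rewrite addn0 /cgap -mulrA /=; case: ifP => _; apply: avg_child => //; [by left|by right].
have cg := cgap_ge0 (k + m.+1).
rewrite (Eq_split k lo tf) mulrDr; have := Qx; rewrite qbox_split => -[Q'x|Q'x].
  rewrite !(bavg_lo _ _ Q'x); apply: le_trans (ih _ _ Q'x) _.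
  by rewrite addSnnS lerDl mulr_ge0// Eq_ge0.
rewrite !(bavg_up _ _ Q'x); apply: le_trans (ih _ _ Q'x) _.
by rewrite addSnnS lerDr mulr_ge0// Eq_ge0.
Qed.

(** The boxes containing x shrink to x, all sides being halved once per n + 1 levels, and f is
    continuous. *)
Lemma cvg_bavg k lo f x : test f -> qbox k lo x -> bavg m k lo f x @[m --> \oo] --> f x.
Proof.
move=> tf Qx; apply/cvgrPdist_le => e e0.
have cf : {for x, continuous f} by apply: smooth_continuous; exact: test_smooth tf.
have /cvgrPdist_le/(_ e e0) := cf; rewrite near_simpl => /nbhs_ballP[d /= d0 dP].
have [K KP] : exists K, forall m, (K <= m)%N -> L * 2^-1 ^+ ((k + m) %/ n.+1) < d.
  have h0 : 0 <= (2^-1 : R) < 1 by lra.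
  have : (fun j : nat => L * 2^-1 ^+ j) @ \oo --> (0 : R).
    rewrite -[X in _ --> X](mulr0 L); apply: cvgM; first exact: cvg_cst.
    by apply: cvg_expr; rewrite ger0_norm; lra.
  move=> /cvgrPdist_lt/(_ d d0)[K _ KP]; exists (K * n.+1)%N => m Km.
  have := KP ((k + m) %/ n.+1)%N; rewrite /= sub0r normrN ger0_norm; last first.
    by rewrite mulr_ge0 ?exprn_ge0// ltW.
  apply; rewrite leq_divRL//; exact: leq_trans (leq_addl _ _).
exists K => // m /= Km; have [lo' [Q'x ->]] := bavg_avg m f Qx.
have mQ := measurable_qbox (k + m) lo'; have v0 := vol_gt0 (k + m).
have -> : f x = (vol (k + m))^-1 * \int[mu]_(y in qbox (k + m) lo') f x.
  by rewrite (Rintegral_cst mu mQ) fine_leb_qbox mulrCA mulVf ?mulr1// gt_eqF.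
have ci := ig_cst mQ (f x) (leb_qbox_fin (k + m) lo').
rewrite /avg -mulrBr -(RintegralB mQ ci (qtest_ig _ _ tf)) normrM ger0_norm ?invr_ge0 ?(ltW v0)//.
rewrite mulrC ler_pdivrMr//.
have ii := igB mQ ci (qtest_ig (k + m) lo' tf).
apply: le_trans (le_normr_Rintegral mQ ii) _.
have -> : e * vol (k + m) = \int[mu]_(y in qbox (k + m) lo') e.
  by rewrite (Rintegral_cst mu mQ) fine_leb_qbox.
apply: (I_le mQ (ig_norm ii) (ig_cst mQ e (leb_qbox_fin _ _))) => y Qy.
apply: dP; split => // i j; rewrite (ord1 i) /ball /=.
have sd := le_lt_trans (side_le (k + m) j) (KP m Km).
have /andP[a1 a2] := Q'x j; have /andP[b1 b2] := Qy j.
by rewrite ltr_norml; apply/andP; split; lra.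
Qed.

(** Each of a and b is at most a + b, so c^s <= c (a + b)^(s-1) for c = a and for c = b. *)
Lemma powR_superadd (s a b : R) : 1 <= s -> 0 <= a -> 0 <= b -> a `^ s + b `^ s <= (a + b) `^ s.
Proof.
move=> s1 a0 b0; have s0 : 0 < s by apply: lt_le_trans s1.
have h c : 0 <= c -> c <= a + b -> c `^ s <= c * (a + b) `^ (s - 1).
  move=> c0 cab; rewrite -(mulr_powRB1 c0 s0); apply: ler_wpM2l => //.
  by apply: powR_mono; rewrite ?subr_ge0.
rewrite -[leRHS](mulr_powRB1 (addr_ge0 a0 b0) s0) mulrDl.
by apply: lerD; apply: h; rewrite ?lerDl ?lerDr.
Qed.

Lemma measurable_bavg m k lo f (A : set V) :
  measurable_fun (A : set (lebT R n)) ((fun x => bavg m k lo f x) : lebT R n -> R).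
Proof.
elim: m k lo => [|m ih] k lo /=; first exact: measurable_cst.
set c := lo ord0 _ + _.
rewrite (_ : (fun x => _) = (fun x => \1_([set x : V | x ord0 (cdir k) < c]) x * bavg m k.+1 lo f x
   + (1 - \1_([set x : V | x ord0 (cdir k) < c]) x) * bavg m k.+1 (up k lo) f x)); last first.
  apply/funext => x; rewrite indicE; case: ifPn => h.
    by rewrite mem_set// subrr mul0r addr0 mul1r.
  by rewrite memNset ?mul0r ?subr0 ?mul1r ?add0r//; apply/negP.
have m1 : measurable_fun (A : set (lebT R n))
    ((fun x => \1_([set x : V | x ord0 (cdir k) < c]) x) : lebT R n -> R).
  by apply: measurable_indic; exact: measurable_halfspace.
apply: measurable_funD; apply: measurable_funM; [exact: m1|exact: ih| |exact: ih].
by apply: measurable_funB; [exact: measurable_cst|exact: m1].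
Qed.

Lemma avg_bounded k lo f (M : R) : test f -> (forall x, `|f x| <= M) -> `|avg k lo f| <= M.
Proof.
move=> tf fM; have v0 := vol_gt0 k; have mQ := measurable_qbox k lo.
rewrite /avg normrM ger0_norm ?invr_ge0 ?(ltW v0)// mulrC ler_pdivrMr//.
apply: le_trans (le_normr_Rintegral mQ (qtest_ig _ _ tf)) _.
have -> : M * vol k = \int[mu]_(y in qbox k lo) M by rewrite (Rintegral_cst mu mQ) fine_leb_qbox.
by apply: (I_le mQ (ig_norm (qtest_ig _ _ tf)) (ig_cst mQ M (leb_qbox_fin _ _))).
Qed.

Lemma bavg_bounded m k lo f x (M : R) : test f -> (forall x, `|f x| <= M) -> `|bavg m k lo f x| <= M.
Proof.
move=> tf fM; elim: m k lo => [|m ih] k lo /=; first exact: avg_bounded.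
by case: ifP => _; exact: ih.
Qed.

Lemma qbounded_ig k lo (w : V -> R) (M : R) (A : set V) : (forall x, `|w x| <= M) ->
  measurable_fun (setT : set (lebT R n)) (w : lebT R n -> R) -> ig (qbox k lo) w.
Proof.
move=> wM wm; have mQ := measurable_qbox k lo.
apply: (ig_le mQ _ (ig_cst mQ M (leb_qbox_fin k lo))).
  exact: measurable_funS wm.
by apply: aeW => x _; exact: wM.
Qed.

Lemma bavgB_ig k lo f (r : R) a b : 0 <= r -> test f ->
  ig (qbox k lo) (fun x => `|bavg a k lo f x - bavg b k lo f x| `^ r).
Proof.
move=> r0 tf; have [M M0 fM] := test_bounded tf.
apply: (@qbounded_ig _ _ _ ((M + M) `^ r) setT).
  move=> x; rewrite ger0_norm ?powR_ge0//; apply: ge0_ler_powR; rewrite ?nnegrE ?addr_ge0//.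
  by apply: le_trans (ler_normB _ _) _; apply: lerD; exact: bavg_bounded.
by apply: mf_normpow; apply: measurable_funB; exact: measurable_bavg.
Qed.

(** On each box of level k + m the gap is bounded through the energy of that box alone, raised to
    the power r / p. As r >= p this power is superadditive, so the energies of the small boxes
    recombine into that of the large one. *)
Lemma int_bavg_gap m k lo f (r : R) : test f -> p <= r ->
  \int[mu]_(x in qbox k lo) (`|bavg m.+1 k lo f x - bavg m k lo f x| `^ r) <=
  vol (k + m) * cgap (k + m) `^ (r / p) * Eq k lo f `^ (r / p).
Proof.
move=> tf pr; have r0 : 0 < r by apply: lt_le_trans pr.
have rp1 : 1 <= r / p by rewrite ler_pdivlMr// mul1r.
have rp0 : 0 <= r / p by rewrite divr_ge0 ?ltW.
elim: m k lo => [|m ih] k lo.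
  have mQ := measurable_qbox k lo.
  rewrite addn0 -mulrA -powRM ?cgap_ge0 ?Eq_ge0// mulrC.
  have -> : (cgap k * Eq k lo f) `^ (r / p) * vol k =
      \int[mu]_(x in qbox k lo) ((cgap k * Eq k lo f) `^ (r / p)).
    by rewrite (Rintegral_cst mu mQ) fine_leb_qbox.
  apply: (I_le mQ (bavgB_ig k lo _ _ (ltW r0) tf) (ig_cst mQ _ (leb_qbox_fin k lo))) => x Qx.
  have := bavg_gap 0 tf Qx; rewrite addn0 => h.
  have -> : `|bavg 1 k lo f x - bavg 0 k lo f x| `^ r =
      (`|bavg 1 k lo f x - bavg 0 k lo f x| `^ p) `^ (r / p).
    by rewrite -powRrM mulrCA mulfV ?mulr1// gt_eqF.
  exact: powR_mono rp0 (powR_ge0 _ _) h.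
rewrite (int_qbox_split (bavgB_ig k lo _ _ (ltW r0) tf)) -addSnnS.
rewrite (@I_eq _ (lebT R n) R mu (qbox k.+1 lo) _ (fun x => `|bavg m.+1 k.+1 lo f x - bavg m k.+1 lo f x| `^ r));
  last by move=> x Qx; rewrite !(bavg_lo _ _ Qx).
rewrite (@I_eq _ (lebT R n) R mu (qbox k.+1 (up k lo)) _
    (fun x => `|bavg m.+1 k.+1 (up k lo) f x - bavg m k.+1 (up k lo) f x| `^ r));
  last by move=> x Qx; rewrite !(bavg_up _ _ Qx).
apply: le_trans (lerD (ih _ _) (ih _ _)) _; rewrite -mulrDr; apply: ler_wpM2l.
  by rewrite mulr_ge0 ?powR_ge0// ltW// vol_gt0.
rewrite (Eq_split k lo tf); apply: powR_superadd => //; exact: Eq_ge0.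
Qed.

(** Each b_j is at most th^j S^(1/r), where S is the weighted sum on the right; the geometric series
    is then summed. It plays the role of Hoelder's inequality for series. *)
Lemma powR_sum_geom (r th : R) (b : nat -> R) k M : 0 < r -> 0 < th < 1 -> (forall j, 0 <= b j) ->
  (\sum_(k <= j < M) b j) `^ r <=
  (th ^+ k / (1 - th)) `^ r * \sum_(k <= j < M) (b j / th ^+ j) `^ r.
Proof.
move=> r0 /andP[th0 th1] b0; set S := \sum_(k <= j < M) (_ / _) `^ r.
have thj j : 0 < th ^+ j by rewrite exprn_gt0.
have S0 : 0 <= S by apply: sumr_ge0 => j _; exact: powR_ge0.
have bS j : (k <= j < M)%N -> b j <= th ^+ j * S `^ r^-1.
  move=> kjM; rewrite mulrC -ler_pdivrMr//.
  have c0 : 0 <= b j / th ^+ j by rewrite divr_ge0// ltW.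
  rewrite -[leLHS](powRK r0 c0); apply: ge0_ler_powR; rewrite ?nnegrE ?powR_ge0 ?invr_ge0 ?(ltW r0)//.
  rewrite /S (@bigD1_seq _ _ _ _ _ j) ?mem_index_iota//=; last by rewrite /index_iota iota_uniq.
  by rewrite lerDl sumr_ge0// => i _; exact: powR_ge0.
have geom K : (\sum_(k <= j < K) th ^+ j) <= th ^+ k / (1 - th).
  rewrite ler_pdivlMr ?subr_gt0//.
  have [kK|Kk] := leqP k K; last first.
    by rewrite big_geq ?mul0r ?exprn_ge0 ?ltW// ltnW.
  rewrite (_ : _ * _ = th ^+ k - th ^+ K); first by rewrite gerBl exprn_ge0// ltW.
  elim: K kK => [|K ih]; first by rewrite leqn0 => /eqP ->; rewrite big_geq// mul0r subrr.
  rewrite leq_eqVlt => /predU1P[<-|]; first by rewrite big_geq// mul0r subrr.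
  by rewrite ltnS => kK; rewrite big_nat_recr//= mulrDl ih// exprS; ring.
have t1 : 0 <= (1 - th)^-1 by rewrite invr_ge0 subr_ge0 ltW.
have step : \sum_(k <= j < M) b j <= \sum_(k <= j < M) th ^+ j * S `^ r^-1.
  rewrite big_nat_cond [leRHS]big_nat_cond; apply: ler_sum => j; rewrite andbT; exact: bS.
rewrite -[X in _ * X](powRVK r0 S0) -powRM ?powR_ge0//; last first.
  by rewrite mulr_ge0// exprn_ge0// ltW.
apply: powR_mono; [exact: ltW|by apply: sumr_ge0|].
apply: le_trans step _.
by rewrite -mulr_suml; apply: ler_wpM2r; [exact: powR_ge0|exact: geom].
Qed.

Lemma telescope_le (a : nat -> R) k M : (k <= M)%N ->
  `|a M - a k| <= \sum_(k <= j < M) `|a j.+1 - a j|.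
Proof. by move=> kM; rewrite -telescope_sumr//; exact: ler_norm_sum. Qed.

Let N : R := n.+1%:R.

(** After k halvings the halved side is at most L 2^(-k/N), and the volume is 2^(-k) [vol 0]. *)
Lemma cgap_le k : cgap k <= L `^ p / vol 0 * 2 `^ (k%:R * (1 - p / N)).
Proof.
have v0 := vol0; have N0 : 0 < N by rewrite ltr0n.
(* Integer division loses less than one, hence the factor 2, which cancels the 1/2 in
   [side_cdirE]. *)
have h : (2^-1 : R) ^+ (k %/ n.+1) <= 2 * 2 `^ (- (k%:R / N)).
  rewrite exprVn powRN -[leLHS]mul1r ler_pdivrMr ?exprn_gt0// mulrAC ler_pdivlMr ?powR_gt0// mul1r.
  rewrite -exprS -powR_mulrn//; apply: ler_powR; first by lra.
  rewrite ler_pdivrMr// -natrM ler_nat {1}(divn_eq k n.+1) mulSn addnC leq_add2r.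
  by rewrite ltnW// ltn_pmod.
have h2 : side k.+1 (cdir k) <= L * 2 `^ (- (k%:R / N)).
  rewrite side_cdirE; apply: (@le_trans _ _ (L / 2 * (2 * 2 `^ (- (k%:R / N))))).
    by apply: ler_wpM2l; [rewrite divr_ge0// ltW|exact: h].
  by rewrite le_eqVlt; apply/orP; left; apply/eqP; field.
have h3 := powR_mono (ltW p0) (ltW (side_gt0 _ _)) h2.
rewrite (powRM _ (ltW L0) (powR_ge0 _ _)) -powRrM in h3.
have h4 : (vol k)^-1 = (vol 0)^-1 * 2 ^+ k by rewrite volE invfM -exprVn invrK.
apply: (@le_trans _ _ (L `^ p * 2 `^ (- (k%:R / N) * p) * (vol k)^-1)).
  by apply: ler_wpM2r => //; rewrite invr_ge0 ltW// vol_gt0.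
have h5 : 2 `^ (k%:R * (1 - p / N)) = 2 `^ (- (k%:R / N) * p) * 2 ^+ k.
  rewrite -[2 ^+ k]powR_mulrn// -powRD; last by rewrite (_ : (2 == 0 :> R) = false) ?implybT// pnatr_eq0.
  by congr powR; ring.
by rewrite h4 h5 le_eqVlt; apply/orP; left; apply/eqP; ring.
Qed.

(** For p < N the condition s = 1 - r/p + r/N > 0 says that r is below the Sobolev exponent. Level j
    contributes 2^(-j s): half of the exponent goes into the weights th^j, whose tail yields the
    decay nu^k, and the other half makes the remaining series converge. *)
Lemma int_bavg_tail (r : R) : p <= r -> 0 < 1 - r / p + r / N ->
  exists K nu : R, [/\ 0 <= K, 0 < nu < 1 & forall f lo k M, test f -> (k <= M)%N ->
    \int[mu]_(x in qbox 0 lo) (`|bavg M 0 lo f x - bavg k 0 lo f x| `^ r) <=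
    K * nu ^+ k * Eq 0 lo f `^ (r / p)].
Proof.
move=> pr s0; have r0 : 0 < r by apply: lt_le_trans pr.
set s := 1 - _ + _ in s0; have v0 := vol0; have rp0 : 0 <= r / p by rewrite divr_ge0 ?ltW.
(* Chosen so that th^r = nu and nu^2 = 2^(-s). *)
pose th : R := 2 `^ (- (s / 2 / r)); pose nu : R := 2 `^ (- (s / 2)).
have lt1 c : 0 < c -> (2 : R) `^ (- c) < 1 by move=> c0; apply: pow2_lt1; rewrite oppr_lt0.
have th01 : 0 < th < 1 by rewrite powR_gt0//= lt1// !divr_gt0.
have nu01 : 0 < nu < 1 by rewrite powR_gt0//= lt1// !divr_gt0.
have thr j : (th ^+ j) `^ r = nu ^+ j.
  have a : th ^+ j = 2 `^ (- (s / 2 / r) * j%:R) by rewrite powRrM powR_mulrn// powR_ge0.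
  have b : nu ^+ j = 2 `^ (- (s / 2) * j%:R) by rewrite powRrM powR_mulrn// powR_ge0.
  rewrite a b -powRrM; congr powR; field.
  by rewrite gt_eqF.
pose K1 := vol 0 * (L `^ p / vol 0) `^ (r / p).
have K10 : 0 <= K1 by rewrite mulr_ge0 ?powR_ge0// ltW.
have gap j : vol j * cgap j `^ (r / p) <= K1 * (nu ^+ j * nu ^+ j).
  have c1 := powR_mono rp0 (cgap_ge0 j) (cgap_le j).
  have Kg : 0 <= L `^ p / vol 0 by rewrite divr_ge0 ?powR_ge0// ltW.
  rewrite (powRM _ Kg (powR_ge0 _ _)) -powRrM in c1.
  apply: le_trans (ler_wpM2l (ltW (vol_gt0 j)) c1) _.
  rewrite volE /K1; set B := (L `^ p / vol 0) `^ _.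
  have -> : (2^-1 : R) ^+ j = 2 `^ (- j%:R) by rewrite powRN powR_mulrn// exprVn.
  have -> : nu ^+ j * nu ^+ j = 2 `^ (- j%:R) * 2 `^ (j%:R * (1 - p / N) * (r / p)).
    have b : nu ^+ j = 2 `^ (- (s / 2) * j%:R) by rewrite powRrM powR_mulrn// powR_ge0.
    have t0 : (2 == 0 :> R) = false by rewrite pnatr_eq0.
    rewrite b.
    rewrite -!powRD ?t0 ?implybT//; congr powR; rewrite /s; field.
    by rewrite (gt_eqF p0) [1 + _]addrC natr1 pnatr_eq0.
  by rewrite le_eqVlt; apply/orP; left; apply/eqP; ring.
have /andP[th0 th1] := th01; have /andP[nu0 nu1] := nu01.
pose K := (1 - th)^-1 `^ r * (K1 / (1 - nu)).
have K0 : 0 <= K by rewrite mulr_ge0 ?powR_ge0// divr_ge0// subr_ge0 ltW.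
exists K, nu; split => // f lo k M tf kM.
have mQ := measurable_qbox 0 lo.
set E := Eq 0 lo f `^ _; have E0 : 0 <= E by exact: powR_ge0.
pose d j x := `|bavg j.+1 0 lo f x - bavg j 0 lo f x|.
have di j : ig (qbox 0 lo) (fun x => d j x `^ r) by exact: bavgB_ig (ltW r0) tf.
have dE j x : (d j x / th ^+ j) `^ r = (nu ^+ j)^-1 * d j x `^ r.
  have thj : 0 <= th ^+ j by rewrite exprn_ge0// ltW.
  have ti : 0 <= (th ^+ j)^-1 by rewrite invr_ge0.
  rewrite (powRM r (normr_ge0 _ : 0 <= d j x) ti) mulrC; congr (_ * _).
  by rewrite -powR_inv1// -powRrM mulN1r powRN thr.
have Si : ig (qbox 0 lo) (fun x => \sum_(k <= j < M) (d j x / th ^+ j) `^ r).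
  apply: (ig_sum mQ) => j _; have := igZ mQ (nu ^+ j)^-1 (di j).
  by apply: eq_integrable => // x _ /=; rewrite dE.
have ptw x : `|bavg M 0 lo f x - bavg k 0 lo f x| `^ r <=
    (th ^+ k / (1 - th)) `^ r * \sum_(k <= j < M) (d j x / th ^+ j) `^ r.
  apply: le_trans (powR_sum_geom k M r0 th01 (fun j => normr_ge0 _)).
  by apply: powR_mono (ltW r0) _ _ => //; exact: telescope_le.
apply: le_trans (I_le mQ (bavgB_ig 0 lo _ _ (ltW r0) tf) (igZ mQ _ Si) (fun x _ => ptw x)) _.
rewrite (RintegralZl _ mQ Si).
have c1 : (th ^+ k / (1 - th)) `^ r = nu ^+ k * (1 - th)^-1 `^ r.
  by rewrite powRM ?exprn_ge0 ?invr_ge0 ?subr_ge0 ?(ltW th0) ?(ltW th1)// thr.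
have nuk : 0 <= nu ^+ k * (1 - th)^-1 `^ r by rewrite mulr_ge0 ?powR_ge0// exprn_ge0// ltW.
rewrite c1 (_ : K * nu ^+ k * E = nu ^+ k * (1 - th)^-1 `^ r * (K1 / (1 - nu) * E)); last by rewrite /K; ring.
apply: ler_wpM2l => //.
rewrite (I_sum mQ); last first.
  move=> j _; have := igZ mQ (nu ^+ j)^-1 (di j).
  by apply: eq_integrable => // x _ /=; rewrite dE.
apply: (@le_trans _ _ (\sum_(k <= j < M) K1 * E * nu ^+ j)).
  apply: ler_sum => j _.
  rewrite (@I_eq _ (lebT R n) R mu (qbox 0 lo) _ (fun x => (nu ^+ j)^-1 * d j x `^ r)); last by move=> x _; exact: dE.
  rewrite (RintegralZl _ mQ (di j)).
  have nj : 0 < nu ^+ j by rewrite exprn_gt0.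
  rewrite mulrC ler_pdivrMr//; apply: le_trans (int_bavg_gap j 0 lo tf pr) _.
  rewrite add0n -/E (_ : K1 * E * nu ^+ j * nu ^+ j = K1 * (nu ^+ j * nu ^+ j) * E); last by ring.
  exact: ler_wpM2r (gap j).
rewrite -mulr_sumr (_ : K1 / (1 - nu) * E = K1 * E * (1 - nu)^-1); last by ring.
apply: ler_wpM2l; first exact: mulr_ge0.
have h := @geometric_le_lim R M 1 nu ler01 nu0.
rewrite (ger0_norm (ltW nu0)) mul1r in h.
apply: le_trans (h nu1); rewrite seriesEnat /= [leRHS](@big_cat_nat _ _ _ k)//=.
rewrite (eq_bigr (fun j => 1 * nu ^+ j)) => [|j _]; last by rewrite mul1r.
by rewrite lerDr; apply: sumr_ge0 => j _; rewrite mul1r exprn_ge0// ltW.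
Qed.

(** Fatou's lemma in M: the averages over shrinking boxes converge pointwise to f. *)
Lemma int_bavg_dist (r : R) : p <= r -> 0 < 1 - r / p + r / N ->
  exists K nu : R, [/\ 0 <= K, 0 < nu < 1 & forall f lo k, test f ->
    ig (qbox 0 lo) (fun x => `|f x - bavg k 0 lo f x| `^ r) /\
    \int[mu]_(x in qbox 0 lo) (`|f x - bavg k 0 lo f x| `^ r) <=
    K * nu ^+ k * Eq 0 lo f `^ (r / p)].
Proof.
move=> pr s0; have r0 : 0 < r by apply: lt_le_trans pr.
have [K [nu [K0 nu01 H]]] := int_bavg_tail pr s0; exists K, nu; split => // f lo k tf.
apply: (@fatouR _ (lebT R n) R mu _ (measurable_qbox 0 lo)
  (fun m x => `|bavg (m + k) 0 lo f x - bavg k 0 lo f x| `^ r)).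
- by move=> m; exact: bavgB_ig (ltW r0) tf.
- apply: mf_normpow; apply: measurable_funB; last exact: measurable_bavg.
  by apply: smooth_measurable; exact: test_smooth tf.
- by move=> m x _; exact: powR_ge0.
- apply: aeW => x Qx; apply: cvg_normpow r0 _; apply: cvgB; last exact: cvg_cst.
  by have := cvg_bavg tf Qx; rewrite -(cvg_shiftn k).
- by move=> m; apply: H => //; exact: leq_addl.
- by move=> x _; exact: powR_ge0.
Qed.

(** For p > N the pointwise gaps already decay geometrically, with ratio nu = 2^((1 - p/N)/p) < 1;
    this is the estimate behind Morrey's inequality. *)
Lemma sup_bavg_dist : N < p -> exists2 K : R, 0 <= K & forall f lo x, test f -> qbox 0 lo x ->
  `|f x - avg 0 lo f| <= K * Eq 0 lo f `^ p^-1.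
Proof.
move=> Np; have N0 : 0 < N by rewrite ltr0n.
have v0 := vol0; have Kg : 0 <= L `^ p / vol 0 by rewrite divr_ge0 ?powR_ge0// ltW.
pose nu : R := 2 `^ ((1 - p / N) / p).
have nu0 : 0 < nu by rewrite powR_gt0.
have nu1 : nu < 1.
  by apply: pow2_lt1; rewrite pmulr_llt0 ?invr_gt0// subr_lt0 ltr_pdivlMr// mul1r.
pose K := (L `^ p / vol 0) `^ p^-1 / (1 - nu).
exists K => [|f lo x tf Qx]; first by rewrite divr_ge0 ?powR_ge0// subr_ge0 ltW.
set E := Eq 0 lo f.
have step j : `|bavg j.+1 0 lo f x - bavg j 0 lo f x| <= (L `^ p / vol 0) `^ p^-1 * E `^ p^-1 * nu ^+ j.
  have h := bavg_gap j tf Qx; rewrite add0n in h.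
  have h2 := le_trans h (ler_wpM2r (Eq_ge0 0 lo f) (cgap_le j)).
  have pi : 0 <= p^-1 by rewrite invr_ge0 ltW.
  have := powR_mono pi (powR_ge0 _ _) h2.
  rewrite (powRK p0 (normr_ge0 _)) => h3; apply: le_trans h3 _.
  have q0 := powR_ge0 2 (j%:R * (1 - p / N)).
  rewrite (powRM _ (mulr_ge0 Kg q0) (Eq_ge0 0 lo f)) (powRM _ Kg q0) -powRrM.
  have b : nu ^+ j = 2 `^ (j%:R * (1 - p / N) / p).
    by rewrite /nu -powR_mulrn ?powR_ge0// -powRrM; congr powR; ring.
  by rewrite b le_eqVlt; apply/orP; left; apply/eqP; rewrite -/E; ring.
have C0 : 0 <= (L `^ p / vol 0) `^ p^-1 * E `^ p^-1 by rewrite mulr_ge0 ?powR_ge0.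
have bd m : `|bavg m 0 lo f x - avg 0 lo f| <= K * E `^ p^-1.
  apply: le_trans (telescope_le (fun m => bavg m 0 lo f x) (leq0n m)) _.
  apply: le_trans (ler_sum _ (fun j _ => step j)) _.
  rewrite -mulr_sumr /K [leRHS]mulrAC; apply: ler_wpM2l => //.
  have h := @geometric_le_lim R m 1 nu ler01 nu0.
  rewrite ger0_norm ?(ltW nu0)// mul1r in h; apply: le_trans (h nu1).
  by rewrite seriesEnat /=; apply: ler_sum => j _; rewrite mul1r.
have cv : `|bavg m 0 lo f x - avg 0 lo f| @[m --> \oo] --> `|f x - avg 0 lo f|.
  by apply: cvg_norm; apply: cvgB; [exact: cvg_bavg|exact: cvg_cst].
rewrite -(cvg_lim (@norm_hausdorff _ R) cv).
by apply: limr_le; [apply/cvg_ex; eexists; exact: cv|exact: nearW].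
Qed.

Lemma avg_pow_le lo f : test f -> ig (qbox 0 lo) (fun x => `|f x| `^ p) ->
  `|avg 0 lo f| `^ p <= (vol 0)^-1 * \int[mu]_(x in qbox 0 lo) (`|f x| `^ p).
Proof.
move=> tf fi; have fi1 := ig_norm (qtest_ig 0 lo tf); have v0 := vol0.
apply: le_trans (jensen_qbox (fun x => normr_ge0 (f x)) fi1 fi).
apply: powR_mono (ltW p0) (normr_ge0 _) _.
rewrite /avg normrM ger0_norm ?invr_ge0 ?(ltW v0)//; apply: ler_wpM2l; first by rewrite invr_ge0 ltW.
exact: le_normr_Rintegral (measurable_qbox 0 lo) (qtest_ig 0 lo tf).
Qed.

(** At a fixed level only finitely many box averages occur, each a bounded sequence, hence
    convergent along the ultrafilter. Intersecting finitely many large sets of indices controls all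
    of them at once, uniformly in x, without nested subsequences. *)
Lemma bavg_ultra (U : set_system nat) (f : nat -> V -> R) m k lo (e : R) : UltraFilter U ->
  (forall k lo, exists M, forall j, `|avg k lo (f j)| <= M) -> 0 < e ->
  exists2 S, U S & forall i j x, S i -> S j -> `|bavg m k lo (f i) x - bavg m k lo (f j) x| <= e.
Proof.
move=> UU bd; elim: m k lo e => [|m ih] k lo e e0; last first.
  have [S1 U1 h1] := ih k.+1 lo e e0; have [S2 U2 h2] := ih k.+1 (up k lo) e e0.
  exists (S1 `&` S2); first exact: filterI.
  by move=> i j x [i1 i2] [j1 j2] /=; case: ifP => _; [exact: h1|exact: h2].
have [M HM] := bd k lo; pose a j := avg k lo (f j).
have cK : compact `[- M, M]%classic by exact: segment_compact.
have PU : ProperFilter (a @ U) by exact: fmap_proper_filter.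
have [|l [_ cl]] := cK (a @ U) PU.
  apply: (@filterS _ U _ setT) => [j _|]; last exact: filterT.
  by rewrite /= in_itv /= -ler_norml; exact: HM.
have e20 : 0 < e / 2 by rewrite divr_gt0.
exists (a @^-1` ball l (e / 2)).
  have [//|nB] := in_ultra_setVsetC (a @^-1` ball l (e / 2)) UU.
  by have [z [zn zB]] := cl _ _ (nB : (a @ U) (~` ball l (e / 2))) (nbhsx_ballx l _ e20).
move=> i j x; rewrite /ball /= -/(a i) -/(a j) => hi hj.
rewrite [leRHS]splitr -(subrKA l); apply: le_trans (ler_normD _ _) _.
by apply: lerD; apply: ltW; [rewrite distrC|].
Qed.

End binary_boxes.

(** * Elementary limits of real sequences *)

Lemma cvg0_le (R : realType) (a b : nat -> R) : (forall k, 0 <= a k <= b k) ->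
  b k @[k --> \oo] --> 0 -> a k @[k --> \oo] --> 0.
Proof.
move=> ab b0; apply: (@squeeze_cvgr _ _ _ _ (fun=> 0) b) => //; last exact: cvg_cst.
exact: nearW.
Qed.

Lemma cvg0_lin (R : realType) (a b : nat -> R) (c d : R) :
  a k @[k --> \oo] --> 0 -> b k @[k --> \oo] --> 0 ->
  c * (d * a k + b k) @[k --> \oo] --> 0.
Proof.
move=> a0 b0; rewrite -[X in _ --> X](mulr0 c); apply: cvgM; first exact: cvg_cst.
rewrite -[X in _ --> X]addr0; apply: cvgD; last exact: b0.
by rewrite -[X in _ --> X](mulr0 d); apply: cvgM; [exact: cvg_cst|exact: a0].
Qed.

Lemma cvg0M (R : realType) (c : R) (a : nat -> R) : a k @[k --> \oo] --> 0 ->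
  c * a k @[k --> \oo] --> 0.
Proof.
by move=> a0; rewrite -[X in _ --> X](mulr0 c); apply: cvgM; [exact: cvg_cst|exact: a0].
Qed.

Lemma cvg_compR (R : realType) (H : R -> R) (a : nat -> R) (l : R) : continuous H ->
  a k @[k --> \oo] --> l -> H (a k) @[k --> \oo] --> H l.
Proof. by move=> Hc al; exact: continuous_cvg (Hc l) al. Qed.

Lemma cvg_cst_eq (R : realType) (a : nat -> R) (c l : R) : (forall k, a k = c) ->
  a k @[k --> \oo] --> l -> l = c.
Proof.
move=> ac al; apply: (cvg_unique _ al) => //.
rewrite (_ : a = fun=> c); first exact: cvg_cst.
exact/funext.
Qed.

Lemma cvg0_small (R : realType) (a : nat -> R) (e : R) : (forall k, 0 <= a k) ->
  a k @[k --> \oo] --> 0 -> 0 < e -> exists K, forall k, (K <= k)%N -> a k <= e.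
Proof.
move=> a0 ac e0; have /cvgrPdist_le/(_ e e0)[K _ KP] := ac.
by exists K => k /KP /=; rewrite sub0r normrN ger0_norm.
Qed.

Lemma small_cvg0 (R : realType) (a : nat -> R) : (forall k, 0 <= a k) ->
  (forall e, 0 < e -> exists K, forall k, (K <= k)%N -> a k <= e) -> a k @[k --> \oo] --> 0.
Proof.
move=> a0 H; apply/cvgrPdist_le => e /H[K KP]; exists K => // k /= /KP.
by rewrite sub0r normrN ger0_norm.
Qed.

Lemma cvg_le_cst (R : realType) (a : nat -> R) (l C : R) : (forall k, a k <= C) ->
  a k @[k --> \oo] --> l -> l <= C.
Proof.
by move=> aC al; rewrite -(cvg_lim (@norm_hausdorff _ R) al);
  apply: limr_le; [apply/cvg_ex; exists l|exact: nearW].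
Qed.

Lemma half_le (R : realType) (a b c C : R) : c <= 2^-1 * a + 2^-1 * b -> a <= C -> b <= C -> c <= C.
Proof. by move=> *; lra. Qed.

(** Every term is at most S^(1/p), where S is the sum of the p-th powers. *)
Lemma powR_sum_le (R : realType) (p : R) (m : nat) (a : 'I_m -> R) : 0 < p ->
  (forall i, 0 <= a i) -> (\sum_(i < m) a i) `^ p <= m%:R `^ p * \sum_(i < m) a i `^ p.
Proof.
move=> p0 a0; set S := \sum_(i < m) a i `^ p.
have S0 : 0 <= S by apply: sumr_ge0 => i _; exact: powR_ge0.
have h i : a i <= S `^ p^-1.
  rewrite -[leLHS](powRK p0 (a0 i)); apply: ge0_ler_powR.
  - by rewrite invr_ge0 ltW.
  - by rewrite nnegrE powR_ge0.
  - by rewrite nnegrE.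
  - by rewrite /S (bigD1 i)//= lerDl sumr_ge0// => j _; exact: powR_ge0.
rewrite -[X in _ * X](powRVK p0 S0) -powRM ?powR_ge0//.
apply: ge0_ler_powR; rewrite ?nnegrE ?sumr_ge0 ?mulr_ge0 ?powR_ge0//; first exact: ltW.
apply: le_trans (ler_sum _ (fun i _ => h i)) _.
by rewrite sumr_const card_ord mulr_natl.
Qed.

(** * L^p functions and vector fields on the domain *)

Section sobolev_pairs.
Context (R : realType) (n : nat).
Local Notation V := 'rV[R]_n.+1.
Local Notation mu := (@leb R n).
Context (Om : set V) (oO : open Om) (bO : bounded_set Om) (p : R) (p1 : 1 < p).
Implicit Types (u v f : V -> R) (g h : V -> V).
Local Notation mf f := (measurable_fun (Om : set (lebT R n)) (f : lebT R n -> R)).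
Local Notation ig f := (mu.-integrable (Om : set (lebT R n)) (EFin \o (f : lebT R n -> R))).

Let p0 : 0 < p. Proof. exact: lt_trans p1. Qed.

Lemma mO : measurable (Om : set (lebT R n)).
Proof. exact: leb_open_measurable. Qed.

Lemma fO : (mu Om < +oo)%E. Proof. exact: leb_bounded_fin. Qed.

Lemma aeOnW (P : V -> Prop) : (forall x, Om x -> P x) -> aeOn Om P.
Proof. by move=> h; apply: aeW => x; exact: h. Qed.

Let ae_filterT : Filter (nbhs (almost_everywhere mu)).
Proof. exact: (@ae_filter_ringOfSetsType _ (lebT R n) R mu). Qed.

Lemma aeOn1 (P Q : V -> Prop) : (forall x, Om x -> P x -> Q x) -> aeOn Om P -> aeOn Om Q.
Proof.
move=> h; rewrite /aeOn => hP; apply: (@filterS _ _ ae_filterT _ _ _ hP) => x hx Ox.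
exact: h Ox (hx Ox).
Qed.

Lemma aeOn2 (P1 P2 Q : V -> Prop) : (forall x, Om x -> P1 x -> P2 x -> Q x) ->
  aeOn Om P1 -> aeOn Om P2 -> aeOn Om Q.
Proof.
move=> h; rewrite /aeOn => hP1 hP2.
apply: (@filterS2 _ _ ae_filterT _ _ _ _ hP1 hP2) => x h1 h2 Ox.
exact: h Ox (h1 Ox) (h2 Ox).
Qed.

Lemma aeOn3 (P1 P2 P3 Q : V -> Prop) : (forall x, Om x -> P1 x -> P2 x -> P3 x -> Q x) ->
  aeOn Om P1 -> aeOn Om P2 -> aeOn Om P3 -> aeOn Om Q.
Proof.
move=> h h1 h2 h3.
have := @aeOn2 P1 P2 (fun x => P1 x /\ P2 x) (fun x _ a b => conj a b) h1 h2.
by move=> h12; apply: (aeOn2 _ h12 h3) => x Ox [a b]; exact: h.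
Qed.

Lemma aeOn_all (P : nat -> V -> Prop) : (forall k, aeOn Om (P k)) ->
  aeOn Om (fun x => forall k, P k x).
Proof.
move=> h; rewrite /aeOn.
have H : {ae mu, forall x, forall k, Om x -> P k x} by exact/ae_foralln.
by apply: (@filterS _ _ ae_filterT _ _ _ H) => x hx Ox k; exact: hx.
Qed.

(* sealed, since unification would otherwise unfold the integrals *)
Fact Npow_key : {F : (V -> R) -> R | forall u, F u = \int[mu]_(x in Om) (`|u x| `^ p)}.
Proof. by exists (fun u => \int[mu]_(x in Om) (`|u x| `^ p)). Qed.

Fact Epow_key : {F : (V -> V) -> R | forall g, F g = \int[mu]_(x in Om) (euclid (g x) `^ p)}.
Proof. by exists (fun g => \int[mu]_(x in Om) (euclid (g x) `^ p)). Qed.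

Definition Npow : (V -> R) -> R := sval Npow_key.
Definition Epow : (V -> V) -> R := sval Epow_key.
Definition Lpv g := forall i, Lebesgue p Om (fun x => g x ord0 i).

Lemma LpP u : Lebesgue p Om u <-> mf u /\ ig (fun x => `|u x| `^ p).
Proof.
have H (um : mf u) := ig_ge0P mu (mf_normpow p um) (fun x _ => powR_ge0 `|u x| p).
by split=> -[um ui]; (split; first exact: um); have [h1 h2] := H um; [exact: h2|exact: h1].
Qed.

Lemma Lp_mf u : Lebesgue p Om u -> mf u. Proof. by case. Qed.

Lemma Lp_igp u : Lebesgue p Om u -> ig (fun x => `|u x| `^ p).
Proof. by move=> /LpP[]. Qed.

Lemma Lp_le u v : Lebesgue p Om u -> mf v ->
  (aeOn Om (fun x => `|v x| <= `|u x|)) -> Lebesgue p Om v.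
Proof.
move=> /LpP[um ui] vm uv; apply/LpP; split => //.
apply: (ig_le mO _ ui); first exact: mf_normpow.
apply: aeOn1 uv => x _ h; rewrite ger0_norm ?powR_ge0//.
by apply: ge0_ler_powR; rewrite ?nnegrE// ltW.
Qed.

Lemma Lp_ae u v : Lebesgue p Om u -> (aeOn Om (fun x => u x = v x)) ->
  Lebesgue p Om v.
Proof.
move=> Lu uv; apply: (Lp_le Lu).
  exact: (measurable_fun_ae (@leb_complete R n) (Lp_mf Lu)).
by apply: aeOn1 uv => x _ ->.
Qed.

Lemma LpD u v : Lebesgue p Om u -> Lebesgue p Om v -> Lebesgue p Om (fun x => u x + v x).
Proof.
move=> /LpP[um ui] /LpP[vm vi]; apply/LpP; split; first exact: measurable_funD.
apply: (ig_le mO _ (igZ mO (2 `^ p) (igD mO ui vi))).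
  by apply: mf_normpow; exact: measurable_funD.
by apply: aeOnW => x _; rewrite ger0_norm ?powR_ge0//; apply: powR_normD_le; exact: ltW.
Qed.

Lemma LpZ a u : Lebesgue p Om u -> Lebesgue p Om (fun x => a * u x).
Proof.
move=> /LpP[um ui]; apply/LpP; split; first exact: measurable_funM.
apply: eq_integrable (igZ mO (`|a| `^ p) ui) => [|x _]; first exact: mO.
by rewrite /= normrM powRM.
Qed.

Lemma LpN u : Lebesgue p Om u -> Lebesgue p Om (fun x => - u x).
Proof. by move=> /(LpZ (-1)); under eq_fun do rewrite mulN1r. Qed.

Lemma LpB u v : Lebesgue p Om u -> Lebesgue p Om v -> Lebesgue p Om (fun x => u x - v x).
Proof. by move=> Lu Lv; exact: LpD Lu (LpN Lv). Qed.

Lemma Lp_norm u : Lebesgue p Om u -> Lebesgue p Om (fun x => `|u x|).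
Proof.
move=> Lu; apply: (Lp_le Lu); first exact: mf_norm (Lp_mf Lu).
by apply: aeOnW => x _; rewrite normr_id.
Qed.

Lemma Lp_bounded u (M : R) : mf u -> (forall x, Om x -> `|u x| <= M) -> Lebesgue p Om u.
Proof.
move=> um uM; apply: (@Lp_le (fun=> M)) => //.
  apply/LpP; split => //; apply: ig_cst; [exact: mO|exact: fO].
by apply: aeOnW => x /uM h; rewrite (le_trans h)// ler_norm.
Qed.

Lemma Lp_test Om' f : test_function Om' f -> Lebesgue p Om f.
Proof.
move=> hf; have [M _ fM] := test_bounded hf.
apply: (@Lp_bounded _ M) => //; apply: smooth_measurable; exact: test_smooth hf.
Qed.

Lemma pow_ge_self (t : R) : 0 <= t -> t <= 1 + t `^ p.
Proof.
move=> t0; have [t1|t1] := leP t 1; first by rewrite (le_trans t1)// lerDl powR_ge0.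
by rewrite (le_trans (le1r_powR (ltW t1) (ltW p1)))// lerDr.
Qed.

Lemma Lp_ig u : Lebesgue p Om u -> ig u.
Proof.
move=> /LpP[um ui].
apply: (ig_le mO um (igD mO (ig_cst mO 1 fO) ui)).
by apply: aeOnW => x _; exact: pow_ge_self.
Qed.

Lemma Lp_bounded_mul u v (M : R) : Lebesgue p Om u -> mf v ->
  (aeOn Om (fun x => `|v x| <= M)) -> Lebesgue p Om (fun x => u x * v x).
Proof.
move=> Lu vm vM; apply: (@Lp_le (fun x => `|M| * u x)); first exact: LpZ.
  by apply: measurable_funM => //; exact: Lp_mf.
apply: aeOn1 vM => x _ h; rewrite !normrM normr_id mulrC ler_wpM2r//.
by rewrite (le_trans h)// ler_norm.
Qed.

Lemma mf_euclid g : (forall i, mf (fun x => g x ord0 i)) -> mf (fun x => euclid (g x)).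
Proof.
move=> gm; apply: (@measurableT_comp _ _ _ _ _ _ (@Num.sqrt R)).
  exact: continuous_measurable_fun (@sqrt_continuous R).
rewrite /dotv; apply: measurable_sum => i; exact: measurable_funM.
Qed.

Lemma mf_dotv g h : (forall i, mf (fun x => g x ord0 i)) ->
  (forall i, mf (fun x => h x ord0 i)) -> mf (fun x => dotv (g x) (h x)).
Proof.
by move=> gm hm; rewrite /dotv; apply: measurable_sum => i; exact: measurable_funM.
Qed.

Lemma Lpv_mf g : Lpv g -> forall i, mf (fun x => g x ord0 i).
Proof. by move=> Lg i; exact: Lp_mf (Lg i). Qed.

Lemma Lpv_euclid g : Lpv g -> Lebesgue p Om (fun x => euclid (g x)).
Proof.
move=> Lg.
have L1 : Lebesgue p Om (fun x => \sum_(i < n.+1) `|g x ord0 i|).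
  apply/LpP; split; first by apply: measurable_sum => i; apply: mf_norm; exact: Lpv_mf.
  have gi : ig (fun x => n.+1%:R `^ p * \sum_(i < n.+1) `|g x ord0 i| `^ p).
    by apply: (igZ mO); apply: (ig_sum mO) => i _; exact: Lp_igp.
  apply: (ig_le mO _ gi).
    apply: mf_normpow; apply: measurable_sum => i; apply: mf_norm; exact: Lpv_mf.
  apply: aeOnW => x _; rewrite ger0_norm ?powR_ge0// ger0_norm ?sumr_ge0//.
  exact: powR_sum_le.
apply: (Lp_le L1); first by apply: mf_euclid; exact: Lpv_mf.
apply: aeOnW => x _; rewrite ger0_norm ?euclid_ge0// ger0_norm ?sumr_ge0//.
exact: euclid_sum_le.
Qed.

Lemma Lpv_igp g : Lpv g -> ig (fun x => euclid (g x) `^ p).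
Proof.
move=> /Lpv_euclid/Lp_igp; apply: eq_integrable => [|x _]; first exact: mO.
by rewrite /= ger0_norm ?euclid_ge0.
Qed.

Lemma LpvD g h : Lpv g -> Lpv h -> Lpv (fun x => g x + h x).
Proof.
move=> Lg Lh i; have := LpD (Lg i) (Lh i).
rewrite (_ : (fun x => _ + _) = (fun x => (g x + h x) ord0 i))//.
by apply/funext => x; rewrite !mxE.
Qed.

Lemma LpvZ a g : Lpv g -> Lpv (fun x => a *: g x).
Proof.
move=> Lg i; have := LpZ a (Lg i).
rewrite (_ : (fun x => _ * _) = (fun x => (a *: g x) ord0 i))//.
by apply/funext => x; rewrite !mxE.
Qed.

Lemma LpvB g h : Lpv g -> Lpv h -> Lpv (fun x => g x - h x).
Proof.
move=> Lg Lh i; have := LpB (Lg i) (Lh i).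
rewrite (_ : (fun x => _ - _) = (fun x => (g x - h x) ord0 i))//.
by apply/funext => x; rewrite !mxE.
Qed.

Lemma Lpv_gradc Om' f : test_function Om' f -> Lpv (gradc f).
Proof.
move=> hf i; have := Lp_test (test_partial i hf).
rewrite (_ : partial i f = fun x => gradc f x ord0 i)//.
by apply/funext => x; rewrite mxE.
Qed.

Lemma Lpv_ae g h : Lpv g -> (aeOn Om (fun x => g x = h x)) -> Lpv h.
Proof.
move=> Lg gh i; apply: (Lp_ae (Lg i)).
by apply: aeOn1 gh => x _ ->.
Qed.

Lemma NpowE u : Npow u = \int[mu]_(x in Om) (`|u x| `^ p).
Proof. exact: (svalP Npow_key). Qed.

Lemma EpowE g : Epow g = \int[mu]_(x in Om) (euclid (g x) `^ p).
Proof. exact: (svalP Epow_key). Qed.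

Lemma eq_Npow u v : (forall x, Om x -> `|u x| = `|v x|) -> Npow u = Npow v.
Proof. by move=> h; rewrite !NpowE; apply: I_eq => x Ox; rewrite h. Qed.

Lemma eq_Epow g h : (forall x, Om x -> euclid (g x) = euclid (h x)) -> Epow g = Epow h.
Proof. by move=> H; rewrite !EpowE; apply: I_eq => x Ox; rewrite H. Qed.

Lemma Npow_ge0 u : 0 <= Npow u.
Proof. by rewrite NpowE; apply: I_ge0 => x _; exact: powR_ge0. Qed.

Lemma Epow_ge0 g : 0 <= Epow g.
Proof. by rewrite EpowE; apply: I_ge0 => x _; exact: powR_ge0. Qed.

Lemma Npow_ae u v : Lebesgue p Om u -> (aeOn Om (fun x => u x = v x)) ->
  Npow u = Npow v.
Proof.
move=> Lu uv; rewrite !NpowE; apply: (I_eq_ae mO).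
- by apply: mf_normpow; exact: Lp_mf.
- by apply: mf_normpow; exact: Lp_mf (Lp_ae Lu uv).
- by apply: aeOn1 uv => x _ ->.
Qed.

Lemma Epow_ae g h : Lpv g -> (aeOn Om (fun x => g x = h x)) -> Epow g = Epow h.
Proof.
move=> Lg gh; rewrite !EpowE; apply: (I_eq_ae mO).
- by apply: mf_powR; apply: mf_euclid; exact: Lpv_mf.
- by apply: mf_powR; apply: mf_euclid; exact: Lpv_mf (Lpv_ae Lg gh).
- by apply: aeOn1 gh => x _ ->.
Qed.

Lemma NpowD u v : Lebesgue p Om u -> Lebesgue p Om v ->
  Npow (fun x => u x + v x) <= 2 `^ p * (Npow u + Npow v).
Proof.
move=> Lu Lv; rewrite !NpowE.
rewrite -(RintegralD mO (Lp_igp Lu) (Lp_igp Lv)).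
rewrite -(RintegralZl _ mO (igD mO (Lp_igp Lu) (Lp_igp Lv))).
apply: (I_le mO).
- exact: Lp_igp (LpD Lu Lv).
- exact: igZ mO _ _ (igD mO (Lp_igp Lu) (Lp_igp Lv)).
- by move=> x _; apply: powR_normD_le; exact: ltW.
Qed.

Lemma NpowN u : Npow (fun x => - u x) = Npow u.
Proof. by rewrite !NpowE; apply: I_eq => x _; rewrite normrN. Qed.

Lemma NpowB u v : Lebesgue p Om u -> Lebesgue p Om v ->
  Npow (fun x => u x - v x) <= 2 `^ p * (Npow u + Npow v).
Proof. by move=> Lu Lv; have := NpowD Lu (LpN Lv); rewrite NpowN. Qed.

Lemma NpowZ a u : Lebesgue p Om u -> Npow (fun x => a * u x) = `|a| `^ p * Npow u.
Proof.
move=> Lu; rewrite !NpowE; rewrite -(RintegralZl _ mO (Lp_igp Lu)).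
by apply: I_eq => x _; rewrite normrM powRM.
Qed.

Lemma NpowBC u v : Npow (fun x => u x - v x) = Npow (fun x => v x - u x).
Proof. by rewrite !NpowE; apply: I_eq => x _; rewrite distrC. Qed.

Lemma EpowD g h : Lpv g -> Lpv h ->
  Epow (fun x => g x + h x) <= 2 `^ p * (Epow g + Epow h).
Proof.
move=> Lu Lv; rewrite !EpowE.
rewrite -(RintegralD mO (Lpv_igp Lu) (Lpv_igp Lv)).
rewrite -(RintegralZl _ mO (igD mO (Lpv_igp Lu) (Lpv_igp Lv))).
apply: (I_le mO).
- exact: Lpv_igp (LpvD Lu Lv).
- exact: igZ mO _ _ (igD mO (Lpv_igp Lu) (Lpv_igp Lv)).
- by move=> x _; exact: euclid_powD_le.
Qed.

Lemma EpowZ a g : Lpv g -> Epow (fun x => a *: g x) = `|a| `^ p * Epow g.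
Proof.
move=> Lu; rewrite !EpowE; rewrite -(RintegralZl _ mO (Lpv_igp Lu)).
by apply: I_eq => x _; rewrite euclid_powZ.
Qed.

Lemma EpowBC g h : Epow (fun x => g x - h x) = Epow (fun x => h x - g x).
Proof. by rewrite !EpowE; apply: I_eq => x _; rewrite -euclidN opprB. Qed.

Lemma EpowB g h : Lpv g -> Lpv h ->
  Epow (fun x => g x - h x) <= 2 `^ p * (Epow g + Epow h).
Proof.
move=> Lg Lh; have := EpowD Lg (LpvZ (-1) Lh).
rewrite (EpowZ _ Lh) normrN1 powR1 mul1r; apply: le_trans.
rewrite (@eq_Epow _ (fun x => g x + -1 *: h x))// => x _.
by rewrite scaleN1r.
Qed.

Lemma Npow_coord g i : Lpv g -> Npow (fun x => g x ord0 i) <= Epow g.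
Proof.
move=> Lg; rewrite NpowE EpowE; apply: (I_le mO); [exact: Lp_igp|exact: Lpv_igp|move=> x _].
by apply: ge0_ler_powR; rewrite ?nnegrE ?euclid_ge0 ?coord_le_euclid// ltW.
Qed.

Lemma Epow_le_coord g : Lpv g ->
  Epow g <= n.+1%:R `^ p * \sum_(i < n.+1) Npow (fun x => g x ord0 i).
Proof.
move=> Lg.
have gi : ig (fun x => \sum_(i < n.+1) `|g x ord0 i| `^ p).
  by apply: (ig_sum mO) => i _; exact: Lp_igp.
rewrite EpowE; under eq_bigr do rewrite NpowE.
rewrite -(I_sum mO); last by move=> i _; exact: Lp_igp.
rewrite -(RintegralZl _ mO gi); apply: (I_le mO); [exact: Lpv_igp|exact: igZ mO _ _ gi|].
move=> x _; apply: le_trans (powR_sum_le p0 _) => //.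
apply: ge0_ler_powR; rewrite ?nnegrE ?euclid_ge0 ?sumr_ge0 ?euclid_sum_le//.
exact: ltW.
Qed.

(** Splitting at a level e gives t <= e + e^(1-p) t^p for t >= 0; the domain has finite measure, and
    e is fixed before the limit is taken. *)
Lemma Npow_cvg0_L1 (w : nat -> V -> R) : (forall k, Lebesgue p Om (w k)) ->
  Npow (w k) @[k --> \oo] --> 0 ->
  \int[mu]_(x in Om) `|w k x| @[k --> \oo] --> 0.
Proof.
move=> Lw w0; set m := fine (mu Om); have m0 : 0 <= m by exact: fine_ge0.
have H e k : 0 < e -> \int[mu]_(x in Om) `|w k x| <= e * m + e `^ (1 - p) * Npow (w k).
  move=> e0; rewrite NpowE -(RintegralZl _ mO (Lp_igp (Lw k))) -(Rintegral_cst mu mO e).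
  rewrite -(RintegralD mO); last 2 first.
    exact: ig_cst mO e fO.
    exact: igZ mO _ _ (Lp_igp (Lw k)).
  apply: (I_le mO).
  - exact: ig_norm (Lp_ig (Lw k)).
  - by apply: (igD mO); [exact: ig_cst mO e fO|exact: igZ mO _ _ (Lp_igp (Lw k))].
  - move=> x _; have [h|h] := leP `|w k x| e.
      by rewrite (le_trans h)// lerDl mulr_ge0 ?powR_ge0.
    have w00 : 0 < `|w k x| by exact: lt_trans h.
    apply: ler_wpDl; first exact: ltW.
    rewrite -[leLHS](powRr1 (ltW w00)).
    have -> : 1 = (1 - p) + p by ring.
    rewrite powRD; last by rewrite (gt_eqF w00) implybT.
    rewrite subrK ler_wpM2r ?powR_ge0//.
    rewrite (_ : 1 - p = - (p - 1)); last by ring.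
    rewrite !powRN lef_pV2 ?posrE ?powR_gt0//.
    by apply: ge0_ler_powR; rewrite ?nnegrE ?subr_ge0 ?(ltW p1) ?(ltW e0) ?(ltW h)// ltW.
apply/cvgrPdist_le => e e0.
pose e1 := e / 2 / (m + 1); have e10 : 0 < e1 by rewrite !divr_gt0// ltr_wpDl.
have c0 : 0 < e1 `^ (1 - p) by rewrite powR_gt0.
have /cvgrPdist_le/(_ (e / 2 / e1 `^ (1 - p))) := w0.
rewrite !divr_gt0// => /(_ isT); apply: filterS => k.
rewrite !sub0r !normrN (ger0_norm (Npow_ge0 _)) ger0_norm; last exact: I_ge0.
rewrite ler_pdivlMr// => h; apply: le_trans (H e1 k e10) _.
have h1 : e1 * m <= e / 2.
  by rewrite /e1 mulrAC ler_pdivrMr ?ltr_wpDl// ler_wpM2l ?lerDl// divr_ge0// ltW.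
by rewrite [leRHS]splitr lerD// mulrC.
Qed.

(** * W^{1,p}_0 as the closure of the pairs (test function, gradient) in L^p *)

Definition Dpair u g := [/\ Lebesgue p Om u, Lpv g &
  exists f : nat -> V -> R, [/\ forall k, test_function Om (f k),
    Npow (fun x => u x - f k x) @[k --> \oo] --> 0 &
    Epow (fun x => g x - gradc (f k) x) @[k --> \oo] --> 0]].

Lemma Dpair_test f : test_function Om f -> Dpair f (gradc f).
Proof.
move=> hf; split; [exact: Lp_test hf|exact: Lpv_gradc hf|].
exists (fun=> f); split => //.
- rewrite (_ : (fun k => _) = fun=> 0); first exact: cvg_cst.
  apply/funext => _; rewrite NpowE; under eq_Rintegral do rewrite subrr normr0 powR0 ?gt_eqF//.
  by rewrite Rintegral_cst ?mul0r//; exact: mO.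
- rewrite (_ : (fun k => _) = fun=> 0); first exact: cvg_cst.
  apply/funext => _; rewrite EpowE; under eq_Rintegral do rewrite subrr euclid0 powR0 ?gt_eqF//.
  by rewrite Rintegral_cst ?mul0r//; exact: mO.
Qed.

Lemma Dpair_approx u g : Dpair u g -> forall e, 0 < e -> exists f,
  [/\ test_function Om f, Npow (fun x => u x - f x) <= e &
      Epow (fun x => g x - gradc f x) <= e].
Proof.
move=> [_ _ [f [tf f1 f2]]] e e0.
have /cvgrPdist_le/(_ e e0) h1 := f1; have /cvgrPdist_le/(_ e e0) h2 := f2.
have [K _ KP] := filterI h1 h2; exists (f K); have [/= a b] := KP K (leqnn K).
split => //.
  by move: a; rewrite sub0r normrN (ger0_norm (Npow_ge0 _)).
by move: b; rewrite sub0r normrN (ger0_norm (Epow_ge0 _)).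
Qed.

Lemma Dpair_of_approx u g : Lebesgue p Om u -> Lpv g ->
  (forall e, 0 < e -> exists f, [/\ test_function Om f,
     Npow (fun x => u x - f x) <= e & Epow (fun x => g x - gradc f x) <= e]) ->
  Dpair u g.
Proof.
move=> Lu Lg H; split => //.
have /choice[f fP] : forall k : nat, exists f, [/\ test_function Om f,
     Npow (fun x => u x - f x) <= k.+1%:R^-1 & Epow (fun x => g x - gradc f x) <= k.+1%:R^-1].
  by move=> k; apply: H; rewrite invr_gt0.
exists f; split; first by move=> k; have [] := fP k.
- apply: (@cvg0_le _ _ (fun k => k.+1%:R^-1)); last exact: cvg_harmonic.
  by move=> k; rewrite Npow_ge0; have [_ h _] := fP k; exact: h.
- apply: (@cvg0_le _ _ (fun k => k.+1%:R^-1)); last exact: cvg_harmonic.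
  by move=> k; rewrite Epow_ge0; have [_ _ h] := fP k; exact: h.
Qed.

(** Diagonal argument: for K large, an approximant of [u_ K] approximates u. *)
Lemma Dpair_closed (u_ : nat -> V -> R) (g_ : nat -> V -> V) u g :
  (forall k, Dpair (u_ k) (g_ k)) -> Lebesgue p Om u -> Lpv g ->
  Npow (fun x => u_ k x - u x) @[k --> \oo] --> 0 ->
  Epow (fun x => g_ k x - g x) @[k --> \oo] --> 0 -> Dpair u g.
Proof.
move=> Dk Lu Lg u0 g0; apply: Dpair_of_approx => // e e0.
(* Two errors of size d, multiplied by the constant 2^p of [NpowD], add up to e. *)
pose d := e / 2 `^ p / 2; have d0 : 0 < d by rewrite !divr_gt0// powR_gt0.
have /cvgrPdist_le/(_ d d0) h1 := u0; have /cvgrPdist_le/(_ d d0) h2 := g0.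
have [K _ KP] := filterI h1 h2; have [/= a b] := KP K (leqnn K).
have [f [tf fN fE]] := Dpair_approx (Dk K) d0.
have [LuK LgK _] := Dk K.
have dd : 2 `^ p * (d + d) = e.
  by rewrite /d -splitr mulrC divfK// gt_eqF// powR_gt0.
exists f; split => //.
- rewrite (_ : Npow _ = Npow (fun x => (u x - u_ K x) + (u_ K x - f x))); last first.
    by apply: eq_Npow => x _; rewrite addrA subrK.
  apply: le_trans (NpowD (LpB Lu LuK) (LpB LuK (Lp_test tf))) _.
  rewrite -dd; apply: ler_wpM2l; [exact: powR_ge0|apply: lerD; [|exact: fN]].
  by move: a; rewrite sub0r normrN (ger0_norm (Npow_ge0 _)) NpowBC.
- rewrite (_ : Epow _ = Epow (fun x => (g x - g_ K x) + (g_ K x - gradc f x))); last first.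
    by apply: eq_Epow => x _; rewrite addrA subrK.
  apply: le_trans (EpowD (LpvB Lg LgK) (LpvB LgK (Lpv_gradc tf))) _.
  rewrite -dd; apply: ler_wpM2l; [exact: powR_ge0|apply: lerD; [|exact: fE]].
  by move: b; rewrite sub0r normrN (ger0_norm (Epow_ge0 _)) EpowBC.
Qed.

Lemma gradc_lin a f1 f2 x : smooth f1 -> smooth f2 ->
  gradc (fun x => a * f1 x + f2 x) x = a *: gradc f1 x + gradc f2 x.
Proof.
move=> s1 s2; apply/rowP => i; rewrite !mxE partialD//; last exact: smoothZ.
by rewrite partialZ.
Qed.

Lemma Dpair_lin a u g v h : Dpair u g -> Dpair v h ->
  Dpair (fun x => a * u x + v x) (fun x => a *: g x + h x).
Proof.
move=> [Lu Lg [f1 [t1 N1 E1]]] [Lv Lh [f2 [t2 N2 E2]]].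
split; [exact: LpD (LpZ a Lu) Lv|exact: LpvD (LpvZ a Lg) Lh|].
exists (fun k x => a * f1 k x + f2 k x); split.
- by move=> k; apply: testD => //; exact: testZ.
- apply: (@cvg0_le _ _ (fun k => 2 `^ p * (`|a| `^ p * Npow (fun x => u x - f1 k x) +
      Npow (fun x => v x - f2 k x)))).
    move=> k; rewrite Npow_ge0 /= -NpowZ; last exact: LpB (Lp_test (t1 k)).
    rewrite (_ : Npow _ = Npow (fun x => a * (u x - f1 k x) + (v x - f2 k x))); last first.
      by apply: eq_Npow => x _; congr `|_|; ring.
    exact: NpowD (LpZ a (LpB Lu (Lp_test (t1 k)))) (LpB Lv (Lp_test (t2 k))).
  exact: cvg0_lin N1 N2.
- apply: (@cvg0_le _ _ (fun k => 2 `^ p * (`|a| `^ p * Epow (fun x => g x - gradc (f1 k) x) +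
      Epow (fun x => h x - gradc (f2 k) x)))).
    move=> k; rewrite Epow_ge0 /= -EpowZ; last exact: LpvB (Lpv_gradc (t1 k)).
    rewrite (_ : Epow _ = Epow (fun x => a *: (g x - gradc (f1 k) x) + (h x - gradc (f2 k) x))); last first.
      apply: eq_Epow => x _; rewrite gradc_lin; [|exact: test_smooth (t1 k)|exact: test_smooth (t2 k)].
      by rewrite scalerBr opprD addrACA.
    exact: EpowD (LpvZ a (LpvB Lg (Lpv_gradc (t1 k)))) (LpvB Lh (Lpv_gradc (t2 k))).
  exact: cvg0_lin E1 E2.
Qed.

Lemma Dpair_ae u g u' g' : Dpair u g -> (aeOn Om (fun x => u x = u' x)) ->
  (aeOn Om (fun x => g x = g' x)) -> Dpair u' g'.
Proof.
move=> [Lu Lg [f [tf fN fE]]] uu gg; split; [exact: Lp_ae Lu uu|exact: Lpv_ae Lg gg|].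
exists f; split; [exact: tf| |].
- rewrite (_ : (fun k => _) = (fun k => Npow (fun x => u x - f k x))); first exact: fN.
  apply/funext => k; apply/esym/Npow_ae; first exact: LpB (Lp_test (tf k)).
  by apply: aeOn1 uu => x _ ->.
- rewrite (_ : (fun k => _) = (fun k => Epow (fun x => g x - gradc (f k) x))); first exact: fE.
  apply/funext => k; apply/esym/Epow_ae; first exact: LpvB (Lpv_gradc (tf k)).
  by apply: aeOn1 gg => x _ ->.
Qed.

(** Each coordinate of the gradients is Cauchy in L^p and has a limit; closedness of the set of
    pairs does the rest. *)
Lemma Dpair_complete (u_ : nat -> V -> R) (g_ : nat -> V -> V) u :
  (forall k, Dpair (u_ k) (g_ k)) -> Lebesgue p Om u ->
  Npow (fun x => u_ k x - u x) @[k --> \oo] --> 0 ->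
  (forall e, 0 < e -> exists K, forall k l, (K <= k)%N -> (K <= l)%N ->
     Epow (fun x => g_ k x - g_ l x) <= e) ->
  exists2 g, Dpair u g & Epow (fun x => g_ k x - g x) @[k --> \oo] --> 0.
Proof.
move=> Dk Lu u0 gC.
have Lgk k : Lpv (g_ k) by have [] := Dk k.
have /choice[G GP] : forall i : 'I_n.+1, exists G : V -> R, Lebesgue p Om G /\
    Npow (fun x => g_ k x ord0 i - G x) @[k --> \oo] --> 0.
  move=> i; have [||e e0|G [s [_ Gm Gi GN _]]] := @Lp_complete _ (lebT R n) R mu Om mO p
    (fun k x => g_ k x ord0 i) p0.
  - by move=> k; exact: Lpv_mf.
  - by move=> k; exact: Lp_igp (Lgk k i).
  - have [K KP] := gC e e0; exists K => k l Kk Kl; apply: le_trans (KP k l Kk Kl).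
    have := Npow_coord i (LpvB (Lgk k) (Lgk l)); apply: le_trans.
    rewrite le_eqVlt; apply/orP; left; apply/eqP; rewrite NpowE; apply: I_eq => x _; by rewrite !mxE.
  - exists G; split; [apply/LpP; split; [exact: Gm|exact: Gi]|].
    by under eq_fun do rewrite NpowE; exact: GN.
pose g x : V := \row_i G i x.
have Lg : Lpv g.
  by move=> i; have [LG _] := GP i; apply: (Lp_ae LG); apply: aeOnW => x _; rewrite mxE.
have gE : Epow (fun x => g_ k x - g x) @[k --> \oo] --> 0.
  apply: (@cvg0_le _ _ (fun k => n.+1%:R `^ p * \sum_(i < n.+1) Npow (fun x => g_ k x ord0 i - G i x))).
    move=> k; rewrite Epow_ge0 /=; apply: le_trans (Epow_le_coord (LpvB (Lgk k) Lg)) _.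
    rewrite le_eqVlt; apply/orP; left; apply/eqP; congr (_ * _); apply: eq_bigr => i _.
    by apply: eq_Npow => x _; rewrite !mxE.
  rewrite -[X in _ --> X](mulr0 (n.+1%:R `^ p)); apply: cvgM; first exact: cvg_cst.
  rewrite [X in _ --> X](_ : 0 = \sum_(i < n.+1) (0 : R)); last by rewrite big1.
  by apply: cvg_sumR => i _; have [_ Gi] := GP i; exact: Gi.
by exists g => //; exact: Dpair_closed Dk _ _ u0 gE.
Qed.

(** * Weak gradients and the identification of the pairs with W^{1,p}_0 *)

Local Notation I f := (\int[mu]_(x in Om) f x).

Lemma I_mul_le (w c : V -> R) (M : R) : ig w -> mf c -> (forall x, Om x -> `|c x| <= M) ->
  ig (fun x => w x * c x).
Proof.
move=> wi cm cM; apply: (ig_le mO _ (igZ mO `|M| (ig_norm wi))).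
  by apply: measurable_funM; [exact: ig_mf wi|exact: cm].
apply: aeOnW => x Ox; rewrite normrM mulrC; apply: ler_wpM2r => //.
by apply: le_trans (cM x Ox) (ler_norm _).
Qed.

Lemma cvg_int_mul (w : nat -> V -> R) (c : V -> R) (M : R) :
  (forall k, Lebesgue p Om (w k)) -> Npow (w k) @[k --> \oo] --> 0 ->
  mf c -> (forall x, Om x -> `|c x| <= M) ->
  \int[mu]_(x in Om) (w k x * c x) @[k --> \oo] --> 0.
Proof.
move=> Lw w0 cm cM; apply/norm_cvg0P.
apply: (@cvg0_le _ _ (fun k => `|M| * \int[mu]_(x in Om) `|w k x|)).
  move=> k; rewrite normr_ge0 /=.
  have wi := I_mul_le (Lp_ig (Lw k)) cm cM.
  apply: le_trans (le_normr_Rintegral mO wi) _.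
  rewrite -(RintegralZl _ mO (ig_norm (Lp_ig (Lw k)))).
  have H := igZ mO `|M| (ig_norm (Lp_ig (Lw k))).
  apply: (I_le mO); [exact: ig_norm wi|exact: H|].
  move=> x Ox; rewrite normrM mulrC; apply: ler_wpM2r => //.
  by apply: le_trans (cM x Ox) (ler_norm _).
rewrite -[X in _ --> X](mulr0 `|M|); apply: cvgM; first exact: cvg_cst.
exact: Npow_cvg0_L1 Lw w0.
Qed.

Lemma Npow_coord_cvg (g_ : nat -> V -> V) i : (forall k, Lpv (g_ k)) ->
  Epow (g_ k) @[k --> \oo] --> 0 -> Npow (fun x => g_ k x ord0 i) @[k --> \oo] --> 0.
Proof.
move=> Lg E0; apply: cvg0_le E0 => k.
by rewrite Npow_ge0 /=; exact: Npow_coord.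
Qed.

Lemma test_mf Om' f : test_function Om' f -> mf f.
Proof. by move=> tf; apply: smooth_measurable; exact: test_smooth tf. Qed.

(** [int_partial] applied to the product of the two test functions. *)
Lemma test_by_parts f1 f i : test_function Om f1 -> test_function Om f ->
  \int[mu]_(x in Om) (f1 x * partial i f x) =
  - \int[mu]_(x in Om) (gradc f1 x ord0 i * f x).
Proof.
move=> t1 tf; have s1 := test_smooth t1; have s := test_smooth tf.
have tM : test_function Om (fun x => f1 x * f x) by apply: testMl.
have H := int_partial i (testS (@subsetT _ Om) tM).
have E x : partial i (fun x => f1 x * f x) x = partial i f1 x * f x + f1 x * partial i f x.
  by rewrite (partialM _ _ s1 s) addrC; congr (_ + _); exact: mulrC.
have i1 : ig (fun x => f1 x * partial i f x).
  have [M _ fM] := test_bounded (test_partial i tf).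
  exact: I_mul_le (Lp_ig (Lp_test t1)) (test_mf (test_partial i tf)) (fun x _ => fM x).
have i2 : ig (fun x => partial i f1 x * f x).
  have [M _ fM] := test_bounded tf.
  exact: I_mul_le (Lp_ig (Lp_test (test_partial i t1))) (test_mf tf) (fun x _ => fM x).
rewrite (@int_supp _ _ Om) in H; last first.
  have [_ [K [_ KO K0]]] := test_partial i tM.
  by move=> x nO; apply: K0 => /KO.
have H2 : \int[mu]_(x in Om) (partial i f1 x * f x) + \int[mu]_(x in Om) (f1 x * partial i f x) = 0.
  rewrite -(RintegralD mO i2 i1) -[RHS]H; apply: I_eq => x _; exact/esym/E.
apply/eqP; rewrite -addr_eq0 addrC -[X in _ == X]H2; apply/eqP; congr (_ + _).
by apply: I_eq => x _; rewrite /gradc mxE.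
Qed.

(** Integration by parts holds for the approximating test functions, so the sum of the two error
    integrals is the same number for every k; it also tends to 0. *)
Lemma Dpair_wg u g : Dpair u g -> weak_gradient p Om u g.
Proof.
move=> [Lu Lg [f_ [tf fN fE]]]; split; first exact: Lg.
move=> f hf i.
have [M _ fM] := test_bounded (test_partial i hf); have [M' _ fM'] := test_bounded hf.
have h1 := cvg_int_mul (fun k => LpB Lu (Lp_test (tf k))) fN (test_mf (test_partial i hf))
  (fun x _ => fM x).
have h2 := cvg_int_mul (fun k => LpvB Lg (Lpv_gradc (tf k)) i)
  (Npow_coord_cvg i (fun k => LpvB Lg (Lpv_gradc (tf k))) fE) (test_mf hf) (fun x _ => fM' x).
have h3 := cvgD h1 h2.
have iu := I_mul_le (Lp_ig Lu) (test_mf (test_partial i hf)) (fun x _ => fM x).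
have iG := I_mul_le (Lp_ig (Lg i)) (test_mf hf) (fun x _ => fM' x).
have iuk k := I_mul_le (Lp_ig (Lp_test (tf k))) (test_mf (test_partial i hf)) (fun x _ => fM x).
have iGk k := I_mul_le (Lp_ig (Lpv_gradc (tf k) i)) (test_mf hf) (fun x _ => fM' x).
have E k : \int[mu]_(x in Om) ((u x - f_ k x) * partial i f x) +
    \int[mu]_(x in Om) ((g x - gradc (f_ k) x) ord0 i * f x) =
    \int[mu]_(x in Om) (u x * partial i f x) + \int[mu]_(x in Om) (g x ord0 i * f x).
  rewrite (@I_eq _ (lebT R n) R mu Om _ (fun x => u x * partial i f x - f_ k x * partial i f x));
    last by move=> x _; rewrite mulrBl.
  rewrite [X in _ + X](@I_eq _ (lebT R n) R mu Om _
    (fun x => g x ord0 i * f x - gradc (f_ k) x ord0 i * f x));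
    last by move=> x _; rewrite !mxE mulrBl.
  rewrite (RintegralB mO iu (iuk k)) (RintegralB mO iG (iGk k)).
  by rewrite (test_by_parts _ (tf k) hf) opprK; ring.
have h0 := cvg_cst_eq E (h3 _).
apply/eqP; rewrite -addr_eq0; apply/eqP/esym.
by rewrite -h0 addr0.
Qed.

Lemma wg_unique u g1 g2 : weak_gradient p Om u g1 -> weak_gradient p Om u g2 ->
  aeOn Om (fun x => g1 x = g2 x).
Proof.
move=> [L1 h1] [L2 h2].
have Hi i : aeOn Om (fun x => g1 x ord0 i - g2 x ord0 i = 0).
  apply: test_int0_ae => //; [exact: fO|exact: Lp_ig (LpB (L1 i) (L2 i))|].
  move=> f tf; have [M _ fM] := test_bounded tf.
  have i1 := I_mul_le (Lp_ig (L1 i)) (test_mf tf) (fun x _ => fM x).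
  have i2 := I_mul_le (Lp_ig (L2 i)) (test_mf tf) (fun x _ => fM x).
  rewrite (@I_eq _ (lebT R n) R mu Om _ (fun x => g1 x ord0 i * f x - g2 x ord0 i * f x));
    last by move=> x _; rewrite mulrBl.
  rewrite (RintegralB mO i1 i2); apply/eqP; rewrite subr_eq0 -eqr_opp.
  by rewrite -(h1 f tf i) -(h2 f tf i).
(* [aeOn_all] ranges over the natural numbers, so the finitely many coordinates are reached through
   their values k < n + 1. *)
have Ha : aeOn Om (fun x => forall k : nat, forall i : 'I_n.+1, k = i :> nat ->
    g1 x ord0 i - g2 x ord0 i = 0).
  apply: aeOn_all => k; have [kn|kn] := ltnP k n.+1.
    apply: aeOn1 (Hi (Ordinal kn)) => x _ h i ki.
    by have -> : i = Ordinal kn by apply: val_inj.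
  by apply: aeOnW => x _ i ki; move: kn; rewrite ki leqNgt ltn_ord.
apply: aeOn1 Ha => x _ h; apply/rowP => i; apply/eqP; rewrite -subr_eq0; apply/eqP.
exact: (h (nat_of_ord i)).
Qed.

Lemma wg_grad u g : weak_gradient p Om u g -> aeOn Om (fun x => g x = grad p Om u x).
Proof.
move=> ug; have h : weak_gradient p Om u (grad p Om u) by rewrite /grad; apply: getPex; exists g.
exact: wg_unique ug h.
Qed.

Lemma wg_dirichlet u g : weak_gradient p Om u g -> dirichlet p Om u = Epow g.
Proof.
move=> ug; have h : weak_gradient p Om u (grad p Om u) by rewrite /grad; apply: getPex; exists g.
apply/esym; rewrite (@Epow_ae g (grad p Om u) ug.1 (wg_unique ug h)).
by rewrite EpowE.
Qed.

Lemma wg_norm1p u g : weak_gradient p Om u g -> norm1p p Om u = (Npow u + Epow g) `^ p^-1.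
Proof. by move=> /wg_dirichlet h; rewrite /norm1p h NpowE. Qed.

Lemma norm1pE u g : Dpair u g -> norm1p p Om u = (Npow u + Epow g) `^ p^-1.
Proof. by move=> /Dpair_wg/wg_norm1p. Qed.

(** The norm in [W1p0] is that of u - f, whose chosen gradient must be identified with the
    difference of [grad p Om u] and [gradc f]; linearity of weak gradients and their uniqueness do
    so. *)
Lemma W1p0_Dpair u : W1p0 p Om u -> Dpair u (grad p Om u).
Proof.
move=> [[Lu [g ug]] H].
have h : weak_gradient p Om u (grad p Om u) by rewrite /grad; apply: getPex; exists g.
apply: (Dpair_of_approx Lu h.1) => e e0.
have [f tf] := H (e `^ p^-1) (powR_gt0 _ e0).
have wf := Dpair_wg (Dpair_test tf).
have wB : weak_gradient p Om (fun x => u x - f x) (fun x => grad p Om u x - gradc f x).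
  split; first exact: LpvB h.1 (Lpv_gradc tf).
  move=> f0 t0 i.
  have [M _ fM] := test_bounded (test_partial i t0); have [M' _ fM'] := test_bounded t0.
  have i1 := I_mul_le (Lp_ig Lu) (test_mf (test_partial i t0)) (fun x _ => fM x).
  have i2 := I_mul_le (Lp_ig (Lp_test tf)) (test_mf (test_partial i t0)) (fun x _ => fM x).
  have i3 := I_mul_le (Lp_ig (h.1 i)) (test_mf t0) (fun x _ => fM' x).
  have i4 := I_mul_le (Lp_ig (Lpv_gradc tf i)) (test_mf t0) (fun x _ => fM' x).
  rewrite (@I_eq _ (lebT R n) R mu Om _ (fun x => u x * partial i f0 x - f x * partial i f0 x));
    last by move=> x _; rewrite mulrBl.
  rewrite [X in _ = - X](@I_eq _ (lebT R n) R mu Om _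
    (fun x => grad p Om u x ord0 i * f0 x - gradc f x ord0 i * f0 x));
    last by move=> x _; rewrite !mxE mulrBl.
  rewrite (RintegralB mO i1 i2) (RintegralB mO i3 i4).
  by rewrite (h.2 f0 t0 i) (wf.2 f0 t0 i) opprD opprK.
rewrite (wg_norm1p wB) => /ltW le; exists f.
have le2 : Npow (fun x => u x - f x) + Epow (fun x => grad p Om u x - gradc f x) <= e.
  rewrite -[leLHS](powRVK p0) ?addr_ge0 ?Npow_ge0 ?Epow_ge0// -[leRHS](powRVK p0 (ltW e0)).
  by apply: ge0_ler_powR; rewrite ?nnegrE ?powR_ge0// ltW.
split; first exact: tf.
- by apply: le_trans le2; rewrite lerDl Epow_ge0.
- by apply: le_trans le2; rewrite lerDr Npow_ge0.
Qed.

Lemma Dpair_W1p0 u g : Dpair u g -> W1p0 p Om u.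
Proof.
move=> ug; have [Lu Lg _] := ug; split; first by split=> //; exists g; exact: Dpair_wg.
(* Two errors of size e^p / 4 leave a strict inequality below e^p. *)
move=> e e0; pose d := e `^ p / 4; have d0 : 0 < d by rewrite divr_gt0// powR_gt0.
have [f [tf fN fE]] := Dpair_approx ug d0; exists f => //.
have D1 : Dpair (fun x => u x - f x) (fun x => g x - gradc f x).
  have D2 := Dpair_lin (-1) (Dpair_test tf) ug.
  apply: (Dpair_ae D2); apply: aeOnW => x _.
    by rewrite mulN1r addrC.
  by rewrite scaleN1r addrC.
rewrite (norm1pE D1) -[ltRHS](powRK p0 (ltW e0)).
have lt : Npow (fun x => u x - f x) + Epow (fun x => g x - gradc f x) < e `^ p.
  apply: le_lt_trans (lerD fN fE) _; rewrite /d.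
  have e1 : 0 < e `^ p by rewrite powR_gt0.
  by rewrite -mulrDr gtr_pMr//; lra.
rewrite gt0_ltr_powR ?invr_gt0// nnegrE ?powR_ge0// addr_ge0 ?Npow_ge0 ?Epow_ge0//.
Qed.

Lemma Dpair_grad u g : Dpair u g -> aeOn Om (fun x => g x = grad p Om u x).
Proof. by move=> /Dpair_wg/wg_grad. Qed.

Lemma dirichletE u g : Dpair u g -> dirichlet p Om u = Epow g.
Proof. by move=> /Dpair_wg/wg_dirichlet. Qed.

Lemma Dpair_unique u g1 g2 : Dpair u g1 -> Dpair u g2 -> aeOn Om (fun x => g1 x = g2 x).
Proof. by move=> /Dpair_wg h1 /Dpair_wg h2; exact: wg_unique h1 h2. Qed.

Lemma mf_pgrad g : (forall i, mf (fun x => g x ord0 i)) ->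
  forall i, mf (fun x => pgrad p (g x) ord0 i).
Proof.
move=> gm i; rewrite (_ : (fun x => _) = (fun x => euclid (g x) `^ (p - 2) * g x ord0 i)).
  by apply: measurable_funM; [apply: mf_powR; exact: mf_euclid|exact: gm].
by apply/funext => x; rewrite mxE.
Qed.

(** Each factor is at most the larger of |X| and |Y|, so the product is at most the larger of the
    two p-th powers. *)
Lemma normr_dotv_pgrad_pow (X Y : V) : `|dotv (pgrad p X) Y| <= euclid X `^ p + euclid Y `^ p.
Proof.
apply: le_trans (normr_dotv_pgrad_le p1 _ _) _.
have [le|lt] := leP (euclid Y) (euclid X).
  apply: (@le_trans _ _ (euclid X `^ p)); last by rewrite lerDl powR_ge0.
  rewrite -[leRHS](dotv_pgradv p1) dotv_pgrad -euclid2 expr2 mulrA (euclid_pow_split p1).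
  by apply: ler_wpM2l => //; exact: powR_ge0.
apply: (@le_trans _ _ (euclid Y `^ p)); last by rewrite lerDr powR_ge0.
rewrite -[leRHS](dotv_pgradv p1) dotv_pgrad -euclid2 expr2 mulrA (euclid_pow_split p1).
apply: ler_wpM2r; first exact: euclid_ge0.
by apply: ge0_ler_powR; rewrite ?nnegrE ?euclid_ge0// ?ltW// subr_gt0.
Qed.

Lemma ig_pgrad g h : Lpv g -> Lpv h -> ig (fun x => dotv (pgrad p (g x)) (h x)).
Proof.
move=> Lg Lh.
apply: (ig_le mO _ (igD mO (Lpv_igp Lg) (Lpv_igp Lh))).
  by apply: mf_dotv; [apply: mf_pgrad; exact: Lpv_mf|exact: Lpv_mf].
by apply: aeOnW => x _; exact: normr_dotv_pgrad_pow.
Qed.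

Lemma neg_plaplacianE u g v h : Dpair u g -> Dpair v h ->
  neg_plaplacian p Om u v = \int[mu]_(x in Om) dotv (pgrad p (g x)) (h x).
Proof.
move=> ug vh; have [_ Lg _] := ug; have [_ Lh _] := vh.
have [_ Lgu _] := W1p0_Dpair (Dpair_W1p0 ug); have [_ Lgv _] := W1p0_Dpair (Dpair_W1p0 vh).
rewrite /neg_plaplacian (I_eq_ae (mu:=mu) (D:=Om) mO
   (f:=fun x => dotv (pgrad p (g x)) (h x))
   (g:=fun x => dotv (pgrad p (grad p Om u x)) (grad p Om v x))).
- by apply: I_eq => x _; rewrite dotv_pgrad.
- exact: ig_mf (ig_pgrad Lg Lh).
- exact: ig_mf (ig_pgrad Lgu Lgv).
- by apply: aeOn2 (Dpair_grad ug) (Dpair_grad vh) => x _ -> ->.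
Qed.

Lemma aeOn_cvg_subseq (w : nat -> V -> R) u : (forall k, Lebesgue p Om (w k)) ->
  Lebesgue p Om u -> Npow (fun x => w k x - u x) @[k --> \oo] --> 0 ->
  exists2 s : nat -> nat, {homo s : i j / (i < j)%N} &
    aeOn Om (fun x => w (s k) x @[k --> \oo] --> u x).
Proof.
move=> Lw Lu w0.
have w1 : \int[mu]_(x in Om) (`|w k x - u x| `^ p) @[k --> \oo] --> 0.
  by under eq_fun do rewrite -NpowE; exact: w0.
have [s hs sP] := L1_cvg_subseq mO (fun k => Lp_igp (LpB (Lw k) Lu))
  (fun k x _ => powR_ge0 `|w k x - u x| p) w1.
exists s => //; apply: aeOn1 sP => x _ h.
apply/cvgrPdist_le => e e0.
have /cvgrPdist_le/(_ (e `^ p) (powR_gt0 _ e0)) := h; apply: filterS => k.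
rewrite sub0r normrN ger0_norm ?powR_ge0// distrC => le.
rewrite -[leLHS](powRK p0 (normr_ge0 _)) -[leRHS](powRK p0 (ltW e0)).
by apply: ge0_ler_powR; rewrite ?nnegrE ?powR_ge0// invr_ge0 ltW.
Qed.

Lemma Lpv_mulr g (c : V -> R) (M : R) : Lpv g -> mf c -> (forall x, Om x -> `|c x| <= M) ->
  Lpv (fun x => c x *: g x).
Proof.
move=> Lg cm cM i.
have := Lp_bounded_mul (Lg i) cm (aeOnW cM).
rewrite (_ : (fun x => g x ord0 i * c x) = (fun x => (c x *: g x) ord0 i))//.
by apply/funext => x; rewrite !mxE mulrC.
Qed.

Lemma Epow_dominated (c : nat -> V -> R) g (M : R) : Lpv g -> (forall k, mf (c k)) ->
  (forall k x, Om x -> `|c k x| <= M) -> aeOn Om (fun x => c k x @[k --> \oo] --> 0) ->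
  Epow (fun x => c k x *: g x) @[k --> \oo] --> 0.
Proof.
move=> Lg cm cM c0.
have gm := mf_euclid (Lpv_mf Lg).
have em k : mf (fun x => euclid (c k x *: g x) `^ p).
  exact: ig_mf (Lpv_igp (Lpv_mulr Lg (cm k) (cM k))).
have gi := igZ mO (`|M| `^ p) (Lpv_igp Lg).
have [||||_ h _] := @dominated_cvgR _ (lebT R n) R mu Om mO
  (fun k x => euclid (c k x *: g x) `^ p) (fun=> 0) (fun x => `|M| `^ p * euclid (g x) `^ p) em.
- exact: measurable_cst.
- exact: gi.
- apply: aeOn1 c0 => x Ox h.
  rewrite (_ : (fun k => _) = (fun k => `|c k x| `^ p * euclid (g x) `^ p)); last first.
    by apply/funext => k; rewrite euclid_powZ.
  rewrite -[X in _ --> X](mul0r (euclid (g x) `^ p)); apply: cvgM; last exact: cvg_cst.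
  have E0 : `|0 : R| `^ p = 0 by rewrite normr0 powR0// gt_eqF.
  by rewrite -[X in _ --> X]E0; exact: cvg_normpow p0 h.
- move=> k; apply: aeOnW => x Ox.
  rewrite ger0_norm ?powR_ge0// euclid_powZ; apply: ler_wpM2r; first exact: powR_ge0.
  apply: ge0_ler_powR; rewrite ?nnegrE//; first exact: ltW.
  by apply: le_trans (cM k x Ox) (ler_norm _).
rewrite (Rintegral_cst mu mO) mul0r in h.
rewrite (_ : (fun k => _) = (fun k => \int[mu]_(x in Om) (euclid (c k x *: g x) `^ p))); first exact: h.
by apply/funext => k; exact: EpowE.
Qed.

Lemma Npow_dist_le u v w z (M : R) : Lebesgue p Om w -> Lebesgue p Om z ->
  mf u -> mf v -> (forall x, Om x -> `|u x - v x| <= M * `|w x - z x|) ->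
  Npow (fun x => u x - v x) <= `|M| `^ p * Npow (fun x => w x - z x).
Proof.
move=> Lw Lz um vm H; have Lwz := LpB Lw Lz.
rewrite -(NpowZ _ Lwz) !NpowE.
have LM := LpZ M Lwz.
apply: (I_le mO).
- apply: Lp_igp; apply: (Lp_le LM); first exact: measurable_funB.
  apply: aeOnW => x Ox; apply: le_trans (H x Ox) _; rewrite normrM.
  by apply: ler_wpM2r => //; exact: ler_norm.
- exact: Lp_igp LM.
- move=> x Ox; apply: ge0_ler_powR; rewrite ?nnegrE//; first exact: ltW.
  apply: le_trans (H x Ox) _; rewrite normrM.
  by apply: ler_wpM2r => //; exact: ler_norm.
Qed.

(** * Chain rule, truncations and products *)

Section composition.
Variables (H dH : R -> R) (M : R).
Hypothesis tH : forall f, test_function Om f -> test_function Om (fun x => H (f x)).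
Hypothesis derH : forall s : R, is_derive s (1 : R) H (dH s).
Hypothesis dHM : forall s, `|dH s| <= M.
Hypothesis dHc : continuous dH.

Lemma derive_bound_lip a b : `|H a - H b| <= M * `|a - b|.
Proof.
wlog ab : a b / a <= b.
  move=> h; have [ab|/ltW ba] := leP a b; first exact: h.
  by rewrite distrC (distrC a); exact: h.
rewrite distrC (distrC a) (ger0_norm (_ : 0 <= b - a)) ?subr_ge0//.
exact: (is_derive_slide_mono ab derH (fun t _ => dHM t)).
Qed.

(** The difference dH(u) g - dH(f_k) grad f_k splits into (dH(u) - dH(f_k)) g, handled by dominated
    convergence along an a.e. convergent subsequence, and dH(f_k) (g - grad f_k), handled by the
    bound M. *)
Lemma Dpair_comp u g : Dpair u g -> Dpair (fun x => H (u x)) (fun x => dH (u x) *: g x).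
Proof.
move=> [Lu Lg [f [tf fN fE]]].
have Hm (v : V -> R) : mf v -> mf (fun x => H (v x)).
  move=> vm; apply: (@measurableT_comp _ _ _ _ _ _ H) => //.
  by apply: continuous_measurable_fun => s; have := is_derive_continuous (derH s).
have dHm (v : V -> R) : mf v -> mf (fun x => dH (v x)).
  move=> vm; apply: (@measurableT_comp _ _ _ _ _ _ dH) => //.
  exact: continuous_measurable_fun.
have fN' : Npow (fun x => f k x - u x) @[k --> \oo] --> 0.
  by rewrite (_ : (fun k => _) = (fun k => Npow (fun x => u x - f k x))); [exact: fN|
    apply/funext => k; exact: NpowBC].
have [s hs sP] := aeOn_cvg_subseq (fun k => Lp_test (tf k)) Lu fN'.
have Lfs k := Lp_test (tf (s k)).
have h0 : `|H 0| <= `|H 0| by [].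
have LHu : Lebesgue p Om (fun x => H (u x)).
  have LM : Lebesgue p Om (fun x => `|H 0| + `|M * u x|).
    apply: LpD; last exact: Lp_norm (LpZ M Lu).
    by apply: (@Lp_bounded _ `|H 0|) => [|x _]; [exact: measurable_cst|rewrite normr_id].
  apply: (Lp_le LM); first exact: Hm (Lp_mf Lu).
  apply: aeOnW => x _; rewrite [leRHS]ger0_norm ?addr_ge0//.
  have := derive_bound_lip (u x) 0; rewrite subr0 => h.
  rewrite -[X in `|X| <= _](subrK (H 0)) addrC; apply: le_trans (ler_normD _ _) _.
  rewrite lerD2l; apply: le_trans h _; rewrite normrM.
  by apply: ler_wpM2r => //; exact: ler_norm.
have LdG := Lpv_mulr Lg (dHm _ (Lp_mf Lu)) (fun x _ => dHM (u x)).
have D1 k : Dpair (fun x => H (f (s k) x)) (fun x => dH (f (s k) x) *: gradc (f (s k)) x).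
  apply: (Dpair_ae (Dpair_test (tH (tf (s k))))); apply: aeOnW => x _ //.
  apply/rowP => i; rewrite !mxE.
  exact: partial_comp (test_smooth (tf (s k))) (derH _).
apply: (Dpair_closed D1 LHu LdG).
- apply: (@cvg0_le _ _ (fun k => `|M| `^ p * Npow (fun x => u x - f (s k) x))).
    move=> k; rewrite Npow_ge0 /= NpowBC.
    apply: (Npow_dist_le Lu (Lfs k) (Hm _ (Lp_mf Lu)) (Hm _ (Lp_mf (Lfs k)))).
    by move=> x _; exact: derive_bound_lip.
  rewrite -[X in _ --> X](mulr0 (`|M| `^ p)); apply: cvgM; first exact: cvg_cst.
  exact: (cvg_subseq hs fN).
- have LGk k := LpvB Lg (Lpv_gradc (tf (s k))).
  have M0 : 0 <= M by apply: le_trans (dHM 0).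
  have L2 k : Lpv (fun x => (dH (f (s k) x) - dH (u x)) *: g x).
    apply: (@Lpv_mulr _ _ (M + M) Lg).
      by apply: measurable_funB; apply: dHm; [exact: Lp_mf (Lfs k)|exact: Lp_mf Lu].
    by move=> x _; apply: le_trans (ler_normB _ _) _; apply: lerD; exact: dHM.
  have L1 k := Lpv_mulr (LGk k) (dHm _ (Lp_mf (Lfs k))) (fun x _ => dHM (f (s k) x)).
  apply: (@cvg0_le _ _ (fun k => 2 `^ p * (`|M| `^ p * Epow (fun x => g x - gradc (f (s k)) x) +
     Epow (fun x => (dH (f (s k) x) - dH (u x)) *: g x)))).
    move=> k; rewrite Epow_ge0 /=.
    rewrite (@eq_Epow _ (fun x => (dH (f (s k) x) - dH (u x)) *: g x - dH (f (s k) x) *: (g x - gradc (f (s k)) x))); last first.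
      by move=> x _; congr euclid; apply/rowP => i; rewrite !mxE; ring.
    apply: le_trans (EpowB (L2 k) (L1 k)) _.
    apply: ler_wpM2l; first exact: powR_ge0.
    rewrite addrC lerD2r -(EpowZ _ (LGk k)) !EpowE; apply: (I_le mO).
    + exact: Lpv_igp (L1 k).
    + exact: Lpv_igp (LpvZ M (LGk k)).
    + move=> x _; rewrite !euclid_powZ; apply: ler_wpM2r; first exact: powR_ge0.
      apply: ge0_ler_powR; rewrite ?nnegrE//; first exact: ltW.
      by apply: le_trans (dHM _) _; exact: ler_norm.
  apply: cvg0_lin; first exact: (cvg_subseq hs fE).
  apply: (@Epow_dominated _ _ (M + M) Lg).
  + by move=> k; apply: measurable_funB; apply: dHm; [exact: Lp_mf (Lfs k)|exact: Lp_mf Lu].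
  + by move=> k x _; apply: le_trans (ler_normB _ _) _; apply: lerD; exact: dHM.
  + apply: aeOn1 sP => x _ h.
    have hc := cvg_compR dHc h.
    by rewrite -(subrr (dH (u x))); apply: cvgB; [exact: hc|exact: cvg_cst].
Qed.

End composition.

(** The limit is 0 at s = 0, which makes the gradient of a truncation at height c vanish on the
    level set {u = c}. *)
Lemma cvg_dsoftpos (s : R) : dsoftpos k.+1%:R^-1 s @[k --> \oo] --> ((0 < s)%R%:R : R).
Proof.
have [s0|s0] := ltP 0 s; last first.
  rewrite (_ : (fun k => _) = fun=> 0); first exact: cvg_cst.
  by apply/funext => k; rewrite dsoftpos_le0.
apply: (@squeeze_cvgr _ _ _ _ (fun k => flat k.+1%:R^-1 0 s) (fun=> 1)).
- apply: nearW => k; rewrite dsoftpos_le1// andbT /dsoftpos lerDl.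
  by rewrite mulr_ge0// flat_ge0.
- exact: cvg_flat0.
- exact: cvg_cst.
Qed.

Lemma continuous_dsoftpos (c : R) : 0 < c -> continuous (dsoftpos c).
Proof.
move=> c0 s; apply: cvgD; first exact: continuous_flat.
by apply: cvgM; [exact: cvg_cst|exact: continuous_flat].
Qed.

Lemma measurable_fun_pos (v : V -> R) c : mf v -> mf (fun x => Num.max (v x - c) 0).
Proof.
move=> vm; apply: measurable_maxr; last exact: measurable_cst.
by apply: measurable_funB => //; exact: measurable_cst.
Qed.

Lemma measurable_gt (v : V -> R) (c : R) : mf v -> mf (fun x => (c < v x)%R%:R : R).
Proof.
move=> vm; apply: (@measurable_fun_cvg _ (lebT R n) R (Om : set (lebT R n)) (fun k x => dsoftpos k.+1%:R^-1 (v x - c))).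
  move=> k; apply: (@measurableT_comp _ _ _ _ _ _ (dsoftpos k.+1%:R^-1)).
    by apply: continuous_measurable_fun; apply: continuous_dsoftpos; rewrite invr_gt0.
  by apply: measurable_funB; [exact: vm|exact: measurable_cst].
by move=> x _; rewrite -subr_gt0; exact: cvg_dsoftpos.
Qed.

(** The limit of [softpos] applied to u - c as the softening parameter tends to 0; c >= 0 keeps the
    value 0 at 0, so compact supports are preserved. *)
Lemma Dpair_trunc u g c : 0 <= c -> Dpair u g ->
  Dpair (fun x => Num.max (u x - c) 0) (fun x => (c < u x)%R%:R *: g x).
Proof.
move=> c0 ug; have [Lu Lg _] := ug.
have Lpos : Lebesgue p Om (fun x => Num.max (u x - c) 0).
  apply: (Lp_le Lu); first exact: measurable_fun_pos (Lp_mf Lu).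
  apply: aeOnW => x _; rewrite [leLHS]ger0_norm ?le_max ?lexx ?orbT//.
  by rewrite ge_max normr_ge0 andbT (le_trans _ (ler_norm _))// gerBl.
have b01 (b : bool) : `|b%:R : R| <= 1 by case: b; rewrite ?normr1 ?normr0.
have LG : Lpv (fun x => (c < u x)%R%:R *: g x).
  apply: (Lpv_mulr (M := 1) Lg (measurable_gt c (Lp_mf Lu))) => x _; exact: b01.
pose e k : R := k.+1%:R^-1.
have e0 k : 0 < e k by rewrite invr_gt0.
have D1 k : Dpair (fun x => softpos (e k) (u x - c)) (fun x => dsoftpos (e k) (u x - c) *: g x).
  apply: (@Dpair_comp (fun s => softpos (e k) (s - c)) (fun s => dsoftpos (e k) (s - c)) 1 _ _ _ _ _ _ ug).
  - move=> f tf; apply: (@test_comp _ _ _ (fun s => softpos (e k) (s - c))) => //.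
      apply: smooth_softpos => //; apply: smoothB; first exact: test_smooth tf.
      exact: smooth_cst.
    by rewrite softpos_le0// sub0r oppr_le0.
  - move=> s.
    have h1 : is_derive s (1 : R) (fun s => s - c) 1.
      by have := is_deriveB (is_derive_id s (1:R)) (is_derive_cst c s (1:R)); rewrite subr0.
    have h2 := @is_derive1_comp R (softpos (e k)) (fun s => s - c) s _ _ (is_derive_softpos (s - c) (e0 k)) h1.
    by rewrite mulr1 in h2.
  - by move=> s; rewrite ger0_norm ?dsoftpos_ge0 ?dsoftpos_le1// ltW.
  - move=> s; apply: (continuous_comp (f := fun s => s - c)).
      by apply: cvgB; [exact: cvg_id|exact: cvg_cst].
    exact: continuous_dsoftpos.
apply: (Dpair_closed D1 Lpos LG).
- apply: (@cvg0_le _ _ (fun k => fine (mu Om) * `|e k| `^ p)).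
    move=> k; rewrite Npow_ge0 /= NpowE mulrC -(Rintegral_cst mu mO).
    have [LS _ _] := D1 k.
    apply: (I_le mO); [exact: Lp_igp (LpB LS Lpos)|exact: ig_cst mO _ fO|].
    move=> x _; apply: ge0_ler_powR; rewrite ?nnegrE//; first exact: ltW.
    by rewrite (ger0_norm (ltW (e0 k))); apply: softpos_dist; exact: ltW.
  apply: cvg0M.
  have E0 : `|0 : R| `^ p = 0 by rewrite normr0 powR0// gt_eqF.
  by rewrite -[X in _ --> X]E0; apply: cvg_normpow p0 _; exact: cvg_harmonic.
- rewrite (_ : (fun k => _) = (fun k => Epow (fun x => (dsoftpos (e k) (u x - c) - (c < u x)%R%:R) *: g x))); last first.
    by apply/funext => k; apply: eq_Epow => x _; rewrite scalerBl.
  apply: (@Epow_dominated _ _ (1 + 1) Lg).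
  + move=> k; apply: measurable_funB; last exact: measurable_gt (Lp_mf Lu).
    apply: (@measurableT_comp _ _ _ _ _ _ (dsoftpos (e k))).
      exact: continuous_measurable_fun (continuous_dsoftpos (e0 k)).
    by apply: measurable_funB; [exact: Lp_mf Lu|exact: measurable_cst].
  + move=> k x _; apply: le_trans (ler_normB _ _) _; apply: lerD; last exact: b01.
    by rewrite ger0_norm ?dsoftpos_ge0 ?dsoftpos_le1// ltW.
  + apply: aeOnW => x _.
    rewrite -(subrr ((c < u x)%R%:R : R)); apply: cvgB; last exact: cvg_cst.
    by rewrite -subr_gt0; exact: cvg_dsoftpos.
Qed.

Lemma DpairZ a u g : Dpair u g -> Dpair (fun x => a * u x) (fun x => a *: g x).
Proof.
move=> ug.
apply: (Dpair_ae (Dpair_lin a ug (Dpair_test (test0 Om)))); apply: aeOnW => x _.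
  by rewrite addr0.
rewrite (_ : gradc _ x = 0) ?addr0//; apply/rowP => i; rewrite !mxE.
by apply: is_derive_partial; exact: is_derive_cst.
Qed.

Lemma DpairD u g v h : Dpair u g -> Dpair v h ->
  Dpair (fun x => u x + v x) (fun x => g x + h x).
Proof.
move=> ug vh; apply: (Dpair_ae (Dpair_lin 1 ug vh)); apply: aeOnW => x _.
  by rewrite mul1r.
by rewrite scale1r.
Qed.

Lemma DpairN u g : Dpair u g -> Dpair (fun x => - u x) (fun x => - g x).
Proof.
move=> ug; apply: (Dpair_ae (DpairZ (-1) ug)); apply: aeOnW => x _.
  by rewrite mulN1r.
by rewrite scaleN1r.
Qed.

Lemma DpairB u g v h : Dpair u g -> Dpair v h ->
  Dpair (fun x => u x - v x) (fun x => g x - h x).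
Proof. by move=> ug vh; exact: DpairD ug (DpairN vh). Qed.

Lemma Dpair0 : Dpair (fun=> 0) (fun=> 0).
Proof.
apply: (Dpair_ae (DpairB (Dpair_test (test0 Om)) (Dpair_test (test0 Om)))); apply: aeOnW => x _.
  by rewrite subrr.
by rewrite subrr.
Qed.

(* [min (u, v) = u - (u - v)^+] *)
Lemma Dpair_min u g v h : Dpair u g -> Dpair v h ->
  Dpair (fun x => Num.min (u x) (v x)) (fun x => if v x < u x then h x else g x).
Proof.
move=> ug vh.
apply: (Dpair_ae (DpairB ug (Dpair_trunc (lexx 0) (DpairB ug vh)))); apply: aeOnW => x _.
  by rewrite subr0; case: (ltP (u x) (v x)) => c; case: (ltP (u x - v x) 0) => d; lra.
rewrite subr_gt0; case: ltP => _; first by rewrite scale1r opprB addrC subrK.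
by rewrite scale0r subr0.
Qed.

Lemma Dpair_minc u g c : 0 <= c -> Dpair u g ->
  Dpair (fun x => Num.min (u x) c) (fun x => if c < u x then 0 else g x).
Proof.
move=> c0 ug.
apply: (Dpair_ae (DpairB ug (Dpair_trunc c0 ug))); apply: aeOnW => x _.
  by case: (ltP (u x) c) => d; case: (ltP (u x - c) 0) => e; lra.
case: ltP => _; first by rewrite scale1r subrr.
by rewrite scale0r subr0.
Qed.

Lemma Dpair_pos u g : Dpair u g ->
  Dpair (fun x => Num.max (u x) 0) (fun x => if 0 < u x then g x else 0).
Proof.
move=> ug; apply: (Dpair_ae (Dpair_trunc (lexx 0) ug)); apply: aeOnW => x _.
  by rewrite subr0.
by case: ltP => _; rewrite ?scale1r ?scale0r.
Qed.

Lemma Dpair_norm u g : Dpair u g ->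
  Dpair (fun x => `|u x|) (fun x => if 0 < u x then g x else if u x < 0 then - g x else 0).
Proof.
move=> ug.
apply: (Dpair_ae (DpairD (Dpair_pos ug) (Dpair_pos (DpairN ug)))); apply: aeOnW => x _.
  by case: (ltrP (u x) 0) => c; case: (ltrP (- u x) 0) => d; rewrite ?(ltr0_norm c) ?(ger0_norm c); lra.
rewrite oppr_gt0; case: (ltrgtP (u x) 0) => _; rewrite ?addr0 ?add0r//.
Qed.

(** The product rule at the level of approximations: psi f_k is a test function whenever f_k is. *)
Lemma Dpair_testM psi u g : smooth psi -> (exists M, forall x, `|psi x| <= M) ->
  (exists M, forall i x, `|partial i psi x| <= M) -> Dpair u g ->
  Dpair (fun x => psi x * u x) (fun x => psi x *: g x + u x *: gradc psi x).
Proof.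
move=> sp [M pM] [M' pM'] [Lu Lg [f [tf fN fE]]].
have pm : mf psi by exact: smooth_measurable.
have pim i : mf (partial i psi) by apply: smooth_measurable; exact: smooth_partial.
have Lmul v : Lebesgue p Om v -> Lebesgue p Om (fun x => psi x * v x).
  move=> Lv; have := Lp_bounded_mul Lv pm (aeOnW (fun x _ => pM x)).
  by under eq_fun do rewrite mulrC.
have Lgrd v : Lebesgue p Om v -> Lpv (fun x => v x *: gradc psi x).
  move=> Lv i; have := Lp_bounded_mul Lv (pim i) (aeOnW (fun x _ => pM' i x)).
  rewrite (_ : (fun x => v x * partial i psi x) = (fun x => (v x *: gradc psi x) ord0 i))//.
  by apply/funext => x; rewrite !mxE.
have tp k : test_function Om (fun x => psi x * f k x) by exact: testMl.
have LG := LpvD (Lpv_mulr Lg pm (fun x _ => pM x)) (Lgrd _ Lu).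
apply: (Dpair_closed (fun k => Dpair_test (tp k)) (Lmul _ Lu) LG).
- apply: (@cvg0_le _ _ (fun k => `|M| `^ p * Npow (fun x => u x - f k x))).
    move=> k; rewrite Npow_ge0 /= NpowBC.
    apply: (Npow_dist_le Lu (Lp_test (tf k))); [exact: Lp_mf (Lmul _ Lu)|exact: test_mf (tp k)|].
    by move=> x _; rewrite -mulrBr normrM; apply: ler_wpM2r.
  exact: cvg0M fN.
- have LB k := LpB Lu (Lp_test (tf k)).
  have LvB k := LpvB Lg (Lpv_gradc (tf k)).
  have L1 k := Lpv_mulr (LvB k) pm (fun x _ => pM x).
  have L2 k := Lgrd _ (LB k).
  apply: (@cvg0_le _ _ (fun k => 2 `^ p * (`|M| `^ p * Epow (fun x => g x - gradc (f k) x) +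
     (n.+1%:R * `|M'|) `^ p * Npow (fun x => u x - f k x)))).
    move=> k; rewrite Epow_ge0 /=.
    rewrite (@eq_Epow _ (fun x => psi x *: (g x - gradc (f k) x) + (u x - f k x) *: gradc psi x)); last first.
      move=> x _; rewrite -[RHS]euclidN; congr euclid; apply/rowP => i; rewrite !mxE.
      rewrite (partialM _ _ sp (test_smooth (tf k))); ring.
    apply: le_trans (EpowD (L1 k) (L2 k)) _.
    apply: ler_wpM2l; first exact: powR_ge0.
    apply: lerD.
      rewrite -(EpowZ _ (LvB k)) !EpowE; apply: (I_le mO).
      + exact: Lpv_igp (L1 k).
      + exact: Lpv_igp (LpvZ M (LvB k)).
      + move=> x _; rewrite !euclid_powZ; apply: ler_wpM2r; first exact: powR_ge0.
        apply: ge0_ler_powR; rewrite ?nnegrE//; first exact: ltW.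
        by apply: le_trans (pM x) _; exact: ler_norm.
    have -> : (n.+1%:R * `|M'|) `^ p = `|n.+1%:R * `|M'| | `^ p by rewrite [in RHS]ger0_norm ?mulr_ge0.
    rewrite -(NpowZ _ (LB k)) EpowE NpowE; apply: (I_le mO).
    + exact: Lpv_igp (L2 k).
    + exact: Lp_igp (LpZ _ (LB k)).
    + move=> x _; apply: ge0_ler_powR; rewrite ?nnegrE ?euclid_ge0//; first exact: ltW.
      rewrite euclidZ normrM mulrC; apply: ler_wpM2r => //.
      rewrite ger0_norm ?mulr_ge0//; apply: le_trans (euclid_sum_le _) _.
      rewrite mulr_natl -[X in _ *+ X]card_ord -sumr_const; apply: ler_sum => i _.
      by rewrite mxE; apply: le_trans (pM' i x) _; exact: ler_norm.
  apply: cvg0M; rewrite -[X in _ --> X]addr0; apply: cvgD.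
    exact: cvg0M fE.
  exact: cvg0M fN.
Qed.

(** * Convergence of norms, and weak limits through midpoints *)

Lemma powR_quasi (e : R) : 0 < e -> exists2 C : R, 0 <= C & forall a b : R, 0 <= a -> 0 <= b ->
  (a + b) `^ p <= (1 + e) * a `^ p + C * b `^ p.
Proof.
(* With (1 + d)^p = 1 + e, either b <= d a, or a < b / d. *)
move=> e0; pose d := (1 + e) `^ p^-1 - 1.
have d0 : 0 < d.
  have E1 : (1 : R) `^ p^-1 = 1 by rewrite powR1.
  rewrite subr_gt0 -[X in X < _]E1.
  by apply: gt0_ltr_powR; rewrite ?invr_gt0// ?nnegrE; lra.
exists ((d^-1 + 1) `^ p) => [|a b a0 b0]; first exact: powR_ge0.
have [le|lt] := leP b (d * a).
  apply: (@le_trans _ _ ((1 + e) * a `^ p)); last by rewrite lerDl mulr_ge0 ?powR_ge0.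
  have -> : 1 + e = (1 + d) `^ p by rewrite /d subrKC powRVK//; lra.
  rewrite -powRM//; last by lra.
  apply: ge0_ler_powR; rewrite ?nnegrE ?addr_ge0 ?mulr_ge0//; [exact: ltW|lra|].
  by rewrite mulrDl mul1r lerD2l.
apply: (@le_trans _ _ ((d^-1 + 1) `^ p * b `^ p)); last first.
  by rewrite lerDr mulr_ge0 ?powR_ge0//; lra.
have di : 0 < d^-1 by rewrite invr_gt0.
rewrite -powRM//; last by lra.
apply: ge0_ler_powR; rewrite ?nnegrE ?addr_ge0 ?mulr_ge0//; [exact: ltW|lra|].
rewrite mulrDl mul1r lerD2r -(ler_pM2l d0) mulrA mulfV ?gt_eqF// mul1r; exact: ltW.
Qed.

(** Together with [powR_quasi] this plays the role of the triangle inequality in L^p: comparison up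
    to a factor 1 + e and a multiple of a vanishing error gives convergence. *)
Lemma cvg_quasi (a d : nat -> R) (l : R) : (forall k, 0 <= a k) -> 0 <= l ->
  (forall k, 0 <= d k) -> d k @[k --> \oo] --> 0 ->
  (forall e, 0 < e -> exists2 C : R, 0 <= C & forall k,
     a k <= (1 + e) * l + C * d k /\ l <= (1 + e) * a k + C * d k) ->
  a k @[k --> \oo] --> l.
Proof.
move=> a0 l0 d0 dc H; apply/cvgrPdist_le => x x0.
have small C y : 0 <= C -> 0 < y -> exists K, forall k, (K <= k)%N -> C * d k <= y.
  move=> C0 y0; have /cvgrPdist_le/(_ y y0)[K _ KP] := cvg0M C dc.
  exists K => k /KP /=; rewrite sub0r normrN ger0_norm// mulr_ge0//.
have [C1 C10 H1] := H 1 ltr01; have [K1 K1P] := small C1 1 C10 ltr01.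
(* A bound for l and for a_k with k large, from the hypothesis at e = 1, so that e B can be made
   small. *)
pose B := 2 * l + 1; have B0 : 0 < B by rewrite /B; lra.
pose e := x / 2 / B; have e0 : 0 < e by rewrite !divr_gt0.
have eB : e * B = x / 2 by rewrite /e divfK// gt_eqF.
have [C C0 HC] := H e e0; have x20 : 0 < x / 2 by rewrite divr_gt0.
have [K KP] := small C (x / 2) C0 x20.
exists (maxn K1 K) => // k; rewrite /= geq_max => /andP[k1 k2].
have [h1 _] := H1 k; have h2 := K1P k k1; have [h3 h4] := HC k; have h5 := KP k k2.
have aB : a k <= B by rewrite /B; lra.
have lB : l <= B by rewrite /B; lra.
have ea : e * a k <= x / 2 by rewrite -eB; apply: ler_wpM2l => //; exact: ltW.
have el : e * l <= x / 2 by rewrite -eB; apply: ler_wpM2l => //; exact: ltW.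
by rewrite ler_norml; apply/andP; split; lra.
Qed.

Lemma I_lin_le (A B C : V -> R) (a b : R) : ig A -> ig B -> ig C ->
  (forall x, Om x -> C x <= a * A x + b * B x) ->
  \int[mu]_(x in Om) C x <= a * \int[mu]_(x in Om) A x + b * \int[mu]_(x in Om) B x.
Proof.
move=> Ai Bi Ci H; have h1 := igZ mO a Ai; have h2 := igZ mO b Bi.
rewrite -(RintegralZl _ mO Ai) -(RintegralZl _ mO Bi) -(RintegralD mO h1 h2).
by apply: (I_le mO); [exact: Ci|exact: (igD mO h1 h2)|exact: H].
Qed.

Lemma powR_quasi_le (e K a b c : R) : 0 <= a -> 0 <= b -> 0 <= c -> c <= a + b ->
  (forall a b : R, 0 <= a -> 0 <= b -> (a + b) `^ p <= (1 + e) * a `^ p + K * b `^ p) ->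
  c `^ p <= (1 + e) * a `^ p + K * b `^ p.
Proof.
move=> a0 b0 c0 cab H; apply: le_trans (H _ _ a0 b0).
by apply: ge0_ler_powR; rewrite ?nnegrE ?addr_ge0// ltW.
Qed.

Lemma Npow_cvg (w : nat -> V -> R) u : (forall k, Lebesgue p Om (w k)) -> Lebesgue p Om u ->
  Npow (fun x => w k x - u x) @[k --> \oo] --> 0 -> Npow (w k) @[k --> \oo] --> Npow u.
Proof.
move=> Lw Lu w0; apply: (cvg_quasi _ (Npow_ge0 u) _ w0) => [k|k|e e0]; [exact: Npow_ge0..|].
have [C C0 HC] := powR_quasi e0; exists C => // k.
rewrite (NpowE (w k)) (NpowE u) (NpowE (fun x => w k x - u x)).
have i1 := Lp_igp (LpB (Lw k) Lu); have i2 := Lp_igp (Lw k); have i3 := Lp_igp Lu.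
split; [apply: (I_lin_le i3 i1 i2) => x _|apply: (I_lin_le i2 i1 i3) => x _].
  apply: (powR_quasi_le (normr_ge0 _) (normr_ge0 _) (normr_ge0 _) _ HC).
  by rewrite -[X in `|X| <= _](subrK (u x)) addrC; exact: ler_normD.
apply: (powR_quasi_le (normr_ge0 _) (normr_ge0 _) (normr_ge0 _) _ HC).
rewrite -[X in `|X| <= _](subKr (w k x)); exact: ler_normB.
Qed.

Lemma Epow_cvg (G : nat -> V -> V) g : (forall k, Lpv (G k)) -> Lpv g ->
  Epow (fun x => G k x - g x) @[k --> \oo] --> 0 -> Epow (G k) @[k --> \oo] --> Epow g.
Proof.
move=> Lw Lu w0; apply: (cvg_quasi _ (Epow_ge0 g) _ w0) => [k|k|e e0]; [exact: Epow_ge0..|].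
have [C C0 HC] := powR_quasi e0; exists C => // k.
rewrite (EpowE (G k)) (EpowE g) (EpowE (fun x => G k x - g x)).
have i1 := Lpv_igp (LpvB (Lw k) Lu); have i2 := Lpv_igp (Lw k); have i3 := Lpv_igp Lu.
split; [apply: (I_lin_le i3 i1 i2) => x _|apply: (I_lin_le i2 i1 i3) => x _].
  apply: (powR_quasi_le (euclid_ge0 _) (euclid_ge0 _) (euclid_ge0 _) _ HC).
  by rewrite -[X in euclid X <= _](subrK (g x)) addrC; exact: euclidD.
apply: (powR_quasi_le (euclid_ge0 _) (euclid_ge0 _) (euclid_ge0 _) _ HC).
rewrite -[X in euclid X <= _](subKr (G k x)); exact: euclidB.
Qed.

(** The vector inequality applied along a fixed nonzero direction. *)
Lemma normpow_mid (a b : R) :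
  `|2^-1 * a + 2^-1 * b| `^ p <= 2^-1 * `|a| `^ p + 2^-1 * `|b| `^ p.
Proof.
pose v : V := const_mx 1.
have v0 : 0 < euclid v `^ p.
  rewrite powR_gt0// lt_def euclid_ge0 andbT euclid_eq0.
  by apply/eqP => /rowP/(_ ord0)/eqP; rewrite !mxE oner_eq0.
have h : 0 <= (2^-1 : R) <= 1 by lra.
have := euclid_pow_convex_le p1 (a *: v) (b *: v) h.
rewrite (_ : 1 - 2^-1 = 2^-1 :> R); last by lra.
by rewrite !scalerA -scalerDl !euclid_powZ !mulrA -mulrDl ler_pM2r.
Qed.

Lemma euclid_pow_mid (X Y : V) : euclid (2^-1 *: X + 2^-1 *: Y) `^ p <=
  2^-1 * euclid X `^ p + 2^-1 * euclid Y `^ p.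
Proof.
have h : 0 <= (2^-1 : R) <= 1 by lra.
have := euclid_pow_convex_le p1 X Y h.
by rewrite (_ : 1 - 2^-1 = 2^-1 :> R)//; lra.
Qed.

Lemma Npow_mid u v : Lebesgue p Om u -> Lebesgue p Om v ->
  Npow (fun x => 2^-1 * u x + 2^-1 * v x) <= 2^-1 * Npow u + 2^-1 * Npow v.
Proof.
move=> Lu Lv; rewrite NpowE (NpowE u) (NpowE v).
apply: (I_lin_le (Lp_igp Lu) (Lp_igp Lv) (Lp_igp (LpD (LpZ _ Lu) (LpZ _ Lv)))) => x _.
exact: normpow_mid.
Qed.

Lemma Epow_mid g h : Lpv g -> Lpv h ->
  Epow (fun x => 2^-1 *: g x + 2^-1 *: h x) <= 2^-1 * Epow g + 2^-1 * Epow h.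
Proof.
move=> Lu Lv; rewrite EpowE (EpowE g) (EpowE h).
apply: (I_lin_le (Lpv_igp Lu) (Lpv_igp Lv) (Lpv_igp (LpvD (LpvZ _ Lu) (LpvZ _ Lv)))) => x _.
exact: euclid_pow_mid.
Qed.

(* iterated midpoints of the tail of a sequence, a convex enough hull for Mazur's lemma *)
Inductive mid (u_ : nat -> V -> R) (g_ : nat -> V -> V) (m : nat) : (V -> R) -> (V -> V) -> Prop :=
| mid_base k : (m <= k)%N -> mid u_ g_ m (u_ k) (g_ k)
| mid_step v1 h1 v2 h2 : mid u_ g_ m v1 h1 -> mid u_ g_ m v2 h2 ->
    mid u_ g_ m (fun x => 2^-1 * v1 x + 2^-1 * v2 x) (fun x => 2^-1 *: h1 x + 2^-1 *: h2 x).

Lemma mid_le (u_ : nat -> V -> R) (g_ : nat -> V -> V) m k v h : (m <= k)%N -> mid u_ g_ k v h -> mid u_ g_ m v h.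
Proof.
move=> mk; elim => [j kj|v1 h1 v2 h2 _ ih1 _ ih2]; last exact: mid_step.
by apply: mid_base; exact: leq_trans kj.
Qed.

Lemma Dpair_mid u g v h : Dpair u g -> Dpair v h ->
  Dpair (fun x => 2^-1 * u x + 2^-1 * v x) (fun x => 2^-1 *: g x + 2^-1 *: h x).
Proof. by move=> ug vh; exact: DpairD (DpairZ _ ug) (DpairZ _ vh). Qed.

Lemma mid_Dpair (u_ : nat -> V -> R) (g_ : nat -> V -> V) m v h : (forall k, Dpair (u_ k) (g_ k)) -> mid u_ g_ m v h -> Dpair v h.
Proof.
by move=> Dk; elim => [j kj|v1 h1 v2 h2 _ ih1 _ ih2]; [exact: Dk|exact: Dpair_mid].
Qed.

(** A convex bound that holds along the tail passes to all its iterated midpoints. *)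
Lemma mid_Npow (u_ : nat -> V -> R) (g_ : nat -> V -> V) m v h u (C : R) : (forall k, Dpair (u_ k) (g_ k)) -> Lebesgue p Om u ->
  (forall k, (m <= k)%N -> Npow (fun x => u_ k x - u x) <= C) -> mid u_ g_ m v h ->
  Npow (fun x => v x - u x) <= C.
Proof.
move=> Dk Lu HC; elim => [j kj|v1 h1 v2 h2 m1 ih1 m2 ih2]; first exact: HC.
have [L1 _ _] := mid_Dpair Dk m1; have [L2 _ _] := mid_Dpair Dk m2.
rewrite (@eq_Npow _ (fun x => 2^-1 * (v1 x - u x) + 2^-1 * (v2 x - u x))); last first.
  by move=> x _; congr `|_|; field.
exact: half_le (Npow_mid (LpB L1 Lu) (LpB L2 Lu)) ih1 ih2.
Qed.

Lemma mid_Epow (u_ : nat -> V -> R) (g_ : nat -> V -> V) m v h (C : R) : (forall k, Dpair (u_ k) (g_ k)) ->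
  (forall k, (m <= k)%N -> Epow (g_ k) <= C) -> mid u_ g_ m v h -> Epow h <= C.
Proof.
move=> Dk HC; elim => [j kj|v1 h1 v2 h2 m1 ih1 m2 ih2]; first exact: HC.
have [_ L1 _] := mid_Dpair Dk m1; have [_ L2 _] := mid_Dpair Dk m2.
exact: half_le (Epow_mid L1 L2) ih1 ih2.
Qed.

Lemma Epow_uniform_convexity (e : R) : 0 < e -> exists2 C : R, 0 <= C &
  forall g h, Lpv g -> Lpv h -> Epow (fun x => g x - h x) <= e * (Epow g + Epow h) +
    C * ((Epow g + Epow h) / 2 - Epow (fun x => 2^-1 *: g x + 2^-1 *: h x)).
Proof.
move=> e0; have [C C0 HC] := uniform_convexity n p1 e0; exists C => // g h Lg Lh.
have Lm := LpvD (LpvZ 2^-1 Lg) (LpvZ 2^-1 Lh).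
have i1 := igD mO (Lpv_igp Lg) (Lpv_igp Lh).
have i2 := igB mO (igZ mO 2^-1 i1) (Lpv_igp Lm).
rewrite (EpowE g) (EpowE h) (EpowE (fun x => g x - h x)).
rewrite (EpowE (fun x => 2^-1 *: g x + 2^-1 *: h x)).
have H x : Om x -> euclid (g x - h x) `^ p <= e * (euclid (g x) `^ p + euclid (h x) `^ p) +
    C * (2^-1 * (euclid (g x) `^ p + euclid (h x) `^ p) - euclid (2^-1 *: g x + 2^-1 *: h x) `^ p).
  by move=> _; rewrite [2^-1 * _]mulrC -scalerDr; exact: HC.
apply: le_trans (I_lin_le i1 i2 (Lpv_igp (LpvB Lg Lh)) H) _.
rewrite (RintegralB mO (igZ mO 2^-1 i1) (Lpv_igp Lm)) (RintegralZl _ mO i1).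
by rewrite (RintegralD mO (Lpv_igp Lg) (Lpv_igp Lh)) [2^-1 * _]mulrC lexx.
Qed.

Lemma half_gap_le (a b c D t dm : R) : a <= D + t -> b <= D + t -> D - t < dm -> dm <= c ->
  (a + b) / 2 - c <= t + t.
Proof. by move=> *; lra. Qed.

(* Weak compactness in disguise: midpoints of almost minimal energy are Cauchy by uniform convexity. *)
Lemma Dpair_weak_limit (u_ : nat -> V -> R) (g_ : nat -> V -> V) u (C : R) :
  (forall k, Dpair (u_ k) (g_ k)) -> (forall k, Epow (g_ k) <= C) -> Lebesgue p Om u ->
  Npow (fun x => u_ k x - u x) @[k --> \oo] --> 0 ->
  exists g (w : nat -> V -> R) (G : nat -> V -> V), [/\ Dpair u g,
    forall m, mid u_ g_ m (w m) (G m),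
    Npow (fun x => w m x - u x) @[m --> \oo] --> 0 &
    Epow (fun x => G m x - g x) @[m --> \oo] --> 0].
Proof.
move=> Dk gC Lu u0.
(* The energies of all iterated midpoints of the tail from m on; their infima are nondecreasing in m
   and at most C. *)
pose S m := [set Epow h | h in [set h | exists v, mid u_ g_ m v h]].
have Sn m : S m !=set0 by exists (Epow (g_ m)), (g_ m) => //; exists (u_ m); exact: mid_base.
have Sb m : has_lbound (S m) by exists 0 => _ [h _ <-]; exact: Epow_ge0.
pose d m := inf (S m).
have dle m v h : mid u_ g_ m v h -> d m <= Epow h.
  by move=> H; apply: ge_inf => //; exists h => //; exists v.
have dC m : d m <= C by apply: le_trans (gC m); apply: dle (mid_base _ _ (leqnn m)).
have dmono m k : (m <= k)%N -> d m <= d k.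
  move=> mk; apply: lb_le_inf => // _ [h [v hm] <-].
  exact: dle (mid_le mk hm).
have /choice[wG wGP] : forall m, exists wG : (V -> R) * (V -> V),
    mid u_ g_ m wG.1 wG.2 /\ Epow wG.2 <= d m + m.+1%:R^-1.
  move=> m; have mp : 0 < m.+1%:R^-1 :> R by rewrite invr_gt0.
  have [_ [h [v hm] <-] lt] := inf_adherent mp (conj (Sn m) (Sb m)).
  by exists (v, h); split => //; exact: ltW.
pose w m := (wG m).1; pose G m := (wG m).2.
have mw m : mid u_ g_ m (w m) (G m) by have [] := wGP m.
have Dw m : Dpair (w m) (G m) := mid_Dpair Dk (mw m).
have LG m : Lpv (G m) by have [] := Dw m.
have w0 : Npow (fun x => w m x - u x) @[m --> \oo] --> 0.
  apply: small_cvg0 => [m|e e0]; first exact: Npow_ge0.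
  have [K KP] := cvg0_small (fun k => Npow_ge0 _) u0 e0.
  exists K => m Km; apply: (mid_Npow Dk Lu _ (mw m)) => k mk.
  exact: KP (leq_trans Km mk).
have GC m : Epow (G m) <= C by apply: (mid_Epow Dk _ (mw m)).
have C0 : 0 <= C := le_trans (Epow_ge0 _) (gC 0%N).
have [|g ug gE] := Dpair_complete Dw Lu w0; last by exists g, w, G.
(* [e1] makes the first term of uniform convexity at most e / 2 on energies bounded by C, and [t]
   below makes the second one at most e / 2. *)
move=> e e0; pose e1 := e / 2 / (2 * C + 1).
have e10 : 0 < e1 by rewrite !divr_gt0//; lra.
have e1C : e1 * (C + C) <= e / 2.
  rewrite /e1 -[leRHS]mulr1 -mulrA; apply: ler_wpM2l; first by lra.
  by rewrite mulrC ler_pdivrMr ?mul1r; lra.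
have [K0 K00 HK] := Epow_uniform_convexity e10.
(* Far out, the energies of [G k] and [G l] are at most D + t, while their midpoint, again a
   midpoint of the tail from [m0], has energy above D - t; the convexity defect is thus at most 2
   t. *)
pose D := sup (range d).
have Db : has_sup (range d).
  by split; [exists (d 0%N), 0%N|exists C => _ [m _ <-]].
pose t := e / 4 / (K0 + 1); have t0 : 0 < t by rewrite !divr_gt0//; lra.
have tK : K0 * (t + t) <= e / 2.
  have h : K0 / (K0 + 1) <= 1 by rewrite ler_pdivrMr ?mul1r; lra.
  rewrite (_ : K0 * (t + t) = e / 2 * (K0 / (K0 + 1))); last by rewrite /t; field; lra.
  by rewrite -[leRHS]mulr1; apply: ler_wpM2l => //; lra.
have [_ [m0 _ <-] m0D] := sup_adherent t0 Db.
have dD m : d m <= D by apply: ub_le_sup; [case: Db|exists m].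
have hp k : 0 <= (k.+1%:R^-1 : R) by rewrite invr_ge0.
have [m1 m1P] := cvg0_small hp (@cvg_harmonic R) t0.
exists (maxn m0 m1) => k l; rewrite !geq_max => /andP[k0 k1] /andP[l0 l1].
have [_ Gk] := wGP k; have [_ Gl] := wGP l.
have mm : d m0 <= Epow (fun x => 2^-1 *: G k x + 2^-1 *: G l x).
  apply: (dle _ (fun x => 2^-1 * w k x + 2^-1 * w l x)).
  by apply: mid_step; [exact: mid_le k0 (mw k)|exact: mid_le l0 (mw l)].
apply: le_trans (HK _ _ (LG k) (LG l)) _.
have h1 := m1P k k1; have h2 := m1P l l1; have h3 := dD k; have h4 := dD l.
rewrite -/(G k) -/(G l) in Gk Gl.
have a1 : e1 * (Epow (G k) + Epow (G l)) <= e / 2.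
  apply: le_trans e1C; apply: ler_wpM2l; first exact: ltW.
  by apply: lerD.
have a2 : K0 * ((Epow (G k) + Epow (G l)) / 2 - Epow (fun x => 2^-1 *: G k x + 2^-1 *: G l x)) <= e / 2.
  apply: le_trans tK; apply: ler_wpM2l => //.
  exact: half_gap_le (le_trans Gk (lerD h3 h1)) (le_trans Gl (lerD h4 h2)) m0D mm.
by rewrite [leRHS]splitr; apply: lerD.
Qed.

(** The energy is convex, so midpoints keep the bound, and so does their strong limit. *)
Lemma Dpair_lsc (u_ : nat -> V -> R) (g_ : nat -> V -> V) u (C : R) :
  (forall k, Dpair (u_ k) (g_ k)) -> (forall k, Epow (g_ k) <= C) -> Lebesgue p Om u ->
  Npow (fun x => u_ k x - u x) @[k --> \oo] --> 0 ->
  exists2 g, Dpair u g & Epow g <= C.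
Proof.
move=> Dk gC Lu u0; have [g [w [G [ug mw _ Gg]]]] := Dpair_weak_limit Dk gC Lu u0.
exists g => //; have [_ Lg _] := ug.
have LG m : Lpv (G m) by have [] := mid_Dpair Dk (mw m).
apply: (cvg_le_cst _ (Epow_cvg LG Lg Gg)) => m.
exact: mid_Epow Dk (fun k _ => gC k) (mw m).
Qed.

(** * Sobolev, Morrey and Rellich theorems on the domain *)

Lemma W1p0_norm_gt0_leb u : W1p0 p Om u -> 0 < norm1p p Om u -> (0 < mu Om)%E.
Proof.
move=> /W1p0_Dpair Du n0; have [Lu Lg _] := Du.
have le0 : (0 <= mu Om)%E := leb_outer_ge0 Om.
rewrite lt_neqAle le0 andbT eq_sym; apply/eqP => m0; move: n0.
have null (w : V -> R) : ig w -> \int[mu]_(x in Om) w x = 0.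
  by move=> iw; rewrite /Rintegral (null_set_integral mO (measurable_int _ iw) m0).
rewrite (norm1pE Du) NpowE EpowE (null _ (Lp_igp Lu)) (null _ (Lpv_igp Lg)) addr0 powR0 ?ltxx//.
by rewrite gt_eqF// invr_gt0.
Qed.

Context (muO : (0 < mu Om)%E).

(** The box has positive measure because the domain has, which [W1p0_norm_gt0_leb] reads off from a
    function of positive norm. *)
Lemma ambient_box : exists (L : R) (lo : V), [/\ 0 < L, Om `<=` qbox L 0 lo & 0 < vol n L 0].
Proof.
have [M M0 OM] := bounded_sub_obox bO.
have L0 : 0 < 2 * M by rewrite mulr_gt0.
pose lo : V := const_mx (- M).
have OQ : Om `<=` qbox (2 * M) 0 lo.
  move=> x /OM h i; have := h i; rewrite /= !mxE /side add0n divn_small ?ltnS ?leq_subr// expr0 mulr1.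
  by move=> /andP[a b]; apply/andP; split; lra.
exists (2 * M), lo; split => //; rewrite -lte_fin -(leb_qbox _ 0 lo).
by apply: lt_le_trans muO _; exact: le_leb_outer.
Qed.

Lemma int_sub_supp (A : set V) (w : V -> R) : Om `<=` A -> (forall x, ~ Om x -> w x = 0) ->
  \int[mu]_(x in A) w x = \int[mu]_(x in Om) w x.
Proof.
move=> OA w0; rewrite -(@int_supp _ _ Om w w0) (@int_supp _ _ A w)// => x Ax.
by apply: w0 => Ox; apply: Ax; exact: OA.
Qed.

Lemma ig_sub_supp (A : set V) (w : V -> R) : measurable (A : set (lebT R n)) -> Om `<=` A ->
  (forall x, ~ Om x -> w x = 0) ->
  mu.-integrable (A : set (lebT R n)) (EFin \o (w : lebT R n -> R)) -> ig w.
Proof. by move=> mA OA w0; exact: (integrableS mA mO OA). Qed.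

Lemma test_out f x : test_function Om f -> ~ Om x -> f x = 0.
Proof. by move=> [_ [K [_ KO K0]]] Ox; apply: K0 => /KO. Qed.

Lemma test_gradc_out f x : test_function Om f -> ~ Om x -> gradc f x = 0.
Proof.
by move=> tf Ox; apply/rowP => i; rewrite !mxE; exact: test_out (test_partial i tf) Ox.
Qed.

Lemma test_setT f : test_function Om f -> test_function setT f.
Proof. by apply: testS; exact: subsetT. Qed.

Lemma test_Npow (A : set V) f : Om `<=` A -> test_function Om f ->
  \int[mu]_(x in A) (`|f x| `^ p) = Npow f.
Proof.
move=> OA tf; rewrite NpowE; apply: int_sub_supp => // x Ox.
by rewrite (test_out tf Ox) normr0 powR0// gt_eqF.
Qed.

Lemma test_Epow (L : R) lo f : Om `<=` qbox L 0 lo -> test_function Om f ->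
  Eq L p 0 lo f = Epow (gradc f).
Proof.
move=> OA tf; rewrite EpowE; apply: int_sub_supp => // x Ox.
by rewrite /egrad (test_gradc_out tf Ox) euclid0 powR0// gt_eqF.
Qed.

Lemma test_Np_ig (A : set V) f : measurable (A : set (lebT R n)) -> test_function Om f ->
  mu.-integrable (A : set (lebT R n)) (EFin \o ((fun x => `|f x| `^ p) : lebT R n -> R)).
Proof.
move=> mA tf; have [M M0 fM] := test_bounded tf.
have [sf [K [cK KO Kf]]] := tf.
apply: (test_dom_ig (g := fun x => `|f x| `^ p) (M := M `^ p) tf mA).
- by apply: mf_normpow; exact: smooth_measurable.
- by move=> x; rewrite ger0_norm ?powR_ge0//; apply: powR_mono (ltW p0) (normr_ge0 _) (fM x).
- by move=> x fx0; rewrite fx0 normr0 powR0// gt_eqF.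
Qed.

Lemma I_powR_sum (w z : V -> R) (A : set V) (r : R) : 0 <= r -> measurable (A : set (lebT R n)) ->
  measurable_fun (A : set (lebT R n)) (w : lebT R n -> R) ->
  measurable_fun (A : set (lebT R n)) (z : lebT R n -> R) ->
  mu.-integrable (A : set (lebT R n)) (EFin \o ((fun x => `|w x| `^ r) : lebT R n -> R)) ->
  mu.-integrable (A : set (lebT R n)) (EFin \o ((fun x => `|z x| `^ r) : lebT R n -> R)) ->
  mu.-integrable (A : set (lebT R n)) (EFin \o ((fun x => `|w x + z x| `^ r) : lebT R n -> R)) /\
  \int[mu]_(x in A) (`|w x + z x| `^ r) <=
  2 `^ r * (\int[mu]_(x in A) (`|w x| `^ r) + \int[mu]_(x in A) (`|z x| `^ r)).
Proof.
move=> r0 mA wm zm wi zi; have i1 := igZ mA (2 `^ r) (igD mA wi zi).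
have h x : `|w x + z x| `^ r <= 2 `^ r * (`|w x| `^ r + `|z x| `^ r) by exact: powR_normD_le.
have i2 : mu.-integrable (A : set (lebT R n)) (EFin \o ((fun x => `|w x + z x| `^ r) : lebT R n -> R)).
  apply: (ig_le mA _ i1); first by apply: mf_normpow; exact: measurable_funD.
  by apply: aeW => x _; rewrite ger0_norm ?powR_ge0.
split; first exact: i2.
rewrite -(RintegralD mA wi zi) -(RintegralZl _ mA (igD mA wi zi)).
by apply: (I_le mA i2 i1).
Qed.

(** The function is split into its deviation from the average over the ambient box, controlled by
    the energy, and the average, controlled by the L^p norm. Passing to the ambient box changes
    neither, since test functions vanish outside the domain. The bound 2 leaves room for
    approximants of a pair of norm at most 1. *)
Lemma sobolev_test (r : R) : p <= r -> 0 < 1 - r / p + r / n.+1%:R ->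
  exists2 K : R, 0 <= K & forall f, test_function Om f -> Npow f + Epow (gradc f) <= 2 ->
    ig (fun x => `|f x| `^ r) /\ \int[mu]_(x in Om) (`|f x| `^ r) <= K.
Proof.
move=> pr s0; have r0 : 0 < r by apply: lt_le_trans pr.
have [L [lo [L0 OQ v0]]] := ambient_box.
have [K [nu [K0 _ H]]] := int_bavg_dist L0 v0 p1 pr s0.
have mQ := measurable_qbox L 0 lo; have rp : 0 <= r / p by rewrite divr_ge0// ltW.
exists (2 `^ r * (K * 2 `^ (r / p) + ((vol n L 0)^-1 * 2) `^ (r / p) * vol n L 0)).
  by rewrite !(mulr_ge0, addr_ge0, powR_ge0)// ltW.
move=> f tf NE.
have N2 : Npow f <= 2 by apply: le_trans NE; rewrite lerDl Epow_ge0.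
have E2 : Epow (gradc f) <= 2 by apply: le_trans NE; rewrite lerDr Npow_ge0.
have tT := test_setT tf.
have [i1 h1] := H f lo 0%N tT; rewrite expr0 mulr1 (test_Epow OQ tf) /= in h1.
have a0 := avg_pow_le L0 v0 p1 tT (test_Np_ig mQ tf); rewrite (test_Npow OQ tf) in a0.
have vi : 0 <= (vol n L 0)^-1 by rewrite invr_ge0 ltW.
have a1 : `|avg L 0 lo f| `^ r <= ((vol n L 0)^-1 * 2) `^ (r / p).
  have -> : `|avg L 0 lo f| `^ r = (`|avg L 0 lo f| `^ p) `^ (r / p).
    by rewrite -powRrM mulrCA mulfV ?mulr1// gt_eqF.
  apply: powR_mono rp (powR_ge0 _ _) _; apply: le_trans a0 _.
  by apply: ler_wpM2l.
have ci := ig_cst mQ (`|avg L 0 lo f| `^ r) (leb_qbox_fin L 0 lo).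
have fm : measurable_fun (qbox L 0 lo : set (lebT R n)) (f : lebT R n -> R).
  by apply: smooth_measurable; exact: test_smooth tf.
have [i2 h2] := @I_powR_sum (fun x => f x - avg L 0 lo f) (fun=> avg L 0 lo f) _ r (ltW r0) mQ
  (measurable_funB fm (measurable_cst _)) (measurable_cst _) i1 ci.
have E : (fun x => `|f x - avg L 0 lo f + avg L 0 lo f| `^ r) = (fun x => `|f x| `^ r).
  by apply/funext => x; rewrite subrK.
rewrite E in i2 h2.
have f0 x : ~ Om x -> `|f x| `^ r = 0.
  by move=> Ox; rewrite (test_out tf Ox) normr0 powR0// gt_eqF.
split; first exact: ig_sub_supp mQ OQ f0 i2.
rewrite -(int_sub_supp OQ f0); apply: le_trans h2 _.
apply: ler_wpM2l; first exact: powR_ge0.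
apply: lerD.
  apply: le_trans h1 _; apply: ler_wpM2l => //; apply: powR_mono => //; exact: Epow_ge0.
rewrite (Rintegral_cst mu mQ) fine_leb_qbox; apply: ler_wpM2r; [exact: ltW|exact: a1].
Qed.

(** Norms of the approximants converge to that of the pair, at most 1, so they are eventually at
    most 2, and only that tail is kept. *)
Lemma Dpair_approx_seq u g : Dpair u g -> Npow u + Epow g <= 1 -> exists f : nat -> V -> R,
  [/\ forall k, test_function Om (f k), forall k, Npow (f k) + Epow (gradc (f k)) <= 2 &
      aeOn Om (fun x => f k x @[k --> \oo] --> u x)].
Proof.
move=> [Lu Lg [f [tf fN fE]]] NE.
have fN' : Npow (fun x => f k x - u x) @[k --> \oo] --> 0.
  by under eq_fun do rewrite NpowBC.
have fE' : Epow (fun x => gradc (f k) x - g x) @[k --> \oo] --> 0.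
  by under eq_fun do rewrite EpowBC.
have c1 := Npow_cvg (fun k => Lp_test (tf k)) Lu fN'.
have c2 := Epow_cvg (fun k => Lpv_gradc (tf k)) Lg fE'.
have lt2 : Npow u + Epow g < 2 by apply: le_lt_trans NE _; rewrite ltr1n.
have c12 : (Npow (f k) + Epow (gradc (f k))) @[k --> \oo] --> Npow u + Epow g by exact: cvgD c1 c2.
have [K _ KP] := cvgr_le _ c12 _ lt2.
have hK : {homo (fun k => k + K)%N : i j / (i < j)%N} by move=> i j; rewrite ltn_add2r.
have [s hs sP] := aeOn_cvg_subseq (fun k => Lp_test (tf (k + K)%N)) Lu (cvg_subseq hK fN').
exists (fun k => f (s k + K)%N); split => //.
by move=> k; apply: KP; exact: leq_addl.
Qed.

Lemma sobolev_embedding (r : R) : p <= r -> 0 < 1 - r / p + r / n.+1%:R ->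
  exists2 K : R, 0 <= K & forall u g, Dpair u g -> Npow u + Epow g <= 1 ->
    ig (fun x => `|u x| `^ r) /\ \int[mu]_(x in Om) (`|u x| `^ r) <= K.
Proof.
move=> pr s0; have r0 : 0 < r by apply: lt_le_trans pr.
have [K K0 H] := sobolev_test pr s0; exists K => // u g ug NE.
have [f [tf fNE fu]] := Dpair_approx_seq ug NE; have [Lu _ _] := ug.
apply: (@fatouR _ (lebT R n) R mu Om mO (fun k x => `|f k x| `^ r)).
- by move=> k; have [] := H _ (tf k) (fNE k).
- by apply: mf_normpow; exact: Lp_mf Lu.
- by move=> k x _; exact: powR_ge0.
- by apply: aeOn1 fu => x _ h; exact: cvg_normpow r0 h.
- by move=> k; have [] := H _ (tf k) (fNE k).
- by move=> x _; exact: powR_ge0.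
Qed.

Lemma morrey_bound : n.+1%:R < p -> exists2 K : R, 0 <= K & forall u g, Dpair u g ->
  Npow u + Epow g <= 1 -> aeOn Om (fun x => `|u x| <= K).
Proof.
move=> Np; have [L [lo [L0 OQ v0]]] := ambient_box.
have [K K0 H] := sup_bavg_dist L0 v0 p1 Np; have mQ := measurable_qbox L 0 lo.
have vi : 0 <= (vol n L 0)^-1 by rewrite invr_ge0 ltW.
have pi : 0 <= p^-1 by rewrite invr_ge0 ltW.
exists (K * 2 `^ p^-1 + ((vol n L 0)^-1 * 2) `^ p^-1).
  by rewrite addr_ge0 ?mulr_ge0 ?powR_ge0.
move=> u g ug NE; have [f [tf fNE fu]] := Dpair_approx_seq ug NE.
apply: aeOn1 fu => x Ox h.
apply: (@cvg_le_cst _ (fun k => `|f k x|)); last exact: cvg_norm h.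
move=> k; have tT := test_setT (tf k).
have N2 : Npow (f k) <= 2 by apply: le_trans (fNE k); rewrite lerDl Epow_ge0.
have E2 : Epow (gradc (f k)) <= 2 by apply: le_trans (fNE k); rewrite lerDr Npow_ge0.
have a0 := avg_pow_le L0 v0 p1 tT (test_Np_ig mQ (tf k)); rewrite (test_Npow OQ (tf k)) in a0.
have h1 := H _ lo x tT (OQ x Ox); rewrite (test_Epow OQ (tf k)) in h1.
rewrite -[X in `|X| <= _](subrK (avg L 0 lo (f k))).
apply: le_trans (ler_normD _ _) _; apply: lerD.
  by apply: le_trans h1 _; apply: ler_wpM2l => //; apply: powR_mono => //; exact: Epow_ge0.
rewrite -[leLHS](powRK p0 (normr_ge0 _)); apply: powR_mono pi (powR_ge0 _ _) _.
by apply: le_trans a0 _; apply: ler_wpM2l.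
Qed.

(** The functions are replaced by test functions f_k with errors at most 1/(k + 1). The difference
    f_i - f_j is split into two tails, uniformly small by [int_bavg_dist] with r = p, and a
    difference of averages over boxes of a fixed level, small for all i, j in a set of the
    ultrafilter. *)
Lemma rellich (u_ : nat -> V -> R) (g_ : nat -> V -> V) (C : R) :
  (forall k, Dpair (u_ k) (g_ k)) -> (forall k, Npow (u_ k) + Epow (g_ k) <= C) ->
  exists (s : nat -> nat) (u : V -> R), [/\ {homo s : i j / (i < j)%N}, Lebesgue p Om u &
    Npow (fun x => u_ (s k) x - u x) @[k --> \oo] --> 0].
Proof.
move=> Dk NE; have [L [lo [L0 OQ v0]]] := ambient_box.
have C0 : 0 <= C by apply: le_trans (NE 0%N); rewrite addr_ge0 ?Npow_ge0 ?Epow_ge0.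
have /choice[f fP] : forall k, exists f, [/\ test_function Om f,
    Npow (fun x => u_ k x - f x) <= k.+1%:R^-1 & Epow (fun x => g_ k x - gradc f x) <= k.+1%:R^-1].
  by move=> k; apply: Dpair_approx (Dk k) _ _; rewrite invr_gt0.
have tf k : test_function Om (f k) by have [] := fP k.
have tT k := test_setT (tf k).
have Lu k : Lebesgue p Om (u_ k) by have [] := Dk k.
have Lg k : Lpv (g_ k) by have [] := Dk k.
pose C1 := 2 `^ p * (C + 1).
have C10 : 0 <= C1 by rewrite mulr_ge0 ?powR_ge0// addr_ge0.
have le1 k : k.+1%:R^-1 <= 1 :> R by rewrite invf_le1// ler1n.
have fN k : Npow (f k) <= C1.
  have [_ h _] := fP k.
  rewrite (@eq_Npow _ (fun x => u_ k x - (u_ k x - f k x))); last by move=> x _; rewrite subKr.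
  apply: le_trans (NpowB (Lu k) (LpB (Lu k) (Lp_test (tf k)))) _.
  apply: ler_wpM2l; first exact: powR_ge0.
  apply: lerD; last exact: le_trans h (le1 k).
  by apply: le_trans (NE k); rewrite lerDl Epow_ge0.
have fE k : Epow (gradc (f k)) <= C1.
  have [_ _ h] := fP k.
  rewrite (@eq_Epow _ (fun x => g_ k x - (g_ k x - gradc (f k) x))); last by move=> x _; rewrite subKr.
  apply: le_trans (EpowB (Lg k) (LpvB (Lg k) (Lpv_gradc (tf k)))) _.
  apply: ler_wpM2l; first exact: powR_ge0.
  apply: lerD; last exact: le_trans h (le1 k).
  by apply: le_trans (NE k); rewrite lerDr Npow_ge0.
have bd k lo' : exists M, forall j, `|avg L k lo' (f j)| <= M.
  exists (((vol n L k)^-1 * C1) `^ p^-1) => j.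
  have vk := vol_gt0 L0 v0 k; have vi : 0 <= (vol n L k)^-1 by rewrite invr_ge0 ltW.
  have i1 := ig_norm (qtest_ig L k lo' (tT j)).
  have i2 := test_Np_ig (measurable_qbox L k lo') (tf j).
  have J := jensen_qbox L0 v0 p1 (fun x => normr_ge0 _) i1 i2.
  have I1 : \int[mu]_(x in qbox L k lo') `|f j x| `^ p <= C1.
    apply: le_trans (fN j); rewrite -(test_Npow (@subsetT _ Om) (tf j)).
    have mT : measurable ([set: V] : set (lebT R n)) by exact: measurableT.
    apply: (I_subset (measurable_qbox L k lo') mT _ (test_Np_ig mT (tf j))) => //.
  have a1 : `|avg L k lo' (f j)| <= (vol n L k)^-1 * \int[mu]_(x in qbox L k lo') `|f j x|.
    rewrite /avg normrM ger0_norm//; apply: ler_wpM2l => //.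
    exact: le_normr_Rintegral (measurable_qbox L k lo') (qtest_ig L k lo' (tT j)).
  rewrite -[leLHS](powRK p0 (normr_ge0 _)); apply: powR_mono; first by rewrite invr_ge0 ltW.
    exact: powR_ge0.
  apply: le_trans (powR_mono (ltW p0) (normr_ge0 _) a1) (le_trans J _).
  exact: ler_wpM2l.
have [U [UU sU]] := ultraFilterLemma eventually_filter.
have s0 : 0 < 1 - p / p + p / n.+1%:R by rewrite mulfV ?gt_eqF// subrr add0r divr_gt0.
have [K [nu [K0 /andP[nu0 nu1] HK]]] := int_bavg_dist L0 v0 p1 (lexx p) s0.
have mQ := measurable_qbox L 0 lo.
have small e : 0 < e -> exists2 S, U S & forall i j, S i -> S j -> Npow (fun x => f i x - f j x) <= e.
  (* [A] bounds what the two tails contribute per unit of nu^k, and [B] what the box averages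
     contribute per unit of d^p; each is allotted e / 2. *)
  move=> e0; pose A := 2 `^ p * (2 `^ p * (K * C1 + K * C1)) + 1.
  have A0 : 0 < A by rewrite ltr_wpDl// !(mulr_ge0, addr_ge0, powR_ge0).
  have nc : nu ^+ k @[k --> \oo] --> 0 by apply: cvg_expr; rewrite ger0_norm// ltW.
  have [k kP] := cvg0_small (fun k => exprn_ge0 k (ltW nu0)) nc (divr_gt0 (divr_gt0 e0 (ltr0Sn R 1)) A0).
  have nuA : nu ^+ k * A <= e / 2 by rewrite -ler_pdivlMr//; exact: kP.
  pose B := 2 `^ p * vol n L 0 + 1.
  have B0 : 0 < B by rewrite ltr_wpDl// mulr_ge0 ?powR_ge0// ltW.
  pose d := (e / 2 / B) `^ p^-1.
  have d0 : 0 < d by rewrite powR_gt0// !divr_gt0.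
  have [S US SP] := @bavg_ultra R n L U f k 0 lo d UU bd d0.
  exists S => // i j Si Sj.
  have tij := testB (tf i) (tf j).
  have mf_ l : measurable_fun (qbox L 0 lo : set (lebT R n)) (f l : lebT R n -> R).
    by apply: smooth_measurable; exact: test_smooth (tf l).
  have mb l : measurable_fun (qbox L 0 lo : set (lebT R n)) ((fun x => bavg L k 0 lo (f l) x) : lebT R n -> R).
    exact: measurable_bavg.
  have ga l : mu.-integrable (qbox L 0 lo : set (lebT R n)) (EFin \o ((fun x => `|f l x - bavg L k 0 lo (f l) x| `^ p) : lebT R n -> R))
      /\ \int[mu]_(x in qbox L 0 lo) (`|f l x - bavg L k 0 lo (f l) x| `^ p) <= K * nu ^+ k * C1.
    have [h1 h2] := HK (f l) lo k (tT l); split => //; apply: le_trans h2 _.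
    rewrite mulfV ?gt_eqF// (test_Epow OQ (tf l)) powRr1 ?Epow_ge0//.
    by apply: ler_wpM2l (fE l); rewrite mulr_ge0// exprn_ge0// ltW.
  have [[i1 h1] [i2 h2]] := (ga i, ga j).
  have i2' : mu.-integrable (qbox L 0 lo : set (lebT R n)) (EFin \o ((fun x => `|bavg L k 0 lo (f j) x - f j x| `^ p) : lebT R n -> R)).
    by under eq_fun do rewrite distrC.
  have h2' : \int[mu]_(x in qbox L 0 lo) (`|bavg L k 0 lo (f j) x - f j x| `^ p) <= K * nu ^+ k * C1.
    by under eq_Rintegral do rewrite distrC.
  have [i3 h3] := I_powR_sum (ltW p0) mQ (measurable_funB (mf_ i) (mb i)) (measurable_funB (mb j) (mf_ j)) i1 i2'.
  have v00 : 0 < vol n L 0 := v0.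
  have dp : d `^ p = e / 2 / B by rewrite /d powRVK// ltW// !divr_gt0.
  have ci := ig_cst mQ (d `^ p) (leb_qbox_fin L 0 lo).
  have i4 : mu.-integrable (qbox L 0 lo : set (lebT R n)) (EFin \o ((fun x => `|bavg L k 0 lo (f i) x - bavg L k 0 lo (f j) x| `^ p) : lebT R n -> R)).
    apply: (ig_le mQ _ ci); first by apply: mf_normpow; exact: measurable_funB.
    by apply: aeW => x _; rewrite ger0_norm ?powR_ge0//; apply: powR_mono (ltW p0) (normr_ge0 _) (SP i j x Si Sj).
  have h4 : \int[mu]_(x in qbox L 0 lo) (`|bavg L k 0 lo (f i) x - bavg L k 0 lo (f j) x| `^ p) <= d `^ p * vol n L 0.
    rewrite -(fine_leb_qbox L 0 lo) -(Rintegral_cst mu mQ).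
    by apply: (I_le mQ i4 ci) => x _; apply: powR_mono (ltW p0) (normr_ge0 _) (SP i j x Si Sj).
  have [i5 h5] := I_powR_sum (ltW p0) mQ
    (measurable_funD (measurable_funB (mf_ i) (mb i)) (measurable_funB (mb j) (mf_ j)))
    (measurable_funB (mb i) (mb j)) i3 i4.
  rewrite -(test_Npow OQ tij).
  rewrite (@I_eq _ (lebT R n) R mu _ _ (fun x => `|(f i x - bavg L k 0 lo (f i) x + (bavg L k 0 lo (f j) x - f j x)) + (bavg L k 0 lo (f i) x - bavg L k 0 lo (f j) x)| `^ p)); last first.
    by move=> x _; congr (`|_| `^ _); ring.
  apply: le_trans h5 _.
  have p2 : 0 <= 2 `^ p :> R by exact: powR_ge0.
  apply: (@le_trans _ _ (2 `^ p * (2 `^ p * (K * nu ^+ k * C1 + K * nu ^+ k * C1) + d `^ p * vol n L 0))).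
    apply: ler_wpM2l => //; apply: lerD => //; apply: le_trans h3 _.
    exact: ler_wpM2l p2 _ _ (lerD h1 h2').
  rewrite mulrDr [leRHS]splitr; apply: lerD.
    apply: le_trans nuA; rewrite (_ : 2 `^ p * _ = nu ^+ k * (A - 1)); last by rewrite /A; ring.
    by rewrite mulrBr mulr1 gerBl exprn_ge0// ltW.
  rewrite dp (_ : 2 `^ p * (e / 2 / B * vol n L 0) = (B - 1) * (e / 2 / B)); last by rewrite /B; ring.
  rewrite mulrBl mul1r (_ : B * (e / 2 / B) = e / 2); last by rewrite mulrC divfK// gt_eqF.
  by rewrite gerBl ltW// !divr_gt0.
have /choice[S SP] : forall q : nat, exists S, U S /\
    forall i j, S i -> S j -> Npow (fun x => f i x - f j x) <= q.+1%:R^-1.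
  by move=> q; have [|S US HS] := small q.+1%:R^-1; [rewrite invr_gt0|exists S].
(* Sets of the ultrafilter are intersected to become decreasing; each meets every tail of the
   indices, so they can be chosen increasing. *)
pose W := fix W q := if q is q'.+1 then W q' `&` S q else S 0%N.
have UW q : U (W q) by elim: q => [|q ih]; [case: (SP 0%N)|apply: filterI; [exact: ih|case: (SP q.+1)]].
have /choice[s1 s1P] : forall qm : nat * nat, exists m, (qm.2 < m)%N /\ W qm.1 m.
  move=> [q m]; have Um : U [set k | (m < k)%N] by apply: sU; exists m.+1.
  by have [k [Wk mk]] := @filter_ex _ _ (@ultra_proper _ _ UU) _ (filterI (UW q) Um); exists k.
pose s := fix s q := if q is q'.+1 then s1 (q, s q') else s1 (0%N, 0%N).
have sS q : W q (s q) by case: q => [|q]; [have [] := s1P (0%N, 0%N)|have [] := s1P (q.+1, s q)].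
have hs : {homo s : i j / (i < j)%N}.
  apply: homo_ltn => [i j k|q]; [exact: ltn_trans|by have [] := s1P (q.+1, s q)].
have WS q l : (q <= l)%N -> W l `<=` S q.
  elim: l => [|l ih]; first by rewrite leqn0 => /eqP ->.
  by rewrite leq_eqVlt => /predU1P[->|/ih h]; [case: l {ih} => [|l] x // []|move=> x [/h]].
have [||e e0|u [s2 [hs2 um ui uN _]]] := @Lp_complete _ (lebT R n) R mu Om mO p (fun q => f (s q)) p0.
- by move=> q; exact: test_mf (tf (s q)).
- by move=> q; exact: Lp_igp (Lp_test (tf (s q))).
- have hp k : 0 <= (k.+1%:R^-1 : R) by rewrite invr_ge0.
  have [q qP] := cvg0_small hp (@cvg_harmonic R) e0; exists q => k l qk ql.
  rewrite -NpowE; apply: le_trans (qP q (leqnn q)).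
  by have [_ h] := SP q; apply: h; [exact: (WS _ _ qk _ (sS k))|exact: (WS _ _ ql _ (sS l))].
have Luu : Lebesgue p Om u by apply/LpP; split; [exact: um|exact: ui].
exists s, u; split => //.
have uN' : Npow (fun x => f (s k) x - u x) @[k --> \oo] --> 0.
  by under eq_fun do rewrite NpowE; exact: uN.
apply: (@cvg0_le _ _ (fun k => 2 `^ p * (1 * (s k).+1%:R^-1 + Npow (fun x => f (s k) x - u x)))).
  move=> k; rewrite Npow_ge0 /= mul1r.
  have [_ h _] := fP (s k).
  rewrite (@eq_Npow _ (fun x => (u_ (s k) x - f (s k) x) + (f (s k) x - u x))); last first.
    by move=> x _; rewrite subrKA.
  apply: le_trans (NpowD (LpB (Lu _) (Lp_test (tf _))) (LpB (Lp_test (tf _)) Luu)) _.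
  by apply: ler_wpM2l; [exact: powR_ge0|rewrite lerD2r].
by apply: cvg0_lin => //; exact: (cvg_subseq hs (@cvg_harmonic R)).
Qed.

(** * Integrability against weights of class X_alpha *)

Lemma young_sum (q q' a b : R) : 1 < q -> q' = q / (q - 1) -> 0 <= a -> 0 <= b ->
  a * b <= a `^ q + b `^ q'.
Proof.
move=> q1 qE a0 b0; have q0 : 0 < q by apply: lt_trans q1.
have qm : 0 < q - 1 by rewrite subr_gt0.
have q'0 : 0 < q' by rewrite qE divr_gt0.
(* The two cases b <= a^(q-1) and a <= b^(1/(q-1)) each bound the product by one of the two
   terms. *)
have [le|lt] := leP b (a `^ (q - 1)).
  apply: (@le_trans _ _ (a `^ q)); last by rewrite lerDl powR_ge0.
  by rewrite -(mulr_powRB1 a0 q0); apply: ler_wpM2l.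
apply: (@le_trans _ _ (b `^ q')); last by rewrite lerDr powR_ge0.
have h : a <= b `^ (q - 1)^-1.
  rewrite -[leLHS](powRK qm a0); apply: powR_mono; [by rewrite invr_ge0 ltW|exact: powR_ge0|exact: ltW].
rewrite -(mulr_powRB1 b0 q'0) mulrC; apply: ler_wpM2l => //.
rewrite (_ : q' - 1 = (q - 1)^-1)//; rewrite qE; field.
by rewrite gt_eqF.
Qed.

(** For p > N the functions are bounded and any exponent will do. Otherwise Young's inequality with
    exponents q and q' separates the weight, in L^q, from u, in L^r with r = beta q'; the definition
    of X_alpha leaves room for a subcritical r > alpha q', that is for beta > alpha. *)
Lemma eta_sobolev (alpha : R) eta : 1 <= alpha <= p -> X_alpha p alpha Om eta ->
  exists beta C : R, alpha < beta /\ forall u g, Dpair u g -> Npow u + Epow g <= 1 ->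
    ig (fun x => `|eta x| * `|u x| `^ beta) /\
    \int[mu]_(x in Om) (`|eta x| * `|u x| `^ beta) <= C.
Proof.
move=> /andP[al1 alp] [X1 X2 X3]; have al0 : 0 < alpha by apply: lt_le_trans al1.
have N0 : 0 < n.+1%:R :> R by rewrite ltr0n.
have [pN|pN] := ltP n.+1%:R p.
  have [em ei] := X1 pN; have [K K0 HK] := morrey_bound pN.
  have ei1 : ig (fun x => `|eta x|).
    apply/(ig_ge0P mu (mf_norm em) (fun x _ => normr_ge0 (eta x))).
    have E : (fun x => (`|eta x| `^ 1)%:E) = (fun x => (`|eta x|)%:E).
      by apply/funext => x; rewrite powRr1.
    by rewrite E in ei.
  exists (alpha + 1), (K `^ (alpha + 1) * \int[mu]_(x in Om) `|eta x|); split.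
    by rewrite ltrDl.
  move=> u g ug NE; have [Lu _ _] := ug; have uK := HK u g ug NE.
  have b0 : 0 <= alpha + 1 by rewrite addr_ge0// ltW.
  have wm : mf (fun x => `|eta x| * `|u x| `^ (alpha + 1)).
    by apply: measurable_funM; [exact: mf_norm|apply: mf_normpow; exact: Lp_mf Lu].
  have i1 := igZ mO (K `^ (alpha + 1)) ei1.
  have le1 : aeOn Om (fun x => `|eta x| * `|u x| `^ (alpha + 1) <= K `^ (alpha + 1) * `|eta x|).
    apply: aeOn1 uK => x _ h; rewrite mulrC; apply: ler_wpM2r => //.
    exact: powR_mono.
  have i2 : ig (fun x => `|eta x| * `|u x| `^ (alpha + 1)).
    apply: (ig_le mO wm i1); apply: aeOn1 le1 => x _ h.
    by rewrite ger0_norm// mulr_ge0 ?powR_ge0.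
  split => //; rewrite -(RintegralZl _ mO ei1).
  exact: (I_le_ae mO i2 i1 le1).
suff [q [r [q1 Lq pr s0 ar]]] : exists q r : R, [/\ 1 < q, Lebesgue q Om eta, p <= r,
    0 < 1 - r / p + r / n.+1%:R & alpha * (q / (q - 1)) < r].
  have q0 : 0 < q by apply: lt_trans q1.
  have qm : 0 < q - 1 by rewrite subr_gt0.
  have q'0 : 0 < q / (q - 1) by rewrite divr_gt0.
  have [em ei] := Lq; have [K K0 HK] := sobolev_embedding pr s0.
  have ei1 : ig (fun x => `|eta x| `^ q).
    by apply/(ig_ge0P mu (mf_normpow q em) (fun x _ => powR_ge0 `|eta x| q)).
  exists (r / (q / (q - 1))), (\int[mu]_(x in Om) (`|eta x| `^ q) + K); split.
    by rewrite ltr_pdivlMr.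
  move=> u g ug NE; have [Lu _ _] := ug; have [ri rK] := HK u g ug NE.
  set b := r / _.
  have le1 x : `|eta x| * `|u x| `^ b <= `|eta x| `^ q + `|u x| `^ r.
    have -> : `|u x| `^ r = (`|u x| `^ b) `^ (q / (q - 1)).
      by rewrite -powRrM /b divfK// gt_eqF.
    exact: (young_sum q1 erefl (normr_ge0 _) (powR_ge0 _ _)).
  have i1 := igD mO ei1 ri.
  have wm : mf (fun x => `|eta x| * `|u x| `^ b).
    by apply: measurable_funM; [exact: mf_norm|apply: mf_normpow; exact: Lp_mf Lu].
  have i2 : ig (fun x => `|eta x| * `|u x| `^ b).
    apply: (ig_le mO wm i1); apply: aeOnW => x _.
    by rewrite ger0_norm// mulr_ge0 ?powR_ge0.
  split => //; apply: le_trans (I_le mO i2 i1 (fun x _ => le1 x)) _.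
  by rewrite (RintegralD mO ei1 ri) lerD2l.
move: pN; rewrite le_eqVlt => /predU1P[pN|pN].
  (* For p = N every r is subcritical, the condition reading 0 < 1. *)
  have [q q1 Lq] := X2 pN; exists q, (Num.max p (alpha * (q / (q - 1))) + 1); split => //.
  - by rewrite ler_wpDr// le_max lexx.
  - by rewrite -pN subrK.
  - by rewrite ltr_pwDr// le_max lexx orbT.
have [q qX Lq] := X3 pN.
have Np : 0 < n.+1%:R - p by rewrite subr_gt0.
pose ps := sobolev_exponent n.+1 p.
have psE : ps = n.+1%:R * p / (n.+1%:R - p) by [].
have ps_p : p < ps.
  by rewrite psE ltr_pdivlMr// mulrC ltr_pM2r// ltrBlDr ltrDl.
pose m := ps / alpha.
have m1 : 1 < m by rewrite ltr_pdivlMr// mul1r; apply: le_lt_trans ps_p.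
have mE : conj_exponent m = m / (m - 1) by [].
rewrite -/ps -/m mE in qX.
have mm : 0 < m - 1 by rewrite subr_gt0.
have q1 : 1 < q by apply: lt_trans qX; rewrite ltr_pdivlMr// mul1r ltrBlDr ltrDl.
have qm : 0 < q - 1 by rewrite subr_gt0.
(* The condition q > m' is equivalent to q' < m, that is alpha q' < [ps]; then r is taken halfway
   between max (p, alpha q') and [ps]. *)
have q'm : q / (q - 1) < m.
  move: qX; rewrite ltr_pdivrMr// => h; rewrite ltr_pdivrMr//; lra.
have aps : alpha * (q / (q - 1)) < ps by rewrite mulrC -ltr_pdivlMr.
pose t := Num.max p (alpha * (q / (q - 1))).
have tps : t < ps by rewrite gt_max ps_p aps.
have pt : p <= t by rewrite le_max lexx.
have at_ : alpha * (q / (q - 1)) <= t by rewrite le_max lexx orbT.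
exists q, ((t + ps) / 2); split => //.
- by lra.
- have rps : (t + ps) / 2 < ps by lra.
  move: rps; set r := (t + ps) / 2; rewrite psE ltr_pdivlMr// => h.
  have -> : 1 - r / p + r / n.+1%:R = (n.+1%:R * p - r * (n.+1%:R - p)) / (n.+1%:R * p).
    by field; rewrite (gt_eqF p0) [1 + _]addrC natr1 pnatr_eq0.
  by rewrite divr_gt0 ?mulr_gt0// subr_gt0.
- by lra.
Qed.

Lemma I_ge0_ae (w : V -> R) : mf w -> aeOn Om (fun x => 0 <= w x) ->
  0 <= \int[mu]_(x in Om) w x.
Proof.
move=> wm w0; rewrite (I_eq_ae mO wm (mf_norm wm)); first by apply: I_ge0.
by apply: aeOn1 w0 => x _ h; rewrite ger0_norm.
Qed.

Lemma measurable_le (v : V -> R) (c : R) : mf v -> mf (fun x => (v x <= c)%R%:R : R).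
Proof.
move=> vm; rewrite (_ : (fun x => _) = (fun x => 1 - (c < v x)%R%:R)); last first.
  by apply/funext => x; rewrite ltNge; case: (v x <= c); rewrite ?subr0 ?subrr.
by apply: measurable_funB; [exact: measurable_cst|exact: measurable_gt].
Qed.

(** X is compared with 2 Y. The coefficient 1/2 of X^p lets the gradient term be absorbed in
    [caccioppoli]. *)
Lemma young_half (X Y : R) : 0 <= X -> 0 <= Y -> X `^ (p - 1) * Y <= X `^ p / 2 + (2 * Y) `^ p.
Proof.
move=> X0 Y0; have pm : 0 <= p - 1 by rewrite subr_ge0 ltW.
have [le|lt] := leP (2 * Y) X.
  apply: (@le_trans _ _ (X `^ p / 2)); last by rewrite lerDl powR_ge0.
  rewrite -(mulr_powRB1 X0 p0) [X * _]mulrC -mulrA; apply: ler_wpM2l; first exact: powR_ge0.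
  by rewrite ler_pdivlMr// mulrC.
apply: (@le_trans _ _ ((2 * Y) `^ p)); last by rewrite lerDr divr_ge0// powR_ge0.
have Y20 : 0 <= 2 * Y by rewrite mulr_ge0.
rewrite -(mulr_powRB1 Y20 p0) mulrC; apply: ler_pM => //; [exact: powR_ge0|lra|].
by apply: powR_mono => //; exact: ltW.
Qed.

(** * Energy estimates for the eigenfunction near its zero level *)

Section strong_maximum.
Variables (phi1 : V -> R) (g1 : V -> V) (lam : R).
Hypotheses (D1 : Dpair phi1 g1) (phi0 : aeOn Om (fun x => 0 < phi1 x)) (lam0 : 0 <= lam).
Hypothesis eqn1 : forall v h, Dpair v h -> \int[mu]_(x in Om) dotv (pgrad p (g1 x)) (h x) =
  lam * \int[mu]_(x in Om) (`|phi1 x| `^ (p - 2) * phi1 x * v x).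

Let below (d : R) (x : V) : R := (phi1 x <= d)%R%:R.

Lemma below01 d x : 0 <= below d x <= 1.
Proof. by rewrite /below; case: (phi1 x <= d); rewrite ?ler01 ?lexx. Qed.

Lemma below_mf d : mf (below d).
Proof. by have [L1 _ _] := D1; apply: measurable_le; exact: Lp_mf L1. Qed.

Lemma below_ig d : ig (below d).
Proof.
apply: (ig_le mO (below_mf d) (ig_cst mO 1 fO)); apply: aeOnW => x _.
by have /andP[a b] := below01 d x; rewrite ger0_norm.
Qed.

(** As phi_1 > 0 almost everywhere, the sets {phi_1 <= 1/(k+1)} shrink to a null set. *)
Lemma below_cvg : \int[mu]_(x in Om) below k.+1%:R^-1 x @[k --> \oo] --> 0.
Proof.
have [||||_ h _] := @dominated_cvgR _ (lebT R n) R mu Om mO (fun k x => below k.+1%:R^-1 x) (fun=> 0)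
  (fun=> 1) (fun k => below_mf _).
- exact: measurable_cst.
- exact: ig_cst mO 1 fO.
- apply: aeOn1 phi0 => x _ p0x; apply: small_cvg0 => [k|e e0].
    by have /andP[] := below01 k.+1%:R^-1 x.
  have hp k : 0 <= (k.+1%:R^-1 : R) by rewrite invr_ge0.
  have p2 : 0 < phi1 x / 2 by rewrite divr_gt0.
  have [K KP] := cvg0_small hp (@cvg_harmonic R) p2; exists K => k /KP le.
  have lt : k.+1%:R^-1 < phi1 x.
    by apply: le_lt_trans le _; rewrite ltr_pdivrMr// ltr_pMr// ltr1n.
  by rewrite /below (lt_geF lt) ltW.
- move=> k; apply: aeOnW => x _.
  by have /andP[a b] := below01 k.+1%:R^-1 x; rewrite ger0_norm.
by rewrite (Rintegral_cst mu mO) mul0r in h.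
Qed.

Variables (psi : V -> R) (C : R).
Hypotheses (tpsi : test_function Om psi) (psi01 : forall x, 0 <= psi x <= 1) (C0 : 0 <= C).
Hypothesis psiC : forall x, euclid (gradc psi x) <= C * psi x `^ ((p - 1) / p).

(* energy estimate near the zero level, from testing with [psi (1 - phi1 / d)^+] *)
Lemma caccioppoli d : 0 < d ->
  \int[mu]_(x in Om) (below d x * (psi x * euclid (g1 x) `^ p)) <=
  2 * (2 * C * d) `^ p * \int[mu]_(x in Om) below d x.
Proof.
move=> d0; have [L1 Lg1 _] := D1; have spsi := test_smooth tpsi.
have bpsi : exists M, forall x, `|psi x| <= M by have [M _ h] := test_bounded tpsi; exists M.
have bdpsi : exists M, forall i x, `|partial i psi x| <= M.
  have [M HM] := test_gradc_bounded (test_setT tpsi); exists M => i x.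
  by apply: le_trans (HM x); have := coord_le_euclid (gradc psi x) i; rewrite mxE.
(* The pair of psi - psi min (phi_1, d) / d, which equals psi (1 - phi_1 / d)^+. *)
have Dv := DpairB (Dpair_test tpsi) (Dpair_testM spsi bpsi bdpsi (DpairZ d^-1 (Dpair_minc (ltW d0) D1))).
have [Lv Lh _] := Dv; have E := eqn1 Dv; have hi := ig_pgrad Lg1 Lh.
set v := (fun x => psi x - _) in Lv E Dv; set h := (fun x => gradc psi x - _) in Lh E hi Dv.
have pe : mf (fun x => psi x * euclid (g1 x) `^ p).
  by apply: measurable_funM; [exact: test_mf tpsi|apply: mf_powR; exact: mf_euclid (Lpv_mf Lg1)].
have ppi : ig (fun x => psi x * euclid (g1 x) `^ p).
  apply: (ig_le mO pe (Lpv_igp Lg1)); apply: aeOnW => x _; have /andP[a b] := psi01 x.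
  by rewrite ger0_norm ?mulr_ge0 ?powR_ge0//; apply: ler_piMl => //; exact: powR_ge0.
have bpi : ig (fun x => below d x * (psi x * euclid (g1 x) `^ p)).
  apply: (ig_le mO (measurable_funM (below_mf d) pe) ppi); apply: aeOnW => x _.
  have /andP[a b] := below01 d x; have /andP[a' b'] := psi01 x.
  rewrite ger0_norm ?mulr_ge0 ?powR_ge0//.
  by apply: ler_piMl => //; rewrite mulr_ge0 ?powR_ge0.
(* The eigenfunction is a supersolution: lam >= 0, and the test function is nonnegative. *)
have RHS0 : 0 <= \int[mu]_(x in Om) dotv (pgrad p (g1 x)) (h x).
  rewrite E; apply: mulr_ge0 => //; apply: I_ge0_ae.
    apply: measurable_funM; last exact: Lp_mf Lv.
    by apply: measurable_funM; [apply: mf_normpow|]; exact: Lp_mf L1.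
  apply: aeOn1 phi0 => x _ px; rewrite mulr_ge0// ?mulr_ge0 ?powR_ge0 ?(ltW px)//.
  rewrite /v -{1}[psi x]mulr1 -mulrBr mulr_ge0//; first by have /andP[] := psi01 x.
  by rewrite subr_ge0 mulrC ler_pdivrMr// mul1r ge_min lexx orbT.
have ptw : aeOn Om (fun x => dotv (pgrad p (g1 x)) (h x) <=
    (- (2 * d)^-1) * (below d x * (psi x * euclid (g1 x) `^ p)) + ((2 * C * d) `^ p / d) * below d x).
  apply: aeOn1 phi0 => x _ px; rewrite /h /below; have /andP[s0 s1] := psi01 x.
  case: (leP (phi1 x) d) => [le|lt]; last first.
    rewrite mulVf ?gt_eqF// scale1r scaler0 scaler0 add0r subrr.
    by rewrite -(scale0r (0 : V)) dotvZr mul0r !mul0r !mulr0 addr0.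
  rewrite !mul1r mulr1.
  set t := d^-1 * phi1 x; have t0 : 0 <= t by apply: mulr_ge0; [rewrite invr_ge0|]; exact: ltW.
  have t1 : t <= 1 by rewrite /t mulrC ler_pdivrMr// mul1r.
  rewrite (_ : gradc psi x - _ = (1 - t) *: gradc psi x - (psi x * d^-1) *: g1 x); last first.
    by rewrite scalerBl scale1r scalerA opprD addrA addrAC.
  rewrite dotvDr dotvNr !dotvZr (dotv_pgradv p1).
  set e := euclid (g1 x); have e0 : 0 <= e by exact: euclid_ge0.
  have ep0 : 0 <= e `^ (p - 1) by exact: powR_ge0.
  have a1 : (1 - t) * dotv (pgrad p (g1 x)) (gradc psi x) <= e `^ (p - 1) * (C * psi x `^ ((p - 1) / p)).
    apply: (@le_trans _ _ (e `^ (p - 1) * euclid (gradc psi x))); last first.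
      by apply: ler_wpM2l => //; exact: psiC.
    apply: le_trans (ler_norm _) _; rewrite normrM.
    rewrite -[leRHS]mul1r; apply: ler_pM => //; first by rewrite ger0_norm ?subr_ge0// gerBl.
    exact: normr_dotv_pgrad_le.
  (* With this X the weight psi^((p-1)/p) allowed by [psiC] turns |g1|^(p-1) into X^(p-1), and psi
     |g1|^p is X^p. *)
  pose X := e * psi x `^ p^-1.
  have X0 : 0 <= X by rewrite mulr_ge0 ?powR_ge0.
  have Xp : X `^ p = e `^ p * psi x by rewrite powRM ?powR_ge0// powRVK.
  have Xp1 : X `^ (p - 1) = e `^ (p - 1) * psi x `^ ((p - 1) / p).
    by rewrite powRM ?powR_ge0// -powRrM [p^-1 * _]mulrC.
  have Cd0 : 0 <= C * d by rewrite mulr_ge0// ltW.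
  have := young_half X0 Cd0; rewrite Xp Xp1 (mulrA 2) => yh.
  have -> : - (2 * d)^-1 * (psi x * e `^ p) + (2 * C * d) `^ p / d =
     (e `^ p * psi x / 2 + (2 * C * d) `^ p) / d - psi x * d^-1 * e `^ p.
    by field; rewrite gt_eqF.
  rewrite lerD2r; apply: le_trans a1 _; rewrite ler_pdivlMr//; apply: le_trans yh.
  by rewrite le_eqVlt; apply/orP; left; apply/eqP; ring.
have i1 := igZ mO (- (2 * d)^-1) bpi; have i2 := igZ mO ((2 * C * d) `^ p / d) (below_ig d).
have := le_trans RHS0 (I_le_ae mO hi (igD mO i1 i2) ptw).
rewrite (RintegralD mO i1 i2) (RintegralZl _ mO bpi) (RintegralZl _ mO (below_ig d)).
move: (\int[mu]_(x in Om) (below d x * _)) (\int[mu]_(x in Om) (below d x)) => I1 I2.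
rewrite mulNr addrC subr_ge0 mulrC ler_pdivrMr ?mulr_gt0// => h2; apply: le_trans h2 _.
by rewrite le_eqVlt; apply/orP; left; apply/eqP; field; rewrite gt_eqF.
Qed.

(** From |g1| / d <= 1 + (|g1| / d)^p, the p-th power being bounded by [caccioppoli], whose factor
    d^p cancels. The gradient of a truncation at height d is thus controlled by the measure of
    {phi_1 <= d}. *)
Lemma gradient_near_zero d : 0 < d ->
  \int[mu]_(x in Om) (below d x * (psi x * (euclid (g1 x) / d))) <=
  (1 + 2 * (2 * C) `^ p) * \int[mu]_(x in Om) below d x.
Proof.
move=> d0; have [L1 Lg1 _] := D1.
have gm := mf_euclid (Lpv_mf Lg1); have pm := test_mf tpsi.
have bm (w : V -> R) : mf w -> mf (fun x => below d x * (psi x * w x)).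
  by move=> wm; apply: measurable_funM; [exact: below_mf|exact: measurable_funM].
have bi (w : V -> R) : mf w -> ig (fun x => `|w x|) -> ig (fun x => below d x * (psi x * w x)).
  move=> wm wi; apply: (ig_le mO (bm _ wm) wi); apply: aeOnW => x _.
  have /andP[a b] := below01 d x; have /andP[a' b'] := psi01 x.
  rewrite !normrM (ger0_norm a) (ger0_norm a') mulrA; apply: ler_piMl => //.
  by rewrite mulr_ile1.
have i1 : ig (fun x => below d x * (psi x * euclid (g1 x) `^ p)).
  apply: bi; first exact: mf_powR.
  by apply: ig_norm; exact: Lpv_igp.
have em : mf (fun x => euclid (g1 x) / d) by apply: measurable_funM => //; exact: measurable_cst.
have i2 : ig (fun x => below d x * (psi x * (euclid (g1 x) / d))).
  apply: bi => //; apply: ig_norm.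
  have := igZ mO d^-1 (Lp_ig (Lpv_euclid Lg1)); apply: eq_integrable => [|x _]; first exact: mO.
  by rewrite /= mulrC.
have ptw x : Om x -> below d x * (psi x * (euclid (g1 x) / d)) <=
    1 * below d x + (d `^ p)^-1 * (below d x * (psi x * euclid (g1 x) `^ p)).
  move=> _; have /andP[a b] := below01 d x; have /andP[a' b'] := psi01 x.
  rewrite (_ : 1 * below d x + _ = below d x * (1 + (d `^ p)^-1 * (psi x * euclid (g1 x) `^ p))); last by ring.
  apply: ler_wpM2l => //.
  have e0 : 0 <= euclid (g1 x) / d by rewrite divr_ge0 ?euclid_ge0// ltW.
  apply: le_trans (ler_wpM2l a' (pow_ge_self e0)) _.
  rewrite mulrDr mulr1; apply: lerD => //.
  have di : 0 <= d^-1 by rewrite invr_ge0 ltW.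
  have dE : d^-1 `^ p = (d `^ p)^-1.
    by rewrite -[d^-1]powR_inv1 ?ltW// -powRrM mulN1r powRN.
  rewrite (powRM _ (euclid_ge0 _) di) dE le_eqVlt; apply/orP; left; apply/eqP.
  by ring.
apply: le_trans (I_lin_le (below_ig d) i1 i2 ptw) _.
rewrite mulrDl; apply: lerD => //.
rewrite mulrC ler_pdivrMr ?powR_gt0//; apply: le_trans (caccioppoli d0) _.
rewrite (powRM _ _ (ltW d0)); last by rewrite mulr_ge0.
by rewrite le_eqVlt; apply/orP; left; apply/eqP; ring.
Qed.

Variable c : V -> R.
Hypotheses (cm : mf c) (c01 : forall x, c x = 0 \/ c x = 1).
Hypothesis Dc : Dpair (fun x => c x * phi1 x) (fun x => c x *: g1 x).

(** The function min (c phi_1 / d, 1) tends to c as d -> 0 wherever phi_1 > 0, while its gradient,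
    carried by {phi_1 <= d}, tends to 0 in L^1 with weight psi. *)
Lemma indicator_zero_gradient i : \int[mu]_(x in Om) (c x * partial i psi x) = 0.
Proof.
have [L1 Lg1 _] := D1.
pose d k : R := k.+1%:R^-1; have d0 k : 0 < d k by rewrite invr_gt0.
pose u k x := Num.min ((d k)^-1 * (c x * phi1 x)) 1.
have Du k := Dpair_minc ler01 (DpairZ (d k)^-1 Dc).
have [M M0 pM] := test_bounded (test_partial i tpsi).
have [M' M'0 pM'] := test_bounded tpsi.
have cvgB : \int[mu]_(x in Om) (u k x * partial i psi x) @[k --> \oo] --> 0.
  apply/norm_cvg0P; apply: (@cvg0_le _ _ (fun k => (1 + 2 * (2 * C) `^ p) * \int[mu]_(x in Om) below (d k) x)).
    move=> k; rewrite normr_ge0 /=; have [_ Lh _] := Du k.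
    rewrite (Dpair_wg (Du k)).2// normrN.
    have i1 := I_mul_le (Lp_ig (Lh i)) (test_mf tpsi) (fun x _ => pM' x).
    apply: le_trans (le_normr_Rintegral mO i1) _; apply: le_trans (gradient_near_zero (d0 k)).
    have Lgk := Lpv_euclid Lg1.
    have i2 : ig (fun x => below (d k) x * (psi x * (euclid (g1 x) / d k))).
      have i3 := igZ mO (d k)^-1 (Lp_ig Lgk).
      apply: (ig_le mO _ i3).
        apply: measurable_funM; first exact: below_mf.
        apply: measurable_funM; first exact: test_mf tpsi.
        by apply: measurable_funM; [exact: Lp_mf Lgk|exact: measurable_cst].
      apply: aeOnW => x _; have /andP[a b] := below01 (d k) x; have /andP[a' b'] := psi01 x.
      have e0 : 0 <= euclid (g1 x) / d k by rewrite divr_ge0 ?euclid_ge0// ltW.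
      rewrite (ger0_norm (mulr_ge0 a (mulr_ge0 a' e0))) mulrA [leRHS]mulrC.
      by apply: ler_piMl => //; rewrite mulr_ile1.
    apply: (I_le_ae mO (ig_norm i1) i2); apply: aeOn1 phi0 => x _ px.
    have /andP[a' b'] := psi01 x.
    rewrite /below; case: (c01 x) => ->; rewrite ?mul0r ?scale0r ?mul1r ?scale1r ?mulr0.
      rewrite ltr10 scaler0 mxE mul0r normr0 mulr_ge0 ?ler0n//.
      by rewrite mulr_ge0 ?divr_ge0 ?euclid_ge0// ltW.
    have -> : (1 < (d k)^-1 * phi1 x) = ~~ (phi1 x <= d k).
      by rewrite -ltNge mulrC ltr_pdivlMr// mul1r.
    case: (phi1 x <= d k) => /=; last by rewrite mxE mul0r normr0 mul0r.
    rewrite mul1r mxE normrM (ger0_norm a') mulrC; apply: ler_wpM2l => //.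
    have dk : 0 <= (d k)^-1 by rewrite invr_ge0 ltW.
    by rewrite normrM (ger0_norm dk) mulrC; apply: ler_wpM2r => //; exact: coord_le_euclid.
  exact: cvg0M below_cvg.
have um k : mf (fun x => u k x * partial i psi x).
  have [Lu _ _] := Du k.
  by apply: measurable_funM; [exact: Lp_mf Lu|exact: test_mf (test_partial i tpsi)].
have [||||_ cvU _] := @dominated_cvgR _ (lebT R n) R mu Om mO (fun k x => u k x * partial i psi x)
    (fun x => c x * partial i psi x) (fun=> M) um.
- by apply: measurable_funM; [exact: cm|exact: test_mf (test_partial i tpsi)].
- exact: ig_cst mO M fO.
- apply: aeOn1 phi0 => x _ px; apply: cvgM; last exact: cvg_cst.
  rewrite /u; case: (c01 x) => ->.
    rewrite (_ : (fun k => _) = fun=> 0); first exact: cvg_cst.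
    by apply/funext => k; rewrite mul0r mulr0 (min_idPl ler01).
  have hp k : 0 <= (k.+1%:R^-1 : R) by rewrite invr_ge0.
  have [K KP] := cvg0_small hp (@cvg_harmonic R) px.
  apply: cvg_near_cst; exists K => // k /= /KP le; rewrite mul1r.
  by apply/min_idPr; rewrite mulrC ler_pdivlMr// mul1r.
- move=> k; apply: aeOn1 phi0 => x _ px; rewrite normrM -[leRHS]mul1r; apply: ler_pM => //.
  have v0 : 0 <= (d k)^-1 * (c x * phi1 x).
    rewrite mulr_ge0 ?invr_ge0 ?(ltW (d0 k))// mulr_ge0 ?(ltW px)//.
    by case: (c01 x) => ->.
  by rewrite ger0_norm ?le_min ?v0 ?ler01// ge_min lexx orbT.
exact: (cvg_unique _ cvU cvgB).
Qed.

End strong_maximum.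

(** * Functions with zero gradient on a connected domain *)

Lemma open_leb_gt0 (U : set V) x : open U -> U x -> (0 < mu U)%E.
Proof.
move=> oU Ux; have [L [lo [L0 _ v0]]] := ambient_box.
have /nbhs_ballP[d /= d0 dU] := open_nbhs_nbhs (conj oU Ux).
have Lc : (fun j : nat => L * 2^-1 ^+ j) @ \oo --> (0 : R).
  by apply: cvg0M; apply: cvg_expr; rewrite ger0_norm; lra.
have L0' j : 0 <= L * 2^-1 ^+ j by rewrite mulr_ge0 ?exprn_ge0// ltW.
have d20 : 0 < d / 2 by rewrite divr_gt0.
have [j jP] := cvg0_small L0' Lc d20.
(* After j rounds over all coordinates the sides are at most L 2^(-j) <= d / 2, so the box at x lies
   in U; its measure is a positive fraction of that of the ambient box. *)
pose k := (j * n.+1)%N.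
have kj : (k %/ n.+1)%N = j by rewrite /k mulnK.
apply: (@lt_le_trans _ _ (mu (qbox L k x))).
  by rewrite leb_qbox lte_fin; exact: vol_gt0.
apply: le_leb_outer => y Qy; apply: dU; split => // i l; rewrite (ord1 i) /ball /=.
have sd := side_le L0 k l; rewrite kj in sd; have := jP j (leqnn j) => jd.
have /andP[a b] := Qy l.
by rewrite ltr_norml; apply/andP; split; lra.
Qed.

Lemma ae_contra (U : set V) x (P : V -> Prop) : open U -> U x ->
  aeOn U P -> aeOn U (fun x => ~ P x) -> False.
Proof.
move=> oU Ux h1 h2; have := open_leb_gt0 oU Ux.
have : mu.-negligible (U : set (lebT R n)).
  have := @filterI _ _ ae_filterT _ _ h1 h2.
  by apply: negligibleS => y Uy; move=> /= [a b]; exact: b Uy (a Uy).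
move=> [A [mA A0 UA]]; rewrite lt_neqAle => /andP[/eqP ne _]; apply: ne.
apply/eqP; rewrite eq_le measure_ge0 /= -A0; exact: le_leb_outer.
Qed.

Local Notation igA A f := (mu.-integrable (A : set (lebT R n)) (EFin \o (f : lebT R n -> R))).

Section zero_gradient.
Context (cO : connected Om) (c : V -> R) (cm : mf c) (c01 : forall x, c x = 0 \/ c x = 1).
Hypothesis bump0 : forall B e i, 0 < e -> cbox B `<=` Om ->
  \int[mu]_(x in Om) (c x * partial i (bump e B) x) = 0.

Let cn1 x : `|c x| <= 1. Proof. by case: (c01 x) => ->; rewrite ?normr0 ?normr1. Qed.

Let ci : ig c.
Proof. by apply: (ig_le mO cm (ig_cst mO 1 fO)); apply: aeOnW => x _; exact: cn1. Qed.

Let shiftB (B : V * V) (T : R) i : V * V := (B.1 - T *: delta_mx ord0 i, B.2 - T *: delta_mx ord0 i).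

Lemma bump_shift e B T i x : bump e B (x + T *: delta_mx ord0 i) = bump e (shiftB B T i) x.
Proof.
apply: eq_bigr => j _; rewrite !mxE; congr (flat _ _ _ * flat _ _ _); ring.
Qed.

(** The derivative of the integral along the translation is the pairing of c with a partial
    derivative of the moved bump, zero by hypothesis. *)
Lemma int_bump_shift B T e i : 0 < e -> 0 <= T ->
  (forall t, 0 <= t <= T -> cbox (shiftB B t i) `<=` Om) ->
  \int[mu]_(x in Om) (c x * bump e B x) = \int[mu]_(x in Om) (c x * bump e (shiftB B T i) x).
Proof.
move=> e0 T0 H.
have tb : test_function setT (bump e B) by exact: test_bump.
have sb := smooth_bump B e0.
have d t := is_derive_slide i t mO ci tb.
have E t : (fun y => bump e B (y + t *: delta_mx ord0 i)) = bump e (shiftB B t i).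
  by apply/funext => y; rewrite bump_shift.
have z t : 0 <= t <= T ->
    `|\int[mu]_(x in Om) (c x * partial i (bump e B) (x + t *: delta_mx ord0 i))| <= 0.
  move=> tT; rewrite -(bump0 i e0 (H t tT)).
  rewrite (@I_eq _ (lebT R n) R mu Om
    (fun x => c x * partial i (bump e B) (x + t *: delta_mx ord0 i))
    (fun x => c x * partial i (bump e (shiftB B t i)) x)).
    by rewrite (bump0 i e0 (H t tT)) normr0.
  by move=> x _; rewrite -(E t) (partial_shift i x _ sb).
have := is_derive_slide_mono T0 d z; rewrite mul0r normr_le0 subr_eq0 => /eqP h.
rewrite (@I_eq _ (lebT R n) R mu Om (fun x => c x * bump e (shiftB B T i) x)
  (fun x => c x * bump e B (x + T *: delta_mx ord0 i))); last by move=> x _; rewrite bump_shift.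
by rewrite h; apply: I_eq => x _; rewrite scale0r addr0.
Qed.

Lemma cvg_int_indic (A : nat -> V -> R) (D : set V) : (forall k, mf (A k)) ->
  (forall k x, `|A k x| <= 1) -> (forall x, A k x @[k --> \oo] --> (\1_D x : R)) ->
  measurable (D : set (lebT R n)) ->
  \int[mu]_(x in Om) (c x * A k x) @[k --> \oo] --> \int[mu]_(x in Om) (c x * \1_D x).
Proof.
move=> Am A1 Ac mD.
have [||||_ h _] := @dominated_cvgR _ (lebT R n) R mu Om mO (fun k x => c x * A k x)
    (fun x => c x * \1_D x) (fun=> 1) (fun k => measurable_funM cm (Am k)).
- by apply: measurable_funM => //; exact: measurable_indic.
- exact: ig_cst mO 1 fO.
- by apply: aeOnW => x _; apply: cvgM; [exact: cvg_cst|exact: Ac].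
- by move=> k; apply: aeOnW => x _; rewrite normrM -[leRHS]mulr1; apply: ler_pM.
exact: h.
Qed.

Lemma int_obox_shift B T i : 0 <= T ->
  (forall t, 0 <= t <= T -> cbox (shiftB B t i) `<=` Om) ->
  \int[mu]_(x in Om) (c x * \1_(obox B) x) =
  \int[mu]_(x in Om) (c x * \1_(obox (shiftB B T i)) x).
Proof.
move=> T0 H; have k0 k : 0 < (k.+1%:R^-1 : R) by rewrite invr_gt0.
have b1 (B' : V * V) (k : nat) (x : V) : `|bump k.+1%:R^-1 B' x| <= 1.
  by rewrite ger0_norm ?bump_ge0// bump_le1// ltW.
have cv B' := @cvg_int_indic (fun k => bump k.+1%:R^-1 B') (obox B')
  (fun k => smooth_measurable (smooth_bump B' (k0 k)))
  (b1 B') (fun x => @cvg_bump R n B' x) (measurable_obox B').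
have h2 := cv (shiftB B T i).
have E : (fun k => \int[mu]_(x in Om) (c x * bump k.+1%:R^-1 B x)) =
    (fun k => \int[mu]_(x in Om) (c x * bump k.+1%:R^-1 (shiftB B T i) x)).
  by apply/funext => k; exact: int_bump_shift (k0 k) T0 H.
have h1 := cv B; rewrite E in h1.
exact: (cvg_unique _ h1 h2).
Qed.

(** Half-open boxes are limits of open boxes whose lower corner recedes by d / (k + 1). *)
Lemma int_hbox_shift (a b lo hi : V) T i : cbox (a, b) `<=` Om ->
  (forall j, a ord0 j < lo ord0 j - (j == i)%:R * T) -> (forall j, hi ord0 j <= b ord0 j) -> 0 <= T ->
  \int[mu]_(x in Om) (c x * \1_(hbox (lo, hi)) x) =
  \int[mu]_(x in Om) (c x * \1_(hbox (shiftB (lo, hi) T i)) x).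
Proof.
move=> abO alo hib T0.
(* The margin between the moved box and the lower corner of the larger box (a, b): receding by at
   most d keeps all the closed boxes in the domain. *)
pose d : V := lo - T *: delta_mx ord0 i - a.
have dE j : d ord0 j = lo ord0 j - (j == i)%:R * T - a ord0 j by rewrite !mxE eqxx /= mulrC.
have d0 j : 0 < d ord0 j by rewrite dE subr_gt0; exact: alo.
pose low (l : V) k : V := l - k.+1%:R^-1 *: d.
have lowE (l : V) k j : low l k ord0 j = l ord0 j - k.+1%:R^-1 * d ord0 j by rewrite 3!mxE.
have k0 k : 0 < (k.+1%:R^-1 : R) by rewrite invr_gt0.
have k1 k : (k.+1%:R^-1 : R) <= 1 by rewrite invf_le1// ler1n.
have cv (l h : V) : \int[mu]_(x in Om) (c x * \1_(obox (low l k, h)) x) @[k --> \oo] -->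
    \int[mu]_(x in Om) (c x * \1_(hbox (l, h)) x).
  apply: cvg_int_indic.
  - by move=> k; apply: measurable_indic; exact: measurable_obox.
  - by move=> k x; rewrite indicE; case: (_ \in _); rewrite ?normr1 ?normr0.
  - move=> x; have [hx|hx] := pselect (hbox (l, h) x).
      apply: cvg_near_cst; exists 0%N => // k _ /=; rewrite !indicE !mem_set// => j.
      have /andP[h1 h2] := hx j; rewrite /= in h1 h2; apply/andP; split => //=.
      apply: lt_le_trans h1; have q := mulr_gt0 (k0 k) (d0 j).
      by rewrite lowE gtrBl.
    move: hx => /existsNP[j hj]; rewrite [X in _ --> X]indicE memNset; last by move=> /(_ j).
    have [lx|xl] := leP (l ord0 j) (x ord0 j).
      apply: cvg_near_cst; exists 0%N => // k _ /=; rewrite indicE memNset// => /(_ j) /andP[_ h2].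
      by apply: hj; rewrite /= lx.
    have e0 : 0 < (l ord0 j - x ord0 j) / d ord0 j by rewrite divr_gt0// subr_gt0.
    have hp k : 0 <= (k.+1%:R^-1 : R) by rewrite invr_ge0.
    have [K KP] := cvg0_small hp (@cvg_harmonic R) e0.
    apply: cvg_near_cst; exists K => // k /= /KP le; rewrite indicE memNset// => /(_ j) /andP[h1 _].
    move: h1; rewrite [_.1]/= lowE; move: le; rewrite ler_pdivlMr ?d0//; move: (k.+1%:R^-1 * d ord0 j) => z; lra.
  - exact: measurable_hbox.
have E k : \int[mu]_(x in Om) (c x * \1_(obox (low lo k, hi)) x) =
    \int[mu]_(x in Om) (c x * \1_(obox (low (lo - T *: delta_mx ord0 i) k, hi - T *: delta_mx ord0 i)) x).
  have -> : (low (lo - T *: delta_mx ord0 i) k, hi - T *: delta_mx ord0 i) =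
      shiftB (low lo k, hi) T i by rewrite /shiftB /low /= addrAC.
  apply: (int_obox_shift T0).
  move=> t /andP[t0 tT] x hx; apply: abO => j; have := hx j.
  have := alo j; have := hib j; have := dE j; have := d0 j; have := k1 k; have := k0 k.
  rewrite /= !mxE /= -(mulrC (j == i)%:R).
  case: (j == i) => /=; rewrite ?mul1r ?mul0r ?mulr1 ?mulr0 ?subr0 => q0 q1 dj0 -> h1 h2 /andP[h3 h4].
    apply/andP; split; last by lra.
    have : k.+1%:R^-1 * (lo ord0 j - T - a ord0 j) <= lo ord0 j - T - a ord0 j.
      by apply: ler_piMl => //; rewrite subr_ge0 ltW.
    move: h3; move: (k.+1%:R^-1 * _) => z; lra.
  apply/andP; split; last by lra.
  have : k.+1%:R^-1 * (lo ord0 j - a ord0 j) <= lo ord0 j - a ord0 j.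
    by apply: ler_piMl => //; rewrite subr_ge0 ltW.
  move: h3; move: (k.+1%:R^-1 * _) => z; lra.
have h1 := cv lo hi; rewrite (funext E) in h1.
exact: (cvg_unique _ h1 (cv _ _)).
Qed.

Lemma obox_sub_qbox (L : R) (lo : V) : obox (lo, lo + \row_j L) `<=` qbox L 0 lo.
Proof.
move=> x Ux j; have /andP[q1] := Ux j; rewrite !mxE => q2.
rewrite (ltW q1) /=; apply: lt_le_trans q2 _; rewrite lerD2l /side add0n divn_small ?expr0 ?mulr1//.
by rewrite ltnS leq_subr.
Qed.

Section dyadic.
Context (L : R) (L0 : 0 < L) (v0 : 0 < vol n L 0) (a b : V) (abO : cbox (a, b) `<=` Om).

Let inside k (lo : V) := forall j, a ord0 j < lo ord0 j /\ lo ord0 j + side L k j <= b ord0 j.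

Lemma inside_lo k lo : inside k lo -> inside k.+1 lo.
Proof.
move=> h j; have [h1 h2] := h j; split=> //; apply: le_trans h2; rewrite lerD2l.
have := sideS L0 k j; have := side_gt0 L0 k.+1 j.
by case: (j == cdir n k) => s0 ->; lra.
Qed.

Lemma inside_up k lo : inside k lo -> inside k.+1 (up L k lo).
Proof.
move=> h j; have [h1 h2] := h j; rewrite upE; have s0 := side_gt0 L0 k.+1 j.
have sE := sideS L0 k j; move: h1 h2 s0 sE.
have [->|ne] := eqVneq j (cdir n k); rewrite ?mul1r ?mul0r ?addr0 => h1 h2 s0 sE; last first.
  by split=> //; rewrite -sE.
by split; lra.
Qed.

Lemma inside_sub k lo : inside k lo -> qbox L k lo `<=` Om.
Proof.
move=> h x Qx; apply: abO => j; have [h1 h2] := h j; have /andP[h3 h4] := Qx j.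
by apply/andP; split; [exact/ltW/(lt_le_trans h1)|exact/ltW/(lt_le_trans h4)].
Qed.


Lemma int_indic_om (A : set V) (w : V -> R) : A `<=` Om ->
  \int[mu]_(x in Om) (w x * \1_A x) = \int[mu]_(x in A) w x.
Proof.
move=> AO; transitivity (\int[mu]_x (w x * \1_A x)).
  by apply/esym/int_supp => x nx; rewrite indicE memNset ?mulr0// => /AO.
rewrite (@int_supp R n A) => [|x nx]; last by rewrite indicE memNset ?mulr0.
by apply: I_eq => x Ax; rewrite indicE mem_set// mulr1.
Qed.

Lemma qbox_shift_int k lo T i : inside k lo -> inside k (lo + T *: delta_mx ord0 i) -> 0 <= T ->
  \int[mu]_(x in qbox L k (lo + T *: delta_mx ord0 i)) c x = \int[mu]_(x in qbox L k lo) c x.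
Proof.
move=> h h' T0; rewrite -(int_indic_om _ (inside_sub h)) -(int_indic_om _ (inside_sub h')).
rewrite !qboxE (@int_hbox_shift a b _ _ T i abO _ _ T0).
- by rewrite /shiftB /= addrK (addrAC _ _ (\row_i0 _)) addrK.
- by move=> j; have [h1 _] := h j; rewrite !mxE eqxx /= (mulrC T) addrK.
- by move=> j; have [_] := h' j; rewrite !mxE.
Qed.

Let S k lo := \int[mu]_(x in qbox L k lo) c x.

Lemma ig_c_qbox k lo : inside k lo -> igA (qbox L k lo) c.
Proof.
by move=> h; apply: integrableS ci => //; [exact: mO|exact: measurable_qbox|exact: inside_sub h].
Qed.

(** The two halves are translates of each other inside the domain, hence carry equal integrals of
    c. *)
Lemma qbox_c_half k lo : inside k lo ->
  S k.+1 lo = S k lo / 2 /\ S k.+1 (up L k lo) = S k lo / 2.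
Proof.
move=> h; have := int_qbox_split L0 (ig_c_qbox h); rewrite -/(S k lo).
have := qbox_shift_int (inside_lo h) (inside_up h) (ltW (side_gt0 L0 k.+1 (cdir n k))).
by rewrite -/(up L k lo) -/(S k.+1 lo) -/(S k.+1 (up L k lo)) => -> ->; split; lra.
Qed.

(** By iterated halving the integral of c over a sub-box is proportional to its measure, so c acts
    as a constant against functions that are constant on the small boxes. *)
Lemma int_c_bavg m k lo f : inside k lo -> test_function setT f ->
  \int[mu]_(x in qbox L k lo) (c x * bavg L m k lo f x) =
  (vol n L k)^-1 * S k lo * \int[mu]_(x in qbox L k lo) bavg L m k lo f x.
Proof.
move=> h tf; elim: m k lo h => [|m IH] k lo h.
  rewrite /= Rintegral_cst ?fine_leb_qbox; last by exact: measurable_qbox.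
  rewrite RintegralZr; [|exact: measurable_qbox|exact: ig_c_qbox].
  have v1 := lt0r_neq0 (vol_gt0 L0 v0 k).
  by rewrite -/(S k lo); field.
have [M M0 fM] := test_bounded tf.
have bb j k' lo' x : `|bavg L j k' lo' f x| <= M by exact: bavg_bounded.
have mb j k' lo' : measurable_fun (setT : set (lebT R n)) (bavg L j k' lo' f : lebT R n -> R).
  exact: measurable_bavg.
have mb' j k' lo' A : measurable_fun (A : set (lebT R n)) (bavg L j k' lo' f : lebT R n -> R).
  exact: measurable_bavg.
have ib j k' lo' k2 lo2 : igA (qbox L k2 lo2) (bavg L j k' lo' f).
  by apply: (@qbounded_ig _ _ _ _ _ _ M setT).
have icb j k' lo' k2 lo2 : inside k2 lo2 ->
    igA (qbox L k2 lo2) (fun x => c x * bavg L j k' lo' f x).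
  move=> hh; have mQ := measurable_qbox L k2 lo2.
  have q := igZ mQ M (ig_norm (ig_c_qbox hh)).
  apply: (ig_le mQ _ q).
    by apply: measurable_funM; [exact: ig_mf (ig_c_qbox hh)|exact: mb'].
  by apply: aeW => x _; rewrite normrM mulrC; apply: ler_wpM2r.
have [hl hu] := (inside_lo h, inside_up h).
have [Sl Su] := qbox_c_half h.
rewrite (int_qbox_split L0 (icb m.+1 k lo k lo h)) (int_qbox_split L0 (ib m.+1 k lo k lo)) mulrDr.
have E c' (g : V -> R -> R) : c' = lo \/ c' = up L k lo ->
    \int[mu]_(x in qbox L k.+1 c') g x (bavg L m.+1 k lo f x) =
    \int[mu]_(x in qbox L k.+1 c') g x (bavg L m k.+1 c' f x).
  by move=> hc; apply: I_eq => x Qx; congr (g x _); case: hc Qx => -> Qx;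
    [exact: bavg_lo Qx|exact: bavg_up Qx].
rewrite (E lo (fun x y => c x * y) (or_introl erefl)) (E _ (fun x y => c x * y) (or_intror erefl)).
rewrite (E lo (fun _ y => y) (or_introl erefl)) (E _ (fun _ y => y) (or_intror erefl)).
rewrite (IH _ _ hl) (IH _ _ hu) Sl Su.
have vE : (vol n L k.+1)^-1 * (S k lo / 2) = (vol n L k)^-1 * S k lo.
  have v1 := lt0r_neq0 (vol_gt0 L0 v0 k.+1).
  by rewrite (volS n L0 k); field.
by rewrite vE.
Qed.

Lemma c_const_qbox lo : inside 0 lo ->
  exists th : R, forall f, test_function setT f ->
  \int[mu]_(x in qbox L 0 lo) (c x * f x) = th * \int[mu]_(x in qbox L 0 lo) f x.
Proof.
move=> h; exists ((vol n L 0)^-1 * S 0 lo) => f tf.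
have [M M0 fM] := test_bounded tf; have mQ := measurable_qbox L 0 lo.
have bb m x : `|bavg L m 0 lo f x| <= M by exact: bavg_bounded.
have mb m : measurable_fun (qbox L 0 lo : set (lebT R n)) (bavg L m 0 lo f : lebT R n -> R).
  exact: measurable_bavg.
have mff : measurable_fun (qbox L 0 lo : set (lebT R n)) (f : lebT R n -> R).
  by apply: smooth_measurable; exact: test_smooth tf.
have ic := ig_c_qbox h; have icm := ig_mf ic.
have iM : igA (qbox L 0 lo) (fun=> M) := ig_cst mQ M (leb_qbox_fin L 0 lo).
have [||||_ h1 _] := @dominated_cvgR _ (lebT R n) R mu (qbox L 0 lo) mQ
    (fun m x => c x * bavg L m 0 lo f x) (fun x => c x * f x) (fun=> M)
    (fun m => measurable_funM icm (mb m)).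
- exact: measurable_funM.
- exact: iM.
- by apply: aeW => x Qx; apply: cvgM; [exact: cvg_cst|exact: cvg_bavg].
- by move=> m; apply: aeW => x _; rewrite normrM -[leRHS]mul1r; apply: ler_pM.
have [||||_ h2 _] := @dominated_cvgR _ (lebT R n) R mu (qbox L 0 lo) mQ
    (fun m x => bavg L m 0 lo f x) f (fun=> M) mb.
- exact: mff.
- exact: iM.
- by apply: aeW => x Qx; exact: cvg_bavg.
- by move=> m; apply: aeW => x _.
rewrite (funext (fun m => int_c_bavg m h tf)) in h1.
apply: (cvg_unique _ h1) => //; apply: cvgM h2; exact: cvg_cst.
Qed.

(** Against test functions of the open box c - th integrates to zero, so the fundamental lemma
    applies. *)
Lemma c_ae_const lo : inside 0 lo ->
  exists th : R, aeOn (obox (lo, lo + \row_j L)) (fun x => c x = th).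
Proof.
move=> h; have [th H] := c_const_qbox h; exists th.
pose U := obox (lo, lo + \row_j L).
have UQ : U `<=` qbox L 0 lo by exact: obox_sub_qbox.
have oU : open U by exact: open_obox.
have mU := leb_open_measurable oU.
have icU : igA U c.
  by apply: integrableS (ig_c_qbox h) => //; exact: measurable_qbox.
have fU : (mu U < +oo)%E.
  by apply: le_lt_trans (leb_qbox_fin L 0 lo); exact: le_leb_outer.
have i1 : igA U (fun=> th) := ig_cst mU th fU.
have : \forall x \ae mu, U x -> c x - th = 0.
  apply: test_int0_ae => //; first by have q := igB mU icU i1.
  move=> f tf; have tfT := testS (@subsetT _ U) tf.
  have f0 x : ~ U x -> f x = 0 by move=> Ux; case: tf => _ [K [_ KU K0]]; apply: K0 => /KU.
  have ifU : igA U f := test_ig tf mU.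
  have icf : igA U (fun x => c x * f x).
    apply: (ig_le mU _ (ig_norm ifU)).
      by apply: measurable_funM; [exact: ig_mf icU|exact: ig_mf ifU].
    by apply: aeW => x _; rewrite normrM; apply: ler_piMl.
  have E (g : V -> R) : (forall x, ~ U x -> g x = 0) ->
      \int[mu]_(x in U) g x = \int[mu]_(x in qbox L 0 lo) g x.
    by move=> g0; rewrite -(int_supp g0) (@int_supp R n (qbox L 0 lo))// => x Qx; apply: g0 => /UQ.
  rewrite (@I_eq _ (lebT R n) R mu U (fun x => (c x - th) * f x) (fun x => c x * f x - th * f x)).
    rewrite RintegralB//; last by have q := igZ mU th ifU.
    rewrite RintegralZl// (E f f0) (E (fun x => c x * f x)).
      by rewrite (H f tfT) subrr.
    by move=> x /f0 ->; rewrite mulr0.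
  by move=> x _; rewrite mulrBl.
by apply: (@filterS _ _ ae_filterT) => x hx Ux; apply/eqP; rewrite -subr_eq0; apply/eqP; exact: hx.
Qed.

End dyadic.

(** The constant is 0 or 1 because the small box has positive measure and c takes no other value. *)
Lemma c_local_const x : Om x -> exists k (b : bool),
  obox (rbox R n k) x /\ aeOn (obox (rbox R n k)) (fun y => c y = b%:R).
Proof.
move=> Ox; have /nbhs_ballP[d /= d0 dO] := open_nbhs_nbhs (conj oO Ox).
have d40 : 0 < d / 4 by rewrite divr_gt0.
pose L := d / 2; have L0 : 0 < L by rewrite divr_gt0.
pose lo : V := x - const_mx (d / 4).
have xU : obox (lo, lo + \row_j L) x.
  by move=> j; rewrite /= !mxE /L; apply/andP; split; lra.
have v0 : 0 < vol n L 0.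
  rewrite -lte_fin -(leb_qbox L 0 lo); apply: lt_le_trans (open_leb_gt0 (@open_obox R n _) xU) _.
  by apply: le_leb_outer; exact: obox_sub_qbox.
pose a : V := x - const_mx (d / 2); pose b : V := x + const_mx (d / 2).
have abO : cbox (a, b) `<=` Om.
  move=> y hy; apply: dO; split => // i l; rewrite (ord1 i) /ball /=.
  by have /andP[] := hy l; rewrite /= !mxE ltr_norml => q1 q2; apply/andP; split; lra.
have [|th hth] := @c_ae_const L L0 v0 a b abO lo.
  move=> j; rewrite !mxE /side add0n divn_small ?expr0 ?mulr1 ?ltnS ?leq_subr// /L.
  by split; lra.
have [k [kx kU]] := open_rbox (@open_obox R n _) xU.
have thE : exists b : bool, th = b%:R.
  apply: contrapT => nb; apply: (ae_contra (@open_obox R n _) xU hth).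
  apply: aeW => y _ cy; apply: nb; case: (c01 y) => e; [exists false|exists true]; rewrite -cy e//.
have [b' bE] := thE; exists k, b'; split => //.
apply: (@filterS _ _ ae_filterT _ _ _ hth) => y hy /obox_cbox /kU Uy; rewrite -bE; exact: hy.
Qed.

(** The union of the rational boxes where c is a.e. 0 and that of the boxes where it is a.e. 1 are
    open and cover the domain. They are disjoint, because an overlap would be a nonempty open set,
    of positive measure. *)
Lemma c_connected : aeOn Om (fun x => c x = 0) \/ aeOn Om (fun x => c x = 1).
Proof.
pose A (b : bool) : set V := \bigcup_(k in [set k | aeOn (obox (rbox R n k)) (fun y => c y = b%:R)])
  obox (rbox R n k).
have oA b : open (A b) by apply: bigcup_open => k _; exact: open_obox.
have aeA b : aeOn (A b) (fun y => c y = b%:R).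
  have : \forall x \ae mu, forall k, aeOn (obox (rbox R n k)) (fun y => c y = b%:R) ->
      obox (rbox R n k) x -> c x = b%:R.
    apply/ae_foralln => k.
    have [hk|nk] := pselect (aeOn (obox (rbox R n k)) (fun y => c y = b%:R)).
      by apply: (@filterS _ _ ae_filterT _ _ _ hk) => x hx _; exact: hx.
    by apply: aeW => x /nk.
  by apply: (@filterS _ _ ae_filterT) => x hx [k /= hk kx]; exact: hx hk kx.
have dis x : A false x -> A true x -> False.
  move=> Ax Bx; have oI := openI (oA false) (oA true).
  have i1 : aeOn (A false `&` A true) (fun y => c y = 0).
    by apply: (@filterS _ _ ae_filterT _ _ _ (aeA false)) => y hy [/hy].
  have i2 : aeOn (A false `&` A true) (fun y => c y <> 0).
    by apply: (@filterS _ _ ae_filterT _ _ _ (aeA true)) => y hy [_ /hy ->] /eqP; rewrite oner_eq0.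
  exact: ae_contra oI (conj Ax Bx) i1 i2.
have cov x : Om x -> A false x \/ A true x.
  by move=> Ox; have [k [[] [kx hk]]] := c_local_const Ox; [right|left]; exists k.
have [[x [Ox Ax]]|no] := pselect (exists x, Om x /\ A false x).
  left; have E : Om `&` A false = Om.
    apply: cO; first by exists x.
    - by exists (A false).
    - exists (~` A true); first exact: open_closedC.
      apply/seteqP; split => y [Oy hy]; split => //; first by move=> /(dis _ hy).
      by case: (cov y Oy).
  rewrite -E; apply: (@filterS _ _ ae_filterT _ _ _ (aeA false)) => y hy [_]; exact: hy.
right; apply: (@filterS _ _ ae_filterT _ _ _ (aeA true)) => y hy Oy; apply: hy.
by case: (cov y Oy) => // ay; exfalso; apply: no; exists y.
Qed.

End zero_gradient.

(** The bump is th^m with m > p, so its gradient is m th^(m-1) grad th, and th^(m-1) <=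
    (th^m)^((p-1)/p) because 0 <= th <= 1 and m - 1 >= m (p - 1) / p. *)
Lemma bump_gradient_bound (B : V * V) (e : R) : 0 < e -> exists2 C, 0 <= C & forall x,
  euclid (gradc (bump e B) x) <= C * bump e B x `^ ((p - 1) / p).
Proof.
move=> e0; pose m := (Num.truncn p).+1; have pm : p < m%:R := real_truncnS_gt (num_real p).
have m0 : (0 < m)%N by []; have mR : 0 < (m%:R : R) by rewrite ltr0n.
have em0 : 0 < e / m%:R by rewrite divr_gt0.
pose th := bump (e / m%:R) B; have sth : smooth th by exact: smooth_bump.
have E : bump e B = (fun x => th x ^+ m).
  by apply/funext => x; rewrite bumpX// mulrC divfK ?gt_eqF.
have tth : test_function setT th by exact: test_bump.
have [M MP] := test_gradc_bounded tth.
have M0 : 0 <= M by apply: le_trans (MP 0); exact: euclid_ge0.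
exists (m%:R * M) => [|x]; first by rewrite mulr_ge0.
have t0 : 0 <= th x by exact: bump_ge0.
have t1 : th x <= 1 by apply: bump_le1; exact: ltW.
have -> : gradc (bump e B) x = (m%:R * th x ^+ m.-1) *: gradc th x.
  by apply/rowP => i; rewrite !mxE E partialX.
rewrite euclidZ ger0_norm ?mulr_ge0 ?exprn_ge0// -!mulrA; apply: ler_wpM2l => //.
rewrite mulrC; apply: ler_pM => //; [exact: euclid_ge0|exact: exprn_ge0|].
rewrite E -powR_mulrn// -powR_mulrn// -powRrM; have [tx0|tn0] := eqVneq (th x) 0.
  have m1 : (m.-1%:R : R) != 0 by rewrite pnatr_eq0 -lt0n truncn_gt0 ltW.
  by rewrite tx0 powR0.
apply: ger_powR; first by rewrite lt_def tn0 t0.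
have -> : (m.-1%:R : R) = m%:R - 1 by rewrite /m /= -[in RHS]natr1 addrK.
rewrite mulrA ler_pdivrMr; last exact: p0.
by rewrite mulrBr mulr1 mulrBl mul1r lerD2l lerN2 ltW.
Qed.

Lemma indicator_trivial (cO : connected Om) (phi1 : V -> R) (g1 : V -> V) (lam : R) (c : V -> R) :
  Dpair phi1 g1 -> aeOn Om (fun x => 0 < phi1 x) -> 0 <= lam ->
  (forall v h, Dpair v h -> \int[mu]_(x in Om) dotv (pgrad p (g1 x)) (h x) =
    lam * \int[mu]_(x in Om) (`|phi1 x| `^ (p - 2) * phi1 x * v x)) ->
  mf c -> (forall x, c x = 0 \/ c x = 1) -> Dpair (fun x => c x * phi1 x) (fun x => c x *: g1 x) ->
  aeOn Om (fun x => c x = 0) \/ aeOn Om (fun x => c x = 1).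
Proof.
move=> D1 phi0 lam0 eqn1 cm c01 Dc; apply: c_connected => // B e i e0 BO.
have [C C0 CP] := bump_gradient_bound B e0.
apply: (indicator_zero_gradient D1 phi0 lam0 eqn1 (test_bump e0 BO) _ C0 CP cm c01 Dc) => x.
by rewrite bump_ge0 bump_le1// ltW.
Qed.

(** * Picone's identity and the simplicity of the first eigenvalue *)

Lemma I0_ae (w : V -> R) : ig w -> (forall x, 0 <= w x) -> \int[mu]_(x in Om) w x <= 0 ->
  aeOn Om (fun x => w x = 0).
Proof.
move=> iw w0 I0.
have E : (\int[mu]_(x in Om) `|(EFin \o w) x| = 0)%E.
  have -> : (\int[mu]_(x in Om) `|(EFin \o w) x|)%E = (\int[mu]_(x in Om) (w x)%:E)%E.
    by apply: eq_integral => x _ /=; rewrite ger0_norm.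
  rewrite -(EFin_I mO iw); congr EFin; apply/eqP; rewrite eq_le I0 /=.
  by apply: I_ge0 => x _; exact: w0.
have /(ae_eq_integral_abs mu mO (measurable_int _ iw)) := E.
by apply: filterS => x h Ox; have [] := h Ox.
Qed.

Lemma cvg_comp_at (H : R -> R) (a : nat -> R) (l : R) : {for l, continuous H} ->
  a k @[k --> \oo] --> l -> H (a k) @[k --> \oo] --> H l.
Proof. by move=> Hc al; exact: continuous_cvg Hc al. Qed.

Lemma cvg_powR (r : R) (a : nat -> R) (l : R) : 0 < l -> a k @[k --> \oo] --> l ->
  a k `^ r @[k --> \oo] --> l `^ r.
Proof. by move=> l0 h; exact: (@cvg_comp_at (fun y => y `^ r) a l (continuous_powR_gt0 l0) h). Qed.

Lemma Npow_dominated (w : nat -> V -> R) (z : V -> R) : Lebesgue p Om z -> (forall k, mf (w k)) ->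
  (forall k, aeOn Om (fun x => `|w k x| <= `|z x|)) -> aeOn Om (fun x => w k x @[k --> \oo] --> 0) ->
  Npow (w k) @[k --> \oo] --> 0.
Proof.
move=> Lz wm wz w0.
have [||||_ h _] := @dominated_cvgR _ (lebT R n) R mu Om mO
  (fun k x => `|w k x| `^ p) (fun=> 0) (fun x => `|z x| `^ p) (fun k => mf_normpow p (wm k)).
- exact: measurable_cst.
- exact: Lp_igp.
- apply: aeOn1 w0 => x Ox h.
  have E0 : `|0 : R| `^ p = 0 by rewrite normr0 powR0// gt_eqF.
  by rewrite -[X in _ --> X]E0; exact: cvg_normpow p0 h.
- move=> k; apply: aeOn1 (wz k) => x Ox h.
  by rewrite ger0_norm ?powR_ge0//; apply: powR_mono => //; exact: ltW.
rewrite (Rintegral_cst mu mO) mul0r in h.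
rewrite (_ : (fun k => _) = (fun k => \int[mu]_(x in Om) (`|w k x| `^ p))); first exact: h.
by apply/funext => k; exact: NpowE.
Qed.

(** A second subsequence makes the gradients converge almost everywhere too; the distance |grad f_k
    - g| is treated as a scalar L^p function. *)
Lemma Dpair_ae_seq u g : Dpair u g -> exists f : nat -> V -> R,
  [/\ forall k, test_function Om (f k), Epow (gradc (f k)) @[k --> \oo] --> Epow g,
      aeOn Om (fun x => f k x @[k --> \oo] --> u x) &
      aeOn Om (fun x => forall i, gradc (f k) x ord0 i @[k --> \oo] --> g x ord0 i)].
Proof.
move=> [Lu Lg [f [tf fN fE]]].
have fN' : Npow (fun x => f k x - u x) @[k --> \oo] --> 0.
  by under eq_fun do rewrite NpowBC.
have fE' : Epow (fun x => gradc (f k) x - g x) @[k --> \oo] --> 0.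
  by under eq_fun do rewrite EpowBC.
have [s hs sP] := aeOn_cvg_subseq (fun k => Lp_test (tf k)) Lu fN'.
have LG k : Lpv (gradc (f k)) by exact: Lpv_gradc (tf k).
have LD k : Lpv (fun x => gradc (f (s k)) x - g x) by exact: LpvB (LG _) Lg.
pose z k x := euclid (gradc (f (s k)) x - g x).
have Lz k : Lebesgue p Om (z k) := Lpv_euclid (LD k).
have z0 : Npow (fun x => z k x - (fun=> 0) x) @[k --> \oo] --> 0.
  rewrite (_ : (fun k => _) = (fun k => Epow (fun x => gradc (f (s k)) x - g x))).
    exact: cvg_subseq hs fE'.
  apply/funext => k; rewrite NpowE EpowE; apply: I_eq => x _.
  by rewrite subr0 ger0_norm ?euclid_ge0.
have L0 : Lebesgue p Om (fun=> 0).
  by apply: (Lp_bounded (M := 0)) => [|x _]; [exact: measurable_cst|rewrite normr0].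
have [r hr rP] := aeOn_cvg_subseq Lz L0 z0.
have hsr : {homo (s \o r) : i j / (i < j)%N} by move=> i j ij; apply: hs; exact: hr.
exists (fun k => f (s (r k))); split => //.
- have c2 := Epow_cvg LG Lg fE'; exact: cvg_subseq hsr c2.
- by apply: aeOn1 sP => x _; exact: cvg_subseq.
apply: aeOn1 rP => x _ h i; apply/cvgrPdist_lt => e e0.
have z0' k : 0 <= z (r k) x by exact: euclid_ge0.
have [K KP] := cvg0_small z0' h (divr_gt0 e0 (ltr0n R 2)).
exists K => // k /= /KP le; apply: (@le_lt_trans _ _ (e / 2)); last lra.
rewrite distrC; apply: le_trans le.
have := coord_le_euclid (gradc (f (s (r k))) x - g x) i; rewrite !mxE; exact.
Qed.

Lemma is_derive_powR_shift (c r s : R) : 0 < s + c ->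
  is_derive s (1 : R) (fun y : R => (y + c) `^ r) (r * (s + c) `^ (r - 1)).
Proof.
move=> sc0; have h1 : is_derive s (1 : R) (fun y => y + c) 1.
  by have := is_deriveD (is_derive_id s (1:R)) (is_derive_cst c s (1:R)); rewrite addr0.
have h2 := @is_derive1_comp R (fun y => y `^ r) (fun y => y + c) s _ _ (is_derive1_powR r sc0) h1.
by rewrite mulr1 in h2.
Qed.

(** The function u is positive but its approximating test functions need not be, so the power is
    composed with [softpos], which keeps its base at least c. Subtracting c^(-r) gives the value 0
    at 0. *)
Lemma Dpair_recip (r c : R) u g : 0 < c -> 0 < r -> (forall x, 0 < u x) -> Dpair u g ->
  Dpair (fun x => (u x + c) `^ (- r) - c `^ (- r)) (fun x => (- r * (u x + c) `^ (- r - 1)) *: g x).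
Proof.
move=> c0 r0 u0 ug; have [Lu Lg _] := ug.
pose e k : R := k.+1%:R^-1.
have e0 k : 0 < e k by rewrite invr_gt0.
have sp0 k s : 0 < softpos (e k) s + c by rewrite ltr_wpDl// softpos_ge0.
have bnd q s : 0 <= s -> 0 <= q -> (s + c) `^ (- q) <= c `^ (- q).
  move=> s0 q0; rewrite !powRN lef_pV2 ?posrE ?powR_gt0//; last by rewrite ltr_wpDl.
  by apply: powR_mono => //; rewrite ?lerDr// ltW.
have r1 : 0 <= r + 1 by rewrite addr_ge0// ltW.
pose dH k s := - r * (softpos (e k) s + c) `^ (- r - 1) * dsoftpos (e k) s.
have rE : - r - 1 = - (r + 1) by rewrite opprD.
have dHM k s : `|dH k s| <= r * c `^ (- (r + 1)).
  rewrite /dH 2!normrM normrN (gtr0_norm r0) -mulrA; apply: ler_wpM2l; first exact: ltW.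
  rewrite rE ger0_norm ?powR_ge0// ger0_norm ?dsoftpos_ge0 ?(ltW (e0 k))//.
  rewrite -[leRHS]mulr1; apply: ler_pM; rewrite ?powR_ge0 ?dsoftpos_ge0 ?(ltW (e0 k))//.
    by apply: bnd => //; exact: softpos_ge0.
  by apply: dsoftpos_le1; exact: ltW.
have dHc k : continuous (dH k).
  move=> s; apply: cvgM; last exact: continuous_dsoftpos.
  apply: cvgM; first exact: cvg_cst.
  exact: (is_derive_continuous (@is_derive1_comp R (fun y => (y + c) `^ (- r - 1)) (softpos (e k)) s _ _
    (is_derive_powR_shift (- r - 1) (sp0 k s)) (is_derive_softpos s (e0 k)))).
have D1 k : Dpair (fun x => (softpos (e k) (u x) + c) `^ (- r) - c `^ (- r)) (fun x => dH k (u x) *: g x).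
  apply: (@Dpair_comp (fun s => (softpos (e k) s + c) `^ (- r) - c `^ (- r)) (dH k) _ _ _ (dHM k) (dHc k) _ _ ug).
  - move=> f tf; apply: (@test_comp _ _ _ (fun s => (softpos (e k) s + c) `^ (- r) - c `^ (- r))) => //.
      apply: smoothB; last exact: smooth_cst.
      apply: smooth_powR => //; apply: smoothD; last exact: smooth_cst.
      by apply: smooth_softpos => //; exact: test_smooth tf.
    by rewrite softpos_le0// add0r subrr.
  - move=> s; rewrite /dH.
    have h1 := is_derive_powR_shift (- r) (sp0 k s).
    have h2 := @is_derive1_comp R (fun y => (y + c) `^ (- r)) (softpos (e k)) s _ _ h1 (is_derive_softpos s (e0 k)).
    by have := is_deriveB h2 (is_derive_cst (c `^ (- r)) s (1:R)); rewrite subr0.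
have mu1 : mf (fun x => (u x + c) `^ (- r) - c `^ (- r)).
  apply: measurable_funB; last exact: measurable_cst.
  apply: mf_powR; apply: measurable_funD; [exact: Lp_mf Lu|exact: measurable_cst].
have b1 s : 0 <= s -> `|(s + c) `^ (- r) - c `^ (- r)| <= c `^ (- r).
  move=> s0; rewrite ler0_norm ?subr_le0 ?bnd// ?(ltW r0)// opprB.
  by rewrite gerBl powR_ge0.
have LH : Lebesgue p Om (fun x => (u x + c) `^ (- r) - c `^ (- r)).
  by apply: (Lp_bounded mu1) => x _; apply: b1; exact: ltW.
have mc : mf (fun x => - r * (u x + c) `^ (- r - 1)).
  apply: measurable_funM; first exact: measurable_cst.
  apply: mf_powR; apply: measurable_funD; [exact: Lp_mf Lu|exact: measurable_cst].
have cM x : `|- r * (u x + c) `^ (- r - 1)| <= r * c `^ (- (r + 1)).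
  rewrite normrM normrN (gtr0_norm r0); apply: ler_wpM2l; first exact: ltW.
  by rewrite rE ger0_norm ?powR_ge0//; apply: bnd => //; exact: ltW.
have Lc : Lpv (fun x => (- r * (u x + c) `^ (- r - 1)) *: g x).
  by apply: (Lpv_mulr Lg mc) => x _; exact: cM.
have spc x : softpos (e k) (u x) @[k --> \oo] --> u x.
  apply/cvgrPdist_lt => d d0; have [K KP] := cvg0_small (fun k => ltW (e0 k)) (@cvg_harmonic R) (divr_gt0 d0 (ltr0n R 2)).
  exists K => // k /= /KP le; rewrite distrC.
  have := softpos_dist (u x) (ltW (e0 k)); rewrite (max_idPl (ltW (u0 x))) => h.
  apply: le_lt_trans h _; apply: le_lt_trans le _; lra.
apply: (Dpair_closed D1 LH Lc).
- have Lz : Lebesgue p Om (fun=> c `^ (- r) + c `^ (- r)).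
    by apply: (Lp_bounded (M := `|c `^ (- r) + c `^ (- r)|)) => [|x _]; [exact: measurable_cst|].
  apply: (Npow_dominated Lz).
  + by move=> k; have [LD _ _] := D1 k; apply: measurable_funB; [exact: Lp_mf LD|exact: mu1].
  + move=> k; apply: aeOnW => x _; rewrite [leRHS]ger0_norm ?addr_ge0 ?powR_ge0//.
    apply: le_trans (ler_normB _ _) _; apply: lerD; apply: b1; first exact: softpos_ge0.
    exact: ltW.
  + apply: aeOnW => x _.
    rewrite -(subrr ((u x + c) `^ (- r) - c `^ (- r))); apply: cvgB; last exact: cvg_cst.
    apply: cvgB; last exact: cvg_cst.
    apply: cvg_powR; first by rewrite addr_gt0.
    by apply: cvgD; [exact: spc|exact: cvg_cst].
- rewrite (_ : (fun k => _) = (fun k => Epow (fun x => (dH k (u x) - (- r * (u x + c) `^ (- r - 1))) *: g x))); last first.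
    by apply/funext => k; apply: eq_Epow => x _; rewrite scalerBl.
  apply: (@Epow_dominated _ _ (r * c `^ (- (r + 1)) + r * c `^ (- (r + 1))) Lg).
  + move=> k; apply: measurable_funB; last exact: mc.
    apply: (@measurableT_comp _ _ _ _ _ _ (dH k)); last exact: Lp_mf Lu.
    exact: continuous_measurable_fun (dHc k).
  + by move=> k x _; apply: le_trans (ler_normB _ _) _; apply: lerD; [exact: dHM|exact: cM].
  + apply: aeOnW => x _.
    rewrite -(subrr (- r * (u x + c) `^ (- r - 1))); apply: cvgB; last exact: cvg_cst.
    rewrite -[X in _ --> X]mulr1; apply: cvgM.
      apply: cvgM; first exact: cvg_cst.
      apply: cvg_powR; first by rewrite addr_gt0.
      by apply: cvgD; [exact: spc|exact: cvg_cst].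
    by have := @cvg_dsoftpos (u x); rewrite u0.
Qed.

(** Picone's expression: with t = w / phi_1, X = grad w and Y = grad phi_1 it is the convexity
    defect of |.|^p between tY and X, hence nonnegative, and zero only if X = tY. *)
Definition picone (t : R) (X Y : V) : R :=
  euclid X `^ p - p * t `^ (p - 1) * dotv (pgrad p Y) X + (p - 1) * t `^ p * euclid Y `^ p.

Lemma pgradZ (t : R) (Y : V) : 0 <= t -> pgrad p (t *: Y) = t `^ (p - 1) *: pgrad p Y.
Proof.
move=> t0; rewrite /pgrad euclidZ (ger0_norm t0) (powRM _ t0 (euclid_ge0 _)) !scalerA; congr (_ *: _).
have [->|tn0] := eqVneq t 0; first by rewrite mulr0 powR0 ?mul0r// subr_eq0 gt_eqF.
have -> : t `^ (p - 1) = t `^ (p - 2) * t.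
  rewrite -{3}(powRr1 t0) -powRD ?tn0 ?implybT//; congr (_ `^ _); ring.
ring.
Qed.

Lemma picone_ge0 t X Y : 0 <= t -> 0 <= picone t X Y.
Proof.
move=> t0; have := subgrad_le p1 (t *: Y) X.
rewrite dotvDr dotvNr dotv_pgradv// euclidZ (ger0_norm t0) (powRM _ t0 (euclid_ge0 _)) pgradZ// dotvZl /picone.
rewrite -subr_ge0; set d := dotv _ _; set a := t `^ p; set b := euclid Y `^ p; set e := euclid X `^ p => h.
apply: le_trans h _; rewrite le_eqVlt; apply/orP; left; apply/eqP; ring.
Qed.

Lemma picone_eq0 t X Y : 0 <= t -> picone t X Y = 0 -> X = t *: Y.
Proof.
move=> t0 P0; apply/eqP; apply: contraT => ne; have := subgrad_lt p1 ne.
rewrite dotvDr dotvNr dotv_pgradv// euclidZ (ger0_norm t0) (powRM _ t0 (euclid_ge0 _)) pgradZ// dotvZl.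
rewrite -subr_gt0; move: P0; rewrite /picone.
set d := dotv _ _; set a := t `^ p; set b := euclid Y `^ p; set e := euclid X `^ p => P0 h.
suff : (0 : R) < 0 by rewrite ltxx.
rewrite -[X in _ < X]P0; apply: lt_le_trans h _; rewrite le_eqVlt; apply/orP; left; apply/eqP; ring.
Qed.

Section simplicity.
Context (cO : connected Om) (phi1 : V -> R) (g1 : V -> V) (lam : R).
Hypotheses (D1 : Dpair phi1 g1) (phi0 : forall x, 0 < phi1 x) (lam0 : 0 <= lam).
Hypothesis eqn1 : forall v h, Dpair v h -> \int[mu]_(x in Om) dotv (pgrad p (g1 x)) (h x) =
  lam * \int[mu]_(x in Om) (`|phi1 x| `^ (p - 2) * phi1 x * v x).

Let phipow x : `|phi1 x| `^ (p - 2) * phi1 x = phi1 x `^ (p - 1).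
Proof.
rewrite gtr0_norm// -{2}(powRr1 (ltW (phi0 x))) -powRD; first by congr (_ `^ _); ring.
by rewrite (gt_eqF (phi0 x)) implybT.
Qed.

Section picone_identity.
Variables (f : V -> R) (d e : R) (tf : test_function Om f) (d0 : 0 < d) (e0 : 0 < e).
Let psi x := softpos d (f x).
Let A x := psi x + d.
Let T x := A x `^ p - d `^ p.
Let B x := phi1 x + e.
Let tpsi : test_function Om psi. Proof. exact: test_softpos. Qed.
Let A0 x : 0 < A x. Proof. by rewrite ltr_wpDl// softpos_ge0. Qed.
Let B0 x : 0 < B x. Proof. by rewrite addr_gt0. Qed.

Let tT : test_function Om T.
Proof.
apply: (@test_comp _ _ _ (fun s => (s + d) `^ p - d `^ p)) tpsi; last by rewrite add0r subrr.
apply: smoothB; last exact: smooth_cst.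
apply: smooth_powR => //; apply: smoothD; [exact: test_smooth tpsi|exact: smooth_cst].
Qed.

Let gT x : gradc T x = (p * A x `^ (p - 1)) *: gradc psi x.
Proof.
apply/rowP => i; rewrite !mxE.
have h := is_deriveB (is_derive_powR_shift p (A0 x)) (is_derive_cst (d `^ p) (psi x) (1:R)).
by rewrite (partial_comp i (test_smooth tpsi) h) subr0.
Qed.

Let T0 x : 0 <= T x.
Proof. by rewrite subr_ge0; apply: powR_mono => //; rewrite ?lerDr ?softpos_ge0// ltW. Qed.

(** Picone's test function w^p / phi_1^(p-1) in regularized form. The shift d makes the power of
    [psi] smooth, the subtracted d^p restores compact support, and the shift e bounds the
    denominator from below. *)
Let v x := T x * B x `^ (- (p - 1)).
Let hv x := T x *: ((- (p - 1) * B x `^ (- p)) *: g1 x) + B x `^ (- (p - 1)) *: gradc T x.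

Let Dv : Dpair v hv.
Proof.
have q1 : 0 < p - 1 by rewrite subr_gt0.
have D2 := Dpair_recip e0 q1 phi0 D1.
have [M _ TM] := test_bounded tT.
have [M' TM'] := test_gradc_bounded (test_setT tT).
have bT : exists M, forall i x, `|partial i T x| <= M.
  exists M' => i x; apply: le_trans (TM' x).
  by have := coord_le_euclid (gradc T x) i; rewrite mxE.
have D3 := Dpair_testM (test_smooth tT) (ex_intro _ M TM) bT D2.
have D4 := Dpair_lin (e `^ (- (p - 1))) (Dpair_test tT) D3.
apply: (Dpair_ae D4); apply: aeOnW => x _; first by rewrite /v /B; ring.
rewrite /hv addrCA; congr (_ + _).
  by congr (_ *: (_ *: _)); congr (_ * _ `^ _); ring.
by rewrite -scalerDl /B; congr (_ *: _); ring.
Qed.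

Let F x := picone (A x / B x) (gradc psi x) (g1 x) + lam * (phi1 x `^ (p - 1) * v x).

Let divpow (s a b : R) : 0 <= a -> 0 < b -> (a / b) `^ s = a `^ s * b `^ (- s).
Proof. by move=> a0 b0; rewrite powRM ?invr_ge0 ?(ltW b0)// powRN -powR_inv1 ?ltW// powRAC powR_inv1 ?powR_ge0. Qed.

(** Expanding [picone] at A / B reproduces the integrand of the eigenvalue equation tested with [v],
    up to the term in d^p caused by the d^p subtracted in [T]. *)
Let FE x : F x = euclid (gradc psi x) `^ p - dotv (pgrad p (g1 x)) (hv x) +
  (p - 1) * d `^ p * (B x `^ (- p) * euclid (g1 x) `^ p) + lam * (phi1 x `^ (p - 1) * v x).
Proof.
rewrite /F; congr (_ + _); rewrite /picone !(divpow _ (ltW (A0 x)) (B0 x)) /hv dotvDr !dotvZr dotv_pgradv//.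
rewrite gT dotvZr /T; set a := dotv _ _; set b := euclid _ `^ p; set c := euclid _ `^ p.
by move: (A x `^ p) (B x `^ (- p)) (A x `^ (p - 1)) (B x `^ (- (p - 1))) (d `^ p) => *; ring.
Qed.

(** Testing the eigenvalue equation with [v] cancels the term in lam against the pairing; what
    remains is the energy of [psi], at most that of f, and an error bounded through B >= e. *)
Lemma picone_energy : ig F /\ (forall x, 0 <= F x) /\
  \int[mu]_(x in Om) F x <= Epow (gradc f) + (p - 1) * (d / e) `^ p * Epow g1.
Proof.
have [L1 Lg1 _] := D1; have [Lv Lhv _] := Dv.
have q1 : 0 <= p - 1 by rewrite subr_ge0 ltW.
have mB : mf B by apply: measurable_funD; [exact: Lp_mf L1|exact: measurable_cst].
have BM x : B x `^ (- p) <= e `^ (- p).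
  by rewrite !powRN lef_pV2 ?posrE ?powR_gt0//; apply: powR_mono; rewrite ?lerDr// ltW.
have i1 := Lpv_igp (Lpv_gradc tpsi).
have i2 := ig_pgrad Lg1 Lhv.
have i3 : ig (fun x => B x `^ (- p) * euclid (g1 x) `^ p).
  have q := igZ mO (e `^ (- p)) (Lpv_igp Lg1).
  apply: (ig_le mO _ q).
    by apply: measurable_funM; [exact: mf_powR|exact: ig_mf (Lpv_igp Lg1)].
  by apply: aeW => x _; rewrite ger0_norm ?mulr_ge0 ?powR_ge0//; apply: ler_wpM2r; rewrite ?powR_ge0.
have [M M0 TM] := test_bounded tT.
have vM x : `|v x| <= M * e `^ (- (p - 1)).
  rewrite normrM (ger0_norm (powR_ge0 _ _)); apply: ler_pM; rewrite ?powR_ge0//.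
  by rewrite !powRN lef_pV2 ?posrE ?powR_gt0//; apply: powR_mono; rewrite ?lerDr// ltW.
have i4 : ig (fun x => phi1 x `^ (p - 1) * v x).
  have q := igZ mO (M * e `^ (- (p - 1))) (igD mO (ig_cst mO 1 fO) (Lp_igp L1)).
  apply: (ig_le mO _ q).
    by apply: measurable_funM; [exact: mf_powR (Lp_mf L1)|exact: Lp_mf Lv].
  apply: aeW => x _; rewrite normrM mulrC; apply: ler_pM => //.
  rewrite ger0_norm ?powR_ge0// (gtr0_norm (phi0 x)).
  have [x1|x1] := leP (phi1 x) 1.
    apply: ler_wpDr; first exact: powR_ge0.
    have := powR_mono q1 (ltW (phi0 x)) x1; by rewrite powR1.
  apply: ler_wpDl => //; apply: ler_powR; first exact: ltW.
  by rewrite gerBl.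
have F0 x : 0 <= F x.
  apply: addr_ge0; first by apply: picone_ge0; rewrite divr_ge0// ltW.
  by rewrite !mulr_ge0 ?powR_ge0 ?T0.
have i12 := igB mO i1 i2; have i3' := igZ mO ((p - 1) * d `^ p) i3; have i4' := igZ mO lam i4.
have i123 := igD mO i12 i3'; have i1234 := igD mO i123 i4'.
have iF : ig F by rewrite (funext FE).
split=> //; split=> //.
have IE : \int[mu]_(x in Om) F x = \int[mu]_(x in Om) (euclid (gradc psi x) `^ p) -
    \int[mu]_(x in Om) dotv (pgrad p (g1 x)) (hv x) +
    (p - 1) * d `^ p * \int[mu]_(x in Om) (B x `^ (- p) * euclid (g1 x) `^ p) +
    lam * \int[mu]_(x in Om) (phi1 x `^ (p - 1) * v x).
  transitivity (\int[mu]_(x in Om) (euclid (gradc psi x) `^ p - dotv (pgrad p (g1 x)) (hv x) +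
      (p - 1) * d `^ p * (B x `^ (- p) * euclid (g1 x) `^ p) + lam * (phi1 x `^ (p - 1) * v x))).
    by apply: I_eq => x _; exact: FE.
  have m1 := mO.
  rewrite RintegralD//; congr (_ + _); last by rewrite RintegralZl.
  rewrite RintegralD//; congr (_ + _); last by rewrite RintegralZl.
  by rewrite RintegralB.
rewrite IE.
rewrite (eqn1 Dv) (@I_eq _ (lebT R n) R mu Om (fun x => `|phi1 x| `^ (p - 2) * phi1 x * v x)
  (fun x => phi1 x `^ (p - 1) * v x)); last by move=> x _; rewrite phipow.
rewrite -EpowE addrAC subrK; apply: lerD.
  rewrite !EpowE; apply: (I_le mO i1 (Lpv_igp (Lpv_gradc tf))) => x _.
  apply: powR_mono; [exact: ltW|exact: euclid_ge0|].
  have -> : gradc psi x = dsoftpos d (f x) *: gradc f x.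
    apply/rowP => i; rewrite !mxE (partial_comp i (test_smooth tf) (is_derive_softpos (f x) d0))//.
  rewrite euclidZ (ger0_norm (dsoftpos_ge0 _ (ltW d0))); apply: ler_piMl; first exact: euclid_ge0.
  by apply: dsoftpos_le1; exact: ltW.
rewrite (divpow _ (ltW d0) e0) -!mulrA; apply: ler_wpM2l => //; apply: ler_wpM2l; first exact: powR_ge0.
have m1 := mO; have ig1 := Lpv_igp Lg1; have q := igZ mO (e `^ (- p)) ig1.
have <- : \int[mu]_(x in Om) (e `^ (- p) * euclid (g1 x) `^ p) = e `^ (- p) * Epow g1.
  by rewrite RintegralZl// EpowE.
by apply: (I_le mO i3 q) => x _; apply: ler_wpM2r; rewrite ?powR_ge0.
Qed.

End picone_identity.

Section minimizer.
Variables (w : V -> R) (gw : V -> V).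
(** The condition [gw0] fixes a representative of the gradient, the one that [Dpair_pos] produces
    for positive parts. *)
Hypotheses (Dw : Dpair w gw) (w0 : forall x, 0 <= w x) (gw0 : forall x, w x = 0 -> gw x = 0).
Hypothesis (wmin : Epow gw <= lam * Npow w).

(** Fatou's lemma along the regularized test functions bounds the integral of [picone] + lam w^p by
    the energy of w, itself at most lam times the integral of w^p. So [picone] integrates to at most
    0 and vanishes almost everywhere. *)
Lemma minimizer_gradient : aeOn Om (fun x => gw x = (w x / phi1 x) *: g1 x).
Proof.
have [f [tf fE fw fg]] := Dpair_ae_seq Dw.
have [L1 Lg1 _] := D1; have [Lw Lgw _] := Dw.
pose e k : R := k.+1%:R^-1; have e0 k : 0 < e k by rewrite invr_gt0.
(* With d = e^2 the error factor (d / e)^p of [picone_energy] is e^p and tends to 0. *)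
pose d k : R := e k * e k; have d0 k : 0 < d k by rewrite mulr_gt0.
have ec : e k @[k --> \oo] --> (0 : R) := @cvg_harmonic R.
have dc : d k @[k --> \oo] --> (0 : R) by rewrite -(mulr0 0); exact: cvgM.
pose psi k x := softpos (d k) (f k x).
pose A k x := psi k x + d k.
pose B k x := phi1 x + e k.
pose F k x := picone (A k x / B k x) (gradc (psi k) x) (g1 x) +
  lam * (phi1 x `^ (p - 1) * ((A k x `^ p - d k `^ p) * B k x `^ (- (p - 1)))).
have H k := picone_energy (tf k) (d0 k) (e0 k).
have iF k : ig (F k) by have [] := H k.
have F0 k x : 0 <= F k x by have [_ [h _]] := H k; exact: h.
pose c k := Epow (gradc (f k)) + (p - 1) * e k `^ p * Epow g1.
have IF k : \int[mu]_(x in Om) F k x <= c k.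
  by have [_ [_ h]] := H k; apply: le_trans h _; rewrite /d mulfK ?gt_eqF.
have e_pc : e k `^ p @[k --> \oo] --> (0 : R).
  have E0 : `|0 : R| `^ p = 0 by rewrite normr0 powR0// gt_eqF.
  rewrite -[X in _ --> X]E0.
  have : `|e k| `^ p @[k --> \oo] --> `|0 : R| `^ p by exact: cvg_normpow p0 ec.
  by under eq_fun do rewrite (gtr0_norm (e0 _)).
have cc : c k @[k --> \oo] --> Epow gw.
  rewrite -[X in _ --> X]addr0 -(mul0r (Epow g1)) -(mulr0 (p - 1)); apply: cvgD => //.
  by apply: cvgM; [apply: cvgM => //; exact: cvg_cst|exact: cvg_cst].
pose G x := picone (w x / phi1 x) (gw x) (g1 x) + lam * w x `^ p.
have p10 : 0 < p - 1 by rewrite subr_gt0.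
have Fc : aeOn Om (fun x => F k x @[k --> \oo] --> G x).
  apply: aeOn2 fw fg => x Ox fx gx.
  have psic : psi k x @[k --> \oo] --> w x.
    apply/cvgrPdist_le => z z0.
    have /cvgrPdist_le/(_ _ (divr_gt0 z0 (ltr0n R 2)))[K1 _ K1P] := fx.
    have [K2 K2P] := cvg0_small (fun k => ltW (d0 k)) dc (divr_gt0 z0 (ltr0n R 2)).
    exists (maxn K1 K2) => // k /=; rewrite geq_max => /andP[k1 k2].
    have h1 := K1P k k1; have h2 := K2P k k2.
    have h3 := softpos_dist (f k x) (ltW (d0 k)).
    have h4 : `|w x - Num.max (f k x) 0| <= z / 2.
      apply: le_trans h1; rewrite -[in X in X <= _](max_idPl (w0 x)).
      have := w0 x; have [a0|a0] := leP (f k x) 0 => b0; last by rewrite (max_idPl b0).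
      by rewrite (max_idPl b0) subr0 !ger0_norm// ?subr_ge0 ?(le_trans a0)// lerDl oppr_ge0.
    have -> : w x - psi k x = (w x - Num.max (f k x) 0) - (psi k x - Num.max (f k x) 0) by ring.
    apply: le_trans (ler_normB _ _) _; rewrite -/(psi k x) in h3; lra.
  have Ac : A k x @[k --> \oo] --> w x by rewrite -(addr0 (w x)); exact: cvgD.
  have Bc : B k x @[k --> \oo] --> phi1 x by rewrite -[X in _ --> X]addr0; apply: cvgD => //; exact: cvg_cst.
  have A0 k : 0 <= A k x by rewrite addr_ge0 ?softpos_ge0// ltW.
  have B0 k : 0 < B k x by rewrite addr_gt0.
  have rc : A k x / B k x @[k --> \oo] --> w x / phi1 x.
    by apply: cvgM => //; apply: cvgV => //; rewrite gt_eqF.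
  have pw (s : R) (a : nat -> R) (l : R) : 0 < s -> (forall k, 0 <= a k) -> 0 <= l -> a k @[k --> \oo] --> l ->
      a k `^ s @[k --> \oo] --> l `^ s.
    move=> s0 a0 l0 al; have : `|a k| `^ s @[k --> \oo] --> `|l| `^ s by exact: cvg_normpow s0 al.
    by rewrite (ger0_norm l0); under eq_fun do rewrite (ger0_norm (a0 _)).
  have wp0 : 0 <= w x / phi1 x by rewrite divr_ge0// ltW.
  have r0 k : 0 <= A k x / B k x by rewrite divr_ge0// ltW.
  have gc i : gradc (psi k) x ord0 i @[k --> \oo] --> gw x ord0 i.
    have E k : gradc (psi k) x ord0 i = dsoftpos (d k) (f k x) * gradc (f k) x ord0 i.
      by rewrite !mxE (partial_comp i (test_smooth (tf k)) (is_derive_softpos (f k x) (d0 k))).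
    (* Where w = 0 the limit gradient is 0 and 0 <= [dsoftpos] <= 1 suffices; where w > 0 the factor
       tends to 1, since d_k / f_k(x) -> 0. *)
    rewrite (funext E); have [wx0|wx0] := eqVneq (w x) 0.
      rewrite (gw0 wx0) mxE; apply/cvgrPdist_le => z z0.
      have := gx i; rewrite (gw0 wx0) mxE => gi0.
      have /cvgrPdist_le/(_ _ z0)[K _ KP] := gi0.
      exists K => // k /= /KP; rewrite !sub0r !normrN => h; apply: le_trans h.
      rewrite normrM (ger0_norm (dsoftpos_ge0 _ (ltW (d0 k)))); apply: ler_piMl => //.
      by apply: dsoftpos_le1; exact: ltW.
    rewrite -[X in _ --> X]mul1r; apply: cvgM; last exact: gx.
    have wp : 0 < w x by rewrite lt_def wx0 w0.
    have fl : flat (d k) 0 (f k x) @[k --> \oo] --> (1 : R).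
      have h : expR (- (d k / f k x)) @[k --> \oo] --> (1 : R).
        rewrite -expR0; apply: cvg_compR; first exact: continuous_expR.
        by rewrite -oppr0 -(mul0r (w x)^-1); apply: cvgN; apply: cvgM => //; apply: cvgV.
      apply: cvg_trans h; apply: near_eq_cvg.
      have [K _ KP] := cvgr_gt _ fx _ wp.
      by exists K => // k /= /KP fk; rewrite /flat fk expr0 mul1r.
    apply: (@squeeze_cvgr _ _ _ _ (fun k => flat (d k) 0 (f k x)) (fun=> 1)) => //; last exact: cvg_cst.
    apply: nearW => k; rewrite dsoftpos_le1 ?(ltW (d0 k))// andbT /dsoftpos lerDl.
    by rewrite mulr_ge0 ?flat_ge0// ltW.
  apply: cvgD.
    apply: cvgD; first apply: cvgB.
    - by apply: pw => // [k||]; [exact: euclid_ge0|exact: euclid_ge0|exact: cvg_euclid].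
    - apply: cvgM; first by apply: cvgM; [exact: cvg_cst|exact: pw].
      by apply: cvg_dotv => i //; exact: cvg_cst.
    - apply: cvgM; last exact: cvg_cst.
      by apply: cvgM; [exact: cvg_cst|exact: pw].
  apply: cvgM; first exact: cvg_cst.
  have -> : w x `^ p = phi1 x `^ (p - 1) * ((w x `^ p - 0 `^ p) * phi1 x `^ (- (p - 1))).
    rewrite powR0 ?gt_eqF// subr0 mulrCA -powRD ?subrr ?powRr0 ?mulr1//.
    by rewrite (gt_eqF (phi0 x)) implybT.
  apply: cvgM; first exact: cvg_cst.
  apply: cvgM; last exact: cvg_powR.
  apply: cvgB; first exact: pw.
  by apply: pw => // k; exact: ltW.
have mG : mf G.
  apply: measurable_funD; last first.
    by apply: measurable_funM; [exact: measurable_cst|exact: mf_powR (Lp_mf Lw)].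
  have mr : mf (fun x => w x / phi1 x).
    apply: measurable_funM; first exact: Lp_mf Lw.
    rewrite (_ : (fun x => _) = (fun x => phi1 x `^ (-1))); last first.
      by apply/funext => x; rewrite powR_inv1// ltW.
    exact: mf_powR (Lp_mf L1).
  apply: measurable_funD; first apply: measurable_funB.
  - exact: ig_mf (Lpv_igp Lgw).
  - apply: measurable_funM; first by apply: measurable_funM; [exact: measurable_cst|exact: mf_powR].
    exact: ig_mf (ig_pgrad Lg1 Lgw).
  - apply: measurable_funM; last exact: ig_mf (Lpv_igp Lg1).
    by apply: measurable_funM; [exact: measurable_cst|exact: mf_powR].
have pic0 x : 0 <= picone (w x / phi1 x) (gw x) (g1 x).
  by apply: picone_ge0; rewrite divr_ge0// ltW.
have G0 x : 0 <= G x by rewrite addr_ge0// mulr_ge0 ?powR_ge0.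
have bound (z : R) : 0 < z -> ig G /\ \int[mu]_(x in Om) G x <= Epow gw + z.
  move=> z0; have lt : Epow gw < Epow gw + z by rewrite ltrDl.
  have [K _ KP] := cvgr_le _ cc _ lt.
  have hK : {homo (fun k => k + K)%N : i j / (i < j)%N} by move=> i j; rewrite ltn_add2r.
  apply: (@fatouR _ (lebT R n) R mu Om mO (fun k => F (k + K)%N)).
  - by move=> k; exact: iF.
  - exact: mG.
  - by move=> k x _; exact: F0.
  - by apply: aeOn1 Fc => x _; exact: cvg_subseq hK.
  - by move=> k; apply: le_trans (IF _) _; apply: KP; exact: leq_addl.
  - by move=> x _; exact: G0.
have [iG _] := bound 1 ltr01.
have IG : \int[mu]_(x in Om) G x <= Epow gw.
  by apply/ler_addgt0Pr => z z0; have [] := bound z z0.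
have wpE : (fun x => `|w x| `^ p) = (fun x => w x `^ p) by apply/funext => x; rewrite ger0_norm.
have iwp : ig (fun x => w x `^ p) by rewrite -wpE; exact: Lp_igp.
have iw := igZ mO lam iwp.
have ip : ig (fun x => picone (w x / phi1 x) (gw x) (g1 x)).
  have := igB mO iG iw; rewrite (_ : (fun x => _ - _) = (fun x => picone (w x / phi1 x) (gw x) (g1 x)))//.
  by apply/funext => x; rewrite /G addrK.
have : \int[mu]_(x in Om) picone (w x / phi1 x) (gw x) (g1 x) <= 0.
  have := IG; have m1 := mO; rewrite /G RintegralD// => h.
  have E : \int[mu]_(x in Om) (lam * w x `^ p) = lam * Npow w.
    by rewrite NpowE wpE RintegralZl.
  by have := le_trans h wmin; rewrite E gerDr.
by move=> /(I0_ae ip pic0); apply: aeOn1 => x _ /picone_eq0; apply; rewrite divr_ge0// ltW.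
Qed.

(** The functions min (k (w - t phi_1)^+, phi_1) = c_k phi_1 lie in the space, and by
    [minimizer_gradient] their gradients are c_k times that of phi_1. They converge to c phi_1 with
    c the indicator of {w > t phi_1}, so [indicator_trivial] applies. *)
Lemma superlevel_trivial (t : R) : 0 <= t ->
  aeOn Om (fun x => w x <= t * phi1 x) \/ aeOn Om (fun x => t * phi1 x < w x).
Proof.
move=> t0; have [L1 Lg1 _] := D1; have [Lw Lgw _] := Dw.
pose c x : R := (t * phi1 x < w x)%R%:R.
have cE x : c x = (0 < w x - t * phi1 x)%R%:R by rewrite subr_gt0.
have Dd := DpairD Dw (DpairZ (- t) D1).
have Ld : Lebesgue p Om (fun x => w x + - t * phi1 x) by have [] := Dd.
have cm : mf c.
  have := measurable_gt 0 (Lp_mf Ld); rewrite (_ : (fun x => _) = c)//.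
  by apply/funext => x; rewrite cE mulNr.
have c01 x : c x = 0 \/ c x = 1 by rewrite /c; case: (_ < _); [right|left].
pose q x := Num.max (w x + - t * phi1 x) 0 / phi1 x.
have q0 x : 0 <= q x by rewrite divr_ge0 ?le_max ?lexx ?orbT// ltW.
pose ck k x := Num.min (k%:R * q x) 1.
have ck01 k x : 0 <= ck k x <= 1 by rewrite le_min mulr_ge0//= ler01 ge_min lexx orbT.
have Dk k : Dpair (fun x => ck k x * phi1 x) (fun x => ck k x *: g1 x).
  have h := Dpair_min (DpairZ k%:R (Dpair_pos Dd)) D1.
  have E x : k%:R * Num.max (w x + - t * phi1 x) 0 = k%:R * q x * phi1 x by rewrite -mulrA divfK ?gt_eqF.
  apply: (Dpair_ae h).
    apply: aeOnW => x _; rewrite E /ck -[X in Num.min _ X]mul1r minr_pMl//; exact: ltW.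
  apply: aeOn1 minimizer_gradient => x _ gE.
  rewrite E -[X in X < _]mul1r ltr_pM2r//.
  rewrite /ck; case: (ltP 1 (k%:R * q x)) => [h1|h1]; first by rewrite scale1r.
  rewrite -scalerA; congr (_ *: _).
  rewrite /q; case: ltP => [d0|d0].
    rewrite gE -scalerDl; congr (_ *: _).
    by rewrite mulrDl -[in RHS]mulrA divff ?gt_eqF// mulr1.
  by rewrite mul0r scale0r.
have ckc x : ck k x @[k --> \oo] --> c x.
  rewrite /c; case: ltP => [lt|ge].
    have qx : 0 < q x.
      by rewrite divr_gt0// lt_max mulNr subr_gt0 lt.
    apply: cvg_near_cst; exists (Num.truncn (q x)^-1).+1 => // k /= hk.
    apply/min_idPr; rewrite -ler_pdivrMr// div1r; apply: ltW.
    apply: lt_le_trans (real_truncnS_gt (num_real _)) _; by rewrite ler_nat.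
  have qx : q x = 0 by rewrite /q (max_idPr _) ?mul0r// mulNr subr_le0.
  apply: cvg_near_cst; exists 0%N => // k _ /=.
  by rewrite /ck qx mulr0; apply/min_idPl; exact: ler01.
have cn1 x : `|c x| <= 1 by case: (c01 x) => ->; rewrite ?normr0 ?normr1.
have ckn1 k x : `|ck k x| <= 1 by have /andP[a b] := ck01 k x; rewrite ger0_norm.
have Lc : Lebesgue p Om (fun x => c x * phi1 x).
  have := Lp_bounded_mul L1 cm (aeOnW (fun x _ => cn1 x)).
  by rewrite (_ : (fun x => phi1 x * c x) = (fun x => c x * phi1 x))//; apply/funext => x; rewrite mulrC.
have mq : mf q.
  apply: measurable_funM.
    by have [Lq _ _] := Dpair_pos Dd; exact: Lp_mf Lq.
  rewrite (_ : (fun x => _) = (fun x => phi1 x `^ (-1))); first exact: mf_powR (Lp_mf L1).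
  by apply/funext => x; rewrite powR_inv1// ltW.
have mck k : mf (ck k).
  apply: measurable_minr; last exact: measurable_cst.
  by apply: measurable_funM => //; exact: measurable_cst.
have dc x : (ck k x - c x) @[k --> \oo] --> 0.
  by rewrite -(subrr (c x)); apply: cvgB; [exact: ckc|exact: cvg_cst].
have dM k x : `|ck k x - c x| <= 1 + 1 by apply: le_trans (ler_normB _ _) _; exact: lerD.
have Dc : Dpair (fun x => c x * phi1 x) (fun x => c x *: g1 x).
  apply: (Dpair_closed Dk Lc).
  - by apply: (Lpv_mulr (M := 1) Lg1 cm) => x _.
  - have L2 := LpZ (1 + 1) L1; apply: (Npow_dominated L2).
    + by move=> k; apply: measurable_funB; [apply: measurable_funM => //|]; [exact: Lp_mf|exact: Lp_mf Lc].
    + move=> k; apply: aeOnW => x _; rewrite -mulrBl !normrM; apply: ler_wpM2r => //.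
      by rewrite [leRHS]ger0_norm// addr_ge0.
    + apply: aeOnW => x _; have : ((ck k x - c x) * phi1 x) @[k --> \oo] --> 0 * phi1 x.
        by apply: cvgM; [exact: dc|exact: cvg_cst].
      by rewrite mul0r; under eq_fun do rewrite mulrBl.
  - rewrite (_ : (fun k => _) = (fun k => Epow (fun x => (ck k x - c x) *: g1 x))); last first.
      by apply/funext => k; apply: eq_Epow => x _; rewrite scalerBl.
    apply: (@Epow_dominated _ _ (1 + 1) Lg1).
    + by move=> k; exact: measurable_funB.
    + by move=> k x _; exact: dM.
    + by apply: aeOnW => x _; exact: dc.
have [c0|c1] := indicator_trivial cO D1 (aeOnW (fun x _ => phi0 x)) lam0 eqn1 cm c01 Dc; [left|right].
  by apply: aeOn1 c0 => x _; rewrite /c; case: ltP => // _ /eqP; rewrite oner_eq0.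
by apply: aeOn1 c1 => x _; rewrite /c; case: ltP => // _ /esym/eqP; rewrite oner_eq0.
Qed.

(** Each superlevel set of w / phi_1 is null or of full measure, so the ratio equals the supremum t
    of the levels of full measure. *)
Lemma nonneg_minimizer : exists2 t : R, 0 <= t & aeOn Om (fun x => w x = t * phi1 x).
Proof.
pose S := [set t : R | 0 <= t /\ aeOn Om (fun x => t * phi1 x < w x)].
have noS t : 0 <= t -> ~ S t -> aeOn Om (fun x => w x <= t * phi1 x).
  by move=> t0 nt; case: (superlevel_trivial t0) => // h; exfalso; apply: nt.
have [[s0 Ss0]|nS] := pselect (S !=set0); last first.
  exists 0 => //; apply: aeOn1 (noS 0 (lexx _) _) => [x _ h|S0]; last by apply: nS; exists 0.
  by apply/eqP; rewrite eq_le h mul0r w0.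
(* Not every integer is a level of full measure, as w / phi_1 is finite on a domain of positive
   measure. *)
have [K KS] : exists K : R, 0 <= K /\ ~ S K.
  apply: contrapT => nK.
  have all k : aeOn Om (fun x => k%:R * phi1 x < w x).
    apply: contrapT => h; apply: nK; exists k%:R; split=> // -[_]; exact: h.
  have := aeOn_all all => [[N [mN N0 NO]]].
  have : (mu Om <= mu N)%E.
    apply: le_measure; rewrite ?inE//; first exact: mO.
    move=> x Ox; apply: NO => /= /(_ Ox) /(_ (Num.truncn (w x / phi1 x)).+1).
    rewrite -ltr_pdivlMr// => h; have := real_truncnS_gt (num_real (w x / phi1 x)).
    by move=> /(lt_trans h); rewrite ltxx.
  by rewrite N0 leNgt muO.
have SK t : S t -> t <= K.
  move=> [t0 St]; rewrite leNgt; apply/negP => Kt; apply: KS.2; split; first exact: KS.1.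
  apply: aeOn1 St => x _; apply: le_lt_trans; rewrite ler_pM2r//; exact: ltW.
have ubS : has_sup S by split; [exists s0|exists K => t /SK].
pose t := sup S.
have t0 : 0 <= t by apply: le_trans Ss0.1 _; exact: sup_upper_bound.
exists t => //.
have lo k : aeOn Om (fun x => (t - k.+1%:R^-1) * phi1 x <= w x).
  have k0 : 0 < (k.+1%:R^-1 : R) by rewrite invr_gt0.
  have [s [s1 Ss] ts] := sup_adherent k0 ubS.
  by apply: aeOn1 Ss => x _ h; apply: ltW; apply: lt_trans h; rewrite ltr_pM2r.
have hi k : aeOn Om (fun x => w x <= (t + k.+1%:R^-1) * phi1 x).
  apply: noS; first by rewrite addr_ge0.
  move=> /(sup_upper_bound ubS); rewrite -/t leNgt => /negP; apply.
  by rewrite ltrDl invr_gt0.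
apply: aeOn2 (aeOn_all lo) (aeOn_all hi) => x _ l h.
have cv (z : R) : (z * k.+1%:R^-1 * phi1 x + t * phi1 x) @[k --> \oo] --> t * phi1 x.
  rewrite -[X in _ --> X]add0r; apply: cvgD; last exact: cvg_cst.
  rewrite -(mul0r (phi1 x)) -(mulr0 z); apply: cvgM; last exact: cvg_cst.
  by apply: cvgM; [exact: cvg_cst|exact: cvg_harmonic].
apply/eqP; rewrite eq_le; apply/andP; split.
  rewrite -lerN2; apply: (@cvg_le_cst _ (fun k => - (1 * k.+1%:R^-1 * phi1 x + t * phi1 x))); last first.
    by apply: cvgN; exact: cv.
  by move=> k; rewrite lerN2; apply: le_trans (h k) _; rewrite mul1r mulrDl addrC.
apply: (cvg_le_cst _ (cv (-1))) => k; apply: le_trans (l k).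
by rewrite mulN1r mulrBl addrC mulNr.
Qed.

End minimizer.

Hypothesis rayleigh : forall v h, Dpair v h -> lam * Npow v <= Epow h.

Lemma Npow_pos_neg (w : V -> R) : Lebesgue p Om w ->
  Npow w = Npow (fun x => Num.max (w x) 0) + Npow (fun x => Num.max (- w x) 0).
Proof.
move=> Lw; have Lm (z : V -> R) : Lebesgue p Om z -> Lebesgue p Om (fun x => Num.max (z x) 0).
  move=> Lz; apply: (Lp_le Lz); first by apply: measurable_maxr; [exact: Lp_mf|exact: measurable_cst].
  apply: aeOnW => x _; rewrite ger0_norm ?le_max ?lexx ?orbT// ge_max normr_ge0 andbT.
  exact: ler_norm.
rewrite !NpowE -RintegralD//; [|exact: mO|exact: Lp_igp (Lm _ Lw)|exact: Lp_igp (Lm _ (LpN Lw))].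
apply: I_eq => x _.
have z0 : `|0 : R| `^ p = 0 by rewrite normr0 powR0// gt_eqF.
have [h|h] := leP (w x) 0.
  by rewrite (max_idPl _) ?oppr_ge0// z0 add0r normrN.
by rewrite (max_idPr _) ?oppr_le0 ?ltW// z0 addr0.
Qed.

Lemma Epow_pos_neg (w : V -> R) (g : V -> V) : Dpair w g ->
  Epow (fun x => if 0 < w x then g x else 0) + Epow (fun x => if 0 < - w x then - g x else 0) <= Epow g.
Proof.
move=> Dw; have [_ Lg _] := Dw; have [_ L1 _] := Dpair_pos Dw; have [_ L2 _] := Dpair_pos (DpairN Dw).
rewrite !EpowE -RintegralD//; [|exact: mO|exact: Lpv_igp L1|exact: Lpv_igp L2].
apply: (I_le mO (igD mO (Lpv_igp L1) (Lpv_igp L2)) (Lpv_igp Lg)) => x _.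
have z0 : euclid (0 : V) `^ p = 0 by rewrite euclid0 powR0// gt_eqF.
rewrite oppr_gt0; case: ltgtP => [h|h|h]; rewrite ?z0 ?add0r ?addr0 ?euclidN ?powR_ge0//.
Qed.

(** The p-th power integral splits over positive and negative parts, so does the energy as an upper
    bound, and each part satisfies the Rayleigh inequality; hence both parts are minimizers. *)
Theorem minimizer_multiple (w : V -> R) (g : V -> V) : Dpair w g -> Epow g <= lam * Npow w ->
  exists t : R, aeOn Om (fun x => w x = t * phi1 x).
Proof.
move=> Dw wm; have [Lw _ _] := Dw.
have Dp := Dpair_pos Dw; have Dn := Dpair_pos (DpairN Dw).
have h1 := rayleigh Dp; have h2 := rayleigh Dn.
have h3 := Epow_pos_neg Dw; move: wm; rewrite (Npow_pos_neg Lw) mulrDr => wm.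
have p1' : Epow (fun x => if 0 < w x then g x else 0) <= lam * Npow (fun x => Num.max (w x) 0) by lra.
have p2' : Epow (fun x => if 0 < - w x then - g x else 0) <= lam * Npow (fun x => Num.max (- w x) 0) by lra.
have m0 (z : V -> R) x : 0 <= Num.max (z x) 0 by rewrite le_max lexx orbT.
have g0 (z : V -> R) (k : V -> V) x : Num.max (z x) 0 = 0 -> (if 0 < z x then k x else 0) = 0.
  by have [h|//] := ltP 0 (z x); move=> /eqP; rewrite (gt_eqF h).
have [s _ sP] := nonneg_minimizer Dp (m0 w) (g0 w g) p1'.
have [t _ tP] := nonneg_minimizer Dn (m0 (fun x => - w x)) (g0 (fun x => - w x) (fun x => - g x)) p2'.
exists (s - t); apply: aeOn2 sP tP => x _ e1 e2; rewrite mulrBl -e1 -e2.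
have [h|h] := leP (w x) 0.
  by rewrite (max_idPl _) ?oppr_ge0// sub0r opprK.
by rewrite (max_idPr _) ?oppr_le0 ?ltW// subr0.
Qed.

End simplicity.

(** * Caratheodory functions and their primitives *)

Definition prim (a : R -> R) (s : R) : R :=
  if 0 <= s then \int[lebesgue_measure]_(t in `[0, s]) a t
  else - \int[lebesgue_measure]_(t in `[s, 0]) a t.

Lemma primitiveE (f : V -> R -> R) x s : primitive f x s = prim (f x) s. Proof. by []. Qed.

Lemma prim0 a : prim a 0 = 0.
Proof. by rewrite /prim lexx set_itv1 Rintegral_set1. Qed.

Lemma is_derive_prim (a : R -> R) (s : R) : continuous a -> is_derive s (1 : R) (prim a) (a s).
Proof.
(* A base point c below both s and 0: near s the primitive is the integral from c minus a constant,
   whatever the sign of s. *)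
move=> ca; pose c := Num.min s 0 - 1; pose d := Num.max s 0 + 1.
have cs : c < s by rewrite ltrBlDr (le_lt_trans (_ : _ <= s)) ?ge_min ?lexx// ltrDl.
have c0 : c < 0 by rewrite subr_lt0 (le_lt_trans (_ : _ <= 0)) ?ge_min ?lexx ?orbT.
have sd : s < d by rewrite (le_lt_trans (_ : _ <= Num.max s 0)) ?le_max ?lexx// ltrDl.
have d0 : 0 < d by rewrite (le_lt_trans (_ : _ <= Num.max s 0)) ?le_max ?lexx ?orbT// ltrDl.
have ia : lebesgue_measure.-integrable `[c, d] (EFin \o a).
  apply: continuous_compact_integrable; first exact: segment_compact.
  by apply: continuous_subspaceT => x; exact: ca.
pose H t := \int[lebesgue_measure]_(y in `[c, t]) a y.
have [H1 H2] := continuous_FTC1_closed sd ia cs (ca s).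
have HB t r : c < t -> t <= r -> r < d -> \int[lebesgue_measure]_(y in `[t, r]) a y = H r - H t.
  move=> ct tr rd.
  have i1 : lebesgue_measure.-integrable `[c, r] (EFin \o a).
    by apply: integrableS ia => //; apply: subset_itvl; rewrite bnd_simp ltW.
  have i2 : lebesgue_measure.-integrable `]t, r] (EFin \o a).
    by apply: integrableS i1 => //; apply: subset_itvr; rewrite bnd_simp ltW.
  by rewrite /H (Rintegral_itvB i1) ?bnd_simp ?(ltW ct)// Rintegral_itv_obnd_cbnd.
have E t : c < t -> t < d -> prim a t = H t - H 0.
  move=> ct td; rewrite /prim; have [t0|t0] := leP 0 t; first by rewrite HB.
  by rewrite HB// ?(ltW t0)// opprB.
have DH : is_derive s (1 : R) (fun t => H t - H 0) (a s).
  have e1 : 'D_1 H s = a s by rewrite -derive1E; exact: H2.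
  have h : is_derive s (1 : R) H (a s) := DeriveDef H1 e1.
  by have := is_deriveB h (is_derive_cst (H 0) s (1:R)); rewrite subr0.
apply: near_eq_is_derive DH => //.
have sI : s \in `]c, d[ by rewrite in_itv /= cs sd.
by apply: filterS (near_in_itvoo sI) => t; rewrite in_itv /= => /andP[h1 h2]; rewrite E.
Qed.

Lemma continuous_prim (a : R -> R) : continuous a -> continuous (prim a).
Proof. by move=> ca s; exact: is_derive_continuous (is_derive_prim s ca). Qed.

(** Compactness of the segment gives a single d; only s is confined to the segment, t may leave
    it. *)
Lemma unif_continuous_segment (a : R -> R) (M e : R) : continuous a -> 0 < e ->
  exists2 d : R, 0 < d & forall s t : R, `|s| <= M -> `|t - s| <= d -> `|a t - a s| <= e.
Proof.
move=> ca e0; have /compact_near_coveringP nc := @segment_compact R (- M) M.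
pose P (d : R) (s : R) := forall t, `|t - s| <= d -> `|a t - a s| <= e.
have e20 : 0 < e / 2 by rewrite divr_gt0.
have h : \forall d \near (0 : R)^'+, `[- M, M] `<=` P d.
  apply: nc => x _; have /cvgrPdist_lt/(_ _ e20) := ca x => /nbhs_ballP[r /= r0 rP].
  have r20 : 0 < r / 2 by rewrite divr_gt0.
  exists (ball x (r / 2), [set d | d < r / 2]).
    by split; [exact: nbhsx_ballx|exact: nbhs_right_lt].
  move=> [y d] [/= xy dr] t td.
  have h1 := rP y (le_ball _ xy); have h2 : `|a x - a t| < e / 2.
    apply: rP; rewrite /ball /=; have := xy; rewrite /ball /= => xy'.
    have -> : x - t = (x - y) - (t - y) by ring.
    apply: le_lt_trans (ler_normB _ _) _; lra.
  have := h1 _; have -> : a t - a y = (a x - a y) - (a x - a t) by ring.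
  move=> h1'; apply: le_trans (ler_normB _ _) _.
  have {}h1' : `|a x - a y| < e / 2 by apply: h1'; lra.
  lra.
have [d [d0 dP]] : exists d : R, 0 < d /\ `[- M, M] `<=` P d.
  by near (0 : R)^'+ => d; exists d; split; near: d; [exact: nbhs_right_gt|exact: h].
exists d => // s t sM; apply: dP => /=; rewrite in_itv /=; by rewrite -ler_norml.
Unshelve. all: by end_near. Qed.

(** On each subinterval A is compared with a linear function, the derivative varying there by at
    most e / (s + 1). Riemann sums are what makes [prim (f x) s] measurable in x. *)
Lemma riemann_prim (a A : R -> R) (s : R) : continuous a -> (forall t : R, is_derive t (1 : R) A (a t)) ->
  0 <= s -> \sum_(j < k.+1) (s / k.+1%:R * a (j%:R * (s / k.+1%:R))) @[k --> \oo] --> A s - A 0.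
Proof.
move=> ca dA s0; apply/cvgrPdist_le => e e0.
have s10 : 0 < s + 1 by rewrite ltr_wpDl.
have [d d0 dP] := unif_continuous_segment s ca (divr_gt0 e0 s10).
have kp k : 0 <= s / k.+1%:R by rewrite divr_ge0.
have sc : s / k.+1%:R @[k --> \oo] --> 0 by apply: cvg0M; exact: cvg_harmonic.
have [K KP] := cvg0_small kp sc d0.
exists K => // k /= /KP hd; set h := s / k.+1%:R in hd *.
pose t (j : nat) := j%:R * h.
have h0 : 0 <= h by exact: kp.
have -> : A s - A 0 = \sum_(j < k.+1) (A (t j.+1) - A (t j)).
  rewrite -(big_mkord xpredT (fun j => A (t j.+1) - A (t j))) telescope_sumr// /t mul0r.
  by rewrite /h mulrC divfK.
rewrite -sumrB; apply: le_trans (ler_norm_sum _ _ _) _.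
have sE : s = \sum_(j < k.+1) h by rewrite sumr_const card_ord -[RHS]mulr_natl /h mulrC divfK.
apply: (@le_trans _ _ (\sum_(j < k.+1) (e / (s + 1) * h))); last first.
  rewrite -mulr_sumr -sE -mulrA; apply: ler_piMr; first exact: ltW.
  by rewrite mulrC ler_pdivrMr// mul1r lerDl.
apply: ler_sum => j _.
have tj : t j.+1 = t j + h by rewrite /t -natr1 mulrDl mul1r.
have dg (r : R) : is_derive r (1 : R) (fun r => A r - a (t j) * r) (a r - a (t j)).
  have h1 := is_deriveM (is_derive_cst (a (t j)) r (1:R)) (is_derive_id r (1:R)).
  have := is_deriveB (dA r) h1; rewrite scaler0 addr0.
  by rewrite -[X in _ -> is_derive _ _ _ (_ - X)]mulr1.
have tb : `|t j| <= s.
  rewrite ger0_norm ?mulr_ge0//; rewrite [leRHS]sE sumr_const card_ord -[leRHS]mulr_natl /t.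
  by apply: ler_wpM2r => //; rewrite ler_nat ltnW.
have := is_derive_slide_mono (_ : t j <= t j.+1) dg (C := e / (s + 1)).
rewrite tj lerDl => /(_ h0) H.
have -> : A (t j + h) - A (t j) - h * a (t j) =
  A (t j + h) - a (t j) * (t j + h) - (A (t j) - a (t j) * t j) by ring.
apply: le_trans (H _) _ => [r /andP[r1 r2]|]; last by rewrite addrAC subrr add0r.
by apply: dP => //; rewrite ger0_norm ?subr_ge0// lerBlDl (le_trans r2)// lerD2l.
Qed.

Lemma mf_ae_lim (w : nat -> V -> R) (u : V -> R) : (forall k, mf (w k)) ->
  aeOn Om (fun x => w k x @[k --> \oo] --> u x) -> mf u.
Proof.
move=> wm [N [mN N0 NP]].
have mI : measurable_fun (Om : set (lebT R n)) (\1_(~` N) : lebT R n -> R).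
  by apply: measurable_indic; exact: measurableC.
have h : mf (fun x => u x * \1_(~` N) x).
  apply: (@measurable_fun_cvg _ (lebT R n) R Om (fun k x => w k x * \1_(~` N) x)).
    by move=> k; apply: measurable_funM.
  move=> x Ox; have [Nx|Nx] := pselect (N x).
    have E : \1_(~` N) x = 0 :> R by rewrite indicE memNset// => /(_ Nx).
    by rewrite E mulr0; under eq_fun do rewrite mulr0; exact: cvg_cst.
  apply: cvgM; last exact: cvg_cst.
  by apply: contrapT => nc; apply: Nx; apply: NP => /= /(_ Ox).
suff ae : aeOn Om (fun x => u x * \1_(~` N) x = u x).
  exact: (measurable_fun_ae (@leb_complete R n) h ae).
exists N; split => // x /=; apply: contra_notP => Nx Ox.
by rewrite indicE mem_set// mulr1.
Qed.

Lemma mf_countable_selection (H : int -> V -> R) (i : V -> int) :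
  (forall j, mf (H j)) -> (forall j, measurable (Om `&` [set x | i x = j] : set (lebT R n))) ->
  mf (fun x => H (i x) x).
Proof.
move=> Hm im _ Y mY.
rewrite (_ : _ `&` _ = \bigcup_(j : int) ((Om `&` [set x | i x = j]) `&` (Om `&` H j @^-1` Y))).
  apply: countable_bigcupT_measurable => // j; apply: measurableI; first exact: im.
  exact: (Hm j mO Y mY).
apply/seteqP; split => x /=.
  by move=> [Ox Hx]; exists (i x).
by move=> [j _ [[Ox ij] [_ Hx]]]; rewrite ij.
Qed.

(** The function u is approximated by floor ((k+1) u) / (k+1), which takes countably many values,
    and continuity in s gives the limit. *)
Lemma mf_caratheodory (F : V -> R -> R) (u : V -> R) : (forall s, mf (fun x => F x s)) ->
  aeOn Om (fun x => continuous (F x)) -> mf u -> mf (fun x => F x (u x)).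
Proof.
move=> Fm Fc um.
pose i k x := Num.floor (k.+1%:R * u x).
pose v k x : R := (i k x)%:~R / k.+1%:R.
have im k j : measurable (Om `&` [set x | i k x = j] : set (lebT R n)).
  have m1 : mf (fun x => k.+1%:R * u x) by apply: measurable_funM => //; exact: measurable_cst.
  have -> : Om `&` [set x | i k x = j] = Om `&` (fun x => k.+1%:R * u x) @^-1` `[j%:~R, (j + 1)%:~R[.
    apply/seteqP; split => x /= [Ox h]; split => //; move: h; rewrite /i in_itv /=.
      by move=> <-; rewrite floor_le floorD1_gt.
    by move=> /floor_def.
  by apply: m1 => //; exact: mO.
have vm k : mf (fun x => F x (v k x)).
  apply: (mf_countable_selection (H := fun j x => F x (j%:~R / k.+1%:R)) (i := i k)) => // j.
have vc x : v k x @[k --> \oo] --> u x.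
  apply/cvgrPdist_le => e e0.
  have hp k : 0 <= (k.+1%:R^-1 : R) by rewrite invr_ge0.
  have [K KP] := cvg0_small hp (@cvg_harmonic R) e0.
  exists K => // k /= /KP; apply: le_trans.
  have k0 : 0 < k.+1%:R :> R by rewrite ltr0n.
  have -> : u x - v k x = (k.+1%:R * u x - (i k x)%:~R) / k.+1%:R.
    by rewrite mulrBl mulrAC divff ?mul1r// gt_eqF.
  have h1 := floor_le (k.+1%:R * u x); have h2 := floorD1_gt (k.+1%:R * u x).
  rewrite normrM [X in _ * X]gtr0_norm ?invr_gt0// -[leRHS]mul1r; apply: ler_wpM2r => //.
  rewrite ger0_norm ?subr_ge0//; move: h2; rewrite intrD /i -/(i k x) => h2.
  by rewrite lerBlDl addrC ltW// addrC.
apply: (mf_ae_lim vm); apply: aeOn1 Fc => x _ cx; exact: cvg_compR cx (vc x).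
Qed.

Section caratheodory.
Context (f : V -> R -> R) (Hf : caratheodory_function Om f).

Lemma mf_prim_cst s : mf (fun x => prim (f x) s).
Proof.
have [fm fc] := Hf.
have pos s' (F : V -> R -> R) : (forall s, mf (fun x => F x s)) -> aeOn Om (fun x => continuous (F x)) ->
    0 <= s' -> mf (fun x => prim (F x) s').
  move=> Fm Fc s0.
  apply: (@mf_ae_lim (fun k x => \sum_(j < k.+1) (s' / k.+1%:R * F x (j%:R * (s' / k.+1%:R))))).
    move=> k; apply: measurable_sum => j.
    by apply: measurable_funM => //; exact: measurable_cst.
  apply: aeOn1 Fc => x _ cx.
  have := riemann_prim cx (fun t => is_derive_prim t cx) s0.
  by rewrite prim0 subr0.
(* For s < 0 the substitution t -> -t leads back to Riemann sums on the positive half-line. *)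
have [s0|s0] := leP 0 s; first exact: pos.
have s0' : 0 <= - s by rewrite oppr_ge0 ltW.
apply: (@mf_ae_lim (fun k x => \sum_(j < k.+1) (- s / k.+1%:R * - f x (- (j%:R * (- s / k.+1%:R)))))).
  move=> k; apply: measurable_sum => j.
  apply: measurable_funM; first exact: measurable_cst.
  by apply: measurable_funN.
apply: aeOn1 fc => x _ cx.
have cx' : continuous (fun t => - f x (- t)).
  have c1 t : {for t, continuous (f x \o -%R)}.
    by apply: continuous_comp; [exact: opp_continuous|exact: cx].
  by move=> t; apply: cvgN; exact: c1.
have dp t : is_derive t (1 : R) (fun t => prim (f x) (- t)) (- f x (- t)).
  have h1 : is_derive t (1 : R) (fun t : R => - t) (- 1).
    exact: is_deriveN (is_derive_id t (1:R)).
  have := @is_derive1_comp R (prim (f x)) (fun t => - t) t _ _ (is_derive_prim (- t) cx) h1.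
  by rewrite mulrN1.
have := riemann_prim cx' dp s0'.
by rewrite oppr0 prim0 subr0 opprK.
Qed.

Lemma mf_f u : mf u -> mf (fun x => f x (u x)).
Proof. by have [fm fc] := Hf; exact: mf_caratheodory. Qed.

Lemma ae_continuous_prim : aeOn Om (fun x => continuous (prim (f x))).
Proof. by have [_ fc] := Hf; apply: aeOn1 fc => x _; exact: continuous_prim. Qed.

Lemma mf_prim u : mf u -> mf (fun x => prim (f x) (u x)).
Proof. exact: (mf_caratheodory (F := fun x => prim (f x)) mf_prim_cst ae_continuous_prim). Qed.

End caratheodory.

(** The supremum is finite almost everywhere by integrability; its real-valued version serves as
    dominating function. *)
Lemma local_bound (f : V -> R -> R) (Hfsup : locally_sup_integrable Om f) (r : R) : 0 < r -> exists M : V -> R, [/\ ig M, forall x, 0 <= M x &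
  aeOn Om (fun x => forall s, `|s| <= r -> `|f x s| <= M x)].
Proof.
move=> r0; have iM := Hfsup r r0.
pose S x := ereal_sup [set (`|f x s|)%:E | s in [set s : R | `|s| <= r]].
have S0 x : (0 <= S x)%E.
  apply: le_trans (_ : (`|f x 0|%:E <= S x)%E); first by rewrite lee_fin.
  by apply: ereal_sup_ubound => /=; exists 0 => //; rewrite /= normr0 ltW.
exists (fine \o S); split.
- apply: (le_integrable mO _ _ iM).
    by apply/measurable_EFinP; apply: measurableT_comp => //; exact: measurable_int iM.
  move=> x _ /=; rewrite -/(S x) (gee0_abs (S0 x)); have := S0 x.
  by case: (S x) => [y| |] //=; rewrite ?lee_fin ?normr0 ?leey// => y0; rewrite ger0_norm.
- by move=> x /=; exact: fine_ge0.
- have Sf := integrable_ae mO iM.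
  apply: (@filterS _ _ ae_filterT _ _ _ Sf) => x h Ox s sr /=.
  rewrite -lee_fin fineK; last exact: h.
  by apply: ereal_sup_ubound; exists s.
Qed.

Lemma prim_bound (f : V -> R -> R) (r : R) M x : 0 <= r -> 0 <= M -> continuous (f x) ->
  (forall s, `|s| <= r -> `|f x s| <= M) ->
  forall s t, `|s| <= r -> `|t| <= r -> `|prim (f x) s - prim (f x) t| <= M * `|s - t|.
Proof.
move=> r0 M0 cx fM.
have main s t : `|s| <= r -> `|t| <= r -> t <= s -> `|prim (f x) s - prim (f x) t| <= M * `|s - t|.
  move=> /ler_normlP[s1 s2] /ler_normlP[t1 t2] ts.
  rewrite [`|s - t|]ger0_norm ?subr_ge0//.
  apply: (is_derive_slide_mono ts (fun y => is_derive_prim y cx)) => y /andP[y1 y2].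
  by apply: fM; rewrite ler_norml; apply/andP; split; lra.
move=> s t hs ht; have [ts|st] := leP t s; first exact: main.
by rewrite distrC (distrC s); apply: main => //; exact: ltW.
Qed.

(** * Fatou lemmas for the nonlinear term *)

Lemma fatou_lower (Y : nat -> V -> R) (B : R) : (forall k, ig (Y k)) -> (forall k x, 0 <= Y k x) ->
  (forall k, \int[mu]_(x in Om) Y k x <= B) ->
  exists q : V -> R, [/\ ig q, \int[mu]_(x in Om) q x <= B &
    aeOn Om (fun x => forall r m, (forall k, (m <= k)%N -> r <= Y k x) -> r <= q x)].
Proof.
move=> iY Y0 YB.
have Ym k : measurable_fun (Om : set (lebT R n)) (EFin \o (Y k : lebT R n -> R)).
  by apply/measurable_EFinP; exact: ig_mf (iY k).
pose P (x : lebT R n) : \bar R := limn_einf (fun k => (Y k x)%:E).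
have Pm : measurable_fun (Om : set (lebT R n)) P.
  apply: (@measurableT_comp _ _ _ _ _ _ (-%E)); first exact: oppe_measurable.
  by apply: measurable_fun_limn_esup => k; apply: measurableT_comp (Ym k); exact: oppe_measurable.
have P0 x : (0 <= P x)%E.
  rewrite /P limn_einf_lim; apply: lime_ge; first exact: is_cvg_einfs.
  by apply: nearW => k; apply: le_ereal_inf_tmp => _ /= [m _ <-]; rewrite lee_fin.
have PB : (\int[mu]_(x in Om) P x <= B%:E)%E.
  apply: le_trans (@fatou _ (lebT R n) R mu Om mO (fun k => EFin \o Y k) Ym (fun k x _ => Y0 k x)) _.
  rewrite limn_einf_lim; apply: lime_le; first exact: is_cvg_einfs.
  apply: nearW => k; apply: (@le_trans _ _ (\int[mu]_(x in Om) Y k x)%:E); last by rewrite lee_fin.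
  by rewrite (EFin_I mO (iY k)); apply: ereal_inf_lbound => /=; exists k => /=.
have iP : mu.-integrable (Om : set (lebT R n)) P.
  apply/integrableP; split=> //; apply: le_lt_trans (ltry B); apply: le_trans PB.
  have -> : (\int[mu]_(x in Om) `|P x| = \int[mu]_(x in Om) P x)%E.
    by apply: eq_integral => x _; rewrite gee0_abs.
  by [].
have Pf := integrable_ae mO iP.
have iq : ig (fine \o P).
  apply: (le_integrable mO _ _ iP).
    by apply/measurable_EFinP; exact: measurableT_comp.
  move=> x _ /=; rewrite (gee0_abs (P0 x)); have := P0 x.
  by case: (P x) => [y| |] //=; rewrite ?lee_fin ?normr0 ?leey// => y0; rewrite ger0_norm.
exists (fine \o P); split => //.
  rewrite -lee_fin (EFin_I mO iq); apply: le_trans PB.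
  apply: ae_ge0_le_integral => //.
  - exact: mO.
  - by move=> x _; rewrite lee_fin; exact: fine_ge0.
  - exact: measurable_int iq.
  - apply: (@filterS _ _ ae_filterT _ _ _ Pf) => x h Ox /=.
    by rewrite fineK//; exact: h.
apply: (@filterS _ _ ae_filterT _ _ _ Pf) => x h Ox r m hr /=.
rewrite -lee_fin fineK; last exact: h.
rewrite /P limn_einf_lim; apply: lime_ge; first exact: is_cvg_einfs.
exists m => // k /= mk; apply: le_ereal_inf_tmp => _ /= [j kj <-]; rewrite lee_fin.
by apply: hr; exact: leq_trans mk kj.
Qed.

(** Since s' < s, the growth bound is uniformly integrable: the excess beyond |w_k| = M is at most a
    M^(s'-s) e' |w_k|^s, with integral at most d for M large. Fatou's lemma is applied to D - min
    (X_k, D), where D is the growth bound at level M. The upper limit Z is extended-valued and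
    enters only through an integrable z below it. *)
Lemma reverse_fatou (e' K : V -> R) (a b s s' C c : R) (w X : nat -> V -> R) (Z : V -> \bar R) :
  ig e' -> (forall x, 0 <= e' x) -> ig K -> (forall x, 0 <= K x) -> 0 <= a -> 0 <= b -> 0 <= s' -> s' < s ->
  (forall k, ig (fun x => e' x * `|w k x| `^ s)) ->
  (forall k, \int[mu]_(x in Om) (e' x * `|w k x| `^ s) <= C) ->
  (forall k, ig (X k)) -> (forall k, c <= \int[mu]_(x in Om) X k x) ->
  (forall k, aeOn Om (fun x => X k x <= e' x * (a * `|w k x| `^ s' + b) + K x)) ->
  aeOn Om (fun x => forall r : R, (Z x < r%:E)%E -> exists m, forall k, (m <= k)%N -> X k x <= r) ->
  forall d, 0 < d -> exists z : V -> R, [/\ ig z, c - d <= \int[mu]_(x in Om) z x &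
    aeOn Om (fun x => ((z x)%:E <= Z x)%E)].
Proof.
move=> ie e0 iK K0 a0 b0 s'0 ss iw wC iX cX XB XZ d d0.
have C0 : 0 <= C.
  apply: le_trans (wC 0%N); apply: I_ge0 => x _; rewrite mulr_ge0// ?powR_ge0//.
have sd : s' - s < 0 by rewrite subr_lt0.
have [M M1 MP] : exists2 M : R, 1 <= M & a * M `^ (s' - s) * C <= d.
  (* Solves M^(s - s') >= (a C + 1) / d. *)
  pose M := Num.max 1 (((a * C + 1) / d) `^ (s - s')^-1).
  have ac0 : 0 < a * C + 1 by rewrite ltr_wpDl// mulr_ge0.
  have q0 : 0 < (a * C + 1) / d by rewrite divr_gt0.
  have ss0 : 0 < s - s' by rewrite subr_gt0.
  exists M; first by rewrite le_max lexx.
  have M0 : 0 < M by rewrite lt_max ltr01.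
  have h : (a * C + 1) / d <= M `^ (s - s').
    rewrite -[leLHS](powRVK ss0 (ltW q0)); apply: powR_mono; [exact: ltW|exact: powR_ge0|].
    by rewrite le_max lexx orbT.
  rewrite -(opprB s s') powRN mulrAC ler_pdivrMr ?powR_gt0//.
  move: h; rewrite ler_pdivrMr// [X in _ <= X -> _]mulrC => h; apply: le_trans h; lra.
have M0 : 0 < M by apply: lt_le_trans M1.
pose D x := e' x * (a * M `^ s' + b) + K x.
have iD : ig D.
  have q := igZ mO (a * M `^ s' + b) ie; have q2 := igD mO q iK.
  by rewrite (_ : D = (fun x => (a * M `^ s' + b) * e' x + K x))//; apply/funext => x; rewrite /D mulrC.
pose T k x := a * M `^ (s' - s) * (e' x * `|w k x| `^ s).
have iT k : ig (T k) by have q := igZ mO (a * M `^ (s' - s)) (iw k).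
have XT k : aeOn Om (fun x => X k x - T k x <= Num.min (X k x) (D x)).
  apply: aeOn1 (XB k) => x _ h.
  have T0 : 0 <= T k x by rewrite !mulr_ge0 ?powR_ge0.
  rewrite le_min lerBlDr lerDl T0 /= lerBlDr; apply: le_trans h _.
  rewrite /D addrAC lerD2r.
  have [wM|Mw] := leP `|w k x| M.
    apply: ler_wpDr => //; apply: ler_wpM2l => //; rewrite lerD2r; apply: ler_wpM2l => //.
    exact: powR_mono.
  have w0 : 0 < `|w k x| by apply: lt_trans Mw.
  have h1 : `|w k x| `^ s' <= M `^ (s' - s) * `|w k x| `^ s.
    have -> : s' = (s' - s) + s by ring.
    rewrite [leLHS]powRD; last by rewrite (gt_eqF w0) implybT.
    rewrite addrK; apply: ler_wpM2r; first exact: powR_ge0.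
    rewrite -(opprB s s') !powRN lef_pV2 ?posrE ?powR_gt0//.
    by apply: powR_mono; [rewrite subr_ge0 ltW|exact: ltW|exact: ltW].
  have h2 : e' x * (a * `|w k x| `^ s') <= T k x.
    have -> : T k x = e' x * (a * (M `^ (s' - s) * `|w k x| `^ s)) by rewrite /T; ring.
    by apply: ler_wpM2l => //; exact: ler_wpM2l.
  rewrite mulrDr [leRHS]addrC mulrDr addrA lerD2r; apply: ler_wpDr => //.
  by rewrite !mulr_ge0 ?powR_ge0.
have imin k : ig (fun x => Num.min (X k x) (D x)).
  have q := igD mO (ig_norm (iX k)) (ig_norm iD); apply: (ig_le mO _ q).
    by apply: measurable_minr; [exact: ig_mf (iX k)|exact: ig_mf iD].
  by apply: aeW => x _; case: (leP (X k x) (D x)) => _; rewrite ?lerDl ?lerDr.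
pose Y k x := D x - Num.min (X k x) (D x).
have iY k : ig (Y k) by have q := igB mO iD (imin k).
have Y0 k x : 0 <= Y k x by rewrite subr_ge0 ge_min lexx orbT.
have YB k : \int[mu]_(x in Om) Y k x <= \int[mu]_(x in Om) D x - c + d.
  have m1 := mO; rewrite /Y RintegralB// -addrA lerD2l lerNl opprD opprK.
  have iXT := igB mO (iX k) (iT k).
  apply: le_trans (I_le_ae mO iXT (imin k) (XT k)).
  rewrite RintegralB//; apply: lerB; first exact: cX.
  rewrite /T RintegralZl//; apply: le_trans MP; apply: ler_wpM2l; last exact: wC.
  by rewrite mulr_ge0// powR_ge0.
have [q [iq qB qP]] := fatou_lower iY Y0 YB.
exists (fun x => D x - q x); split.
- by have h := igB mO iD iq.
- have m1 := mO; rewrite RintegralB//; move: qB; lra.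
apply: aeOn2 qP XZ => x _ hq hZ; rewrite leNgt; apply/negP => lt.
(* A real number strictly between Z(x) and the candidate z(x); Z(x) = -oo is possible. *)
have [r [r1 r2]] : exists r : R, (Z x < r%:E)%E /\ r < D x - q x.
  case E : (Z x) lt => [y| |] //; last first.
    by move=> _; exists (D x - q x - 1); split; [exact: ltNyr|lra].
  rewrite lte_fin => lt; exists ((y + (D x - q x)) / 2); rewrite lte_fin; split; lra.
have [m mP] := hZ r r1.
have : D x - r <= q x.
  apply: (hq _ m) => k /mP h; rewrite /Y lerD2l lerN2; apply: le_trans h.
  by rewrite ge_min lexx.
lra.
Qed.

(** The integral is a difference of suprema over simple functions below the positive and negative
    parts, so monotonicity holds for arbitrary functions. This lets weighted upper limits such as
    [Gplus] be compared without a measurability proof. *)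
Lemma le_integral_pointwise d (T : measurableType d) (nu : {measure set T -> \bar R})
  (A : set T) (f1 f2 : T -> \bar R) : (forall x, A x -> f1 x <= f2 x)%E ->
  (\int[nu]_(x in A) f1 x <= \int[nu]_(x in A) f2 x)%E.
Proof.
move=> h; have h' x : ((f1 \_ A) x <= (f2 \_ A) x)%E.
  by rewrite /patch; case: ifPn => // /set_mem; exact: h.
rewrite /integral; apply: leeB; apply: ereal_sup_le => _ [k /= kf <-]; exists k => // x;
  apply: le_trans (kf x) _; rewrite !(funeposE, funenegE).
  by rewrite ge_max !le_max lexx h' !orbT.
by rewrite ge_max !le_max lexx leeN2 h' !orbT.
Qed.

(** The function z is replaced by -oo where z <= Z fails, a null set. By completeness of the measure
    this keeps measurability and the integral, and it gives a pointwise comparison with Z. *)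
Lemma I_ereal_ge (z : V -> R) (Z : V -> \bar R) : ig z -> aeOn Om (fun x => ((z x)%:E <= Z x)%E) ->
  ((\int[mu]_(x in Om) z x)%:E <= \int[mu]_(x in Om) Z x)%E.
Proof.
move=> iz zZ.
pose z' (x : lebT R n) : \bar R := if ((z x)%:E <= Z x)%E then (z x)%:E else -oo%E.
have E : ae_eq mu (Om : set (lebT R n)) (EFin \o (z : lebT R n -> R)) z'.
  by apply: (@filterS _ _ ae_filterT _ _ _ zZ) => x h Ox; rewrite /z' h.
have zm := measurable_int _ iz.
have zm' : measurable_fun (Om : set (lebT R n)) z' := ae_measurable_fun (@leb_complete R n) E zm.
rewrite (EFin_I mO iz) (@ae_eq_integral _ (lebT R n) R mu Om z' (EFin \o z) mO zm zm' E).
by apply: le_integral_pointwise => x Ox; rewrite /z'; case: ifP => // _; exact: leNye.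
Qed.

Lemma Lebesgue_normD1 (q : R) (eta : V -> R) : 0 <= q -> Lebesgue q Om eta ->
  Lebesgue q Om (fun x => `|eta x| + 1).
Proof.
move=> q0 [em ei].
have m1 : mf (fun x => `|eta x| + 1).
  by apply: measurable_funD; [exact: mf_norm|exact: measurable_cst].
have i1 : ig (fun x => `|eta x| `^ q).
  by apply/(ig_ge0P mu (mf_normpow q em) (fun x _ => powR_ge0 `|eta x| q)).
have w0 (x : V) : Om x -> 0 <= `| `|eta x| + 1| `^ q by move=> _; exact: powR_ge0.
have [P1 _] := ig_ge0P mu (mf_normpow q m1) w0.
split; first exact: m1.
apply: P1; have h := igZ mO (2 `^ q) (igD mO i1 (ig_cst mO 1 fO)).
apply: (ig_le mO (mf_normpow q m1) h); apply: aeW => x _.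
rewrite (ger0_norm (powR_ge0 _ _)) (ger0_norm (addr_ge0 (normr_ge0 _) ler01)).
by apply: le_trans (powRD_le q0 (normr_ge0 _) ler01) _; rewrite powR1.
Qed.

Lemma conj_sobolev_gt1 alpha : 1 <= alpha <= p -> p < n.+1%:R ->
  1 < conj_exponent (sobolev_exponent n.+1 p / alpha).
Proof.
move=> /andP[a1 ap] pN; have a0 : 0 < alpha by apply: lt_le_trans a1.
have Np : 0 < n.+1%:R - p by rewrite subr_gt0.
have N0 : 0 < n.+1%:R :> R by rewrite ltr0n.
have s1 : 1 < sobolev_exponent n.+1 p / alpha.
  rewrite ltr_pdivlMr// mul1r /sobolev_exponent ltr_pdivlMr//; apply: le_lt_trans (_ : p * (n.+1%:R - p) < _).
    by apply: ler_wpM2r => //; exact: ltW.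
  by rewrite mulrC ltr_pM2r// gtrBl.
by rewrite /conj_exponent ltr_pdivlMr ?subr_gt0// mul1r gtrBl.
Qed.

(** The weight |eta| + 1 is nonnegative and absorbs the epsilon of the uniform bound on G, taken
    equal to 1. *)
Lemma X_alpha_normD1 alpha eta : 1 <= alpha <= p -> X_alpha p alpha Om eta ->
  X_alpha p alpha Om (fun x => `|eta x| + 1).
Proof.
move=> ap [X1 X2 X3]; split.
- by move=> /X1 h; exact: (Lebesgue_normD1 ler01 h).
- by move=> /X2[q q1 h]; exists q; [exact: q1|have q0 := lt_trans ltr01 q1; exact: (Lebesgue_normD1 (ltW q0) h)].
- move=> pN; have [q q1 h] := X3 pN; exists q; first exact: q1.
  have q0 := lt_trans ltr01 (lt_trans (conj_sobolev_gt1 ap pN) q1); exact: (Lebesgue_normD1 (ltW q0) h).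
Qed.

Lemma Lebesgue_ig (q : R) eta : 1 <= q -> Lebesgue q Om eta -> ig (fun x => `|eta x|).
Proof.
move=> q1 [em ei]; have q0 : 0 <= q by apply: le_trans q1.
have i1 : ig (fun x => `|eta x| `^ q).
  by apply/(ig_ge0P mu (mf_normpow q em) (fun x _ => powR_ge0 `|eta x| q)).
have h := igD mO (ig_cst mO 1 fO) i1.
apply: (ig_le mO (mf_norm em) h); apply: aeW => x _; rewrite normr_id.
have [t1|t1] := leP `|eta x| 1; first by apply: ler_wpDr; rewrite ?powR_ge0.
apply: ler_wpDl => //; rewrite -[leLHS]powRr1//; apply: ler_powR => //; exact: ltW.
Qed.

Lemma X_alpha_ig alpha eta : 1 <= alpha <= p -> X_alpha p alpha Om eta -> ig (fun x => `|eta x|).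
Proof.
move=> ap [X1 X2 X3]; case: (ltgtP p n.+1%:R) => [pN|pN|pN].
- have [q q1 h] := X3 pN; apply: (Lebesgue_ig (q := q)) => //.
  by apply: ltW; apply: lt_trans q1; exact: conj_sobolev_gt1 ap pN.
- exact: Lebesgue_ig (lexx _) (X1 pN).
- by have [q q1 h] := X2 pN; apply: (Lebesgue_ig (q := q)) => //; exact: ltW.
Qed.

(** * Comparison functions *)

Section comparison.
Context (alpha : R) (phi : R -> R) (Hphi : comparison_function p alpha phi).

Lemma phi_even s : phi s = phi `|s|.
Proof. by have [[_ e _] _] := Hphi; have [s0|s0] := leP 0 s; rewrite ?(ger0_norm s0) ?(ltr0_norm s0) ?e. Qed.

Lemma phi_ge (A : R) : exists2 t0 : R, 0 < t0 & forall t, t0 <= t -> A * t <= phi t.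
Proof.
have [_ [_ h _ _]] := Hphi.
have /cvgryPge/(_ A)[M [_ MP]] := h.
exists (`|M| + 1) => [|t tM]; first by rewrite ltr_wpDl.
have t0 : 0 < t by apply: lt_le_trans tM; rewrite ltr_wpDl.
have := MP t; rewrite /= ler_pdivlMr ?(gtr0_norm t0)//; apply.
by apply: lt_le_trans tM; rewrite (le_lt_trans (ler_norm M))// ltrDl.
Qed.

(** Condition (iv) freed of the division by [phi t], with nonnegative constants, and extended to all
    real s by evenness. *)
Lemma phi_growth beta : alpha < beta -> exists t0 a b : R, [/\ 0 < t0, 0 <= a, 0 <= b,
  (forall t, t0 <= t -> 0 < phi t) &
  forall t s, t0 <= t -> phi (t * s) <= phi t * (a * `|s| `^ beta + b)].
Proof.
move=> ab; have [_ [_ _ _ h]] := Hphi; have [t0 [a [b H]]] := h beta ab.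
have [t1 t10 t1P] := phi_ge 1.
exists (Num.max t0 t1), (Num.max a 0), (Num.max b 0).
have pos t : Num.max t0 t1 <= t -> 0 < phi t.
  rewrite ge_max => /andP[_ h1]; apply: lt_le_trans (t1P t h1).
  by rewrite mul1r; exact: lt_le_trans h1.
split => //; rewrite ?lt_max ?t10 ?orbT ?le_max ?lexx ?orbT//.
move=> t s tt; have pt := pos t tt; move: tt; rewrite ge_max => /andP[h0 h1].
have t00 : 0 < t by apply: lt_le_trans h1.
have -> : phi (t * s) = phi (t * `|s|).
  by rewrite phi_even normrM (gtr0_norm t00).
have := H t `|s| h0 (normr_ge0 s); rewrite ler_pdivrMr// normr_id => /le_trans; apply; rewrite mulrC.
apply: ler_wpM2l; first exact: ltW.
by apply: lerD; [apply: ler_wpM2r; rewrite ?powR_ge0//|]; rewrite le_max lexx.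
Qed.

(** Condition (iii) for t_k |s_k| and t_k; a nonzero limit l makes the first sequence tend to
    infinity. *)
Lemma phi_ratio (t s : nat -> R) (l : R) : (forall k, 0 < t k) -> t k @[k --> \oo] --> +oo ->
  s k @[k --> \oo] --> l -> l != 0 ->
  phi (t k * s k) / phi (t k) @[k --> \oo] --> `|l| `^ alpha.
Proof.
move=> t0 tc sc l0; have [_ [_ _ h _]] := Hphi.
have l0' : 0 < `|l| by rewrite normr_gt0.
have sc' : `|s k| @[k --> \oo] --> `|l| by exact: cvg_norm.
have E : (fun k => phi (t k * s k) / phi (t k)) = (fun k => phi (t k * `|s k|) / phi (t k)).
  by apply/funext => k; congr (_ / _); rewrite phi_even normrM (gtr0_norm (t0 k)).
rewrite E; apply: (h (fun k => t k * `|s k|) t) => //.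
  apply/cvgryPge => A; have l20 : 0 < `|l| / 2 by rewrite divr_gt0.
  have lt2 : `|l| / 2 < `|l| by lra.
  have [K1 _ K1P] := cvgr_ge _ sc' _ lt2.
  have /cvgryPge/(_ (`|A| / (`|l| / 2)))[K2 _ K2P] := tc.
  exists (maxn K1 K2) => // k /=; rewrite geq_max => /andP[/K1P h1 /K2P h2].
  apply: le_trans (ler_norm A) _; rewrite -(@divfK _ (`|l| / 2) _ `|A|) ?gt_eqF//.
  by apply: ler_pM => //; rewrite ?divr_ge0.
rewrite (_ : (fun k => _) = (fun k => `|s k|))//.
by apply/funext => k; rewrite mulrC mulKf// gt_eqF.
Qed.

End comparison.

(** * The first eigenvalue and continuous linear forms *)

Lemma aeOn_false (P : V -> Prop) : aeOn Om P -> (forall x, Om x -> ~ P x) -> False.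
Proof.
move=> hP nP; have [[x Ox]|n0] := pselect (Om !=set0).
  by apply: (ae_contra oO Ox hP); apply: aeOnW => y Oy; exact: nP.
have E : Om = set0 by apply/seteqP; split => // x Ox; apply: n0; exists x.
by have := muO; rewrite E measure0 ltxx.
Qed.

Lemma Npow_ae0 v : Lebesgue p Om v -> aeOn Om (fun x => v x = 0) -> Npow v = 0.
Proof.
move=> Lv v0; rewrite (Npow_ae Lv v0) NpowE (@I_eq _ (lebT R n) R mu Om _ (fun=> 0)).
  by rewrite (Rintegral_cst mu mO) mul0r.
by move=> x _; rewrite normr0 powR0// gt_eqF.
Qed.

Lemma Epow0 : Epow (fun=> 0) = 0.
Proof.
rewrite EpowE (@I_eq _ (lebT R n) R mu Om _ (fun=> 0)).
  by rewrite (Rintegral_cst mu mO) mul0r.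
by move=> x _; rewrite euclid0 powR0// gt_eqF.
Qed.

Local Notation lam := (lambda1 p Om).

Lemma lambda1_le v h : Dpair v h -> lam * Npow v <= Epow h.
Proof.
move=> Dv; have [Lv Lh _] := Dv.
have [N0|N0] := leP (Npow v) 0.
  have -> : Npow v = 0 by apply/eqP; rewrite eq_le N0 Npow_ge0.
  by rewrite mulr0 Epow_ge0.
rewrite -ler_pdivlMr//; apply: ge_inf.
  exists 0 => _ /= [u [/W1p0_Dpair Du _] <-].
  by rewrite divr_ge0 ?(dirichletE Du) ?Epow_ge0// I_ge0.
exists v; last by rewrite (dirichletE Dv) -NpowE.
split; first exact: Dpair_W1p0 Dv.
by move=> v0; rewrite (Npow_ae0 Lv v0) ltxx in N0.
Qed.

Lemma lambda1_ge0 u : W1p0 p Om u -> ~ aeOn Om (fun x => u x = 0) -> 0 <= lam.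
Proof.
move=> Wu u0; apply: lb_le_inf.
  by exists (dirichlet p Om u / \int[mu]_(x in Om) (`|u x| `^ p)); exists u.
move=> _ /= [v [/W1p0_Dpair Dv _] <-].
by rewrite divr_ge0 ?(dirichletE Dv) ?Epow_ge0// I_ge0.
Qed.

Section dual.
Context (T : (V -> R) -> R) (HT : dualW p Om T).

Lemma dual_lin a u v g k : Dpair u g -> Dpair v k -> T (fun x => a * u x + v x) = a * T u + T v.
Proof. by move=> Du Dv; have [h _] := HT; apply: h; [exact: Dpair_W1p0 Du|exact: Dpair_W1p0 Dv]. Qed.

Lemma dual0 : T (fun=> 0) = 0.
Proof.
have := dual_lin 1 Dpair0 Dpair0; rewrite mul1r addr0 mul1r => /eqP.
by rewrite -subr_eq0 opprD addrA subrr add0r oppr_eq0 => /eqP.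
Qed.

Lemma dualZ a u g : Dpair u g -> T (fun x => a * u x) = a * T u.
Proof.
move=> Du; rewrite -[RHS]addr0 -dual0 -(dual_lin a Du Dpair0).
by congr T; apply/funext => x; rewrite addr0.
Qed.

Lemma dualD u v g k : Dpair u g -> Dpair v k -> T (fun x => u x + v x) = T u + T v.
Proof.
by move=> Du Dv; rewrite -[T u]mul1r -(dual_lin 1 Du Dv); congr T; apply/funext => x; rewrite mul1r.
Qed.

Lemma dual_bound : exists2 C : R, 0 <= C & forall u g, Dpair u g ->
  `|T u| <= C * (Npow u + Epow g) `^ p^-1.
Proof.
have [_ [C h]] := HT; exists `|C| => // u g Du.
apply: le_trans (h u (Dpair_W1p0 Du)) _; rewrite (norm1pE Du); apply: ler_wpM2r; first exact: powR_ge0.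
exact: ler_norm.
Qed.

Lemma dual_cvg (w : nat -> V -> R) (G : nat -> V -> V) u g : (forall k, Dpair (w k) (G k)) -> Dpair u g ->
  Npow (fun x => w k x - u x) @[k --> \oo] --> 0 -> Epow (fun x => G k x - g x) @[k --> \oo] --> 0 ->
  T (w k) @[k --> \oo] --> T u.
Proof.
move=> Dw Du N0 E0; have [C C0 H] := dual_bound.
have E k : T (w k) - T u = T (fun x => w k x - u x).
  rewrite (dualD (Dw k) (DpairN Du)); congr (_ + _).
  by rewrite -mulN1r -(dualZ (-1) Du); congr T; apply/funext => x; rewrite mulN1r.
suff : `|T (w k) - T u| @[k --> \oo] --> 0.
  move=> h; apply/cvgrPdist_le => e e0.
  have [K KP] := cvg0_small (fun k => normr_ge0 _) h e0.
  by exists K => // k /= /KP; rewrite distrC.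
apply: (@cvg0_le _ _ (fun k => C * (Npow (fun x => w k x - u x) + Epow (fun x => G k x - g x)) `^ p^-1)).
  by move=> k; rewrite normr_ge0 /= E; exact: H (DpairB (Dw k) Du).
apply: cvg0M.
have s0 : (Npow (fun x => w k x - u x) + Epow (fun x => G k x - g x)) @[k --> \oo] --> (0 : R).
  by rewrite -(addr0 0); exact: cvgD.
have q0 : 0 < p^-1 by rewrite invr_gt0.
have z0 : `|0 : R| `^ p^-1 = 0 by rewrite normr0 powR0// gt_eqF.
have : `|Npow (fun x => w k x - u x) + Epow (fun x => G k x - g x)| `^ p^-1 @[k --> \oo] --> `|0 : R| `^ p^-1.
  exact: cvg_normpow q0 s0.
by rewrite z0; under eq_fun do rewrite (ger0_norm (addr_ge0 (Npow_ge0 _) (Epow_ge0 _))).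
Qed.

(** The functional is convex, so the bound c passes to iterated midpoints, and it is continuous
    along their strong limit. *)
Lemma convex_lsc (u_ : nat -> V -> R) (g_ : nat -> V -> V) u (C c : R) :
  (forall k, Dpair (u_ k) (g_ k)) -> (forall k, Epow (g_ k) <= C) -> Lebesgue p Om u ->
  Npow (fun x => u_ k x - u x) @[k --> \oo] --> 0 ->
  (forall k, p^-1 * Epow (g_ k) - T (u_ k) <= c) ->
  exists2 g, Dpair u g & p^-1 * Epow g - T u <= c.
Proof.
move=> D EC Lu N0 H; have [g [w [G [Du mw wN GE]]]] := Dpair_weak_limit D EC Lu N0.
exists g => //; have Dw m := mid_Dpair D (mw m).
have pV0 : 0 <= p^-1 by rewrite invr_ge0 ltW.
have Hm m v k : mid u_ g_ m v k -> p^-1 * Epow k - T v <= c.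
  elim=> [j _|v1 h1 v2 h2 m1 IH1 m2 IH2]; first exact: H.
  have D1 := mid_Dpair D m1; have D2 := mid_Dpair D m2.
  have [_ Lh1 _] := D1; have [_ Lh2 _] := D2.
  rewrite (dualD (DpairZ 2^-1 D1) (DpairZ 2^-1 D2)) (dualZ _ D1) (dualZ _ D2).
  have h := ler_wpM2l pV0 (Epow_mid Lh1 Lh2); rewrite mulrDr 2!(mulrCA p^-1) in h; lra.
apply: (@cvg_le_cst _ (fun m => p^-1 * Epow (G m) - T (w m))); first by move=> m; exact: Hm (mw m).
have [_ Lg _] := Du; have LG m : Lpv (G m) by have [] := Dw m.
apply: cvgB; last exact: dual_cvg Dw Du wN GE.
by apply: cvgM; [exact: cvg_cst|exact: Epow_cvg LG Lg GE].
Qed.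

End dual.

Lemma scale_norm (t : R) u g : 0 < t -> Dpair u g -> Npow u + Epow g <= t `^ p ->
  Npow (fun x => t^-1 * u x) + Epow (fun x => t^-1 *: g x) <= 1.
Proof.
move=> t0 Du NE; have [Lu Lg _] := Du.
have ti : 0 <= t^-1 by rewrite invr_ge0 ltW.
rewrite (NpowZ _ Lu) (EpowZ _ Lg) -mulrDr (ger0_norm ti).
have -> : t^-1 `^ p = (t `^ p)^-1 by rewrite -(powR_inv1 (ltW t0)) powRAC powR_inv1 ?powR_ge0.
by rewrite ler_pdivrMl ?powR_gt0// mulr1.
Qed.

(** * Growth and lower semicontinuity of the energy *)

Section variational.
Context (f : V -> R -> R) (Hf : caratheodory_function Om f) (Hfsup : locally_sup_integrable Om f).
Context (alpha : R) (phi : R -> R) (eta : V -> R) (ap : 1 <= alpha <= p)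
  (Hphi : comparison_function p alpha phi) (Heta : X_alpha p alpha Om eta)
  (HG : G_le_uniformly p Om f phi eta) (lam0 : 0 <= lam).

Local Notation G := (Gfun p Om f).

Lemma mf_G u : mf u -> mf (fun x => G x (u x)).
Proof.
move=> um; apply: measurable_funB; first exact: (mf_prim Hf um).
by apply: measurable_funM; [exact: measurable_cst|exact: mf_normpow].
Qed.

Lemma ae_continuous_G : aeOn Om (fun x => continuous (G x)).
Proof.
apply: aeOn1 (ae_continuous_prim Hf) => x _ cx s.
apply: cvgB; first exact: cx.
by apply: cvgM; [exact: cvg_cst|exact: continuous_normpow].
Qed.

(** For |s| >= r this is the uniform bound with epsilon = 1. For |s| < r the primitive is at most r
    times the local bound of |f|, and the term in lambda_1 has a favourable sign. *)
Lemma G_bound : exists K : V -> R, [/\ ig K, forall x, 0 <= K x &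
  aeOn Om (fun x => forall s, G x s <= (`|eta x| + 1) * phi s + K x)].
Proof.
have [r r0 HGr] := HG ltr01; have [M [iM M0 MP]] := local_bound Hfsup r0.
have phi0 s : 0 <= phi s by have [[_ _ h] _] := Hphi.
exists (fun x => r * M x); split; first by have q := igZ mO r iM.
  by move=> x; rewrite mulr_ge0// ltW.
have [_ fc] := Hf; apply: aeOn3 HGr MP fc => x _ h1 h2 cx s.
have [rs|sr] := leP r `|s|.
  apply: ler_wpDr; first by rewrite mulr_ge0// ltW.
  apply: le_trans (h1 s rs) _; apply: ler_wpM2r => //; rewrite lerD2r; exact: ler_norm.
apply: ler_wpDl; first by rewrite mulr_ge0// addr_ge0.
have r0' := ltW r0.
have := prim_bound r0' (M0 x) cx (h2) (ltW sr) (_ : `|0| <= r); rewrite normr0 prim0 !subr0 => /(_ r0') h.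
rewrite /Gfun primitiveE; apply: (@le_trans _ _ (prim (f x) s)).
  by rewrite gerBl mulr_ge0 ?powR_ge0// divr_ge0// ltW.
apply: le_trans (ler_norm _) _; apply: le_trans h _; rewrite mulrC; apply: ler_wpM2r => //; exact: ltW.
Qed.

(** The constants of the growth estimate, bundled: the exponent s comes from the weighted Sobolev
    bound, and s' in (alpha, s) from condition (iv) on phi. The gap s' < s is the uniform
    integrability that [reverse_fatou] consumes. *)
Record growth_data := GrowthData {
  gd_K : V -> R; gd_t : R; gd_a : R; gd_b : R; gd_s : R; gd_s' : R; gd_C : R }.

Definition growth_ok (d : growth_data) := [/\ ig (gd_K d) /\ (forall x, 0 <= gd_K d x),
  [/\ 1 <= gd_t d, 0 <= gd_a d, 0 <= gd_b d & 0 <= gd_s' d < gd_s d],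
  (forall t, gd_t d <= t -> t <= phi t),
  (aeOn Om (fun x => forall t s, gd_t d <= t -> G x (t * s) <=
     (`|eta x| + 1) * (phi t * (gd_a d * `|s| `^ gd_s' d + gd_b d)) + gd_K d x)) &
  forall u g, Dpair u g -> Npow u + Epow g <= 1 ->
    ig (fun x => (`|eta x| + 1) * `|u x| `^ gd_s d) /\
    \int[mu]_(x in Om) ((`|eta x| + 1) * `|u x| `^ gd_s d) <= gd_C d].

Lemma growth_exists : exists d, growth_ok d.
Proof.
have [K [iK K0 KP]] := G_bound.
have [s [C [as_ HC]]] := eta_sobolev ap (X_alpha_normD1 ap Heta).
have /andP[a1 _] := ap.
pose s' := (alpha + s) / 2.
have [sa ss] : alpha < s' /\ s' < s by rewrite /s'; split; lra.
have [t0 [a [b [t00 a0 b0 _ H]]]] := phi_growth Hphi sa.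
have [t1 t10 t1P] := phi_ge Hphi 1.
exists (GrowthData K (Num.max 1 (Num.max t0 t1)) a b s s' C); split => //=.
- by rewrite le_max lexx; split=> //; rewrite ss andbT; lra.
- by move=> t; rewrite !ge_max => /andP[_ /andP[_ /t1P]]; rewrite mul1r.
- apply: aeOn1 KP => x _ h t s2; rewrite !ge_max => /andP[_ /andP[tt _]].
  apply: le_trans (h _) _; rewrite lerD2r; apply: ler_wpM2l; first by rewrite addr_ge0.
  exact: H.
- move=> u g Du NE; have := HC u g Du NE.
  have e0 x : `| `|eta x| + 1 | = `|eta x| + 1 by rewrite ger0_norm// addr_ge0.
  by rewrite (_ : (fun x => `| `|eta x| + 1 | * `|u x| `^ s) = (fun x => (`|eta x| + 1) * `|u x| `^ s))//;
    apply/funext => x; rewrite e0.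
Qed.

Context (d : growth_data) (Hd : growth_ok d).

Let e' x := `|eta x| + 1.
Let e'0 x : 0 <= e' x. Proof. by rewrite addr_ge0. Qed.
Let ie' : ig e'. Proof. by have q := igD mO (X_alpha_ig ap Heta) (ig_cst mO 1 fO). Qed.
Let t1 : 1 <= gd_t d. Proof. by have [_ []] := Hd. Qed.
Let tpos (t : R) : gd_t d <= t -> 0 < t. Proof. by move=> h; apply: lt_le_trans ltr01 (le_trans t1 h). Qed.
Let phipos t : gd_t d <= t -> 0 < phi t.
Proof. by move=> h; have [_ _ H _ _] := Hd; apply: lt_le_trans (tpos h) (H t h). Qed.

(** As 0 <= s' < s, r^s' <= 1 + r^s for every r >= 0. *)
Lemma ig_e'w (w : V -> R) g : Dpair w g -> Npow w + Epow g <= 1 ->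
  ig (fun x => e' x * `|w x| `^ gd_s' d) /\
  \int[mu]_(x in Om) (e' x * `|w x| `^ gd_s' d) <= \int[mu]_(x in Om) e' x + gd_C d.
Proof.
move=> Dw NE; have [_ [_ _ _ /andP[s0 ss]] _ _ H] := Hd; have [i1 C1] := H w g Dw NE.
have [Lw _ _] := Dw; have q := igD mO ie' i1.
have le x : e' x * `|w x| `^ gd_s' d <= e' x + e' x * `|w x| `^ gd_s d.
  rewrite -[X in X + _]mulr1 -mulrDr; apply: ler_wpM2l => //.
  have [w1|w1] := leP `|w x| 1.
    apply: ler_wpDr; first exact: powR_ge0.
    by have := powR_mono s0 (normr_ge0 (w x)) w1; rewrite powR1.
  by apply: ler_wpDl => //; apply: ler_powR; exact: ltW.
have i2 : ig (fun x => e' x * `|w x| `^ gd_s' d).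
  apply: (ig_le mO _ q).
    by apply: measurable_funM; [exact: ig_mf ie'|exact: mf_normpow (Lp_mf Lw)].
  by apply: aeW => x _; rewrite ger0_norm ?mulr_ge0 ?powR_ge0.
split=> //; apply: le_trans (I_le mO i2 q (fun x _ => le x)) _.
by have m1 := mO; rewrite RintegralD// lerD2l.
Qed.

Definition gd_B := gd_a d * (\int[mu]_(x in Om) e' x + gd_C d) + gd_b d * \int[mu]_(x in Om) e' x.

(** Writing u = t w with w in the unit ball turns the growth estimate into [phi t] times a bound
    that does not depend on u. *)
Lemma G_pos_bound (t : R) u g : gd_t d <= t -> Dpair u g -> Npow u + Epow g <= t `^ p ->
  ig (fun x => Num.max (G x (u x)) 0) /\
  \int[mu]_(x in Om) Num.max (G x (u x)) 0 <= phi t * gd_B + \int[mu]_(x in Om) gd_K d x.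
Proof.
move=> tt Du NE; have t0 := tpos tt; have [Lu _ _] := Du.
have [[iK K0] [_ a0 b0 _] _ GB _] := Hd.
have Dw := DpairZ t^-1 Du; have NEw := scale_norm t0 Du NE.
have [i1 I1] := ig_e'w Dw NEw.
pose A x := phi t * (gd_a d * (e' x * `|t^-1 * u x| `^ gd_s' d)) + phi t * (gd_b d * e' x).
have i2 := igZ mO (phi t) (igZ mO (gd_a d) i1); have i3 := igZ mO (phi t) (igZ mO (gd_b d) ie').
have iA : ig A by have q := igD mO i2 i3.
have iAK := igD mO iA iK.
have mG : mf (fun x => Num.max (G x (u x)) 0).
  by apply: measurable_maxr; [exact: mf_G (Lp_mf Lu)|exact: measurable_cst].
have pt := ltW (phipos tt).
have A0 x : 0 <= A x by rewrite addr_ge0// !mulr_ge0 ?powR_ge0.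
have le : aeOn Om (fun x => Num.max (G x (u x)) 0 <= A x + gd_K d x).
  apply: aeOn1 GB => x _ h; rewrite ge_max addr_ge0// andbT.
  have := h t (t^-1 * u x) tt; rewrite mulrA divff ?gt_eqF// mul1r => /le_trans; apply.
  by rewrite lerD2r /A le_eqVlt; apply/orP; left; apply/eqP; rewrite /e'; ring.
have iG : ig (fun x => Num.max (G x (u x)) 0).
  apply: (ig_le mO mG iAK); apply: aeOn1 le => x _ h.
  by rewrite ger0_norm// le_max lexx orbT.
split=> //; apply: le_trans (I_le_ae mO iG iAK le) _; have m1 := mO.
rewrite RintegralD// lerD2r /A RintegralD//.
have e1 : \int[mu]_(x in Om) (phi t * (gd_a d * (e' x * `|t^-1 * u x| `^ gd_s' d))) =
    phi t * (gd_a d * \int[mu]_(x in Om) (e' x * `|t^-1 * u x| `^ gd_s' d)).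
  by have q := igZ mO (gd_a d) i1; rewrite RintegralZl// RintegralZl.
have e2 : \int[mu]_(x in Om) (phi t * (gd_b d * e' x)) = phi t * (gd_b d * \int[mu]_(x in Om) e' x).
  by have q := igZ mO (gd_b d) ie'; rewrite RintegralZl// RintegralZl.
by rewrite e1 e2 -mulrDr; apply: ler_wpM2l => //; rewrite lerD2r; apply: ler_wpM2l.
Qed.

(** After rescaling by t the growth estimate meets the hypotheses of [reverse_fatou]. Integrability
    of the limit has two sides: the positive part comes from [G_pos_bound] at a radius adapted to u,
    the negative part from the integrable function z below it. *)
Lemma G_usc (t c : R) (u_ : nat -> V -> R) (g_ : nat -> V -> V) u g : gd_t d <= t ->
  (forall k, Dpair (u_ k) (g_ k)) -> (forall k, Npow (u_ k) + Epow (g_ k) <= t `^ p) ->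
  (forall k, ig (fun x => G x (u_ k x))) -> (forall k, c <= \int[mu]_(x in Om) G x (u_ k x)) ->
  aeOn Om (fun x => u_ k x @[k --> \oo] --> u x) -> Dpair u g ->
  ig (fun x => G x (u x)) /\ c <= \int[mu]_(x in Om) G x (u x).
Proof.
move=> tt D NE iG cG uc Du; have t0 := tpos tt; have [Lu _ _] := Du.
have [[iK K0] [_ a0 b0 /andP[s0 ss]] _ GB HC] := Hd; have pt := ltW (phipos tt).
pose w k x := t^-1 * u_ k x.
have Hw k := HC _ _ (DpairZ t^-1 (D k)) (scale_norm t0 (D k) (NE k)).
have XB k : aeOn Om (fun x => G x (u_ k x) <=
    e' x * (phi t * gd_a d * `|w k x| `^ gd_s' d + phi t * gd_b d) + gd_K d x).
  apply: aeOn1 GB => x _ h; have := h t (w k x) tt.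
  rewrite {1}/w mulrA divff ?gt_eqF// mul1r => /le_trans; apply.
  by rewrite lerD2r -mulrA -mulrDr.
have Zc : aeOn Om (fun x => forall r : R, ((G x (u x))%:E < r%:E)%E ->
    exists m, forall k, (m <= k)%N -> G x (u_ k x) <= r).
  apply: aeOn2 uc ae_continuous_G => x _ ux cx r; rewrite lte_fin => lt.
  have h : G x (u_ k x) @[k --> \oo] --> G x (u x) by exact: cvg_compR cx ux.
  by have [m _ mP] := cvgr_le _ h _ lt; exists m => k /mP.
have RF := reverse_fatou ie' e'0 iK K0 (mulr_ge0 pt a0) (mulr_ge0 pt b0) s0 ss
  (fun k => (Hw k).1) (fun k => (Hw k).2) iG cG XB Zc.
have [NT [NT1 NT2]] : exists t' : R, gd_t d <= t' /\ Npow u + Epow g <= t' `^ p.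
  exists (Num.max (gd_t d) ((Npow u + Epow g) `^ p^-1)); rewrite le_max lexx; split => //.
  have NE0 : 0 <= Npow u + Epow g by rewrite addr_ge0 ?Npow_ge0 ?Epow_ge0.
  rewrite -[leLHS](powRVK p0 NE0); apply: powR_mono; [exact: ltW|exact: powR_ge0|].
  by rewrite le_max lexx orbT.
have [iP _] := G_pos_bound NT1 Du NT2.
have iGu : ig (fun x => G x (u x)).
  have [z [iz _ zG]] := RF 1 ltr01.
  have q := igD mO (ig_norm iz) iP; apply: (ig_le mO (mf_G (Lp_mf Lu)) q).
  apply: aeOn1 zG => x _; rewrite lee_fin => h; rewrite ler_norml; apply/andP; split.
    rewrite lerNl; apply: le_trans (_ : - z x <= _); first by rewrite lerN2.
    apply: le_trans (ler_norm _) _; rewrite normrN lerDl le_max lexx orbT//.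
  by apply: ler_wpDl => //; rewrite le_max lexx.
split=> //; apply/ler_addgt0Pr => e e0; have [z [iz cz zG]] := RF e e0.
rewrite -lerBlDr; apply: le_trans cz _; apply: (I_le_ae mO iz iGu).
by apply: aeOn1 zG => x _; rewrite lee_fin.
Qed.

(** The eigenfunction is changed on a null set to be positive everywhere, as the Picone argument
    divides by it pointwise. *)
Lemma first_eigenfunction_simple phi1 w g : connected Om -> first_eigenfunction p Om phi1 ->
  Dpair w g -> Epow g <= lam * Npow w -> exists t : R, aeOn Om (fun x => w x = t * phi1 x).
Proof.
move=> cO [W1 eq1 pos1 _] Dw wm; have D1 := W1p0_Dpair W1; have [L1 Lg1 _] := D1.
pose psi x := if 0 < phi1 x then phi1 x else 1.
have psi0 x : 0 < psi x by rewrite /psi; case: ifP.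
have E : aeOn Om (fun x => phi1 x = psi x) by apply: aeOn1 pos1 => x _ h; rewrite /psi h.
have D2 : Dpair psi (grad p Om phi1) by apply: (Dpair_ae D1 E); exact: aeOnW.
have [L2 _ _] := D2.
have eqn v k : Dpair v k -> \int[mu]_(x in Om) dotv (pgrad p (grad p Om phi1 x)) (k x) =
    lam * \int[mu]_(x in Om) (`|psi x| `^ (p - 2) * psi x * v x).
  move=> Dv; rewrite -(neg_plaplacianE D1 Dv) (eq1 v (Dpair_W1p0 Dv)); congr (_ * _).
  have [Lv _ _] := Dv.
  have m (z : V -> R) : mf z -> mf (fun x => `|z x| `^ (p - 2) * z x * v x).
    move=> mz; apply: measurable_funM; last exact: Lp_mf Lv.
    by apply: measurable_funM; [exact: mf_normpow mz|exact: mz].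
  apply: (I_eq_ae mO (m _ (Lp_mf L1)) (m _ (Lp_mf L2))).
  by apply: aeOn1 E => x _ ->.
have l0 : 0 <= lam.
  apply: (lambda1_ge0 W1) => h; apply: (aeOn_false h) => x Ox e.
  have := aeOn2 (P1 := fun x => 0 < phi1 x) (P2 := fun x => phi1 x = 0) (Q := fun _ => False).
  move=> H; have : aeOn Om (fun _ => False).
    by apply: H pos1 h => y _ a b; rewrite b ltxx in a.
  by move=> F; exact: (aeOn_false F (fun _ _ => id)).
have [t tP] := minimizer_multiple cO D2 psi0 l0 eqn lambda1_le Dw wm.
by exists t; apply: aeOn2 tP E => x _ ->  ->.
Qed.

Lemma Gplus_lt x (r : R) : (Gplus p Om f phi x < r%:E)%E ->
  exists A : R, forall s, A <= s -> G x s / phi s <= r.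
Proof.
rewrite /Gplus limf_esupE => /ereal_inf_lt[_ [U [M [_ MU]] <-] lt].
exists (M + 1) => s sM; rewrite -lee_fin; apply: ltW; apply: le_lt_trans lt.
by apply: ereal_sup_ubound => /=; exists s => //; apply: MU; apply: lt_le_trans sM; rewrite ltrDl.
Qed.

Lemma Gminus_lt x (r : R) : (Gminus p Om f phi x < r%:E)%E ->
  exists A : R, forall s, A <= - s -> G x s / phi s <= r.
Proof.
rewrite /Gminus limf_esupE => /ereal_inf_lt[_ [U [M [_ MU]] <-] lt].
exists (- M + 1) => s sM; rewrite -lee_fin; apply: ltW; apply: le_lt_trans lt.
by apply: ereal_sup_ubound => /=; exists s => //; apply: MU; lra.
Qed.

Context (h : (V -> R) -> R) (Hh : dualW p Om h).

Definition energy u g := p^-1 * (Epow g - lam * Npow u) - \int[mu]_(x in Om) G x (u x) - h u.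

Lemma energy_convex_part_ge0 u g : Dpair u g -> 0 <= p^-1 * (Epow g - lam * Npow u).
Proof.
by move=> Du; apply: mulr_ge0; [rewrite invr_ge0; exact: ltW|rewrite subr_ge0; exact: lambda1_le Du].
Qed.

Lemma int_G_le (t : R) u g : gd_t d <= t -> Dpair u g -> Npow u + Epow g <= t `^ p ->
  ig (fun x => G x (u x)) ->
  \int[mu]_(x in Om) G x (u x) <= phi t * gd_B + \int[mu]_(x in Om) gd_K d x.
Proof.
move=> tt Du NE iG; have [i1 I1] := G_pos_bound tt Du NE.
by apply: le_trans I1; apply: (I_le mO iG i1) => x _; rewrite le_max lexx.
Qed.

Lemma dual_le : exists2 C : R, 0 <= C & forall u g (t : R), Dpair u g -> 0 <= t -> Npow u + Epow g <= t `^ p ->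
  `|h u| <= C * t.
Proof.
have [C C0 H] := dual_bound Hh; exists C => // u g t Du t0 NE.
apply: le_trans (H u g Du) _; apply: ler_wpM2l => //.
rewrite -[leRHS](powRK p0 t0); apply: powR_mono => //; first by rewrite invr_ge0 ltW.
by rewrite addr_ge0 ?Npow_ge0 ?Epow_ge0.
Qed.

(** The convex part is lower and the integral of G upper semicontinuous, by different arguments; a
    subsequence along which the integrals of G converge decouples them. *)
Lemma energy_lsc (t c : R) (u_ : nat -> V -> R) (g_ : nat -> V -> V) : gd_t d <= t ->
  (forall k, Dpair (u_ k) (g_ k)) -> (forall k, Npow (u_ k) + Epow (g_ k) <= t `^ p) ->
  (forall k, ig (fun x => G x (u_ k x))) ->
  (forall e, 0 < e -> exists m, forall k, (m <= k)%N -> energy (u_ k) (g_ k) <= c + e) ->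
  exists u g, [/\ Dpair u g, ig (fun x => G x (u x)) & energy u g <= c].
Proof.
move=> tt D NE iG Ec.
have [s [u [hs Lu N0]]] := rellich D NE.
have Lu_ k : Lebesgue p Om (u_ (s k)) by have [] := D (s k).
have [s2 hs2 ae2] := aeOn_cvg_subseq Lu_ Lu N0.
have t0 : 0 < t by exact: tpos tt.
have [Ch Ch0 HC] := dual_le.
have hE k := HC _ _ t (D k) (ltW t0) (NE k).
pose b k := \int[mu]_(x in Om) G x (u_ (s (s2 k)) x).
have [m0 m0P] := Ec 1 ltr01.
have [r hr br] : exists2 r : nat -> nat, {homo r : i j / (i < j)%N} & exists l : R, b (r k) @[k --> \oo] --> l.
  (* Bounds the integrals of G from both sides: above by the growth estimate, below because the
     energy is bounded and its convex part is nonnegative. *)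
  pose B := `|phi t * gd_B + \int[mu]_(x in Om) gd_K d x| + (`|c| + 1 + Ch * t).
  have bB k : `|b (k + m0)%N| <= B.
    have nm k' : (k' <= s (s2 k'))%N by apply: leq_trans (homo_ltn_ge hs2 k') (homo_ltn_ge hs _).
    rewrite ler_norml; apply/andP; split.
      have := m0P (s (s2 (k + m0)%N)) (leq_trans (leq_addl _ _) (nm _)); rewrite /energy -/(b _).
      have := energy_convex_part_ge0 (D (s (s2 (k + m0)%N))).
      have := hE (s (s2 (k + m0)%N)); rewrite ler_norml => /andP[q1 q2].
      have := ler_norm (c : R); have := normr_ge0 (phi t * gd_B + \int[mu]_(x in Om) gd_K d x).
      rewrite /B; move: (p^-1 * _) (b _) (h _) (Ch * t) (`|c|) `|_ + _| q1 q2 => z1 z2 z3 z4 z5 z6.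
      move: Ec m0P => _ _; lra.
    apply: le_trans (int_G_le tt (D _) (NE _) (iG _)) _; apply: le_trans (ler_norm _) _.
    by rewrite /B lerDl !addr_ge0// mulr_ge0// ltW.
  have bb : bounded_fun (fun k => b (k + m0)%N).
    exists B; split; first exact: num_real.
    by move=> x Bx k _ /=; apply: le_trans (bB k) (ltW Bx).
  have [r ir cr] := bolzano_weierstrass bb.
  exists (fun k => (r k + m0)%N).
    move=> i j; rewrite ltn_add2r !ltnNge => /negP nij; apply/negP => ji; apply: nij.
    by rewrite -(ir j i).
  by exists (limn (fun k => b (r k + m0)%N)); exact: cr.
have [l bl] := br.
pose v k := u_ (s (s2 (r k))); pose gv k := g_ (s (s2 (r k))).
have hsig : {homo (fun k => s (s2 (r k))) : i j / (i < j)%N} by move=> i j ij; apply: hs; apply: hs2; exact: hr.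
have hs2r : {homo (s2 \o r) : i j / (i < j)%N} by move=> i j ij; apply: hs2; exact: hr.
have vN : Npow (fun x => v k x - u x) @[k --> \oo] --> 0 by exact: cvg_subseq hs2r N0.
have vc : aeOn Om (fun x => v k x @[k --> \oo] --> u x).
  by apply: aeOn1 ae2 => x _; exact: cvg_subseq hr.
have Dv k : Dpair (v k) (gv k) := D _.
have NEv k : Npow (v k) + Epow (gv k) <= t `^ p := NE _.
have Ev k : Epow (gv k) <= t `^ p by apply: le_trans (NEv k); rewrite lerDr Npow_ge0.
have Nc : Npow (v k) @[k --> \oo] --> Npow u.
  have Lv k : Lebesgue p Om (v k) by have [] := Dv k.
  exact: Npow_cvg Lv Lu vN.
have shiftk m (a : nat -> R) (z : R) : a k @[k --> \oo] --> z -> a (k + m)%N @[k --> \oo] --> z.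
  by move=> az; apply: (@cvg_subseq _ a z (fun k => (k + m)%N)) => // i j; rewrite ltn_add2r.
have main (e : R) : 0 < e -> exists2 g, Dpair u g & ig (fun x => G x (u x)) /\ energy u g <= c + e.
  (* Four errors of size e / 4: the energy bound, the limit of the L^p norms, and twice the limit of
     the integrals of G. *)
  move=> e0; pose z := e / 4; have z0 : 0 < z by rewrite divr_gt0.
  have /cvgrPdist_le/(_ _ z0)[m1 _ m1P] := bl.
  have [m2 m2P] := Ec z z0.
  have Nl : (p^-1 * (lam * Npow (v k))) @[k --> \oo] --> p^-1 * (lam * Npow u).
    by apply: cvgM; [exact: cvg_cst|apply: cvgM => //; exact: cvg_cst].
  have /cvgrPdist_le/(_ _ z0)[m3 _ m3P] := Nl.
  pose m := maxn m1 (maxn m2 m3).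
  have mm k : [/\ (m1 <= k + m)%N, (m2 <= s (s2 (r (k + m))))%N & (m3 <= k + m)%N].
    have hk := homo_ltn_ge hsig (k + m)%N.
    have hm : (m <= k + m)%N := leq_addl _ _.
    split; [|apply: leq_trans hk|]; apply: leq_trans hm; rewrite /m !leq_max leqnn ?orbT//.
  have conv k : p^-1 * Epow (gv (k + m)%N) - h (v (k + m)%N) <= c + p^-1 * (lam * Npow u) + l + 3 * z.
    have [h1 h2 h3] := mm k; have := m1P _ h1; have := m3P _ h3; have := m2P _ h2.
    rewrite !ler_norml /energy -/(b _) -/(v _) -/(gv _) mulrBr => q1 /andP[q2 q3] /andP[q4 q5].
    rewrite /b /v /gv in q1 q2 q3 q4 q5 *.
    by move: (p^-1 * Epow _) (p^-1 * _) (p^-1 * _) (\int[mu]_(x in Om) _) (h _) q1 q2 q3 q4 q5 => *; lra.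
  have vNm : Npow (fun x => v (k + m)%N x - u x) @[k --> \oo] --> 0 by exact: shiftk vN.
  have [g Dg gE] := convex_lsc Hh (fun k => Dv (k + m)%N) (fun k => Ev (k + m)%N) Lu vNm conv.
  have bm k : l - z <= \int[mu]_(x in Om) G x (v (k + m)%N x).
    have [h1 _ _] := mm k; have := m1P _ h1; rewrite ler_norml => /andP[q1 q2].
    rewrite /b /v in q1 q2 *; move: (\int[mu]_(x in Om) _) q1 q2 => *; lra.
  have vcm : aeOn Om (fun x => v (k + m)%N x @[k --> \oo] --> u x).
    by apply: aeOn1 vc => x _; exact: shiftk.
  have [iGu Gl] := G_usc tt (fun k => Dv (k + m)%N) (fun k => NEv (k + m)%N) (fun k => iG _) bm vcm Dg.
  exists g => //; split => //; rewrite /energy mulrBr.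
  have e4 : e = 4 * z by rewrite /z mulrC divfK.
  rewrite e4; move: (p^-1 * Epow g) (p^-1 * _) (\int[mu]_(x in Om) _) (h _) gE Gl => *; lra.
have [g Dg [iGu _]] := main 1 ltr01.
exists u, g; split => //; apply/ler_addgt0Pr => e e0.
have [g' Dg' [_ h']] := main e e0.
have [_ Lg' _] := Dg'.
by rewrite /energy -(Epow_ae Lg' (Dpair_unique Dg' Dg)).
Qed.

(** * Coercivity and existence of a minimizer *)

Section coercivity.
Context (cO : connected Om) (phi1 : V -> R) (Hphi1 : first_eigenfunction p Om phi1).

Let phi1_gt0 : aeOn Om (fun x => 0 < phi1 x). Proof. by have [] := Hphi1. Qed.

(** A strong L^p limit v of the normalized functions satisfies Epow <= lam Npow, by lower
    semicontinuity. It is nonzero because 1 = Npow + Epow <= (1 + lam) Npow + e_k along the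
    sequence. *)
Lemma normalized_limit (t e : nat -> R) (u_ : nat -> V -> R) (g_ : nat -> V -> V) :
  (forall k, 0 < t k) -> (forall k, Dpair (u_ k) (g_ k)) ->
  (forall k, Npow (u_ k) + Epow (g_ k) = t k `^ p) ->
  (forall k, Epow (g_ k) - lam * Npow (u_ k) <= e k * t k `^ p) -> e k @[k --> \oo] --> 0 ->
  exists (s : nat -> nat) (c : R), [/\ {homo s : i j / (i < j)%N}, c != 0 &
    aeOn Om (fun x => (t (s k))^-1 * u_ (s k) x @[k --> \oo] --> c * phi1 x)].
Proof.
move=> t0 D NE Ee e0.
pose w k x := (t k)^-1 * u_ k x; pose gw k x := (t k)^-1 *: g_ k x.
have Dw k : Dpair (w k) (gw k) := DpairZ _ (D k).
have NEw k : Npow (w k) + Epow (gw k) = 1 /\ Epow (gw k) - lam * Npow (w k) <= e k.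
  have [Lu Lg _] := D k; have ti : 0 <= (t k)^-1 by rewrite invr_ge0 ltW.
  have tp : (t k)^-1 `^ p = (t k `^ p)^-1.
    by rewrite -(powR_inv1 (ltW (t0 k))) powRAC powR_inv1 ?powR_ge0.
  rewrite (NpowZ _ Lu) (EpowZ _ Lg) (ger0_norm ti) tp.
  have tp0 : 0 < t k `^ p by rewrite powR_gt0.
  split; first by rewrite -mulrDr NE mulVf// gt_eqF.
  by rewrite mulrCA -mulrBr mulrC ler_pdivrMr.
have NEw1 k : Npow (w k) + Epow (gw k) <= 1 by rewrite (NEw k).1.
have [s1 [v [hs1 Lv vN]]] := rellich Dw NEw1.
have Lw k : Lebesgue p Om (w (s1 k)) by have [] := Dw (s1 k).
have [s2 hs2 ae2] := aeOn_cvg_subseq Lw Lv vN.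
have Nc : Npow (w (s1 k)) @[k --> \oo] --> Npow v := Npow_cvg Lw Lv vN.
have ec : e (s1 k) @[k --> \oo] --> 0 := cvg_subseq hs1 e0.
have Ec : lam * Npow (w (s1 k)) + e (s1 k) @[k --> \oo] --> lam * Npow v.
  by rewrite -[X in _ --> X]addr0; apply: cvgD => //; apply: cvgM => //; exact: cvg_cst.
have Eg (z : R) : 0 < z -> exists2 g, Dpair v g & Epow g <= lam * Npow v + z.
  move=> z0; have /cvgrPdist_le/(_ _ z0)[m _ mP] := Ec.
  apply: (@Dpair_lsc (fun k => w (s1 (k + m)%N)) (fun k => gw (s1 (k + m)%N))) => // [k|].
    have h1 := (NEw (s1 (k + m)%N)).2; have h2 := mP _ (leq_addl k m).
    rewrite /= ler_norml in h2; have /andP[h3 _] := h2.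
    by move: (lam * _) (lam * _) h1 h3 => *; lra.
  by apply: (cvg_subseq _ vN) => i j; rewrite ltn_add2r.
have [g Dg _] := Eg 1 ltr01.
have Egl : Epow g <= lam * Npow v.
  apply/ler_addgt0Pr => z z0; have [g' Dg' hh'] := Eg z z0; have [_ Lg' _] := Dg'.
  by rewrite -(Epow_ae Lg' (Dpair_unique Dg' Dg)).
have N1 : 1 <= Npow v + lam * Npow v.
  rewrite -lerN2; apply: (@cvg_le_cst _ (fun k => - (Npow (w (s1 k)) + (lam * Npow (w (s1 k)) + e (s1 k))))).
    by move=> k; have [] := NEw (s1 k); move: (lam * _) => *; lra.
  by apply: cvgN; apply: cvgD.
have [c vc] := first_eigenfunction_simple cO Hphi1 Dg Egl.
exists (s1 \o s2), c; split.
- by move=> i j ij; apply: hs1; apply: hs2.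
- apply/eqP => c0; have v0 : aeOn Om (fun x => v x = 0) by apply: aeOn1 vc => x _ ->; rewrite c0 mul0r.
  by move: N1; rewrite (Npow_ae0 Lv v0) mulr0 addr0 ler10.
- by apply: aeOn2 ae2 vc => x _ hh <-.
Qed.

(** [Gs] stands for [Gplus] or [Gminus] according to the sign of c, the side on which u_k(x)
    diverges. The quotient X_k of G by |c|^alpha phi(t_k) has upper limit at most Gs phi_1^alpha,
    because phi(u_k) / phi(t_k) -> |c phi_1|^alpha, while its integral is bounded below by a
    quantity tending to 0. *)
Lemma limit_contradiction (t : nat -> R) (u_ : nat -> V -> R) (g_ : nat -> V -> V) (c : R) (Gs : V -> \bar R) :
  (forall x r, (Gs x < r%:E)%E -> exists A : R, forall s, A <= Num.sg c * s -> G x s / phi s <= r) ->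
  (\int[mu]_(x in Om) (Gs x * (phi1 x `^ alpha)%:E) < 0)%E ->
  (forall k, gd_t d <= t k) -> t k @[k --> \oo] --> +oo ->
  (forall k, Dpair (u_ k) (g_ k)) -> (forall k, Npow (u_ k) + Epow (g_ k) <= t k `^ p) ->
  (forall k, ig (fun x => G x (u_ k x))) ->
  (forall e, 0 < e -> exists m, forall k, (m <= k)%N ->
     - (e * phi (t k)) <= \int[mu]_(x in Om) G x (u_ k x)) ->
  c != 0 -> aeOn Om (fun x => (t k)^-1 * u_ k x @[k --> \oo] --> c * phi1 x) -> False.
Proof.
move=> GsP IG tt tc D NE iG GE c0 uc.
have [[iK K0] [_ a0 b0 /andP[s0 ss]] _ GB HC] := Hd.
have t0 k : 0 < t k := tpos (tt k).
have p0' k : 0 < phi (t k) := phipos (tt k).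
pose w k x := (t k)^-1 * u_ k x.
have Hw k := HC _ _ (DpairZ (t k)^-1 (D k)) (scale_norm (t0 k) (D k) (NE k)).
have ca : 0 < `|c| `^ alpha by apply: powR_gt0; rewrite normr_gt0.
pose q k := (`|c| `^ alpha * phi (t k))^-1.
have q0 k : 0 < q k by rewrite invr_gt0 mulr_gt0.
pose X k x := q k * G x (u_ k x).
have iX k : ig (X k) by have hh := igZ mO (q k) (iG k).
have IX k : \int[mu]_(x in Om) X k x = q k * \int[mu]_(x in Om) G x (u_ k x).
  by have m1 := mO; rewrite /X RintegralZl//; exact: iG.
have ph1 k : 1 <= phi (t k).
  by have [_ _ H _ _] := Hd; apply: le_trans (H _ (tt k)); apply: le_trans (tt k).
have XB k : aeOn Om (fun x => X k x <=
    e' x * ((`|c| `^ alpha)^-1 * gd_a d * `|w k x| `^ gd_s' d + (`|c| `^ alpha)^-1 * gd_b d) +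
    (`|c| `^ alpha)^-1 * gd_K d x).
  apply: aeOn1 GB => x _ hh; have := hh (t k) (w k x) (tt k).
  rewrite {1}/w mulrA divff ?gt_eqF// mul1r => h1.
  have h2 := ler_wpM2l (ltW (q0 k)) h1; apply: le_trans h2 _; rewrite mulrDr; apply: lerD.
    rewrite /q -/(e' x) le_eqVlt; apply/orP; left; apply/eqP; field.
    by rewrite !gt_eqF.
  apply: ler_wpM2r => //; rewrite /q lef_pV2 ?posrE ?mulr_gt0//.
  by rewrite ler_peMr// ltW.
have iK' : ig (fun x => (`|c| `^ alpha)^-1 * gd_K d x) by have hh := igZ mO (`|c| `^ alpha)^-1 iK.
have ci : 0 <= (`|c| `^ alpha)^-1 by rewrite invr_ge0 ltW.
have Zc : aeOn Om (fun x => forall r : R, (Gs x * (phi1 x `^ alpha)%:E < r%:E)%E ->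
    exists m, forall k, (m <= k)%N -> X k x <= r).
  apply: aeOn2 uc phi1_gt0 => x _ ux x0 r lt.
  pose P := phi1 x `^ alpha; have P0 : 0 < P by rewrite powR_gt0.
  (* Room between Gs(x) and r / phi_1(x)^alpha; Gs(x) = -oo is allowed. *)
  have [r' [Gr' r'P]] : exists r', (Gs x < r'%:E)%E /\ r' * P < r.
    move: lt; rewrite -/P; case: (Gs x) => [a|/=|_].
    - rewrite -EFinM lte_fin => lt; exists ((a + r / P) / 2); rewrite lte_fin.
      have hh : a < r / P by rewrite ltr_pdivlMr.
      by split; [lra|rewrite -ltr_pdivlMr//; lra].
    - by rewrite gt0_mulye ?lte_fin// => /lt_trans/(_ (ltry r)); rewrite ltxx.
    - by exists (r / P - 1); rewrite ltNyr; split=> //; rewrite -ltr_pdivlMr// gtrBl.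
  have [A AP] := GsP x r' Gr'.
  have lx : c * phi1 x != 0 by rewrite mulf_neq0// gt_eqF.
  have sc : Num.sg c * (t k)^-1 * u_ k x @[k --> \oo] --> `|c| * phi1 x.
    rewrite -[`|c|]mulr1 -mulrA mul1r [`|c|]normrEsg -mulrA.
    under eq_fun do rewrite -mulrA.
    by apply: cvgM => //; exact: cvg_cst.
  pose b := `|c| * phi1 x / 2.
  have b0' : 0 < b by rewrite divr_gt0// mulr_gt0// normr_gt0.
  have lb : b < `|c| * phi1 x by rewrite /b in b0' *; lra.
  have [m1 _ m1P] := cvgr_ge _ sc _ lb.
  have [t2 t20 t2P] := phi_ge Hphi 1.
  have /cvgryPge/(_ (Num.max A t2 / b))[m2 _ m2P] := tc.
  have ubig k : (maxn m1 m2 <= k)%N -> Num.max A t2 <= Num.sg c * u_ k x.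
    rewrite geq_max => /andP[/m1P h1 /m2P h2]; rewrite /= in h1 h2.
    rewrite ler_pdivrMr// in h2; apply: le_trans h2 _.
    rewrite mulrAC ler_pdivlMr in h1; last exact: t0.
    by rewrite mulrC.
  pose qx k := phi (u_ k x) / phi (t k) / `|c| `^ alpha.
  have qc : r' * qx k @[k --> \oo] --> r' * P.
    apply: cvgM; first exact: cvg_cst.
    have hh := phi_ratio Hphi t0 tc ux lx.
    have E : (fun k => phi (t k * ((t k)^-1 * u_ k x)) / phi (t k)) = (fun k => phi (u_ k x) / phi (t k)).
      by apply/funext => k; rewrite mulrA divff ?mul1r// gt_eqF.
    rewrite E in hh.
    have -> : P = `|c * phi1 x| `^ alpha / `|c| `^ alpha.
      by rewrite normrM powRM// (gtr0_norm x0) mulrC mulKf// gt_eqF.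
    by apply: cvgM => //; exact: cvg_cst.
  have [m3 _ m3P] := cvgr_le _ qc _ r'P.
  exists (maxn (maxn m1 m2) m3) => k; rewrite geq_max => /andP[/ubig h1 /m3P h2].
  rewrite /= in h2; apply: le_trans h2.
  move: h1; rewrite ge_max => /andP[/AP h1 h3].
  have pu : 0 < phi (u_ k x).
    have su : t2 <= `|u_ k x|.
      apply: le_trans h3 _; apply: le_trans (ler_norm _) _.
      by rewrite normrM normr_sg c0 mul1r.
    have := t2P _ su; rewrite mul1r => h4.
    have <- : phi `|u_ k x| = phi (u_ k x) by rewrite (phi_even Hphi (u_ k x)).
    by apply: lt_le_trans h4; apply: lt_le_trans su.
  rewrite ler_pdivrMr// in h1.
  have h4 := ler_wpM2l (ltW (q0 k)) h1; apply: le_trans h4 _.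
  rewrite /q /qx le_eqVlt; apply/orP; left; apply/eqP; field.
  by rewrite !gt_eqF.
(* The integral is at least -e for every e > 0; whether it is real, +oo or -oo, this contradicts its
   being negative. *)
have main (e : R) : 0 < e -> ((- e)%:E <= \int[mu]_(x in Om) (Gs x * (phi1 x `^ alpha)%:E))%E.
  move=> e0; pose z := e / 2; have z0 : 0 < z by rewrite divr_gt0.
  have zc : 0 < z * `|c| `^ alpha by rewrite mulr_gt0.
  have [m mP] := GE _ zc.
  have cX k : - z <= \int[mu]_(x in Om) X (k + m)%N x.
    have hh := ler_wpM2l (ltW (q0 (k + m)%N)) (mP _ (leq_addl k m)); rewrite IX; apply: le_trans hh.
    rewrite /q le_eqVlt; apply/orP; left; apply/eqP; field.
    by rewrite !gt_eqF.
  have Zm : aeOn Om (fun x => forall r : R, (Gs x * (phi1 x `^ alpha)%:E < r%:E)%E ->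
      exists m', forall k, (m' <= k)%N -> X (k + m)%N x <= r).
    apply: aeOn1 Zc => x _ hh r /hh[m' m'P]; exists m' => k km; apply: m'P.
    by apply: leq_trans km (leq_addr _ _).
  have [y [iy Iy yZ]] := reverse_fatou ie' e'0 iK' (fun x => mulr_ge0 ci (K0 x))
    (mulr_ge0 ci a0) (mulr_ge0 ci b0) s0 ss
    (fun k => (Hw (k + m)%N).1) (fun k => (Hw (k + m)%N).2)
    (fun k => iX (k + m)%N) cX (fun k => XB (k + m)%N) Zm z0.
  apply: le_trans (I_ereal_ge iy yZ); rewrite lee_fin; apply: le_trans Iy.
  by rewrite /z; lra.
move: IG main; case: (\int[mu]_(x in Om) _)%E => [r| |].
- rewrite lte_fin => r0 /(_ (- r / 2)); rewrite lee_fin => hh.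
  have : 0 < - r / 2 by lra.
  by move=> /hh; lra.
- by [].
- by move=> _ /(_ 1 ltr01); rewrite leeNy_eq.
Qed.

Context (HGplus : (\int[mu]_(x in Om) (Gplus p Om f phi x * (phi1 x `^ alpha)%:E) < 0)%E)
  (HGminus : (\int[mu]_(x in Om) (Gminus p Om f phi x * (phi1 x `^ alpha)%:E) < 0)%E).

Lemma coercive (c : R) : exists2 t : R, gd_t d <= t & forall u g, Dpair u g -> ig (fun x => G x (u x)) ->
  energy u g <= c -> Npow u + Epow g <= t `^ p.
Proof.
apply: contrapT => nt.
have /choice[ug ugP] : forall k : nat, exists ug : (V -> R) * (V -> V),
    [/\ Dpair ug.1 ug.2, ig (fun x => G x (ug.1 x)), energy ug.1 ug.2 <= c &
        (gd_t d + k%:R) `^ p < Npow ug.1 + Epow ug.2].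
  move=> k; apply: contrapT => nk; apply: nt; exists (gd_t d + k%:R); first by rewrite lerDl.
  move=> u g Du iG Eu; rewrite leNgt; apply/negP => lt; apply: nk.
  by exists (u, g).
pose NE k := Npow (ug k).1 + Epow (ug k).2.
pose t k := NE k `^ p^-1.
have NE0 k : 0 <= NE k by rewrite addr_ge0 ?Npow_ge0 ?Epow_ge0.
have tp k : t k `^ p = NE k by exact: powRVK.
have tk k : gd_t d + k%:R <= t k.
  have [_ _ _ hh] := ugP k; have gk : 0 <= gd_t d + k%:R by rewrite addr_ge0// (le_trans ler01).
  rewrite -(powRK p0 gk); apply: powR_mono; [by rewrite invr_ge0; exact: ltW|exact: powR_ge0|exact: ltW].
have tt k : gd_t d <= t k by apply: le_trans (tk k); rewrite lerDl.
have tc : t k @[k --> \oo] --> +oo.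
  apply/cvgryPge => A; exists (Num.truncn A).+1 => // k /= Ak; apply: le_trans (tk k).
  have := real_truncnS_gt (num_real A) => hh; apply: ltW; apply: lt_le_trans hh _.
  apply: (@le_trans _ _ k%:R); first by rewrite ler_nat.
  by rewrite lerDr (le_trans ler01).
have t0 k : 0 < t k := tpos (tt k).
have [Ch Ch0 HC] := dual_le.
have hE k : `|h (ug k).1| <= Ch * t k.
  by have [Dk _ _ _] := ugP k; apply: (HC _ _ (t k) Dk (ltW (t0 k))); rewrite tp.
have pht k : t k <= phi (t k) by have [_ _ H _ _] := Hd; exact: H.
have t1k k : 1 <= t k by exact: le_trans t1 (tt k).
pose KI := \int[mu]_(x in Om) gd_K d x.
(* Since 1 <= t <= phi(t), the constants, the growth term and the linear form are all bounded in
   units of phi(t). *)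
pose C := p * (`|c + KI| + gd_B + Ch).
have E1 k : Epow (ug k).2 - lam * Npow (ug k).1 <= C * (phi (t k) / `|t k| `^ p) * t k `^ p.
  have [Dk iGk Ek _] := ugP k.
  have tpk : 0 < t k `^ p by apply: powR_gt0; exact: t0.
  rewrite (gtr0_norm (t0 k)) -mulrA divfK ?gt_eqF//.
  have NEk : Npow (ug k).1 + Epow (ug k).2 <= t k `^ p by rewrite tp.
  have := int_G_le (tt k) Dk NEk iGk; rewrite -/KI => h1.
  have := hE k; rewrite ler_norml => /andP[_ h2].
  rewrite /energy in Ek.
  rewrite /C -mulrA -ler_pdivrMl//.
  have h3 : `|c + KI| <= `|c + KI| * phi (t k).
    by rewrite ler_peMr// (le_trans (t1k k)).
  have h4 : Ch * t k <= Ch * phi (t k) by rewrite ler_wpM2l.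
  have h5 := ler_norm (c + KI).
  have -> : (`|c + KI| + gd_B + Ch) * phi (t k) = `|c + KI| * phi (t k) + phi (t k) * gd_B + Ch * phi (t k).
    by ring.
  move: (p^-1 * _) (\int[mu]_(x in Om) _) (h _) Ek h1 h2 => z1 z2 z3 Ek h1 h2.
  move: (`|c + KI|) (phi (t k)) h1 h2 h3 h4 h5 => A P h1 h2 h3 h4 h5.
  by move: (P * gd_B) (Ch * P) (Ch * t k) (A * P) h1 h2 h3 h4 => *; lra.
have e0 : C * (phi (t k) / `|t k| `^ p) @[k --> \oo] --> 0.
  have [_ [Hi _ _ _]] := Hphi.
  by apply: cvg0M; apply: (cvg_comp _ _ tc Hi).
have Du k : Dpair (ug k).1 (ug k).2 by have [] := ugP k.
have [s [tau [hs tau0 uc]]] := normalized_limit t0 Du (fun k => esym (tp k)) E1 e0.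
have tsc : t (s k) @[k --> \oo] --> +oo.
  apply/cvgryPge => A; have /cvgryPge/(_ A)[m _ mP] := tc; exists m => // k /= mk; apply: mP.
  by apply: leq_trans mk (homo_ltn_ge hs k).
have iGs k : ig (fun x => G x ((ug (s k)).1 x)) by have [] := ugP (s k).
have NEs k : Npow (ug (s k)).1 + Epow (ug (s k)).2 <= t (s k) `^ p by rewrite tp.
(* From energy <= c the integral of G is at least -(Ch + |c|) t, and superlinearity of phi makes
   this at least -e phi(t) for t large. *)
have GE (e : R) : 0 < e -> exists m, forall k, (m <= k)%N ->
     - (e * phi (t (s k))) <= \int[mu]_(x in Om) G x ((ug (s k)).1 x).
  move=> ep; have [A _ AP] := phi_ge Hphi ((Ch + `|c|) / e).
  have /cvgryPge/(_ A)[m _ mP] := tsc.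
  exists m => k /mP /= /AP; rewrite mulrAC ler_pdivrMr// => h1.
  have [Dk _ Ek _] := ugP (s k); have c1 := energy_convex_part_ge0 Dk.
  have := hE (s k); rewrite ler_norml => /andP[_ h2].
  rewrite /energy in Ek; rewrite mulrDl in h1.
  have h3 : c <= `|c| * t (s k) by apply: le_trans (ler_norm c) _; rewrite ler_peMr.
  rewrite mulrC; move: (p^-1 * _) (\int[mu]_(x in Om) _) (h _) c1 Ek h2 => z1 z2 z3 c1 Ek h2.
  by move: (Ch * _) (`|c| * _) (phi _ * e) h1 h2 h3 => z4 z5 z6; lra.
have fin (Gs : V -> \bar R) : (forall x r, (Gs x < r%:E)%E -> exists A : R, forall s, A <= Num.sg tau * s -> G x s / phi s <= r) ->
  (\int[mu]_(x in Om) (Gs x * (phi1 x `^ alpha)%:E) < 0)%E -> False.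
  by move=> h1 h2; apply: (limit_contradiction h1 h2 (fun k => tt (s k)) tsc (fun k => Du (s k)) NEs iGs GE tau0 uc).
have [taup|taun|tz] := ltrgtP tau 0; last by rewrite tz eqxx in tau0.
- apply: (fin (Gminus p Om f phi)) => // x r /Gminus_lt[A AP]; exists A => z.
  by rewrite ltr0_sg// mulN1r; exact: AP.
- apply: (fin (Gplus p Om f phi)) => // x r /Gplus_lt[A AP]; exists A => z.
  by rewrite gtr0_sg// mul1r; exact: AP.
Qed.

Local Notation F := (fun x s => prim (f x) s).

Lemma ig_F u g : Dpair u g -> ig (fun x => G x (u x)) <-> ig (fun x => F x (u x)).
Proof.
move=> [Lu _ _]; have iN := igZ mO (lam / p) (Lp_igp Lu); split=> i.
  have q := igD mO i iN; apply: (ig_ae mO (mf_prim Hf (Lp_mf Lu)) q).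
  by apply: aeOnW => x _; rewrite /Gfun primitiveE subrK.
by have q := igB mO i iN.
Qed.

Lemma energyE u g : Dpair u g -> ig (fun x => F x (u x)) ->
  energy u g = p^-1 * Epow g - \int[mu]_(x in Om) F x (u x) - h u.
Proof.
move=> [Lu _ _] i; have iN := igZ mO (lam / p) (Lp_igp Lu); rewrite /energy.
have -> : \int[mu]_(x in Om) G x (u x) = \int[mu]_(x in Om) F x (u x) - lam / p * Npow u.
  have m1 := mO; transitivity (\int[mu]_(x in Om) (F x (u x) - lam / p * `|u x| `^ p)); first by [].
  by rewrite RintegralB// RintegralZl ?NpowE//; exact: Lp_igp Lu.
have -> : p^-1 * (Epow g - lam * Npow u) = p^-1 * Epow g - lam / p * Npow u.
  by rewrite mulrBr mulrA (mulrC p^-1 lam).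
by move: (p^-1 * Epow g) (\int[mu]_(x in Om) _) (h u) (lam / p * _) => a b c e; ring.
Qed.

(** The growth bound on G always makes the positive part integrable, so only the negative part of
    F(x, u) can have infinite integral. *)
Lemma ig_F_pos u g : Dpair u g -> ig (fun x => Num.max (F x (u x)) 0).
Proof.
move=> Du; have [Lu _ _] := Du; have iN := igZ mO (lam / p) (Lp_igp Lu).
have NE0 : 0 <= Npow u + Epow g by rewrite addr_ge0 ?Npow_ge0 ?Epow_ge0.
pose t := Num.max (gd_t d) ((Npow u + Epow g) `^ p^-1).
have tt : gd_t d <= t by rewrite le_max lexx.
have NEt : Npow u + Epow g <= t `^ p.
  rewrite -[leLHS](powRVK p0 NE0); apply: powR_mono; [exact: ltW|exact: powR_ge0|].
  by rewrite le_max lexx orbT.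
have [iP _] := G_pos_bound tt Du NEt; have q := igD mO iP iN.
apply: (ig_le mO _ q).
  by apply: measurable_maxr; [exact: (mf_prim Hf (Lp_mf Lu))|exact: measurable_cst].
apply: aeOnW => x _; have l0 : 0 <= lam / p * `|u x| `^ p by rewrite mulr_ge0 ?powR_ge0// divr_ge0// ltW.
rewrite ger0_norm ?le_max ?lexx ?orbT// ge_max addr_ge0 ?le_max ?lexx ?orbT// andbT.
by rewrite -lerBlDr -primitiveE le_max lexx.
Qed.

(** The zero function has energy 0, so the infimum is taken over energies at most 0, where
    coercivity bounds the norms; competitors of positive energy are compared with the zero
    function. *)
Lemma energy_minimizer : exists u g, [/\ Dpair u g, ig (fun x => F x (u x)) &
  forall v k, Dpair v k -> ig (fun x => F x (v x)) ->
    p^-1 * Epow g - \int[mu]_(x in Om) F x (u x) - h u <=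
    p^-1 * Epow k - \int[mu]_(x in Om) F x (v x) - h v].
Proof.
have [t tt tP] := coercive 0.
have [Ch Ch0 HC] := dual_le.
have G0 x : G x 0 = 0 by rewrite /Gfun primitiveE prim0 normr0 powR0 ?mulr0 ?subr0// gt_eqF.
have iG0 : ig (fun x => G x 0).
  apply: (ig_ae mO (mf_G (measurable_cst _)) (ig_cst mO 0 fO)).
  by apply: aeOnW => x _ /=; rewrite G0.
have E0 : energy (fun=> 0) (fun=> 0) = 0.
  have [Lz _ _] := Dpair0.
  rewrite /energy Epow0 (Npow_ae0 Lz (aeOnW (fun _ _ => erefl))) (dual0 Hh) !(mulr0, subr0) sub0r.
  by rewrite (@I_eq _ (lebT R n) R mu Om _ (fun=> 0)) ?(Rintegral_cst mu mO) ?mul0r ?oppr0// => x _; exact: G0.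
pose S := [set r : R | exists u g, [/\ Dpair u g, ig (fun x => G x (u x)), energy u g <= 0 & r = energy u g]].
have Sinf : has_inf S.
  split.
    exists 0, (fun=> 0), (fun=> 0); rewrite E0; split=> //; exact: Dpair0.
  exists (- (phi t * gd_B + \int[mu]_(x in Om) gd_K d x) - Ch * t) => _ [u [g [Du iG Eu ->]]].
  have NE := tP _ _ Du iG Eu; have h1 := int_G_le tt Du NE iG.
  have := HC _ _ t Du (ltW (tpos tt)) NE; rewrite ler_norml => /andP[_ h2].
  have c1 := energy_convex_part_ge0 Du; rewrite /energy.
  move: (p^-1 * _) (\int[mu]_(x in Om) G x (u x)) (h u) (Ch * t) c1 h1 h2 => z1 z2 z3 z4 c1 h1 h2; lra.
pose c := inf S.
have /choice[ug ugP] : forall k : nat, exists ug : (V -> R) * (V -> V),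
    [/\ Dpair ug.1 ug.2, ig (fun x => G x (ug.1 x)), energy ug.1 ug.2 <= 0 &
        energy ug.1 ug.2 <= c + k.+1%:R^-1].
  move=> k; have k0 : 0 < (k.+1%:R^-1 : R) by rewrite invr_gt0.
  have [_ [u [g [Du iG Eu ->]]] lt] := inf_adherent k0 Sinf.
  by exists (u, g); split=> //; exact: ltW.
have Du k : Dpair (ug k).1 (ug k).2 by have [] := ugP k.
have iGk k : ig (fun x => G x ((ug k).1 x)) by have [] := ugP k.
have NE k : Npow (ug k).1 + Epow (ug k).2 <= t `^ p.
  by have [D1 i1 E1 _] := ugP k; exact: tP D1 i1 E1.
have Ec (e : R) : 0 < e -> exists m, forall k, (m <= k)%N -> energy (ug k).1 (ug k).2 <= c + e.
  move=> e0; have := real_truncnS_gt (num_real e^-1); set m := (Num.truncn _).+1 => lt.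
  exists m => k mk; have [_ _ _ h1] := ugP k; apply: le_trans h1 _; rewrite lerD2l.
  rewrite invf_ple ?posrE//; apply: ltW; apply: lt_le_trans lt _; rewrite ler_nat.
  exact: leq_trans mk (leqnSn _).
have [u [g [Dug iGu Eu]]] := energy_lsc tt Du NE iGk Ec.
have iFu := iffLR (ig_F Dug) iGu; exists u, g; split=> //.
move=> v k Dv iv; suff : energy u g <= energy v k by rewrite (energyE Dug iFu) (energyE Dv iv).
apply: le_trans Eu _.
have [Ev|Ev] := leP (energy v k) 0.
  by apply: ge_inf; [exact: Sinf.2|exists v, k; split=> //; exact/(ig_F Dv)].
apply: le_trans (ltW Ev); apply: ge_inf; first exact: Sinf.2.
exists (fun=> 0), (fun=> 0); rewrite E0; split=> //; first exact: Dpair0.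
Qed.

End coercivity.
End variational.

(** * First variation and the weak equation *)

Lemma prim_diffquot (a : R -> R) (s v : R) (t : nat -> R) : continuous a ->
  (forall k, t k != 0) -> t k @[k --> \oo] --> 0 ->
  (t k)^-1 * (prim a (s + t k * v) - prim a s) @[k --> \oo] --> a s * v.
Proof.
move=> ca tn t0.
have [->|v0] := eqVneq v 0.
  rewrite mulr0; apply: cvg_near_cst; apply: nearW => k.
  by rewrite mulr0 addr0 subrr mulr0.
have [dA vA] := is_derive_prim s ca.
have H : h^-1 *: ((prim a \o shift s) (h *: 1) - prim a s) @[h --> 0^'] --> a s by rewrite -vA; exact: dA.
have tv0 : t k * v @[k --> \oo] --> 0 by rewrite -(mul0r v); apply: cvgM => //; exact: cvg_cst.
have tvn k : t k * v != 0 by rewrite mulf_neq0.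
have /cvgr_dnbhsP/(_ (fun k => t k * v) (conj tvn tv0)) H' := H.
rewrite (_ : (fun k => _) =
    (fun k => (t k * v)^-1 *: ((prim a \o shift s) (t k * v *: (1 : R)) - prim a s) * v)).
  by apply: cvgM; [exact: H'|exact: cvg_cst].
apply/funext => k; rewrite /GRing.scale /= mulr1 (addrC (t k * v)); field.
by rewrite v0 tn.
Qed.

(** At a = 0 the factor |Z|^(p-2) need not be continuous, so the limit there comes from homogeneity:
    the quantity equals |b|^p t^(p-1). *)
Lemma cvg_pgrad_line (a b : V) (t : nat -> R) : (forall k, 0 < t k) -> t k @[k --> \oo] --> 0 ->
  dotv (pgrad p (a + t k *: b)) b @[k --> \oo] --> dotv (pgrad p a) b.
Proof.
move=> tp t0; have [->|a0] := eqVneq a 0.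
  have -> : dotv (pgrad p 0) b = 0 by rewrite /pgrad scaler0 -(scale0r (0 : V)) dotvZl mul0r.
  have E k : dotv (pgrad p (0 + t k *: b)) b = euclid b `^ p * `|t k| `^ (p - 1).
    by rewrite add0r (pgradZ b (ltW (tp k))) dotvZl (dotv_pgradv p1) mulrC (gtr0_norm (tp k)).
  rewrite (_ : (fun k => _) = (fun k => euclid b `^ p * `|t k| `^ (p - 1))); last by apply/funext => k; exact: E.
  apply: cvg0M; have q0 : 0 < p - 1 by rewrite subr_gt0.
  have z0 : `|0 : R| `^ (p - 1) = 0 by rewrite normr0 powR0// gt_eqF.
  have : `|t k| `^ (p - 1) @[k --> \oo] --> `|0 : R| `^ (p - 1) by exact: cvg_normpow q0 t0.
  by rewrite z0.
have ea : 0 < euclid a by rewrite lt_def euclid_eq0 a0 euclid_ge0.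
have at0 i : (a + t k *: b) ord0 i @[k --> \oo] --> a ord0 i.
  rewrite (_ : (fun k => _) = (fun k => a ord0 i + t k * b ord0 i)); last by apply/funext => k; rewrite !mxE.
  rewrite -[X in _ --> X]addr0 -(mul0r (b ord0 i)); apply: cvgD; first exact: cvg_cst.
  by apply: cvgM; [exact: t0|exact: cvg_cst].
rewrite (_ : (fun k => _) = (fun k => euclid (a + t k *: b) `^ (p - 2) * dotv (a + t k *: b) b)); last first.
  by apply/funext => k; rewrite dotv_pgrad.
rewrite dotv_pgrad; apply: cvgM; first by apply: cvg_powR ea _; exact: cvg_euclid at0.
by apply: cvg_dotv => // i; exact: cvg_cst.
Qed.

(** For 0 < t <= 1 the integrand is dominated by (|g| + |k|)^p. *)
Lemma pgrad_line_cvg g k (t : nat -> R) : Lpv g -> Lpv k -> (forall j, 0 < t j) -> (forall j, t j <= 1) ->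
  t j @[j --> \oo] --> 0 ->
  \int[mu]_(x in Om) dotv (pgrad p (g x + t j *: k x)) (k x) @[j --> \oo] -->
  \int[mu]_(x in Om) dotv (pgrad p (g x)) (k x).
Proof.
move=> Lg Lk tp tl t0.
have i k0 : ig (fun x => dotv (pgrad p (g x + t k0 *: k x)) (k x)) := ig_pgrad (LpvD Lg (LpvZ (t k0) Lk)) Lk.
have ib := Lp_igp (LpD (Lpv_euclid Lg) (Lpv_euclid Lk)).
have [||_ H _] := @dominated_cvgR _ (lebT R n) R mu Om mO
  (fun j x => dotv (pgrad p (g x + t j *: k x)) (k x)) (fun x => dotv (pgrad p (g x)) (k x)) _
  (fun j => ig_mf (i j)) (ig_mf (ig_pgrad Lg Lk)) ib; last exact: H.
- by apply: aeOnW => x _; exact: cvg_pgrad_line.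
- move=> j; apply: aeOnW => x _; apply: le_trans (normr_dotv_pgrad_le p1 _ _) _.
  have e0 : 0 <= euclid (g x) + euclid (k x) by rewrite addr_ge0 ?euclid_ge0.
  rewrite (ger0_norm e0) -[leRHS](mulr_powRB1 e0 p0) mulrC; apply: ler_pM; rewrite ?powR_ge0 ?euclid_ge0//.
    by rewrite lerDr euclid_ge0.
  apply: ge0_ler_powR; rewrite ?nnegrE ?euclid_ge0// ?subr_ge0 ?(ltW p1)//.
  apply: le_trans (euclidD _ _) _; rewrite lerD2l euclidZ (gtr0_norm (tp j)).
  by rewrite ler_piMl// euclid_ge0.
Qed.

(** The subgradient inequality at the moved point g + t k bounds the difference of energies from
    above without differentiating the energy. *)
Lemma Epow_subgrad g k (t : R) : Lpv g -> Lpv k ->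
  p^-1 * (Epow (fun x => g x + t *: k x) - Epow g) <= t * \int[mu]_(x in Om) dotv (pgrad p (g x + t *: k x)) (k x).
Proof.
move=> Lg Lk; have Lz := LpvD Lg (LpvZ t Lk); have i := ig_pgrad Lz Lk.
rewrite ler_pdivrMl// mulrA.
have H x : Om x -> euclid (g x + t *: k x) `^ p <= 1 * euclid (g x) `^ p + p * t * dotv (pgrad p (g x + t *: k x)) (k x).
  move=> _; have := subgrad_le p1 (g x + t *: k x) (g x).
  rewrite opprD addrA subrr add0r dotvNr dotvZr mul1r; move: (dotv _ _) => z; lra.
have := I_lin_le (Lpv_igp Lg) i (Lpv_igp Lz) H.
by rewrite (EpowE g) (EpowE (fun x => g x + t *: k x)); move: (\int[mu]_(x in Om) _) => z; lra.
Qed.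

Section weak_solution.
Context (f : V -> R -> R) (Hf : caratheodory_function Om f) (Hfsup : locally_sup_integrable Om f).
Context (h : (V -> R) -> R) (Hh : dualW p Om h) (u : V -> R) (gu : V -> V) (Du : Dpair u gu).

(** The functional -Delta_p u - h, the candidate for f(x, u). *)
Let residual v := neg_plaplacian p Om u v - h v.

(** The crude bound |X|^p + |Y|^p of the integrand is applied to v / t and multiplied back by t,
    which gives a bound linear in t. *)
Lemma neg_plaplacian_bound v k (t : R) : Dpair v k -> 0 < t -> Npow v + Epow k <= t `^ p ->
  `|neg_plaplacian p Om u v| <= (Epow gu + 1) * t.
Proof.
move=> Dv t0 NE; have [_ Lg _] := Du; have [_ Lk _] := Dv.
have NE1 := scale_norm t0 Dv NE; have Lw := LpvZ t^-1 Lk; have i := ig_pgrad Lg Lw.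
have m1 := mO.
have E : neg_plaplacian p Om u v = t * \int[mu]_(x in Om) dotv (pgrad p (gu x)) (t^-1 *: k x).
  rewrite (neg_plaplacianE Du Dv) -RintegralZl//; apply: I_eq => x _.
  by rewrite dotvZr mulrA divff ?mul1r// gt_eqF.
rewrite E normrM (gtr0_norm t0) mulrC; apply: ler_wpM2r; first exact: ltW.
have E1 : Epow (fun x => t^-1 *: k x) <= 1 by apply: le_trans NE1; rewrite lerDr Npow_ge0.
apply: le_trans (_ : Epow gu + Epow (fun x => t^-1 *: k x) <= _); last by rewrite lerD2l.
have B x : Om x -> `|dotv (pgrad p (gu x)) (t^-1 *: k x)| <=
    1 * euclid (gu x) `^ p + 1 * euclid (t^-1 *: k x) `^ p.
  by move=> _; rewrite !mul1r; exact: normr_dotv_pgrad_pow.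
have h1 := I_lin_le (Lpv_igp Lg) (Lpv_igp Lw) (ig_norm i) B.
have h2 := @le_normr_Rintegral _ (lebT R n) R mu Om (fun x => dotv (pgrad p (gu x)) (t^-1 *: k x)) mO i.
apply: le_trans h2 _.
rewrite (EpowE gu) (EpowE (fun x => t^-1 *: k x)) -[X in X + _]mul1r -[X in _ + X]mul1r; exact: h1.
Qed.

Lemma dualW_residual : dualW p Om residual.
Proof.
have [_ Lg _] := Du; split.
  move=> a v w /W1p0_Dpair Dv /W1p0_Dpair Dw; have [_ Lv _] := Dv; have [_ Lw _] := Dw.
  rewrite /residual (dual_lin Hh a Dv Dw) (neg_plaplacianE Du (Dpair_lin a Dv Dw)).
  rewrite (neg_plaplacianE Du Dv) (neg_plaplacianE Du Dw).
  have i1 := ig_pgrad Lg Lv; have i2 := ig_pgrad Lg Lw; have i3 := igZ mO a i1.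
  have -> : \int[mu]_(x in Om) dotv (pgrad p (gu x)) (a *: grad p Om v x + grad p Om w x) =
      a * \int[mu]_(x in Om) dotv (pgrad p (gu x)) (grad p Om v x) +
      \int[mu]_(x in Om) dotv (pgrad p (gu x)) (grad p Om w x).
    have m1 := mO; rewrite -RintegralZl// -RintegralD//.
    by apply: I_eq => x _; rewrite dotvDr dotvZr.
  by move: (\int[mu]_(x in Om) _) (\int[mu]_(x in Om) _) (h v) (h w) => z1 z2 z3 z4; ring.
have [Ch Ch0 HC] := dual_bound Hh.
exists (Epow gu + 1 + Ch) => v /W1p0_Dpair Dv; rewrite (norm1pE Dv) mulrDl.
apply: le_trans (ler_normB _ _) _; apply: lerD; last exact: HC Dv.
have C0 : 0 < Epow gu + 1 by rewrite ltr_wpDl ?Epow_ge0.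
have NE0 : 0 <= Npow v + Epow (grad p Om v) by rewrite addr_ge0 ?Npow_ge0 ?Epow_ge0.
apply/ler_addgt0Pr => e e0.
(* The term in e keeps t positive when v has norm zero; since e is arbitrary it does no harm. *)
pose t := (Npow v + Epow (grad p Om v)) `^ p^-1 + e / (Epow gu + 1).
have s0 : 0 <= (Npow v + Epow (grad p Om v)) `^ p^-1 := powR_ge0 _ _.
have e1 : 0 < e / (Epow gu + 1) by rewrite divr_gt0.
have t0 : 0 < t by rewrite /t ltr_wpDl.
apply: le_trans (neg_plaplacian_bound Dv t0 _) _; last by rewrite /t mulrDr mulrCA divff ?mulr1// gt_eqF.
rewrite -[leLHS](powRVK p0 NE0); apply: ge0_ler_powR; rewrite ?nnegrE//; try exact: ltW.
by rewrite lerDl ltW.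
Qed.

Context (iFu : ig (fun x => prim (f x) (u x))) (umin : forall v k, Dpair v k -> ig (fun x => prim (f x) (v x)) ->
    p^-1 * Epow gu - \int[mu]_(x in Om) prim (f x) (u x) - h u <=
    p^-1 * Epow k - \int[mu]_(x in Om) prim (f x) (v x) - h v).

(** Bounded, and carried by a set where u is bounded: for such v the local suprema of f give an
    integrable bound on the difference quotients of F(x, u + t v). *)
Definition bounded_test v := (exists M : R, aeOn Om (fun x => `|v x| <= M)) /\
  (exists M : R, aeOn Om (fun x => v x != 0 -> `|u x| <= M)).

Lemma ig_f_bounded_test v k : Dpair v k -> bounded_test v -> ig (fun x => f x (u x) * v x).
Proof.
move=> Dv [[M1 v1] [M u1]]; have [Lu _ _] := Du; have [Lv _ _] := Dv.
have r0 : 0 < `|M| + 1 by rewrite ltr_wpDl.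
have [N [iN N0 NP]] := local_bound Hfsup r0.
have q := igZ mO `|M1| iN; apply: (ig_le mO _ q).
  by apply: measurable_funM; [exact: (mf_f Hf (Lp_mf Lu))|exact: Lp_mf Lv].
apply: aeOn3 v1 u1 NP => x _ h1 h2 h3.
have [->|v0] := eqVneq (v x) 0; first by rewrite mulr0 normr0 mulr_ge0.
rewrite normrM mulrC; apply: ler_pM => //; first by apply: le_trans h1 (ler_norm _).
apply: h3; apply: le_trans (h2 v0) _; apply: le_trans (ler_norm M) _; by rewrite lerDl.
Qed.

(** Minimality against u + t v, divided by t, with the energy difference bounded by the subgradient
    inequality; both sides pass to the limit t -> 0 by dominated convergence. *)
Lemma first_variation_le v k : Dpair v k -> bounded_test v ->
  \int[mu]_(x in Om) (f x (u x) * v x) <= \int[mu]_(x in Om) dotv (pgrad p (gu x)) (k x) - h v.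
Proof.
move=> Dv bt; have ifv := ig_f_bounded_test Dv bt; have [[M1 v1] [M u1]] := bt.
have [Lu Lg _] := Du; have [Lv Lk _] := Dv; have m1 := mO.
have r0 : 0 < `|M| + `|M1| + 1 by rewrite ltr_wpDl ?addr_ge0.
have [N [iN N0 NP]] := local_bound Hfsup r0.
have [_ fc] := Hf.
pose t (j : nat) : R := j.+1%:R^-1.
have tp j : 0 < t j by rewrite invr_gt0.
have tl j : t j <= 1 by rewrite invf_le1// ler1n.
have t0 : t j @[j --> \oo] --> 0 := @cvg_harmonic R.
pose q j x := (t j)^-1 * (prim (f x) (u x + t j * v x) - prim (f x) (u x)).
have qm j : mf (q j).
  apply: measurable_funM; first exact: measurable_cst.
  apply: measurable_funB; last exact: (mf_prim Hf (Lp_mf Lu)).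
  exact: (mf_prim Hf (Lp_mf (LpD Lu (LpZ (t j) Lv)))).
have iNM := igZ mO `|M1| iN.
have qb j : aeOn Om (fun x => `|q j x| <= `|M1| * N x).
  have H := aeOn2 (fun x _ a b => conj a b) v1 u1.
  apply: aeOn3 H NP fc => x _ [h1 h2] h3 cx.
  rewrite /q normrM gtr0_norm ?invr_gt0// ler_pdivrMl//.
  have [->|v0] := eqVneq (v x) 0; first by rewrite mulr0 addr0 subrr normr0 !mulr_ge0// ltW.
  have h1' : `|v x| <= `|M1| by apply: le_trans h1 (ler_norm _).
  have h2' : `|u x| <= `|M| by apply: le_trans (h2 v0) (ler_norm _).
  have b1 : `|u x| <= `|M| + `|M1| + 1 by apply: le_trans h2' _; rewrite -addrA lerDl addr_ge0.
  have b2 : `|u x + t j * v x| <= `|M| + `|M1| + 1.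
    apply: le_trans (ler_normD _ _) _; rewrite -addrA; apply: lerD => //.
    rewrite normrM gtr0_norm// ; apply: ler_wpDr => //; apply: le_trans h1'.
    by rewrite ler_piMl.
  apply: le_trans (prim_bound (ltW r0) (N0 x) cx h3 b2 b1) _.
  rewrite addrAC subrr add0r normrM (gtr0_norm (tp j)) mulrCA; apply: ler_wpM2l; first exact: ltW.
  by rewrite mulrC; apply: ler_wpM2r.
have qc : aeOn Om (fun x => q j x @[j --> \oo] --> f x (u x) * v x).
  by apply: aeOn1 fc => x _ cx; apply: prim_diffquot => // j; rewrite gt_eqF.
have [_ Ic iq] := dominated_cvgR mO qm (ig_mf ifv) iNM qc qb.
have Dt j := DpairD Du (DpairZ (t j) Dv).
have Et j : (fun x => prim (f x) (u x + t j * v x)) = (fun x => prim (f x) (u x) + t j * q j x).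
  by apply/funext => x; rewrite /q mulrA divff ?gt_eqF// mul1r [RHS]addrC subrK.
have iFt j : ig (fun x => prim (f x) (u x + t j * v x)).
  by rewrite Et; have z := igD mO iFu (igZ mO (t j) (iq j)).
have It j : \int[mu]_(x in Om) prim (f x) (u x + t j * v x) =
    \int[mu]_(x in Om) prim (f x) (u x) + t j * \int[mu]_(x in Om) q j x.
  have z := igZ mO (t j) (iq j); have z' := iq j.
  transitivity (\int[mu]_(x in Om) (prim (f x) (u x) + t j * q j x)); first by rewrite Et.
  by rewrite RintegralD// RintegralZl.
have key j : \int[mu]_(x in Om) q j x <=
    \int[mu]_(x in Om) dotv (pgrad p (gu x + t j *: k x)) (k x) - h v.
  have h1 := umin (Dt j) (iFt j); rewrite It (dualD Hh Du (DpairZ (t j) Dv)) (dualZ Hh (t j) Dv) in h1.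
  have h2 := Epow_subgrad (t j) Lg Lk; rewrite mulrBr in h2.
  rewrite -(ler_pM2l (tp j)) mulrBr.
  move: (t j * \int[mu]_(x in Om) q j x) (t j * h v) (t j * \int[mu]_(x in Om) _) h1 h2 => z1 z2 z3.
  by move: (p^-1 * _) (p^-1 * _) (\int[mu]_(x in Om) _) (h u) => z4 z5 z6 z7 h1 h2; lra.
have Rc := pgrad_line_cvg Lg Lk tp tl t0.
have Rc' : \int[mu]_(x in Om) dotv (pgrad p (gu x + t j *: k x)) (k x) - h v - \int[mu]_(x in Om) q j x
   @[j --> \oo] --> \int[mu]_(x in Om) dotv (pgrad p (gu x)) (k x) - h v - \int[mu]_(x in Om) (f x (u x) * v x).
  by apply: cvgB => //; apply: cvgB => //; exact: cvg_cst.
rewrite -subr_ge0 -oppr_le0; apply: (cvg_le_cst _ (cvgN Rc')) => j.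
by rewrite oppr_le0 subr_ge0; exact: key.
Qed.

(** The one-sided inequality, for v and for -v. *)
Lemma euler_lagrange v k : Dpair v k -> bounded_test v ->
  residual v = \int[mu]_(x in Om) (f x (u x) * v x).
Proof.
move=> Dv bt; rewrite /residual (neg_plaplacianE Du Dv); apply/eqP; rewrite eq_le; apply/andP; split; last exact: first_variation_le.
have bt' : bounded_test (fun x => - v x).
  have [[M1 v1] [M u1]] := bt; split; first by exists M1; apply: aeOn1 v1 => x _; rewrite normrN.
  by exists M; apply: aeOn1 u1 => x _; rewrite oppr_eq0.
have ifv := ig_f_bounded_test Dv bt; have [_ Lg _] := Du; have [_ Lk _] := Dv.
have i := ig_pgrad Lg Lk; have m1 := mO.
have := first_variation_le (DpairN Dv) bt'.
have -> : \int[mu]_(x in Om) (f x (u x) * - v x) = - \int[mu]_(x in Om) (f x (u x) * v x).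
  rewrite -mulN1r -RintegralZl//; apply: I_eq => x _; by rewrite mulrN mulN1r.
have -> : \int[mu]_(x in Om) dotv (pgrad p (gu x)) (- k x) = - \int[mu]_(x in Om) dotv (pgrad p (gu x)) (k x).
  rewrite -mulN1r -RintegralZl//; apply: I_eq => x _; by rewrite dotvNr mulN1r.
have -> : h (fun x => - v x) = - h v.
  by rewrite -mulN1r -(dualZ Hh _ Dv); congr h; apply/funext => x; rewrite mulN1r.
by move: (\int[mu]_(x in Om) _) (\int[mu]_(x in Om) _) (h v) => z1 z2 z3; lra.
Qed.

(** Take v_j = min (v, j) - (b_j - 2j)^+ with b_j = min (v, j) + min (|u|, 2j). Where |u| >= 2j the
    two terms cancel, and where v + |u| < j nothing is cut, so v_j(x) = v(x) for j large. Only
    truncations and sums occur, so the gradients are explicit and differ from that of v by at most 2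
    |grad v| plus the gradient of |u| in length. *)
Lemma bounded_test_approx v k : Dpair v k -> (forall x, 0 <= v x) ->
  exists (v_ : nat -> V -> R) (k_ : nat -> V -> V), [/\ forall j, Dpair (v_ j) (k_ j) /\ bounded_test (v_ j),
    forall j x, 0 <= v_ j x <= v x, forall x, v_ j x @[j --> \oo] --> v x,
    Npow (fun x => v_ j x - v x) @[j --> \oo] --> 0 & Epow (fun x => k_ j x - k x) @[j --> \oo] --> 0].
Proof.
move=> Dv v0; have Da := Dpair_norm Du; set ga := (X in Dpair _ X) in Da.
pose b (j : nat) x := Num.min (v x) j%:R + Num.min `|u x| (2 * j%:R).
pose gb (j : nat) x := (if j%:R < v x then 0 else k x) + (if 2 * j%:R < `|u x| then 0 else ga x).
pose v_ j x := Num.min (v x) j%:R - Num.max (b j x - 2 * j%:R) 0.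
pose k_ j x := (if j%:R < v x then 0 else k x) - (2 * j%:R < b j x)%R%:R *: gb j x.
have j0 (j : nat) : 0 <= j%:R :> R by rewrite ler0n.
have j20 (j : nat) : 0 <= 2 * j%:R :> R by rewrite mulr_ge0.
have D1 j := Dpair_minc (j0 j) Dv.
have D2 j : Dpair (b j) (gb j) := DpairD (D1 j) (Dpair_minc (j20 j) Da).
have D j : Dpair (v_ j) (k_ j) := DpairB (D1 j) (Dpair_trunc (j20 j) (D2 j)).
have vv j x : 0 <= v_ j x <= Num.min (v x) j%:R.
  rewrite /v_ /b; have := v0 x; have := j0 j; have := normr_ge0 (u x).
  move: (`|u x|) (v x) (j%:R : R) => a1 a2 a3 q1 q2 q3.
  by case: (leP a2 a3) => h1; case: (leP a1 (2 * a3)) => h2;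
    case: (leP (_ + _ - _) 0) => h3; apply/andP; split; lra.
have vle j x : 0 <= v_ j x <= v x.
  by have /andP[h1 h2] := vv j x; rewrite h1 /=; apply: le_trans h2 _; rewrite ge_min lexx.
have ev x : exists m, forall j, (m <= j)%N -> v_ j x = v x /\ k_ j x = k x.
  pose m := (Num.truncn (v x + `|u x|)).+1; exists m => j mj.
  have := real_truncnS_gt (num_real (v x + `|u x|)); rewrite -/m => h1.
  have h2 : v x + `|u x| < j%:R by apply: lt_le_trans h1 _; rewrite ler_nat.
  have h3 : v x <= j%:R by apply: ltW; apply: le_lt_trans h2; rewrite lerDl.
  have h4 : `|u x| <= j%:R by apply: ltW; apply: le_lt_trans h2; rewrite lerDr.
  have h5 : `|u x| <= 2 * j%:R by apply: le_trans h4 _; rewrite ler_peMl// ler1n.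
  have bE : b j x = v x + `|u x| by rewrite /b (min_idPl h3) (min_idPl h5).
  have h6 : b j x <= 2 * j%:R by rewrite bE; have := j0 j; move: (j%:R : R) h2 => *; lra.
  split; first by rewrite /v_ (min_idPl h3) (max_idPr _) ?subr0// subr_le0.
  by rewrite /k_ !ltNge h3 h6 /= scale0r subr0.
have [Lv Lk _] := Dv; have [_ Lga _] := Da.
exists v_, k_; split=> //.
- move=> j; split=> //; split.
    exists j%:R; apply: aeOnW => x _; have /andP[h1 h2] := vv j x.
    by rewrite ger0_norm//; apply: le_trans h2 _; rewrite ge_min lexx orbT.
  exists (2 * j%:R); apply: aeOnW => x _; apply: contraR; rewrite -ltNge => lt.
  have h1 : b j x = Num.min (v x) j%:R + 2 * j%:R by rewrite /b (min_idPr (ltW lt)).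
  have h2 : 0 <= Num.min (v x) j%:R by rewrite le_min v0 j0.
  by rewrite /v_ h1 addrK (max_idPl h2) subrr.
- move=> x; have [m mP] := ev x; apply: cvg_near_cst; exists m => // j /= /mP[]; by move=> ->.
- apply: (Npow_dominated Lv).
  + by move=> j; apply: measurable_funB; [have [L _ _] := D j; exact: Lp_mf L|exact: Lp_mf Lv].
  + move=> j; apply: aeOnW => x _; have /andP[h1 h2] := vle j x.
    by rewrite distrC !ger0_norm ?subr_ge0// gerBl.
  + apply: aeOnW => x _; have [m mP] := ev x; apply: cvg_near_cst; exists m => // j /= /mP[->].
    by rewrite subrr.
have E j : Epow (fun x => k_ j x - k x) = Npow (fun x => euclid (k_ j x - k x)).
  by rewrite EpowE NpowE; apply: I_eq => x _; rewrite ger0_norm// euclid_ge0.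
rewrite (_ : (fun j => Epow _) = (fun j => Npow (fun x => euclid (k_ j x - k x)))); last by apply/funext.
apply: (Npow_dominated (LpD (LpZ 2 (Lpv_euclid Lk)) (Lpv_euclid Lga))).
- move=> j; have [_ L _] := DpairB (D j) Dv; exact: Lp_mf (Lpv_euclid L).
- move=> j; apply: aeOnW => x _.
  have k0 := euclid_ge0 (k x); have g0 := euclid_ge0 (ga x).
  rewrite (ger0_norm (euclid_ge0 _)) ger0_norm ?addr_ge0 ?mulr_ge0//.
  have h1 : euclid (gb j x) <= euclid (k x) + euclid (ga x).
    by apply: le_trans (euclidD _ _) _; apply: lerD; case: ifP => _ //; rewrite euclid0.
  have h2 : euclid ((if j%:R < v x then 0 else k x) - k x) <= euclid (k x).
    by case: ifP => _; rewrite ?sub0r ?euclidN// subrr euclid0.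
  rewrite /k_ addrAC; apply: le_trans (euclidB _ _) _; rewrite euclidZ.
  have h3 : `|(2 * j%:R < b j x)%R%:R : R| <= 1 by case: (_ < _); rewrite ?normr1 ?normr0.
  have h4 := ler_wpM2r (euclid_ge0 (gb j x)) h3.
  by move: (`|_| * _) h4 => z h4; lra.
- apply: aeOnW => x _; have [m mP] := ev x; apply: cvg_near_cst; exists m => // j /= /mP[_ ->].
  by rewrite subrr euclid0.
Qed.

(** The approximations satisfy 0 <= v_j <= v, so |f(x, u) v| dominates, while the residual is
    continuous along them. *)
Lemma residual_ge0 v k : Dpair v k -> (forall x, 0 <= v x) -> ig (fun x => f x (u x) * v x) ->
  residual v = \int[mu]_(x in Om) (f x (u x) * v x).
Proof.
move=> Dv v0 ifv; have [v_ [k_ [D vle vc Nc Ec]]] := bounded_test_approx Dv v0.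
have Rc := dual_cvg dualW_residual (fun j => (D j).1) Dv Nc Ec.
have E j : residual (v_ j) = \int[mu]_(x in Om) (f x (u x) * v_ j x).
  by have [D1 b1] := D j; exact: euler_lagrange D1 b1.
have [||_ Ic _] := @dominated_cvgR _ (lebT R n) R mu Om mO (fun j x => f x (u x) * v_ j x)
  (fun x => f x (u x) * v x) (fun x => `|f x (u x) * v x|) (fun j => ig_mf (ig_f_bounded_test (D j).1 (D j).2))
  (ig_mf ifv) (ig_norm ifv).
- by apply: aeOnW => x _; apply: cvgM => //; exact: cvg_cst.
- move=> j; apply: aeOnW => x _; rewrite !normrM; apply: ler_wpM2l => //.
  by have /andP[h1 h2] := vle j x; rewrite !ger0_norm.
rewrite (_ : (fun j => residual (v_ j)) = (fun j => \int[mu]_(x in Om) (f x (u x) * v_ j x))) in Rc; last by apply/funext.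
by rewrite -(cvg_lim (@norm_hausdorff _ R) Rc) (cvg_lim (@norm_hausdorff _ R) Ic).
Qed.

(** Positive and negative parts of v stay in the space, and f(x, u) times each of them is dominated
    by |f(x, u) v|. *)
Lemma residual_integrable v k : Dpair v k -> ig (fun x => f x (u x) * v x) ->
  residual v = \int[mu]_(x in Om) (f x (u x) * v x).
Proof.
move=> Dv ifv; have D1 := Dpair_pos Dv; have D2 := Dpair_pos (DpairN Dv).
have [Lu _ _] := Du; have m1 := mO.
have i1 : ig (fun x => f x (u x) * Num.max (v x) 0).
  apply: (ig_le mO _ (ig_norm ifv)).
    have [L _ _] := D1; apply: measurable_funM; [exact: (mf_f Hf (Lp_mf Lu))|exact: Lp_mf L].
  apply: aeOnW => x _; rewrite !normrM; apply: ler_wpM2l => //.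
  by case: (leP (v x) 0) => h0; rewrite ?normr0.
have i2 : ig (fun x => f x (u x) * Num.max (- v x) 0).
  apply: (ig_le mO _ (ig_norm ifv)).
    have [L _ _] := D2; apply: measurable_funM; [exact: (mf_f Hf (Lp_mf Lu))|exact: Lp_mf L].
  apply: aeOnW => x _; rewrite !normrM; apply: ler_wpM2l => //.
  by case: (leP (- v x) 0) => h0; rewrite ?normr0 ?normrN.
have E x : v x = Num.max (v x) 0 + -1 * Num.max (- v x) 0.
  by rewrite mulN1r; case: (leP (v x) 0) => h1; case: (leP (- v x) 0) => h2; lra.
have pos (w : V -> R) x : 0 <= Num.max (w x) 0 by rewrite le_max lexx orbT.
have -> : v = (fun x => Num.max (v x) 0 + -1 * Num.max (- v x) 0) by apply/funext.
rewrite (dualD dualW_residual D1 (DpairZ (-1) D2)) (dualZ dualW_residual (-1) D2).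
rewrite (residual_ge0 D1 (pos _) i1) (residual_ge0 D2 (pos (fun x => - v x)) i2).
have i3 := igZ mO (-1) i2.
transitivity (\int[mu]_(x in Om) (f x (u x) * Num.max (v x) 0 + -1 * (f x (u x) * Num.max (- v x) 0))).
  by rewrite RintegralD// RintegralZl.
by apply: I_eq => x _; rewrite mulrDr mulrCA.
Qed.

Lemma minimizer_weak_solution : weak_solution p Om f h u.
Proof.
have Wu := Dpair_W1p0 Du; split=> //.
  have [C C0 HC] := dual_bound dualW_residual.
  apply: (@le_lt_trans _ _ C%:E); last exact: ltry.
  apply: ge_ereal_sup => _ [v [[Wv iv] nv] <-]; rewrite lee_fin.
  have Dv := W1p0_Dpair Wv; rewrite -(residual_integrable Dv iv).
  apply: le_trans (ler_norm _) _; apply: le_trans (HC _ _ Dv) _.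
  by rewrite -(norm1pE Dv) ler_piMr.
exists residual; last by move=> v _; rewrite /residual subrK.
split; first exact: dualW_residual.
move=> v [Wv [_ [M1 v1] _] [M u1]]; apply: (euler_lagrange (W1p0_Dpair Wv)).
by split; [exists M1|exists M].
Qed.

End weak_solution.

(** * The extended-valued functional and the conclusion *)

Lemma Phi_fin (f : V -> R -> R) (h : (V -> R) -> R) v k : Dpair v k -> ig (fun x => prim (f x) (v x)) ->
  Phi p Om f h v = (p^-1 * Epow k - \int[mu]_(x in Om) prim (f x) (v x) - h v)%:E.
Proof.
move=> Dv iF; rewrite /Phi (dirichletE Dv).
have m0 : measurable_fun (Om : set (lebT R n)) ((fun=> 0) : lebT R n -> R) by exact: measurable_cst.
have iP : ig (fun x => Num.max (prim (f x) (v x)) 0).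
  apply: (ig_le mO _ (ig_norm iF)); first by apply: measurable_maxr; [exact: ig_mf iF|exact: m0].
  by apply: aeOnW => x _; case: (leP (prim (f x) (v x)) 0) => _; rewrite ?normr0.
have P0 (x : V) : Om x -> 0 <= Num.max (prim (f x) (v x)) 0 by move=> _; rewrite le_max lexx orbT.
have lt : ((\int[mu]_(x in Om) (Num.max (primitive f x (v x)) 0)%:E)%E < +oo)%E.
  by have /(ig_ge0P mu (ig_mf iP) P0) := iP.
have m1 := mO.
rewrite /int_negF (lt_eqF lt) andFb -(EFin_I mO (igN mO iF)).
have -> : \int[mu]_(x in Om) - prim (f x) (v x) = - \int[mu]_(x in Om) prim (f x) (v x).
  by rewrite -mulN1r -RintegralZl//; apply: I_eq => x _; rewrite mulN1r.
by [].
Qed.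

(** With the positive part of F(x, v) integrable, failure of integrability means that the negative
    part has infinite integral; such competitors cannot beat the minimizer. *)
Lemma Phi_pinfty (f : V -> R -> R) (h : (V -> R) -> R) v k : Dpair v k -> mf (fun x => prim (f x) (v x)) ->
  ig (fun x => Num.max (prim (f x) (v x)) 0) -> ~ ig (fun x => prim (f x) (v x)) ->
  Phi p Om f h v = +oo%E.
Proof.
move=> Dv mF iP nF; rewrite /Phi (dirichletE Dv).
have P0 (x : V) : Om x -> 0 <= Num.max (prim (f x) (v x)) 0 by move=> _; rewrite le_max lexx orbT.
have N0 (x : V) : Om x -> 0 <= Num.max (- prim (f x) (v x)) 0 by move=> _; rewrite le_max lexx orbT.
have lt : ((\int[mu]_(x in Om) (Num.max (prim (f x) (v x)) 0)%:E)%E < +oo)%E.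
  by have /(ig_ge0P mu (ig_mf iP) P0) := iP.
have mN : mf (fun x => Num.max (- prim (f x) (v x)) 0).
  by apply: measurable_maxr; [exact: measurable_funN|exact: measurable_cst].
have Noo : (\int[mu]_(x in Om) (Num.max (- prim (f x) (v x)) 0)%:E)%E = +oo%E.
  apply/eqP; apply: contra_notT nF; rewrite -ltey => lt'.
  have /(ig_ge0P mu mN N0) iN := lt'.
  have q := igB mO iP iN; apply: (ig_ae mO mF q).
  by apply: aeOnW => x _; case: (leP (prim (f x) (v x)) 0) => h1; case: (leP (- prim (f x) (v x)) 0) => h2; lra.
have -> : int_negF Om f v = +oo%E.
  rewrite /int_negF (lt_eqF lt) andFb integralE.
  have -> : (\int[mu]_(x in Om) ((fun x => (- prim (f x) (v x))%:E)^\+ x)%E)%E = +oo%E.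
    rewrite -Noo; apply: eq_integral => x _; rewrite funeposE -EFin_max//.
  have -> : (\int[mu]_(x in Om) ((fun x => (- prim (f x) (v x))%:E)^\- x)%E)%E =
      (\int[mu]_(x in Om) (Num.max (prim (f x) (v x)) 0)%:E)%E.
    by apply: eq_integral => x _; rewrite funenegE -EFinN opprK -EFin_max.
  by rewrite -(EFin_I mO iP).
by [].
Qed.

End sobolev_pairs.

Theorem theorem9 (R : realType) (n : nat) (Om : set 'rV[R]_n.+1)
    (p alpha : R) (h : ('rV[R]_n.+1 -> R) -> R)
    (f : 'rV[R]_n.+1 -> R -> R) (phi : R -> R)
    (eta phi1 : 'rV[R]_n.+1 -> R)
    (HOm : bounded_domain Om)
    (Hp : 1 < p)
    (Hh : dualW p Om h)
    (Hf : caratheodory_function Om f)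
    (Hfsup : locally_sup_integrable Om f)
    (Halpha : 1 <= alpha <= p)
    (Hphi : comparison_function p alpha phi)
    (Hphi1 : first_eigenfunction p Om phi1)
    (Heta : X_alpha p alpha Om eta)
    (HG : G_le_uniformly p Om f phi eta)
    (HGplus : (\int[leb]_(x in Om)
                 (Gplus p Om f phi x * (phi1 x `^ alpha)%:E) < 0)%E)
    (HGminus : (\int[leb]_(x in Om)
                 (Gminus p Om f phi x * (phi1 x `^ alpha)%:E) < 0)%E) :
  exists u : 'rV[R]_n.+1 -> R,
    [/\ W1p0 p Om u,
        (forall v, W1p0 p Om v -> (Phi p Om f h u <= Phi p Om f h v)%E),
        (@leb R n).-integrable Om (fun x => (primitive f x (u x))%:E)
      & weak_solution p Om f h u].
Proof.
have [oO cO _ bO] := HOm.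
have [W1 eq1 pos1 n1] := Hphi1.
(* The normalization of phi_1 provides the positive measure of the domain on which the box estimates
   rest. *)
have muO : (0 < leb Om)%E by apply: (W1p0_norm_gt0_leb oO bO Hp W1); rewrite n1.
have lam0 : 0 <= lambda1 p Om.
  apply: (lambda1_ge0 oO bO Hp W1) => e0.
  have F : aeOn Om (fun _ => False) by apply: aeOn2 pos1 e0 => x _ lt e; rewrite e ltxx in lt.
  exact: (aeOn_false oO bO muO F (fun _ _ => id)).
have [d Hd] := growth_exists oO bO Hp muO Hf Hfsup Halpha Hphi Heta HG lam0.
have [u [g [Du iF umin]]] := energy_minimizer oO bO Hp muO Hf Halpha Hphi Heta Hd Hh cO Hphi1 HGplus HGminus.
exists u; split; first exact: (Dpair_W1p0 oO bO Hp Du).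
- move=> v /(W1p0_Dpair oO bO Hp) Dv; rewrite (Phi_fin oO bO Hp h Du iF).
  (* Competitors for which F(x, v) is not integrable have [Phi] equal to +oo. *)
  have [iv|niv] := pselect (leb.-integrable (Om : set (lebT R n)) (EFin \o ((fun x => prim (f x) (v x)) : lebT R n -> R))).
    by rewrite (Phi_fin oO bO Hp h Dv iv) lee_fin; exact: umin Dv iv.
  have [Lv _ _] := Dv.
  rewrite (Phi_pinfty oO bO Hp h Dv (mf_prim oO Hf (Lp_mf Lv)) _ niv) ?leey//.
  exact: (ig_F_pos oO bO Hp Hf Halpha Heta lam0 Hd Dv).
- exact: iF.
exact: (minimizer_weak_solution oO bO Hp Hf Hfsup Hh Du iF umin).
Qed.
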